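(* Let $E$ be a symmetric quasi-Banach function space on $\mathbb{R}_+$ which is $s$-convex for some $0<s<\infty$ and let $\mathcal{M}$ be a semi-finite von Neumann algebra. Let $(\mathcal{E}_k)_{k\geq1}$ be an increasing sequence of conditional expectations in $\mathcal{M}$. If $1<p_E\leq q_E<\infty$, then there is a constant $C_E$ depending only on $E$ such that for any sequence $(x_k)_{k\geq1}$ in $E(\mathcal{M})_+$ such that $\sum_kx_k$ converges in norm in $E(\mathcal{M})$, the series $\sum_k\mathcal{E}_k(x_k)$ converges in norm in $E(\mathcal{M})$ and $$\Big\|\sum_{k\geq1}\mathcal{E}_k(x_k)\Big\|_{E(\mathcal{M})}\leq C_E\Big\|\sum_{k\geq1}x_k\Big\|_{E(\mathcal{M})}.$$
   Context: $\mathcal{M}$ is equipped with a normal, semi-finite, faithful trace $\tau$. An increasing sequence of conditional expectations means: $(\mathcal{M}_k)_{k\ge1}$ is an increasing sequence of von Neumann subalgebras of $\mathcal{M}$ with $\tau|_{\mathcal{M}_k}$ semi-finite, and $\mathcal{E}_k$ is the $\tau$-preserving normal conditional expectation of $\mathcal{M}$ onto $\mathcal{M}_k$; it extends to a contraction on $L^p(\mathcal{M})$ for all $1\le p\le\infty$, hence is defined on $L^1(\mathcal{M})+\mathcal{M}$, which contains $E(\mathcal{M})$. For measurable a.e. finite $f$ on $\mathbb{R}_+$, $d(v;f)=\lambda(|f|>v)$ ($\lambda$ Lebesgue measure); $S(\mathbb{R}_+)$ denotes those $f$ with $d(v;f)<\infty$ for some $v>0$; $\mu_t(f)=\inf\{v>0:d(v;f)\le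 t\}$. A (nonzero) symmetric quasi-Banach function space $E$ on $\mathbb{R}_+$ is a complete quasi-normed linear subspace of $S(\mathbb{R}_+)$ such that $f\in S(\mathbb{R}_+)$, $g\in E$, $\mu(f)\le\mu(g)$ imply $f\in E$, $\|f\|_E\le\|g\|_E$. $E$ is $s$-convex if for some $C$, $\|(\sum_i|f_i|^s)^{1/s}\|_E\le C(\sum_i\|f_i\|_E^s)^{1/s}$ for all finite sequences in $E$. With $(D_af)(u)=f(au)$ on $E$, the Boyd indices are $p_E=\lim_{u\to\infty}\frac{\log u}{\log\|D_{1/u}\|}$ and $q_E=\lim_{u\downarrow0}\frac{\log u}{\log\|D_{1/u}\|}$ ($=\infty$ if the denominator vanishes). For a closed densely defined $x$ affiliated with $\mathcal{M}$, $d(v;x)=\tau(e^{|x|}(v,\infty))$, $\mu_t(x)=\inf\{v>0:d(v;x)\le t\}$; $S(\tau)$ is the set of $\tau$-measurable operators ($d(v;x)<\infty$ for some $v>0$). $E(\mathcal{M})=\{x\in S(\tau):\mu(x)\in E\}$ with $\|x\|_{E(\mathcal{M})}=\|\mu(x)\|_E$; $E(\mathcal{M})_+$ is its positive cone. *)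

(* Defs.v *)
From HB Require Import structures.
From mathcomp Require Import all_boot all_order all_algebra.
From mathcomp Require Import sesquilinear complex.
From mathcomp Require Import all_classical all_reals all_analysis.

Set Implicit Arguments.
Unset Strict Implicit.
Unset Printing Implicit Defensive.
Import Order.TTheory GRing.Theory Num.Theory.
Import numFieldNormedType.Exports.

Local Open Scope classical_set_scope.
Local Open Scope ring_scope.
Local Open Scope complex_scope.

Section Rearrangement.
Variable R : realType.

(* [rearrangement d t = inf {v > 0 | d v <= t}] is used with [d] a
   distribution function of a function or of an operator. It is extended-real
   valued, but finite for [t > 0] when [d] is the distribution function of an
   element of S(R_+) or of S(tau). *)
Definition rearrangement (d : R -> \bar R) (t : R) : \bar R :=
  ereal_inf [set v%:E | v in [set v : R | 0 < v /\ (d v <= t%:E)%E]].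

(* A function on R_+ is represented by a function [R -> R] whose values on the
   negative half-line are irrelevant: everything below depends on it only
   through its restriction to [0, +oo). *)
Definition fun_dist (f : R -> R) (v : R) : \bar R :=
  lebesgue_measure [set t : R | 0 <= t /\ v < `|f t|].

Definition fun_mu (f : R -> R) : R -> \bar R := rearrangement (fun_dist f).

Definition S_fun : set (R -> R) :=
  [set f | measurable_fun (`[0%R, +oo[%classic : set R) f /\
           exists2 v : R, 0 < v & (fun_dist f v < +oo)%E].

End Rearrangement.

Record symmetricSpace (R : realType) := SymmetricSpace {
  carrier : set (R -> R);
  qnorm : (R -> R) -> R;
  carrier_S : carrier `<=` @S_fun R;
  carrier0 : carrier (fun=> 0);
  carrierD : forall f g, carrier f -> carrier g -> carrier (fun t => f t + g t);
  carrierZ : forall (a : R) f, carrier f -> carrier (fun t => a * f t);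
  qnorm_ge0 : forall f, carrier f -> 0 <= qnorm f;
  qnorm_eq0 : forall f, carrier f -> qnorm f = 0 <->
    {ae lebesgue_measure, forall t : R, 0 <= t -> f t = 0};
  qnormZ : forall (a : R) f, carrier f ->
    qnorm (fun t => a * f t) = `|a| * qnorm f;
  qnormD : exists K : R, forall f g, carrier f -> carrier g ->
    qnorm (fun t => f t + g t) <= K * (qnorm f + qnorm g);
  qnorm_complete : forall f : nat -> R -> R, (forall n, carrier (f n)) ->
    (forall e : R, 0 < e -> exists N, forall m n, (N <= m)%N -> (N <= n)%N ->
       qnorm (fun t => f m t - f n t) < e) ->
    exists2 g, carrier g & qnorm (fun t => f n t - g t) @[n --> \oo] --> (0 : R);
  qnorm_symm : forall f g, S_fun f -> carrier g ->
    (forall t, 0 <= t -> (fun_mu f t <= fun_mu g t)%E) ->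
    carrier f /\ qnorm f <= qnorm g;
  carrier_neq0 : exists2 f, carrier f & qnorm f != 0 }.

Section FunctionSpace.
Variables (R : realType) (E : symmetricSpace R).

Definition s_convex (s : R) : Prop :=
  exists C : R, forall (n : nat) (f : 'I_n -> R -> R),
    (forall i, carrier E (f i)) ->
    qnorm E (fun t => (\sum_(i < n) `|f i t| `^ s) `^ s^-1)
      <= C * (\sum_(i < n) qnorm E (f i) `^ s) `^ s^-1.

(* The set is bounded for a > 0, so this real [sup] is the quasi-norm of D_a. *)
Definition dilation_norm (a : R) : R :=
  sup [set qnorm E (fun u => f (a * u)) |
        f in [set f | carrier E f /\ qnorm E f <= 1]].

Definition boyd_quotient (u : R) : \bar R :=
  let l := ln (dilation_norm u^-1) in
  if l == 0 then +oo%E else (ln u / l)%:E.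

Definition lower_boyd : \bar R := lim (boyd_quotient u @[u --> +oo%R]).
Definition upper_boyd : \bar R := lim (boyd_quotient u @[u --> (0 : R)^'+]).

End FunctionSpace.

(* A bounded operator is a function [H -> H]; an unbounded operator is its graph,
  a subset of [H * H]. The inner product is linear in its first argument. *)

Section Operators.
Variables (R : realType) (H : completeNormedModType R[i]).
Variable dot : {dot H for (@Num.conj R[i])}.

Definition hilbert_norm : Prop := forall u : H, `|u| ^+ 2 = dot u u.

Definition bounded_op (a : H -> H) : Prop := linear a /\ continuous a.
Definition adjoint_pair (a b : H -> H) : Prop :=
  forall u v, dot (a u) v = dot u (b v).
Definition op_ge0 (a : H -> H) : Prop := forall u, 0 <= dot (a u) u.
Definition op_le (a b : H -> H) : Prop := forall u, dot (a u) u <= dot (b u) u.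

Definition graph (a : H -> H) : set (H * H) := [set p | p.2 = a p.1].

Definition dom (x : set (H * H)) : set H := [set u | exists v, x (u, v)].
Definition linear_graph (x : set (H * H)) : Prop :=
  [/\ x 0, forall (c : R[i]) p q, x p -> x q -> x (c *: p + q)
    & forall v, x (0, v) -> v = 0].
Definition closed_densely_defined (x : set (H * H)) : Prop :=
  [/\ linear_graph x, closed x & dense (dom x)].

Definition adj (x : set (H * H)) : set (H * H) :=
  [set p | forall q, x q -> dot q.2 p.1 = dot q.1 p.2].
Definition comp_graph (x y : set (H * H)) : set (H * H) :=
  [set p | exists2 w, y (p.1, w) & x (w, p.2)].

Definition selfadjoint (x : set (H * H)) : Prop :=
  closed_densely_defined x /\ adj x = x.
Definition positive (x : set (H * H)) : Prop :=
  selfadjoint x /\ forall p, x p -> 0 <= dot p.2 p.1.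

(* The [xget] below picks the unique such T, which exists for x closed and
  densely defined. *)
Definition modulus (x : set (H * H)) : set (H * H) :=
  xget set0 [set T | positive T /\ comp_graph T T = comp_graph (adj x) x].

Definition orth_projection (e : H -> H) : Prop :=
  [/\ bounded_op e, e \o e = e & adjoint_pair e e].

Definition scalar_measure (P : set R -> H -> H) (u : H) : set R -> \bar R :=
  fun B => (complex.Re (dot (P B u) u))%:E.

(* T is the integral of the identity function with respect to P: the equality
   of quadratic forms determines T on its domain by polarization. P is unique on
   Borel sets, so the [xget] below is unambiguous there. *)
Definition spectral_measure (T : set (H * H)) (P : set R -> H -> H) : Prop :=
  [/\ forall B : set R, measurable B -> orth_projection (P B),
      P setT = id,
      forall F : nat -> set R, (forall n, measurable (F n)) ->
        trivIset setT F -> forall u,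
        \sum_(0 <= k < n) P (F k) u @[n --> \oo] --> P (\bigcup_k F k) u,
      dom T = [set u | (\int[scalar_measure P u]_l (l ^+ 2)%:E < +oo)%E]
    & forall u v, T (u, v) ->
        dot v u = (fine (\int[scalar_measure P u]_l l%:E)%E)%:C].

Definition spectral_projection (T : set (H * H)) : set R -> H -> H :=
  xget (fun _ _ => 0) [set P | spectral_measure T P].

Definition strong_add (x y : set (H * H)) : set (H * H) :=
  closure [set p | exists v w, [/\ x (p.1, v), y (p.1, w) & p.2 = v + w]].
Definition strong_sub (x y : set (H * H)) : set (H * H) :=
  strong_add x [set p | y (p.1, - p.2)].
Definition partial_sum (x : nat -> set (H * H)) (n : nat) : set (H * H) :=
  \big[strong_add/graph (fun=> 0)]_(0 <= k < n) x k.

Definition commutant (A : set (H -> H)) : set (H -> H) :=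
  [set b | bounded_op b /\ forall a, A a -> a \o b = b \o a].

Definition von_neumann (M : set (H -> H)) : Prop :=
  (forall a, M a -> exists2 b, M b & adjoint_pair a b) /\
  commutant (commutant M) = M.

Definition pos_cone (M : set (H -> H)) : set (H -> H) := M `&` op_ge0.

(* Increasing nets in M_+ are replaced by their ranges, the upward directed
   subsets of M_+. *)
Definition increasing_to (M D : set (H -> H)) (a : H -> H) : Prop :=
  [/\ D !=set0, D `<=` pos_cone M,
      forall b c, D b -> D c -> exists d, [/\ D d, op_le b d & op_le c d]
    & [/\ pos_cone M a, forall b, D b -> op_le b a
        & forall c, pos_cone M c -> (forall b, D b -> op_le b c) -> op_le a c]].

Definition semifinite_on (N : set (H -> H)) (tau : (H -> H) -> \bar R) : Prop :=
  forall a, pos_cone N a -> a <> (fun=> 0) ->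
    exists b, [/\ pos_cone N b, b <> (fun=> 0), op_le b a & (tau b < +oo)%E].

(* Only the values of tau on M_+ matter. *)
Record nsf_trace (M : set (H -> H)) (tau : (H -> H) -> \bar R) : Prop := {
  trace_ge0 : forall a, pos_cone M a -> (0 <= tau a)%E;
  traceD : forall a b, pos_cone M a -> pos_cone M b ->
    tau (a \+ b) = (tau a + tau b)%E;
  traceZ : forall (c : R) a, 0 <= c -> pos_cone M a ->
    tau (fun u => c%:C *: a u) = (c%:E * tau a)%E;
  trace_comm : forall a b, M a -> M b -> adjoint_pair a b ->
    tau (b \o a) = tau (a \o b);
  trace_normal : forall D a, increasing_to M D a ->
    tau a = ereal_sup [set tau b | b in D];
  trace_faithful : forall a, pos_cone M a -> tau a = 0%E -> a = (fun=> 0);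
  trace_semifinite : semifinite_on M tau }.

Record cond_expectation (M : set (H -> H)) (tau : (H -> H) -> \bar R)
    (N : set (H -> H)) (Eps : (H -> H) -> H -> H) : Prop := {
  cexp_in : forall a, M a -> N (Eps a);
  cexp_linear : forall (c : R[i]) a b, M a -> M b ->
    Eps (fun u => c *: a u + b u) = (fun u => c *: Eps a u + Eps b u);
  cexp_id : forall b, N b -> Eps b = b;
  cexp_ge0 : forall a, pos_cone M a -> op_ge0 (Eps a);
  cexp_module : forall b a c, N b -> M a -> N c ->
    Eps (b \o a \o c) = b \o Eps a \o c;
  cexp_normal : forall D a, increasing_to M D a ->
    increasing_to M [set Eps b | b in D] (Eps a);
  cexp_trace : forall a, pos_cone M a -> tau (Eps a) = tau a }.

Section Measurable.
Variables (M : set (H -> H)) (tau : (H -> H) -> \bar R).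

Definition affiliated (x : set (H * H)) : Prop :=
  forall b, commutant M b -> forall p, x p -> x (b p.1, b p.2).

Definition op_dist (x : set (H * H)) (v : R) : \bar R :=
  tau (spectral_projection (modulus x) `]v, +oo[).

Definition op_mu (x : set (H * H)) : R -> \bar R := rearrangement (op_dist x).

Definition tau_measurable (x : set (H * H)) : Prop :=
  [/\ closed_densely_defined x, affiliated x
    & exists2 v : R, 0 < v & (op_dist x v < +oo)%E].

(* The norm of L^1(M), that is of E(M) for E = L^1(R_+). *)
Definition L1_norm (x : set (H * H)) : \bar R :=
  (\int[lebesgue_measure]_(t in (`[0%R, +oo[%classic : set R)) op_mu x t)%E.
Definition in_L1 (x : set (H * H)) : Prop :=
  tau_measurable x /\ (L1_norm x < +oo)%E.

(* The extension of a conditional expectation to L^1(M) + M: on L^1(M) it is the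
   L^1-continuous extension from the dense subspace M `&` L^1(M), and
   x = y + z is sent to the sum of the images of y in L^1(M) and z in M. *)
Definition cexp_graph (Eps : (H -> H) -> H -> H) (x w : set (H * H)) : Prop :=
  exists y z u (a : nat -> H -> H),
    [/\ in_L1 y, M z, x = strong_add y (graph z),
        forall n, M (a n) /\ in_L1 (graph (a n))
      & [/\ L1_norm (strong_sub (graph (a n)) y) @[n --> \oo] --> 0%E,
            in_L1 u,
            L1_norm (strong_sub (graph (Eps (a n))) u) @[n --> \oo] --> 0%E
          & w = strong_add u (graph (Eps z))]].

Definition cexp_ext (Eps : (H -> H) -> H -> H) (x : set (H * H))
    : set (H * H) :=
  xget set0 [set w | cexp_graph Eps x w].

Variable E : symmetricSpace R.

Definition in_EM (x : set (H * H)) : Prop :=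
  tau_measurable x /\ carrier E (fun t => fine (op_mu x t)).
Definition EM_norm (x : set (H * H)) : R :=
  qnorm E (fun t => fine (op_mu x t)).

Definition EM_series_cvg (x : nat -> set (H * H)) (X : set (H * H)) : Prop :=
  [/\ forall k, in_EM (x k), in_EM X
    & EM_norm (strong_sub (partial_sum x n) X) @[n --> \oo] --> (0 : R)].

End Measurable.

End Operators.

(* Main.v *)
(* Noncommutative dual Doob inequality. Let B be a finite sum of positive bounded
   x_k and let A be the sum of the E_k(x_k). If e is the spectral projection of A
   on [V, +oo) and t its trace, then V t <= trace (e A), which is the sum of the
   traces of E_k(e) x_k. Cuculescu's projections for the martingale E_k(e) at the
   levels 2^-j give projections d_j with trace d_j <= 2^(j+2) t such that, up to a
   constant, the sum of the (rho/2)^j d_j dominates all the E_k(e) at once, where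
   1 < rho < 2; hence V t is at most the sum over j of (rho/2)^j trace (d_j B).
   This bounds the generalized singular numbers of A by a dyadic Hardy operator
   applied to those of B, and that operator is bounded on E because
   1 < p_E <= q_E < +oo.

   Unbounded operators enter through the measure topology only: "near x a k t"
   compares x with a bounded operator a. A positive x in E(M) is in this sense
   the limit of its bounded spectral cuts, and E_k(x) that of their images, by a
   weak-type estimate for E_k on L^1(M). The bound for A then passes to the limit,
   and applied to the tails of the series it also gives the convergence. *)
Require Import Defs.
From HB Require Import structures.
From mathcomp Require Import all_boot all_order all_algebra.
From mathcomp Require Import sesquilinear complex.
From mathcomp Require Import all_classical all_reals all_analysis.
From mathcomp Require Import measurable_realfun.
From mathcomp Require Import zify lra ring.

Set Implicit Arguments.
Unset Strict Implicit.
Unset Printing Implicit Defensive.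
Import Order.TTheory GRing.Theory Num.Theory.
Import numFieldNormedType.Exports.

Local Open Scope classical_set_scope.
Local Open Scope ring_scope.
Local Open Scope complex_scope.

(** * Operators on a Hilbert space *)

(** Since [E] is only quasi-normed, a duality argument with a maximal inequality is not at hand;
    operators are compared through singular numbers, that is, through traces of spectral
    projections. The number rho meets two opposite demands. The pieces d_j do not commute with
    E_k(e), so cross terms are removed by a Cauchy-Schwarz inequality with weights rho^-j, summable
    because rho > 1. The price is a factor rho^j in front of a dilation by 2^j, whose norm decays
    like sig^j with sig < 1 because q_E is finite, so rho sig < 1 is imposed as well. The condition
    p_E > 1 makes 2^-i times the norm of the dilation by 2^-i summable; it also puts the unbounded
    part of x in L^1, where conditional expectations act.

    Modulus, spectral projection and extended conditional expectation are choices among the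
    solutions of a specification. Hence existence and uniqueness of the spectral projections are
    derived from the bounded operator (1 + x^* x)^-1, and all L^1 approximants allowed by the
    specification of the extension are shown to have the same limit in measure. *)

Record hdot (R : realType) (H : completeNormedModType R[i]) := HDot {
  hd :> {dot H for (@Num.conj R[i])}; hdP : hilbert_norm hd }.

Section Hilbert.
Variables (R : realType) (H : completeNormedModType R[i]) (dot : hdot H).
Implicit Types u v w : H.

(** Real parts suffice: the imaginary part is minus the real part taken at i u ([dotIm]), so real
    quadratic inequalities and real limits can be used throughout. *)
Definition rip u v : R := complex.Re (hd dot u v).
Local Notation ip := rip.
Definition sqn u : R := ip u u.
Local Notation nq := sqn.

Lemma ReD (a b : R[i]) : complex.Re (a + b) = complex.Re a + complex.Re b.
Proof. by case: a b => [a1 a2] [b1 b2]. Qed.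
Lemma ReN (a : R[i]) : complex.Re (- a) = - complex.Re a.
Proof. by case: a. Qed.
Lemma ReZ (c : R) (a : R[i]) : complex.Re (c%:C * a) = c * complex.Re a.
Proof. by case: a => a1 a2 /=; rewrite mul0r subr0. Qed.
Lemma conjcE (a : R[i]) : Num.conj a = (complex.Re a -i* complex.Im a)%C.
Proof. by case: a. Qed.

Lemma ipDl u v w : ip (u + v) w = ip u w + ip v w.
Proof. by rewrite /rip linearDl ReD. Qed.
Lemma ipDr u v w : ip u (v + w) = ip u v + ip u w.
Proof. by rewrite /rip linearDr ReD. Qed.
Lemma ipNl u v : ip (- u) v = - ip u v.
Proof. by rewrite /rip linearNl ReN. Qed.
Lemma ipNr u v : ip u (- v) = - ip u v.
Proof. by rewrite /rip linearNr ReN. Qed.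
Lemma ipBl u v w : ip (u - v) w = ip u w - ip v w.
Proof. by rewrite ipDl ipNl. Qed.
Lemma ipBr u v w : ip u (v - w) = ip u v - ip u w.
Proof. by rewrite ipDr ipNr. Qed.
Lemma ip0l u : ip 0 u = 0. Proof. by rewrite /rip linear0l. Qed.
Lemma ip0r u : ip u 0 = 0. Proof. by rewrite /rip linear0r. Qed.
Lemma ipZl (c : R) u v : ip (c%:C *: u) v = c * ip u v.
Proof. by rewrite /rip linearZl_LR ReZ. Qed.
Lemma dotC u v : hd dot u v = Num.conj (hd dot v u).
Proof. by rewrite hermC /= expr0 mul1r. Qed.
Lemma ipC u v : ip u v = ip v u.
Proof. by rewrite /rip dotC conjcE. Qed.
Lemma ipZr (c : R) u v : ip u (c%:C *: v) = c * ip u v.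
Proof. by rewrite ipC ipZl ipC. Qed.
Lemma dotZl (c : R[i]) u v : hd dot (c *: u) v = c * hd dot u v.
Proof. by rewrite linearZl_LR. Qed.
Lemma dotIm u v : complex.Im (hd dot u v) = - ip ('i%C *: u) v.
Proof. by rewrite /rip dotZl; case: (hd dot u v) => a b /=; rewrite mul0r mul1r sub0r opprK. Qed.
Lemma ip_ii u v : ip ('i%C *: u) ('i%C *: v) = ip u v.
Proof.
rewrite {1}/rip dotZl dotC dotZl /rip (dotC u v) !conjcE.
by case: (hd dot v u) => a b /=; rewrite !(mul0r, mul1r, add0r, sub0r, addr0) opprK.
Qed.
Lemma ip_iC u v : ip ('i%C *: u) v = - ip u ('i%C *: v).
Proof.
by rewrite -[in RHS]ip_ii scalerA -expr2 sqr_i scaleN1r ipNr opprK.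
Qed.
Lemma dot_ip u v : hd dot u v = ip u v +i* (- ip ('i%C *: u) v).
Proof. by rewrite -dotIm /rip; case: (hd dot u v). Qed.
Lemma dotr u : hd dot u u = (nq u)%:C.
Proof.
rewrite dot_ip; congr (_ +i* _)%C; have := ip_iC u u; rewrite ipC; lra.
Qed.
Lemma norm_nq u : `|u| ^+ 2 = (nq u)%:C.
Proof. by rewrite (hdP dot) dotr. Qed.
Lemma nq_ge0 u : 0 <= nq u.
Proof. by rewrite -ler0c -norm_nq exprn_ge0. Qed.
Lemma nq_eq0 u : nq u = 0 -> u = 0.
Proof.
move=> u0; have := norm_nq u; rewrite u0 => /eqP.
by rewrite sqrf_eq0 normr_eq0 => /eqP.
Qed.
Lemma nq0 : nq 0 = 0. Proof. exact: ip0l. Qed.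
Lemma nqN u : nq (- u) = nq u. Proof. by rewrite /sqn ipNl ipNr opprK. Qed.
Lemma nqZ (c : R) u : nq (c%:C *: u) = c ^+ 2 * nq u.
Proof. by rewrite /sqn ipZl ipZr mulrA expr2. Qed.

Lemma nqD u v : nq (u + v) = nq u + 2 * ip u v + nq v.
Proof. rewrite /sqn ipDl !ipDr (ipC v u); ring. Qed.
Lemma nqB u v : nq (u - v) = nq u - 2 * ip u v + nq v.
Proof. rewrite nqD nqN ipNr; ring. Qed.
Lemma nqBC u v : nq (u - v) = nq (v - u).
Proof. by rewrite -nqN opprB. Qed.
Lemma nqD2 u v : nq (u + v) <= 2 * (nq u + nq v).
Proof. have := nq_ge0 (u - v); rewrite nqB nqD; lra. Qed.
Lemma nq_tri u v w : nq (u - w) <= 2 * (nq (u - v) + nq (v - w)).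
Proof. by have := nqD2 (u - v) (v - w); rewrite addrA subrK. Qed.

Lemma quad_ge0 (a b c : R) : 0 <= a ->
  (forall t : R, 0 <= a * t ^+ 2 + 2 * b * t + c) -> b ^+ 2 <= a * c.
Proof.
move=> a0 h; have [a1|a1] := eqVneq a 0; last first.
  have ap : 0 < a by rewrite lt_def a1 a0.
  have := h (- b / a); rewrite expr2.
  have -> : a * (- b / a * (- b / a)) + 2 * b * (- b / a) + c = (a * c - b ^+ 2) / a.
    by field.
  by rewrite pmulr_lge0 ?invr_gt0// subr_ge0.
rewrite a1 mul0r; have [-> |b0] := eqVneq b 0; first by rewrite expr0n.
(* For a = 0 the polynomial is affine; at this point it takes the value -1. *)
have := h ((- c - 1) / (2 * b)); rewrite a1 mul0r add0r.
by rewrite mulrC divfK ?mulf_neq0//; lra.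
Qed.
Lemma CS u v : ip u v ^+ 2 <= nq u * nq v.
Proof.
rewrite mulrC; apply: quad_ge0 => [|t]; first exact: nq_ge0.
have := nq_ge0 (u + t%:C *: v); rewrite nqD nqZ ipZr; lra.
Qed.
Lemma CS_le u v (a b : R) : 0 <= a -> 0 <= b -> nq u <= a ^+ 2 -> nq v <= b ^+ 2 ->
  `|ip u v| <= a * b.
Proof.
move=> a0 b0 ua vb; rewrite -(@ler_pXn2r _ 2)// ?nnegrE ?mulr_ge0// real_normK ?num_real//.
by rewrite (le_trans (CS u v))// exprMn ler_pM ?nq_ge0.
Qed.
Lemma CS2 u v (a : R) : 0 < a -> 2 * ip u v <= a * nq u + a^-1 * nq v.
Proof.
move=> a0; have := nq_ge0 (a%:C *: u - v); rewrite nqB nqZ ipZl => h.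
have : 0 <= a^-1 * (a ^+ 2 * nq u - 2 * (a * ip u v) + nq v).
  by rewrite mulr_ge0 ?invr_ge0// ltW.
have -> : a^-1 * (a ^+ 2 * nq u - 2 * (a * ip u v) + nq v) = a * nq u - 2 * ip u v + a^-1 * nq v.
  by field; rewrite gt_eqF.
lra.
Qed.

Definition sconv (un : nat -> H) u := nq (un n - u) @[n --> \oo] --> (0 : R).
Local Notation scvg := sconv.

Lemma nq_norm u : `|u| = (Num.sqrt (nq u))%:C.
Proof.
apply/eqP; rewrite -(@eqrXn2 _ 2)// ?norm_nq; last by rewrite ler0c sqrtr_ge0.
by rewrite -rmorphXn /= sqr_sqrtr// nq_ge0.
Qed.
Lemma norm_lt u (e : R) : 0 < e -> (`|u| < e%:C) = (nq u < e ^+ 2).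
Proof.
move=> e0; rewrite nq_norm ltcR -[RHS](@ltr_sqrt _ (nq u)) ?exprn_gt0//.
by rewrite sqrtr_sqr gtr0_norm.
Qed.
Lemma gt0_complex (e : R[i]) : 0 < e -> exists2 e' : R, 0 < e' & e = e'%:C.
Proof. by case: e => a b; rewrite ltcE /= => /andP[/eqP -> a0]; exists a. Qed.

Lemma scvgP (un : nat -> H) u : scvg un u <-> un n @[n --> \oo] --> u.
Proof.
split=> [h|/cvgrPdist_lt h].
  apply/cvgrPdist_lt => e /gt0_complex[e' e0 ->].
  move/cvgrPdist_lt: h => /(_ _ (exprn_gt0 2 e0)); apply: filterS => n.
  by rewrite sub0r normrN ger0_norm ?nq_ge0// norm_lt// nqBC.
apply/cvgrPdist_lt => e e0.
have se : 0 < Num.sqrt e by rewrite sqrtr_gt0.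
have := h (Num.sqrt e)%:C; rewrite ltcR => /(_ se).
apply: filterS => n; rewrite norm_lt// sqr_sqrtr ?ltW//.
by rewrite sub0r normrN ger0_norm ?nq_ge0// nqBC.
Qed.

Lemma scvg_unique (un : nat -> H) u v : scvg un u -> scvg un v -> u = v.
Proof. by move=> /scvgP h /scvgP h'; apply: cvg_unique h h'. Qed.

Lemma scauchy (un : nat -> H) :
  (forall e : R, 0 < e -> exists N, forall m n, (N <= m)%N -> (N <= n)%N -> nq (un m - un n) < e) ->
  exists u, scvg un u.
Proof.
move=> h; have : cauchy (un n @[n --> \oo]).
  apply/cauchy_exP => e /gt0_complex[e' e0 ->].
  have [N hN] := h _ (exprn_gt0 2 e0); exists (un N).
  exists N => //= n Nn; rewrite -ball_normE /ball_ /= norm_lt//.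
  exact: (hN N n (leqnn N) Nn).
by move=> /cauchy_cvg /cvg_ex[l hl]; exists l; apply/scvgP.
Qed.

Lemma scvg_ip (un vn : nat -> H) u v : scvg un u -> scvg vn v ->
  ip (un n) (vn n) @[n --> \oo] --> ip u v.
Proof.
move=> hu hv.
have hcv : nq (un n - u) + nq (vn n - v) + 
   Num.sqrt (nq (un n - u)) * Num.sqrt (nq v) + Num.sqrt (nq u) * Num.sqrt (nq (vn n - v)) @[n --> \oo] --> (0 : R).
  have sq (w : nat -> R) : w n @[n --> \oo] --> (0 : R) -> Num.sqrt (w n) @[n --> \oo] --> (0 : R).
    by move=> hw; rewrite -[X in _ --> X](@sqrtr0 R); apply: continuous_cvg hw; exact: sqrt_continuous.
  rewrite -[X in _ --> X](_ : 0 + 0 + 0 * Num.sqrt (nq v) + Num.sqrt (nq u) * 0 = 0); last by ring.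
  apply: cvgD; first apply: cvgD; first exact: cvgD.
    by apply: cvgM; [exact: sq|exact: cvg_cst].
  by apply: cvgM; [exact: cvg_cst|exact: sq].
apply/cvgrPdist_le => e e0; move/cvgrPdist_le: hcv => /(_ e e0).
apply: filterS => n; rewrite sub0r normrN => h; apply: le_trans h.
rewrite [leRHS]ger0_norm; last by rewrite !addr_ge0 ?nq_ge0// mulr_ge0 ?sqrtr_ge0.
have -> : ip u v - ip (un n) (vn n) = - ip (un n - u) (vn n - v) - ip (un n - u) v - ip u (vn n - v).
  by rewrite !ipBl !ipBr; ring.
have cs a b : `|ip a b| <= Num.sqrt (nq a) * Num.sqrt (nq b).
  by apply: CS_le; rewrite ?sqrtr_ge0 ?sqr_sqrtr ?nq_ge0.
have h1 : `|ip (un n - u) (vn n - v)| <= nq (un n - u) + nq (vn n - v).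
  have := @CS2 (un n - u) (vn n - v) 1 ltr01; have := @CS2 (- (un n - u)) (vn n - v) 1 ltr01.
  rewrite nqN ipNl invr1 !mul1r ler_norml; have := nq_ge0 (un n - u); have := nq_ge0 (vn n - v); lra.
have := cs (un n - u) v; have := cs u (vn n - v).
have := ler_normB (- ip (un n - u) (vn n - v) - ip (un n - u) v) (ip u (vn n - v)).
have := ler_normB (- ip (un n - u) (vn n - v)) (ip (un n - u) v); rewrite normrN; lra.
Qed.
Lemma scvg_nq (un : nat -> H) u : scvg un u -> nq (un n) @[n --> \oo] --> nq u.
Proof. by move=> h; apply: scvg_ip. Qed.
Lemma scvg_cst u : scvg (fun=> u) u.
Proof. by apply/scvgP; exact: cvg_cst. Qed.
Lemma scvgD (un vn : nat -> H) u v : scvg un u -> scvg vn v -> scvg (fun n => un n + vn n) (u + v).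
Proof. by move=> /scvgP h /scvgP h'; apply/scvgP; apply: cvgD. Qed.
Lemma scvgZ (c : R[i]) (un : nat -> H) u : scvg un u -> scvg (fun n => c *: un n) (c *: u).
Proof. by move=> /scvgP h; apply/scvgP; apply: cvgZ => //; exact: cvg_cst. Qed.
Lemma scvgB (un vn : nat -> H) u v : scvg un u -> scvg vn v -> scvg (fun n => un n - vn n) (u - v).
Proof. by move=> /scvgP h /scvgP h'; apply/scvgP; apply: cvgB. Qed.

Lemma squeeze0 (a b : nat -> R) : (forall n, 0 <= a n <= b n) -> b n @[n --> \oo] --> (0 : R) ->
  a n @[n --> \oo] --> (0 : R).
Proof.
move=> h hb; apply: (squeeze_cvgr _ (cvg_cst (0 : R)) hb).
by near=> n; apply: h.
Unshelve. all: by end_near. Qed.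

Lemma cvg0_bound (b : nat -> R) e : b n @[n --> \oo] --> (0 : R) -> 0 < e -> exists N, forall n, (N <= n)%N -> b n < e.
Proof.
move=> /cvgrPdist_lt h e0; have [N _ hN] := h _ e0; exists N => n Nn.
have := hN n Nn; rewrite /= sub0r normrN; exact: le_lt_trans (ler_norm _).
Qed.

Definition ip2 (p q : H * H) : R := ip p.1 q.1 + ip p.2 q.2.
Definition nq2 (p : H * H) : R := ip2 p p.
Definition scvg2 (pn : nat -> H * H) p := scvg (fun n => (pn n).1) p.1 /\ scvg (fun n => (pn n).2) p.2.

Lemma ip2Dl p q r : ip2 (p + q) r = ip2 p r + ip2 q r.
Proof. by rewrite /ip2 !ipDl; ring. Qed.
Lemma ip2C p q : ip2 p q = ip2 q p. Proof. by rewrite /ip2 !(ipC p.1) (ipC p.2). Qed.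
Lemma ip2Zl (c : R) p q : ip2 (c%:C *: p) q = c * ip2 p q.
Proof. by rewrite /ip2 !ipZl; ring. Qed.

Lemma nq2_ge0 p : 0 <= nq2 p. Proof. by rewrite /nq2 /ip2 addr_ge0 ?nq_ge0. Qed.

Definition sclosed (G : set (H * H)) := forall pn p, (forall n, G (pn n)) -> scvg2 pn p -> G p.
Definition ssub (G : set (H * H)) := G 0 /\ forall (c : R) p q, G p -> G q -> G (c%:C *: p + q).

Lemma scauchy2 (pn : nat -> H * H) :
  (forall e : R, 0 < e -> exists N, forall m n, (N <= m)%N -> (N <= n)%N -> nq2 (pn m - pn n) < e) ->
  exists p, scvg2 pn p.
Proof.
move=> h; have [|u hu] := @scauchy (fun n => (pn n).1).
  move=> e e0; have [N hN] := h e e0; exists N => m n Nm Nn.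
  by apply: le_lt_trans (hN m n Nm Nn); rewrite /nq2 /ip2 /= lerDl nq_ge0.
have [|v hv] := @scauchy (fun n => (pn n).2).
  move=> e e0; have [N hN] := h e e0; exists N => m n Nm Nn.
  by apply: le_lt_trans (hN m n Nm Nn); rewrite /nq2 /ip2 /= lerDr nq_ge0.
by exists (u, v).
Qed.

(* Minimize |p|^2 - 2 phi(p) on G. *)
Lemma riesz (G : set (H * H)) (phi : H * H -> R) (K : R) : sclosed G -> ssub G ->
  (forall (c : R) p q, phi (c%:C *: p + q) = c * phi p + phi q) ->
  0 <= K -> (forall p, phi p ^+ 2 <= K * nq2 p) ->
  exists2 g, G g & forall p, G p -> phi p = ip2 p g.
Proof.
move=> clG [G0 subG] lphi K0 bphi.
have phi0 : phi 0 = 0.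
  by have := lphi 1 0 0; rewrite scaler0 addr0 mul1r; lra.
have phiZ (c : R) p : phi (c%:C *: p) = c * phi p by have := lphi c p 0; rewrite !addr0 phi0 addr0.
have phiD p q : phi (p + q) = phi p + phi q.
  by have := lphi 1 p q; rewrite scale1r mul1r.
pose J p := nq2 p - 2 * phi p.
have Jlow p : - K <= J p.
  have h := bphi p; have n0 := nq2_ge0 p.
  have h2 : 2 * phi p <= K + nq2 p.
    apply: le_trans (ler_norm _) _.
    have h3 : `|2 * phi p| ^+ 2 <= (K + nq2 p) ^+ 2.
      rewrite real_normK ?num_real// exprMn.
      have : 0 <= (K - nq2 p) ^+ 2 by exact: sqr_ge0.
      by move: h n0; rewrite !expr2; nra.
    have h4 : 0 <= K + nq2 p by rewrite addr_ge0.
    by rewrite -ler_sqr ?nnegrE.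
  rewrite /J; lra.
pose S := [set J p | p in G].
have S0 : S !=set0 by exists (J 0); exists 0.
have lS : lbound S (- K) by move=> x [q Gq <-]; exact: Jlow.
pose m := inf S.
have mJ p : G p -> m <= J p by move=> Gp; apply: ge_inf; [exists (- K)|exists p].
have ex (n : nat) : exists p, G p /\ J p < m + n.+1%:R^-1.
  have [||_ [p0 Gp <-] h] := @inf_adherent R S (n.+1%:R^-1); first by rewrite invr_gt0.
    by split=> //; exists (- K).
  by exists p0.
have [pn hpn] := choice ex.
have addJ (t : R) p q : J (t%:C *: p + q) = t ^+ 2 * nq2 p + 2 * t * (ip2 q p - phi p) + J q.
  rewrite /J lphi /nq2 ip2Dl ip2Zl (ip2C p) (ip2C q (_ + _)) !ip2Dl !ip2Zl (ip2C p q); ring.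
have [|g hg] := @scauchy2 pn.
  move=> e e0; have [N _ hN] := near_infty_natSinv_lt (PosNum (divr_gt0 e0 (ltr0n _ 8))).
  exists N => a b Na Nb.
  have h1 := (hpn a).2; have h2 := (hpn b).2.
  (* Parallelogram argument: [J] at the midpoint is at least m, which bounds [nq2 (pn a - pn b)] by
     twice the sum of the two errors. *)
  have := mJ ((2^-1)%:C *: (pn a - pn b) + pn b); rewrite addJ => /(_ _).
  have Gm : G (pn a - pn b) by rewrite addrC -scaleN1r -(rmorphN1 (real_complex R)); apply: subG; [exact: (hpn b).1|exact: (hpn a).1].
  move=> /(_ (subG _ _ _ Gm (hpn b).1)).
  have := addJ 1 (pn a - pn b) (pn b); rewrite scale1r subrK.
  have := hN a Na; have := hN b Nb; rewrite /=; set x := a.+1%:R^-1; set y := b.+1%:R^-1 in h2 *.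
  set I := ip2 _ _ - _; set Q := nq2 _ => hy hx hJ hm.
  by move: h1; rewrite hJ -/x; rewrite expr1n !expr2 in hm *; nra.
have Gg : G g by apply: clG hg => n; case: (hpn n).
exists g => // p Gp.
have cvi : ip2 (pn n) p @[n --> \oo] --> ip2 g p.
  by apply: cvgD; apply: scvg_ip; [exact: hg.1|exact: scvg_cst|exact: hg.2|exact: scvg_cst].
(* First-order condition at the minimum: moving from g along p gives a nonnegative quadratic in t
   without constant term, so [quad_ge0] kills its linear coefficient. *)
suff : (ip2 g p - phi p) ^+ 2 <= nq2 p * 0.
  by rewrite mulr0 => h; apply/eqP; rewrite eq_sym (ip2C p) -subr_eq0 -sqrf_eq0 eq_le h sqr_ge0.
apply: quad_ge0 => [|t]; first exact: nq2_ge0.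
rewrite addr0.
have cv : nq2 p * t ^+ 2 + 2 * (ip2 (pn n) p - phi p) * t + n.+1%:R^-1 @[n --> \oo] --> nq2 p * t ^+ 2 + 2 * (ip2 g p - phi p) * t + 0.
  apply: cvgD; last exact: cvg_harmonic.
  apply: cvgD; first exact: cvg_cst.
  apply: cvgM; last exact: cvg_cst.
  apply: cvgM; first exact: cvg_cst.
  by apply: cvgB => //; exact: cvg_cst.
rewrite -[X in 0 <= X]addr0; apply: (cvgr_to_ge cv); near=> n.
have := mJ _ (subG t _ _ Gp (hpn n).1); rewrite addJ; have := (hpn n).2.
have -> : nq2 p * t ^+ 2 + 2 * (ip2 (pn n) p - phi p) * t = t ^+ 2 * nq2 p + 2 * t * (ip2 (pn n) p - phi p) by ring.
set A := _ + 2 * t * _; set B := J _; set C := _^-1; lra.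
Unshelve. all: by end_near. Qed.
End Hilbert.

(** * The ring of bounded operators *)

Section BopRing.
Variables (R : realType) (H : completeNormedModType R[i]).

Record bop := Bop { bf :> H -> H; bfP : bounded_op bf }.

Lemma bopE (a b : bop) : (forall u, a u = b u) -> a = b.
Proof.
case: a b => [a ap] [b bp] /= /funext ab; subst b; congr Bop; exact: Prop_irrelevance.
Qed.

HB.instance Definition _ := gen_eqMixin bop.
HB.instance Definition _ := gen_choiceMixin bop.

Lemma bop_lin (a : bop) (c : R[i]) u v : a (c *: u + v) = c *: a u + a v.
Proof. by have [h _] := bfP a; rewrite h. Qed.
Lemma bop0 (a : bop) : a 0 = 0.
Proof. by have := bop_lin a (-1) 0 0; rewrite scaleN1r oppr0 addr0 scaleN1r addNr. Qed.
Lemma bopD (a : bop) u v : a (u + v) = a u + a v.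
Proof. by have := bop_lin a 1 u v; rewrite !scale1r. Qed.
Lemma bopZ (a : bop) (c : R[i]) u : a (c *: u) = c *: a u.
Proof. by have := bop_lin a c u 0; rewrite bop0 !addr0. Qed.
Lemma bopN (a : bop) u : a (- u) = - a u.
Proof. by rewrite -scaleN1r bopZ scaleN1r. Qed.
Lemma bopB (a : bop) u v : a (u - v) = a u - a v.
Proof. by rewrite bopD bopN. Qed.
Lemma bop_cont (a : bop) : continuous a. Proof. by have [_] := bfP a. Qed.

Lemma zero_bounded : bounded_op (fun _ : H => 0 : H).
Proof. by split=> [c u v|u]; [rewrite scaler0 addr0|exact: cvg_cst]. Qed.
Lemma add_bounded (a b : bop) : bounded_op (fun u => a u + b u).
Proof.
split=> [c u v|u]; first by rewrite !bop_lin scalerDr addrACA.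
by apply: cvgD; exact: bop_cont.
Qed.
Lemma opp_bounded (a : bop) : bounded_op (fun u => - a u).
Proof.
split=> [c u v|u]; first by rewrite !bop_lin opprD scalerN.
by apply: cvgN; exact: bop_cont.
Qed.
Lemma scale_bounded (c : R[i]) (a : bop) : bounded_op (fun u => c *: a u).
Proof.
split=> [d u v|u]; first by rewrite !bop_lin scalerDr !scalerA mulrC.
by apply: cvgZ; [exact: cvg_cst|exact: bop_cont].
Qed.
Lemma id_bounded : bounded_op (fun u : H => u).
Proof. by split=> [d u v|u] //; exact: cvg_id. Qed.
Lemma comp_bounded (a b : bop) : bounded_op (fun u => a (b u)).
Proof.
split=> [d u v|u]; first by rewrite !bop_lin.
exact: (@continuous_comp _ _ _ b a u (@bop_cont b u) (@bop_cont a (b u))).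
Qed.

Lemma bop_addA : associative (fun a b : bop => Bop (add_bounded a b)).
Proof. by move=> a b c; apply: bopE => u /=; rewrite addrA. Qed.
Lemma bop_addC : commutative (fun a b : bop => Bop (add_bounded a b)).
Proof. by move=> a b; apply: bopE => u /=; rewrite addrC. Qed.
Lemma bop_add0 : left_id (Bop zero_bounded) (fun a b : bop => Bop (add_bounded a b)).
Proof. by move=> a; apply: bopE => u /=; rewrite add0r. Qed.
Lemma bop_addN : left_inverse (Bop zero_bounded) (fun a => Bop (opp_bounded a)) (fun a b : bop => Bop (add_bounded a b)).
Proof. by move=> a; apply: bopE => u /=; rewrite addNr. Qed.
HB.instance Definition _ := GRing.isZmodule.Build bop bop_addA bop_addC bop_add0 bop_addN.

Lemma bop_mulA : associative (fun a b : bop => Bop (comp_bounded a b)).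
Proof. by move=> a b c; apply: bopE => u. Qed.
Lemma bop_mul1 : left_id (Bop id_bounded) (fun a b : bop => Bop (comp_bounded a b)).
Proof. by move=> a; apply: bopE => u. Qed.
Lemma bop_mulr1 : right_id (Bop id_bounded) (fun a b : bop => Bop (comp_bounded a b)).
Proof. by move=> a; apply: bopE => u. Qed.
Lemma bop_mulDl : left_distributive (fun a b : bop => Bop (comp_bounded a b)) (fun a b => a + b).
Proof. by move=> a b c; apply: bopE => u. Qed.
Lemma bop_mulDr : right_distributive (fun a b : bop => Bop (comp_bounded a b)) (fun a b => a + b).
Proof. by move=> a b c; apply: bopE => u /=; rewrite bopD. Qed.
HB.instance Definition _ := GRing.Zmodule_isPzRing.Build bop bop_mulA bop_mul1 bop_mulr1 bop_mulDl bop_mulDr.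

(** Real scalars are the ones that preserve self-adjointness, and the nonnegative ones the order;
    complex multiples are taken on vectors. *)
Definition bscale (c : R) (a : bop) := Bop (scale_bounded c%:C a).
Lemma bscaleA c d (a : bop) : bscale c (bscale d a) = bscale (c * d) a.
Proof. by apply: bopE => u /=; rewrite scalerA rmorphM. Qed.
Lemma bscale1 : left_id 1 bscale.
Proof. by move=> a; apply: bopE => u /=; rewrite scale1r. Qed.
Lemma bscaleDr : right_distributive bscale +%R.
Proof. by move=> c a b; apply: bopE => u /=; rewrite scalerDr. Qed.
Lemma bscaleDl (a : bop) : {morph bscale^~ a : c d / c + d}.
Proof. by move=> c d; apply: bopE => u /=; rewrite rmorphD scalerDl. Qed.
HB.instance Definition _ := GRing.Zmodule_isLmodule.Build R bop bscaleA bscale1 bscaleDr bscaleDl.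

Lemma scAl (c : R) (a b : bop) : (c *: a) * b = c *: (a * b).
Proof. exact: bopE. Qed.
Lemma scAr (c : R) (a b : bop) : a * (c *: b) = c *: (a * b).
Proof. by apply: bopE => u /=; rewrite bopZ. Qed.

Lemma addE (a b : bop) u : (a + b) u = a u + b u. Proof. by []. Qed.
Lemma oppE (a : bop) u : (- a) u = - a u. Proof. by []. Qed.
Lemma subE (a b : bop) u : (a - b) u = a u - b u. Proof. by []. Qed.
Lemma mulE (a b : bop) u : (a * b) u = a (b u). Proof. by []. Qed.
Lemma scaleE (c : R) (a : bop) u : (c *: a) u = c%:C *: a u. Proof. by []. Qed.
Lemma oneE u : (1 : bop) u = u. Proof. by []. Qed.
Lemma zeroE u : (0 : bop) u = 0. Proof. by []. Qed.
Lemma sumE I (r : seq I) (P : pred I) (F : I -> bop) u : (\sum_(i <- r | P i) F i) u = \sum_(i <- r | P i) F i u.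
Proof. by elim/big_rec2: _ => [|i x y _ <-]. Qed.
End BopRing.
Definition bE := (addE, oppE, mulE, scaleE, oneE, zeroE).

(** * Adjoints and positivity *)

Section Adjoint.
Variables (R : realType) (H : completeNormedModType R[i]) (dot : hdot H).
Local Notation bop := (bop H).
Local Notation ip := (rip dot).
Local Notation nq := (sqn dot).
Local Notation scvg := (sconv dot).
Implicit Types (a b c : bop) (u v w : H).

(** Squared norms are compared, so k plays the role of the square of a bound for the operator
    norm. *)
Definition nb a (k : R) := forall u, nq (a u) <= k * nq u.

Lemma bounded_nq (f : H -> H) : bounded_op f -> exists2 k, 0 <= k & forall u, nq (f u) <= k * nq u.
Proof.
move=> [lf cf]; pose F := GRing.isLinear.Build _ _ _ _ f lf.
pose fl : {linear H -> H} := HB.pack f F.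
have : bounded_near fl (nbhs (0 : H)) by apply/linear_bounded_continuous.
move/linear_boundedP => [k [kr hk]].
have [k' k'E] : exists k', k = k'%:C by move/complex_realP: kr.
pose K := Num.max k' 0 + 1.
have K0 : 0 < K by rewrite ltr_pwDr// le_max lexx orbT.
exists (K ^+ 2); first exact: sqr_ge0.
move=> u; have /hk/(_ u) : k < K%:C by rewrite k'E ltcR /K ltr_pwDr// le_max lexx.
rewrite /= !(nq_norm dot) -rmorphM lecR => h.
rewrite -[nq (f u)]sqr_sqrtr ?nq_ge0// -[X in _ * X]sqr_sqrtr ?nq_ge0// -exprMn.
by rewrite ler_sqr ?nnegrE ?mulr_ge0 ?sqrtr_ge0 ?(ltW K0).
Qed.

Lemma nbP a : exists2 k, 0 <= k & nb a k.
Proof. exact: (bounded_nq (bfP a)). Qed.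

Lemma bounded_nqP (f : H -> H) (k : R) : linear f -> (forall u, nq (f u) <= k * nq u) -> bounded_op f.
Proof.
move=> lf hk; split => // u; apply/cvgrPdist_lt => e /gt0_complex[e' e0 ->].
pose K := `|k| + 1; have K0 : 0 < K by rewrite ltr_wpDl.
have := @nbhsx_ballx _ _ u (Num.sqrt (e' ^+ 2 / K))%:C.
rewrite ltcR sqrtr_gt0 divr_gt0 ?exprn_gt0// => /(_ isT).
apply: filterS => v; rewrite -ball_normE /= (norm_lt dot) ?sqrtr_gt0 ?divr_gt0 ?exprn_gt0//.
rewrite sqr_sqrtr ?divr_ge0 ?ltW ?exprn_gt0// ltr_pdivlMr// (norm_lt dot)// => h.
have -> : f u - f v = f (u - v) by rewrite addrC -scaleN1r -lf scaleN1r addrC.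
apply: le_lt_trans (hk _) _; apply: le_lt_trans h.
by rewrite mulrC ler_wpM2l ?nq_ge0// (le_trans (ler_norm k))// lerDl.
Qed.

Definition mkbop (f : H -> H) (k : R) (lf : linear f) (hk : forall u, nq (f u) <= k * nq u) :=
  Bop (bounded_nqP lf hk).

Lemma bop_scvg a un u : scvg un u -> scvg (fun n => a (un n)) (a u).
Proof. by move=> /scvgP h; apply/scvgP; apply: continuous_cvg h; exact: bop_cont. Qed.

(* Riesz representation applied to u |-> ip (a u) v on H x {0} *)
Lemma adj_ex a v : exists w, forall u, ip (a u) v = ip u w.
Proof.
have [k k0 hk] := nbP a.
have [|||||g Gg hg] := @riesz _ _ dot [set p | p.2 = 0] (fun p => ip (a p.1) v) (k * nq v).
- move=> pn p h [_ h2]; apply: (scvg_unique (dot:=dot)) h2 _.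
  by rewrite (_ : (fun n => (pn n).2) = fun=> 0); [exact: scvg_cst|apply/funext => n; exact: h].
- by split=> // d p q /= -> ->; rewrite scaler0 addr0.
- by move=> d p q /=; rewrite bopD bopZ ipDl ipZl.
- by rewrite mulr_ge0 ?nq_ge0.
- move=> p; apply: le_trans (CS _ _ _) _; rewrite mulrAC ler_wpM2r ?nq_ge0//.
  apply: le_trans (hk _) _; rewrite ler_wpM2l// /nq2 /ip2 lerDl; exact: nq_ge0.
by exists g.1 => u; have := hg (u, 0) erefl; rewrite /ip2 /= ip0l addr0.
Qed.

Lemma ip_inj u v : (forall w, ip w u = ip w v) -> u = v.
Proof.
move=> h; apply/eqP; rewrite -subr_eq0; apply/eqP; apply: (@nq_eq0 _ _ dot).
by rewrite /sqn ipBr h subrr.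
Qed.

Lemma adj_bop_ex a : exists b, forall u v, ip (a u) v = ip u (b v).
Proof.
have [f hf] := choice (adj_ex a); have [k k0 hk] := nbP a.
have lf : linear f.
  move=> d u v; apply: ip_inj => w; rewrite -hf !ipDr -!hf; congr (_ + _).
  (* Complex linearity follows from the real identity because multiplication by i is skew for [ip]
     ([ip_iC]). *)
  case: d => x y; have -> : (x +i* y)%C = x%:C + y%:C * 'i%C.
    by apply/eqP; rewrite eq_complex /= !(mul0r, mulr0, mulr1, addr0, subr0, add0r) !eqxx.
  rewrite !scalerDl !ipDr -!scalerA !ipZr hf; congr (_ + _ * _).
  by have := ip_iC dot (a w) u; have := ip_iC dot w (f u); rewrite -hf -bopZ hf; lra.
have bf_ u : nq (f u) <= k * nq u.
  have h : nq (f u) ^+ 2 <= k * nq (f u) * nq u.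
    rewrite {1}/sqn -hf; apply: le_trans (CS _ _ _) _; rewrite ler_wpM2r ?nq_ge0//; exact: hk.
  have [n0|] := eqVneq (nq (f u)) 0; first by rewrite n0 mulr_ge0 ?nq_ge0.
  have := nq_ge0 dot (f u); rewrite le0r => /orP[/eqP -> /eqP//|n0 _].
  by move: h; rewrite expr2 mulrAC ler_pM2r.
by exists (mkbop lf bf_).
Qed.

Definition adjo a : bop := xget (0 : bop) [set b : bop | forall u v, ip (a u) v = ip u (b v)].
Lemma adjP a u v : ip (a u) v = ip u (adjo a v).
Proof. by rewrite /adjo; case: xgetP => [b _ hb|h]; [exact: hb|have [b hb] := adj_bop_ex a; have := h b]. Qed.
Lemma adjPr a u v : ip u (a v) = ip (adjo a u) v.
Proof. by rewrite ipC adjP ipC. Qed.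
Lemma adj_uniq a b : (forall u v, ip (a u) v = ip u (b v)) -> adjo a = b.
Proof. by move=> h; apply: bopE => v; apply: ip_inj => u; rewrite -adjP h. Qed.
Lemma adjK a : adjo (adjo a) = a.
Proof. by apply: adj_uniq => u v; rewrite -adjPr. Qed.
Lemma adjM a b : adjo (a * b) = adjo b * adjo a.
Proof. by apply: adj_uniq => u v; rewrite !bE !adjP. Qed.
Lemma adjD a b : adjo (a + b) = adjo a + adjo b.
Proof. by apply: adj_uniq => u v; rewrite !bE ipDl ipDr !adjP. Qed.
Lemma adjN a : adjo (- a) = - adjo a.
Proof. by apply: adj_uniq => u v; rewrite !bE ipNl ipNr !adjP. Qed.
Lemma adjZ (k : R) a : adjo (k *: a) = k *: adjo a.
Proof. by apply: adj_uniq => u v; rewrite !bE ipZl ipZr !adjP. Qed.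
Lemma adj1 : adjo 1 = 1. Proof. exact: adj_uniq. Qed.
Lemma adj0 : adjo 0 = 0. Proof. by apply: adj_uniq => u v; rewrite !bE ip0l ip0r. Qed.

Lemma dot_adj (f g : H -> H) : linear f -> linear g ->
  (forall u v, ip (f u) v = ip u (g v)) -> adjoint_pair dot f g.
Proof.
move=> lf lg h u v; rewrite !dot_ip h; congr (_ +i* - _)%C.
have fZ : 'i%C *: f u = f ('i%C *: u).
  have f0 : f 0 = 0 by have := lf (-1) 0 0; rewrite scaleN1r oppr0 addr0 scaleN1r addNr.
  by have := lf 'i%C u 0; rewrite f0 !addr0.
by rewrite fZ h.
Qed.
Lemma adjoint_pairP a b : adjoint_pair dot a b <-> b = adjo a.
Proof.
split=> [h|->]; first by apply/esym/adj_uniq => u v; rewrite /rip h.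
by apply: dot_adj; [exact: (bfP _).1|exact: (bfP _).1|exact: adjP].
Qed.

Definition sa a := adjo a = a.
Definition psd a := sa a /\ forall u, 0 <= ip (a u) u.
Definition ole a b := psd (b - a).

(** On a complex space a form with nonnegative values is Hermitian: expand it at x + y and replace x
    by i u. Self-adjointness can therefore be part of [psd], which the order arguments use
    constantly. *)
Lemma op_ge0P a : op_ge0 dot a <-> psd a.
Proof.
split=> [h|[sa_ h] u]; last first.
  rewrite dot_ip lecE /= h andbT -bopZ adjP sa_.
  by have := ip_iC dot u (a u); rewrite -bopZ [ip u _]ipC adjP sa_; lra.
have h1 u : 0 <= ip (a u) u by have := h u; rewrite dot_ip lecE => /andP[].
have h2 u : ip ('i%C *: a u) u = 0 by have := h u; rewrite dot_ip lecE => /andP[/eqP/=]; lra.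
split=> //; apply: adj_uniq => u v.
have h3 x y : ip ('i%C *: a x) y = - ip ('i%C *: a y) x.
  by have := h2 (x + y); rewrite bopD scalerDr ipDl !ipDr !h2; lra.
have := h3 ('i%C *: u) v; rewrite ip_ii bopZ scalerA -expr2 sqr_i scaleN1r ipNl (ipC dot _ (a v)); lra.
Qed.
End Adjoint.

(** * Order and strong limits *)

Section Order.
Variables (R : realType) (H : completeNormedModType R[i]) (dot : hdot H).
Local Notation bop := (bop H).
Local Notation one := (1 : bop).
Local Notation ip := (rip dot).
Local Notation nq := (sqn dot).
Local Notation scvg := (sconv dot).
Local Notation adjo := (adjo dot).
Local Notation sa := (sa dot).
Local Notation psd := (psd dot).
Local Notation ole := (ole dot).
Local Notation nb := (nb dot).
Implicit Types (a b c x y : bop) (u v w : H).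

Lemma sa_ip a u v : sa a -> ip (a u) v = ip u (a v).
Proof. by move=> h; rewrite adjP h. Qed.
Lemma saD a b : sa a -> sa b -> sa (a + b).
Proof. by move=> ha hb; rewrite /sa adjD ha hb. Qed.
Lemma saN a : sa a -> sa (- a).
Proof. by move=> ha; rewrite /sa adjN ha. Qed.
Lemma saB a b : sa a -> sa b -> sa (a - b).
Proof. by move=> ha hb; apply: saD => //; exact: saN. Qed.
Lemma saZ (k : R) a : sa a -> sa (k *: a).
Proof. by move=> ha; rewrite /sa adjZ ha. Qed.
Lemma sa1 : sa 1. Proof. exact: adj1. Qed.
Lemma sa0 : sa 0. Proof. exact: adj0. Qed.
Lemma psdD a b : psd a -> psd b -> psd (a + b).
Proof.
move=> [sa_ ha] [sb hb]; split=> [|u]; first exact: saD.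
by rewrite bE ipDl addr_ge0.
Qed.
Lemma psdZ (k : R) a : 0 <= k -> psd a -> psd (k *: a).
Proof.
move=> k0 [sa_ ha]; split=> [|u]; first exact: saZ.
by rewrite bE ipZl mulr_ge0.
Qed.
Lemma psd0 : psd 0.
Proof. by split=> [|u]; [exact: sa0|rewrite bE ip0l]. Qed.
Lemma psd1 : psd 1.
Proof. by split=> [|u]; [exact: sa1|exact: nq_ge0]. Qed.
Lemma psd_conj a x : psd a -> psd (adjo x * a * x).
Proof.
move=> [sa_ ha]; split=> [|u]; first by rewrite /sa !adjM adjK sa_ mulrA.
by rewrite !bE -adjPr.
Qed.
Lemma psd_conjsa a x : psd a -> sa x -> psd (x * a * x).
Proof. by move=> ha hx; rewrite -[X in X * a]hx; exact: psd_conj. Qed.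
Lemma psd_adjM x : psd (adjo x * x).
Proof. by rewrite -[adjo x]mulr1; exact: psd_conj psd1. Qed.
Lemma psd_sq x : sa x -> psd (x * x).
Proof. by move=> hx; rewrite -{1}hx; exact: psd_adjM. Qed.
Lemma psd_sum I (r : seq I) (P : pred I) (F : I -> bop) :
  (forall i, P i -> psd (F i)) -> psd (\sum_(i <- r | P i) F i).
Proof. by move=> h; elim/big_rec: _ => [|i x Pi hx]; [exact: psd0|apply: psdD; [exact: h|]]. Qed.

Lemma ole_refl a : ole a a. Proof. by rewrite /ole subrr; exact: psd0. Qed.
Lemma ole_trans b a c : ole a b -> ole b c -> ole a c.
Proof. by move=> ab bc; have := psdD ab bc; rewrite addrC subrKA. Qed.
Lemma ole0 a : ole 0 a <-> psd a. Proof. by rewrite /ole subr0. Qed.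
Lemma oleD a b c d : ole a b -> ole c d -> ole (a + c) (b + d).
Proof. by move=> ab cd; rewrite /ole opprD addrACA; exact: psdD. Qed.
Lemma oleZ (k : R) a b : 0 <= k -> ole a b -> ole (k *: a) (k *: b).
Proof. by move=> k0 ab; rewrite /ole -scalerBr; exact: psdZ. Qed.
Lemma ole_conj x a b : ole a b -> ole (adjo x * a * x) (adjo x * b * x).
Proof. by move=> ab; rewrite /ole -mulrBl -mulrBr; exact: psd_conj. Qed.
Lemma ole_conjsa x a b : sa x -> ole a b -> ole (x * a * x) (x * b * x).
Proof. by move=> hx; rewrite -{1 3}hx; exact: ole_conj. Qed.
Lemma ole_ip a b u : ole a b -> ip (a u) u <= ip (b u) u.
Proof. by move=> [_ /(_ u)]; rewrite bE ipBl subr_ge0. Qed.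
Lemma oleP a b : sa a -> sa b -> (forall u, ip (a u) u <= ip (b u) u) -> ole a b.
Proof. by move=> ha hb h; split=> [|u]; [exact: saB|rewrite bE ipBl subr_ge0]. Qed.
Lemma ole_psd a b : psd a -> ole a b -> psd b.
Proof. by move=> ha ab; apply/ole0; apply: ole_trans ab; apply/ole0. Qed.

Lemma CS_psd a u v : psd a -> ip (a u) v ^+ 2 <= ip (a u) u * ip (a v) v.
Proof.
move=> [sa_ ha]; rewrite mulrC; apply: quad_ge0 => // t.
have := ha (u + t%:C *: v); rewrite bopD bopZ !ipDl !ipDr !ipZl !ipZr (sa_ip v u sa_) (ipC dot v); lra.
Qed.
(** Cauchy-Schwarz for the form of a at the pair u, a u. It bounds a vector by a form, so that
    monotone convergence of forms becomes strong convergence. *)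
Lemma psd_nq (K : R) a u : 0 <= K -> psd a -> ole a (K *: one) -> nq (a u) <= K * ip (a u) u.
Proof.
move=> K0 ha aK; have := CS_psd u (a u) ha; have := ole_ip (a u) aK.
rewrite !bE ipZl; change (ip (a u) (a u)) with (nq (a u)) => h1 h2.
have a0 := ha.2 u; have n0 := nq_ge0 dot (a u).
have h3 : nq (a u) ^+ 2 <= nq (a u) * (K * ip (a u) u).
  by apply: le_trans h2 _; rewrite (_ : _ * (K * _) = ip (a u) u * (K * nq (a u))); [rewrite ler_wpM2l|ring].
have [->|nz] := eqVneq (nq (a u)) 0; first by rewrite mulr_ge0.
by move: h3; rewrite expr2 ler_pM2l// lt_def nz.
Qed.
Lemma psd_nb (K : R) a : 0 <= K -> psd a -> ole a (K *: one) -> nb a (K ^+ 2).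
Proof.
move=> K0 ha aK u; apply: le_trans (psd_nq u K0 ha aK) _.
by rewrite expr2 -mulrA ler_wpM2l//; have := ole_ip u aK; rewrite !bE ipZl.
Qed.
Lemma psd_ker a u : psd a -> ip (a u) u = 0 -> a u = 0.
Proof.
move=> ha h; apply: (@nq_eq0 _ _ dot); apply/eqP; rewrite -sqrf_eq0 eq_le sqr_ge0 andbT.
by have := CS_psd u (a u) ha; rewrite h mul0r.
Qed.
Lemma psd_bounded a : psd a -> exists2 K, 0 <= K & ole a (K *: one).
Proof.
move=> ha; have [k k0 hk] := nbP dot a; exists (1 + k); first by rewrite addr_ge0.
apply: oleP => [||u]; [exact: ha.1|exact/saZ/sa1|rewrite !bE ipZl].
have := CS2 dot (a u) u ltr01; have := hk u; rewrite invr1 !mul1r.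
change (ip u u) with (nq u); have := nq_ge0 dot u; have := ha.2 u; lra.
Qed.

Definition slim (an : nat -> bop) a := forall u, scvg (fun n => an n u) (a u).

Lemma slim_ex (K : R) (an : nat -> bop) : (forall u, exists v, scvg (fun n => an n u) v) ->
  (forall n, nb (an n) K) -> exists2 a, slim an a & nb a K.
Proof.
move=> /choice[f hf] hK.
have lf : linear f.
  move=> d u v; apply: (scvg_unique (hf _)).
  rewrite (_ : (fun n => _) = fun n => d *: an n u + an n v); last by apply/funext => n; rewrite bop_lin.
  by apply: scvgD => //; exact: scvgZ.
have bf_ u : nq (f u) <= K * nq u.
  by apply: (cvgr_to_le (scvg_nq (hf u))); near=> n; exact: hK.
by exists (mkbop lf bf_).
Unshelve. all: by end_near. Qed.
Lemma slim_unique an a b : slim an a -> slim an b -> a = b.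
Proof. by move=> h h'; apply: bopE => u; exact: scvg_unique (h u) (h' u). Qed.
Lemma slim_ip an a u v : slim an a -> ip (an n u) v @[n --> \oo] --> ip (a u) v.
Proof. by move=> h; apply: scvg_ip => //; exact: scvg_cst. Qed.
Lemma slim_cst a : slim (fun=> a) a.
Proof. by move=> u; exact: scvg_cst. Qed.
Lemma slimD an bn a b : slim an a -> slim bn b -> slim (fun n => an n + bn n) (a + b).
Proof. by move=> h h' u; exact: scvgD. Qed.
Lemma slimN an a : slim an a -> slim (fun n => - an n) (- a).
Proof. by move=> h u; apply/scvgP; apply: cvgN; apply/scvgP; exact: h. Qed.
Lemma slimB an bn a b : slim an a -> slim bn b -> slim (fun n => an n - bn n) (a - b).
Proof. by move=> h h'; apply: slimD => //; exact: slimN. Qed.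
Lemma slimZ (k : R) an a : slim an a -> slim (fun n => k *: an n) (k *: a).
Proof. by move=> h u; exact: scvgZ. Qed.
Lemma slimMl c an a : slim an a -> slim (fun n => c * an n) (c * a).
Proof. by move=> h u; exact: bop_scvg. Qed.
Lemma slimMr c an a : slim an a -> slim (fun n => an n * c) (a * c).
Proof. by move=> h u; exact: h. Qed.
(** Write a_n b_n - a b as a_n (b_n - b) + (a_n - a) b; the uniform bound on a_n handles the first
    term. *)
Lemma slimM (K : R) an bn a b : (forall n, nb (an n) K) -> slim an a -> slim bn b ->
  slim (fun n => an n * bn n) (a * b).
Proof.
move=> hK ha hb u.
rewrite (_ : (fun n => _) = fun n => an n (bn n u - b u) + an n (b u)); last first.
  by apply/funext => n; rewrite -bopD subrK.
rewrite -[X in scvg _ X]add0r; apply: scvgD; last exact: ha.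
apply: (@squeeze0 _ _ (fun n => `|K| * nq (bn n u - b u))) => [n|]; rewrite ?subr0.
  rewrite nq_ge0 /=; apply: le_trans (hK _ _) _; rewrite ler_wpM2r ?nq_ge0 ?ler_norm//.
by rewrite -[X in _ --> X](mulr0 `|K|); apply: cvgM; [exact: cvg_cst|exact: hb].
Qed.
Lemma slim_comm c an a : slim an a -> (forall n, c * an n = an n * c) -> c * a = a * c.
Proof.
move=> h hc; apply: (@slim_unique (fun n => c * an n)); first exact: slimMl.
by rewrite (_ : (fun n => _) = fun n => an n * c); [exact: slimMr|apply/funext].
Qed.
Lemma slim_sa an a : slim an a -> (forall n, sa (an n)) -> sa a.
Proof.
move=> h hs; apply: adj_uniq => u v; have h1 := @slim_ip _ _ u v h.
have h2 : ip (an n u) v @[n --> \oo] --> ip u (a v).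
  rewrite (_ : (fun n => _) = fun n => ip (an n v) u); first by rewrite ipC; exact: slim_ip.
  by apply/funext => n; rewrite sa_ip// ipC.
exact: cvg_unique h1 h2.
Qed.
Lemma slim_psd an a : slim an a -> (forall n, psd (an n)) -> psd a.
Proof.
move=> h hs; split=> [|u]; first by apply: slim_sa h _ => n; exact: (hs n).1.
by apply: (cvgr_to_ge (@slim_ip _ _ u u h)); near=> n; exact: (hs n).2.
Unshelve. all: by end_near. Qed.
Lemma slim_shift an a (k : nat) : slim an a -> slim (fun n => an (n + k)%N) a.
Proof. by move=> h u; have := h u; rewrite /sconv -(cvg_shiftn k). Qed.
Lemma slim_ole an a b N : slim an a -> (forall n, (N <= n)%N -> ole b (an n)) -> ole b a.
Proof.
move=> /(slim_shift N) h hb; apply: slim_psd (slimB h (slim_cst b)) _ => n.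
by apply: hb; rewrite leq_addl.
Qed.
Lemma slim_ole_le an a b : slim an a -> (forall n, ole (an n) b) -> ole a b.
Proof. by move=> h hb; apply: slim_psd (slimB (slim_cst b) h) _ => n; exact: hb. Qed.

Lemma mono_cauchy (xn : nat -> R) (B : R) : (forall n, xn n <= xn n.+1) -> (forall n, xn n <= B) ->
  forall e, 0 < e -> exists N, forall m n, (N <= m)%N -> (N <= n)%N -> `|xn m - xn n| < e.
Proof.
move=> hm hB e e0.
have cv : cvgn xn.
  apply: nondecreasing_is_cvgn; first exact/nondecreasing_seqP.
  by exists B => _ [n _ <-].
have /cvgrPdist_lt/(_ (e / 2)) := cv; rewrite divr_gt0// => /(_ isT)[N _ hN].
exists N => m n Nm Nn; have := hN m Nm; have := hN n Nn => /=.
set l := limn _ => h1 h2; rewrite (_ : _ - _ = (l - xn n) - (l - xn m)); last by ring.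
by rewrite (le_lt_trans (ler_normB _ _))// (splitr e) ltrD.
Qed.

Lemma ole_homo (an : nat -> bop) : (forall n, ole (an n) (an n.+1)) ->
  forall m n, (m <= n)%N -> ole (an m) (an n).
Proof.
move=> h m n; elim: n => [|n IH]; first by rewrite leqn0 => /eqP ->; exact: ole_refl.
rewrite leq_eqVlt => /orP[/eqP ->|/IH]; [exact: ole_refl|move=> h'; exact: ole_trans (h n)].
Qed.

(** The forms of a bounded increasing sequence are Cauchy, and [psd_nq] applied to the differences
    a_n - a_m makes the vectors Cauchy. *)
Lemma slim_mono (K : R) (an : nat -> bop) : 0 <= K -> (forall n, psd (an n)) ->
  (forall n, ole (an n) (an n.+1)) -> (forall n, ole (an n) (K *: one)) ->
  exists a, [/\ slim an a, psd a, forall n, ole (an n) a & ole a (K *: one)].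
Proof.
move=> K0 hp hm hK.
have mono := ole_homo hm.
have [u|n|a ha _] := @slim_ex (K ^+ 2) an; last first.
- exists a; split=> [//||n|]; first exact: slim_psd ha hp.
    by apply: (slim_ole ha) => m; exact: mono.
  exact: slim_ole_le ha hK.
- exact: psd_nb.
apply: scauchy => e e0.
have xm n : ip (an n u) u <= ip (an n.+1 u) u by apply: ole_ip.
have xB n : ip (an n u) u <= K * nq u by have := ole_ip u (hK n); rewrite !bE ipZl.
have K1 : 0 < K + 1 by rewrite ltr_wpDl.
have [N hN] := mono_cauchy xm xB (divr_gt0 e0 K1).
have dK m n : ole (an n - an m) (K *: one).
  by rewrite -[K *: one]subr0; apply: oleD (hK n) _; rewrite /ole opprK addrC subr0; exact: hp.
have key m n : (m <= n)%N -> (N <= m)%N -> nq (an n u - an m u) < e.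
  move=> mn Nm; have := psd_nq u K0 (mono _ _ mn) (dK m n).
  rewrite bE ipBl => h; apply: le_lt_trans h _.
  have := hN n m (leq_trans Nm mn) Nm; rewrite ltr_pdivlMr// mulrC; apply: le_lt_trans.
  by rewrite ler_pM// ?lerDl ?ler_norm// subr_ge0; apply: ole_ip; exact: mono.
exists N => m n Nm Nn; case: (leqP m n) => mn; first by rewrite nqBC key.
by rewrite key// ltnW.
Qed.
Lemma slim_mono_dec (K : R) (an : nat -> bop) : 0 <= K -> (forall n, psd (an n)) ->
  (forall n, ole (an n.+1) (an n)) -> (forall n, ole (an n) (K *: one)) ->
  exists a, [/\ slim an a, psd a & forall n, ole a (an n)].
Proof.
move=> K0 hp hm hK.
have [||||b [hb pb hle bK]] := @slim_mono K (fun n => K *: one - an n) => //.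
- by move=> n; rewrite /ole opprB addrC subrKA; exact: hm.
- by move=> n; rewrite /ole subKr.
exists (K *: one - b); split=> //.
  have := slimB (slim_cst (K *: one)) hb; rewrite (_ : (fun n => _) = an)//.
  by apply/funext => n; rewrite subKr.
by move=> n; have := hle n; rewrite /ole !opprB addrCA.
Qed.
End Order.

(** * Spectral theory *)

Section Projections.
Variables (R : realType) (H : completeNormedModType R[i]) (dot : hdot H).
Local Notation bop := (bop H).
Local Notation one := (1 : bop).
Local Notation ip := (rip dot).
Local Notation nq := (sqn dot).
Local Notation scvg := (sconv dot).
Local Notation adjo := (adjo dot).
Local Notation sa := (sa dot).
Local Notation psd := (psd dot).
Local Notation ole := (ole dot).
Local Notation nb := (nb dot).
Implicit Types (a b c e f x y : bop) (u v w : H).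

Definition proj e := sa e /\ e * e = e.

Lemma proj_fix e u : proj e -> e (e u) = e u.
Proof. by move=> [_ ee]; rewrite -[LHS]mulE ee. Qed.
Lemma proj_ip e u : proj e -> ip (e u) u = nq (e u).
Proof. by move=> pe; rewrite -{1}(proj_fix u pe) sa_ip//; exact: pe.1. Qed.
Lemma proj_psd e : proj e -> psd e.
Proof. by move=> pe; split=> [|u]; [exact: pe.1|rewrite proj_ip// nq_ge0]. Qed.
Lemma projC e : proj e -> proj (1 - e).
Proof.
move=> [se ee]; split; first exact/saB/se/sa1.
by rewrite mulrBl mul1r mulrBr mulr1 ee subrr subr0.
Qed.
Lemma proj0 : proj 0. Proof. by split; [exact: sa0|rewrite mul0r]. Qed.
Lemma proj1 : proj 1. Proof. by split; [exact: sa1|rewrite mul1r]. Qed.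
Lemma proj_le1 e : proj e -> ole e 1.
Proof. by move=> /projC/proj_psd. Qed.
Lemma proj_pyth e u : proj e -> nq u = nq (e u) + nq ((1 - e) u).
Proof.
move=> pe; rewrite -!proj_ip//; last exact: projC.
by rewrite !bE ipBl addrC subrK.
Qed.
Lemma proj_nq e u : proj e -> nq (e u) <= nq u.
Proof. by move=> pe; rewrite (proj_pyth u pe) lerDl nq_ge0. Qed.
Lemma proj_nb e : proj e -> nb e 1.
Proof. by move=> pe u; rewrite mul1r proj_nq. Qed.

Lemma projCe e : proj e -> (1 - e) * e = 0.
Proof. by move=> [_ ee]; rewrite mulrBl mul1r ee subrr. Qed.
Lemma projeC e : proj e -> e * (1 - e) = 0.
Proof. by move=> [_ ee]; rewrite mulrBr mulr1 ee subrr. Qed.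
Lemma proj_oleP e f : proj e -> proj f -> ole e f <-> f * e = e.
Proof.
move=> pe pf; split=> [ef|fe].
  apply: bopE => u; rewrite bE; apply/esym/eqP; rewrite -subr_eq0; apply/eqP.
  apply: (@nq_eq0 _ _ dot); apply/eqP; rewrite eq_le nq_ge0 andbT.
  have := ole_ip (e u) ef; rewrite !proj_ip// proj_fix//; have := proj_pyth (e u) pf.
  by rewrite !bE; lra.
have ef : e * f = e by have := congr1 adjo fe; rewrite adjM pe.1 pf.1.
suff : proj (f - e) by exact: proj_psd.
split; first exact/saB/pe.1/pf.1.
by rewrite mulrBl !mulrBr fe ef pe.2 pf.2 subrr subr0.
Qed.
Lemma proj_oleB e f : proj e -> proj f -> ole e f -> proj (f - e).
Proof.
move=> pe pf ef; have fe := (proj_oleP pe pf).1 ef.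
have ef' : e * f = e by have := congr1 adjo fe; rewrite adjM pe.1 pf.1.
split; first exact/saB/pe.1/pf.1.
by rewrite mulrBl !mulrBr fe ef' pe.2 pf.2 subrr subr0.
Qed.
Lemma proj_commM e f : proj e -> proj f -> e * f = f * e -> proj (e * f).
Proof.
move=> pe pf ef; split; first by rewrite /sa adjM pe.1 pf.1 ef.
by rewrite mulrA -(mulrA e) -ef mulrA pe.2 -mulrA pf.2.
Qed.

Definition csub (S : set H) := [/\ S 0, forall (c : R[i]) u v, S u -> S v -> S (c *: u + v)
  & forall un u, (forall n, S (un n)) -> scvg un u -> S u].

(** Riesz representation on S x {0} yields the point of S representing [ip _ u]; since S is stable
    under i, the resulting map is complex linear. *)
Lemma sproj_ex (S : set H) : csub S -> exists P, proj P /\ forall u, S u <-> P u = u.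
Proof.
move=> [S0 Slin Scl].
have ex u : exists g, S g /\ forall z, S z -> ip z u = ip z g.
  have [|||||g [g2 Sg] hg] := @riesz _ _ dot [set p | p.2 = 0 /\ S p.1] (fun p => ip p.1 u) (nq u).
  - move=> pn p h [h1 h2]; split; last by apply: Scl h1 => n; exact: (h n).2.
    apply: (scvg_unique (dot:=dot)) h2 _.
    by rewrite (_ : (fun n => (pn n).2) = fun=> 0); [exact: scvg_cst|apply/funext => n; exact: (h n).1].
  - by split=> // d p q /= [-> Sp] [-> Sq]; rewrite scaler0 addr0; split=> //; exact: Slin.
  - by move=> d p q /=; rewrite ipDl ipZl.
  - exact: nq_ge0.
  - move=> p; apply: le_trans (CS _ _ _) _; rewrite mulrC ler_wpM2l ?nq_ge0//.
    by rewrite /nq2 /ip2 lerDl nq_ge0.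
  by exists g.1; split=> // z Sz; have := hg (z, 0) (conj erefl Sz); rewrite /ip2 /= ip0l addr0.
have [f hf] := choice ex.
have Sf u := (hf u).1; have fP u z : S z -> ip z u = ip z (f u) by exact: (hf u).2.
have SZ (c : R[i]) z : S z -> S (c *: z) by move=> Sz; rewrite -[_ *: _]addr0; exact: Slin.
have SB z z' : S z -> S z' -> S (z - z') by move=> h h'; rewrite addrC -scaleN1r; exact: Slin.
have uniq g g' : S g -> S g' -> (forall z, S z -> ip z g = ip z g') -> g = g'.
  move=> Sg Sg' h; apply/eqP; rewrite -subr_eq0; apply/eqP; apply: (@nq_eq0 _ _ dot).
  by rewrite /sqn ipBr h ?subrr//; exact: SB.
have lf : linear f.
  move=> d u v; apply: uniq => [||z Sz]; [exact: Sf|exact: Slin|].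
  rewrite -fP// !ipDr -!fP//; congr (_ + _).
  case: d => x y; have -> : (x +i* y)%C = x%:C + y%:C * 'i%C.
    by apply/eqP; rewrite eq_complex /= !(mul0r, mulr0, mulr1, addr0, subr0, add0r) !eqxx.
  rewrite !scalerDl !ipDr -!scalerA !ipZr fP//; congr (_ + _ * _).
  have := ip_iC dot z u; have := ip_iC dot z (f u); rewrite (fP u); last exact: SZ.
  lra.
have bf_ u : nq (f u) <= 1 * nq u.
  have := fP u _ (Sf u); change (ip (f u) (f u)) with (nq (f u)) => h.
  have := nq_ge0 dot (u - f u); rewrite nqB ipC h; lra.
exists (mkbop lf bf_); split; first split.
- apply: adj_uniq => u v /=; rewrite (fP v)// ipC -[LHS]ipC; apply/esym.
  by rewrite ipC (fP u)// ipC.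
- apply: bopE => u /=; apply: uniq => // z Sz; by rewrite -fP.
- move=> u; split=> /= [Su|<-]//; apply: uniq => // z Sz; by rewrite -fP.
Qed.
Definition sproj (S : set H) : bop := xget (0 : bop) [set P : bop | proj P /\ forall u, S u <-> P u = u].
Lemma sprojP S : csub S -> proj (sproj S) /\ forall u, S u <-> sproj S u = u.
Proof. by rewrite /sproj => /sproj_ex[P hP]; case: xgetP => [Q _ //|/(_ P)]. Qed.
Lemma proj_comm P x : proj P -> (forall u, P u = u -> P (x u) = x u) ->
  (forall u, P u = u -> P (adjo x u) = adjo x u) -> x * P = P * x.
Proof.
move=> pP h h'.
have PxP : P * (x * P) = x * P by apply: bopE => u; rewrite !bE; apply: h; exact: proj_fix.
have : P * (adjo x * P) = adjo x * P by apply: bopE => u; rewrite !bE; apply: h'; exact: proj_fix.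
by move=> /(congr1 adjo); rewrite !adjM adjK pP.1 -mulrA PxP.
Qed.

Lemma csub_ker a : csub [set u | a u = 0].
Proof.
split=> [|c u v /= hu hv|un u h hu] /=; first exact: bop0.
  by rewrite bop_lin hu hv scaler0 addr0.
apply: scvg_unique (bop_scvg a hu) _.
by rewrite (_ : (fun n => _) = fun=> 0); [exact: scvg_cst|apply/funext].
Qed.

Definition kproj a := sproj [set u | a u = 0].
Lemma kprojP a : proj (kproj a). Proof. exact: (sprojP (csub_ker a)).1. Qed.
Lemma kprojE a u : a u = 0 <-> kproj a u = u. Proof. exact: (sprojP (csub_ker a)).2. Qed.

Lemma kproj_comm a x : sa a -> x * a = a * x -> x * kproj a = kproj a * x.
Proof.
move=> ha xa; apply: proj_comm (kprojP a) _ _ => u /kprojE h; apply/kprojE.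
  by rewrite -mulE -xa mulE h bop0.
have := congr1 adjo xa; rewrite !adjM ha => xa'.
by rewrite -mulE xa' mulE h bop0.
Qed.

(** Polynomials in c with nonnegative coefficients. They are stable under products and positive for
    positive c (an even power is a square, an odd one is c conjugated by a power), which yields
    monotone iterations without a functional calculus. *)
Inductive pcone c : bop -> Prop :=
| pc_pow n : pcone c (c ^+ n)
| pc_add x y : pcone c x -> pcone c y -> pcone c (x + y)
| pc_scale (k : R) x : 0 <= k -> pcone c x -> pcone c (k *: x).

Lemma pcone_mul c x y : pcone c x -> pcone c y -> pcone c (x * y).
Proof.
move=> hx; elim: hx y => [n|x1 x2 _ h1 _ h2|k x1 k0 _ h1] y hy.
- elim: hy => [m|y1 y2 _ h1 _ h2|k y1 k0 _ h1].
  + by rewrite -exprD; exact: pc_pow.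
  + by rewrite mulrDr; exact: pc_add.
  + by rewrite scAr; exact: pc_scale.
- by rewrite mulrDl; apply: pc_add; [exact: h1|exact: h2].
- by rewrite scAl; apply: pc_scale => //; exact: h1.
Qed.
Lemma sa_exp c n : sa c -> sa (c ^+ n).
Proof.
by move=> hc; elim: n => [|n IH]; [exact: sa1|rewrite /sa {1}exprS adjM hc IH -exprSr].
Qed.
Lemma pcone_psd c x : psd c -> pcone c x -> psd x.
Proof.
move=> hc; elim=> [n|x1 x2 _ h1 _ h2|k x1 k0 _ h1]; [|exact: psdD|exact: psdZ].
have sn := sa_exp n./2 hc.1.
rewrite -[n]odd_double_half -addnn exprD exprD; case: (odd n) => /=; last by rewrite expr0 mul1r; exact: psd_sq.
by rewrite expr1 mulrA -exprS exprSr; exact: psd_conjsa.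
Qed.
Lemma pcone_comm c x y : y * c = c * y -> pcone c x -> y * x = x * y.
Proof.
move=> hy; elim=> [n|x1 x2 _ h1 _ h2|k x1 k0 _ h1].
- by apply: commrX.
- by rewrite mulrDr mulrDl h1 h2.
- by rewrite scAr scAl h1.
Qed.

(** A fixed point y of y -> (c + y^2) / 2 with c = 1 - a satisfies (1 - y)^2 = a. The iterates from
    0 are polynomials of [pcone c] increasing below 1, hence they converge, and they commute with
    whatever commutes with a. *)
Lemma sqrt_ex1 a : psd a -> ole a 1 ->
  exists s, [/\ psd s, s * s = a & forall x, x * a = a * x -> x * s = s * x].
Proof.
move=> ha a1; pose c := 1 - a.
have hc : psd c by [].
have c1 : ole c 1 by rewrite /ole /c subKr.
pose F y := (2^-1 : R) *: (c + y * y).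
pose Y n := iter n F 0.
have z0 : (0 : bop) = (0 : R) *: c by rewrite scale0r.
have h2 : (0 : R) <= 2^-1 by rewrite invr_ge0.
have pc : pcone c c by have := pc_pow c 1; rewrite expr1.
have pY n : pcone c (Y n).
  elim: n => [|n IH] /=; first by rewrite z0; apply: pc_scale pc.
  by apply: pc_scale => //; apply: pc_add pc _; exact: pcone_mul.
have comY m n : Y m * Y n = Y n * Y m.
  apply: (@pcone_comm c) (pY n); apply/esym.
  exact: (@pcone_comm c _ c erefl (pY m)).
have inc n : pcone c (Y n.+1 - Y n).
  elim: n => [|n IH].
    by rewrite /Y /= /F mul0r addr0 subr0; exact: pc_scale.
  have -> : Y n.+2 - Y n.+1 = F (Y n.+1) - F (Y n) by [].
  rewrite /F -scalerBr; apply: pc_scale => //; rewrite opprD addrACA subrr add0r.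
  (* The iterates commute, so the difference of squares factors inside the cone. *)
  rewrite (_ : _ - _ = (Y n.+1 - Y n) * (Y n.+1 + Y n)); first by apply: pcone_mul => //; apply: pc_add.
  by rewrite mulrBl !mulrDr opprD addrA (comY n.+1 n) addrK.
have psY n : psd (Y n) by exact: pcone_psd (pY n).
have Y1 n : ole (Y n) one.
  elim: n => [|n IH]; first by apply/ole0; exact: psd1.
  have y2 : ole (Y n * Y n) one.
    apply: oleP => [||u]; [exact: (psd_sq (psY n).1).1|exact: sa1|].
    rewrite !bE (sa_ip _ _ (psY n).1); change (nq (Y n u) <= nq u).
    have := psd_nb ler01 (psY n); rewrite scale1r => /(_ IH u); by rewrite expr1n mul1r.
  have -> : one = (2^-1 : R) *: (one + one).
    by rewrite -[X in X + X]scale1r -scalerDl scalerA mulVf ?scale1r.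
  by apply: oleZ => //; exact: oleD.
have [|||y [hy py _ y1]] := @slim_mono _ _ dot 1 Y ler01 => //.
- by move=> n; exact: pcone_psd (inc n).
- by move=> n; rewrite scale1r.
rewrite scale1r in y1.
have hK n : nb (Y n) 1.
  by have := psd_nb ler01 (psY n); rewrite scale1r expr1n; apply; exact: Y1.
have yE : y = (2^-1 : R) *: (c + y * y).
  apply: (@slim_unique _ _ dot (fun n => Y (n + 1)%N)); first exact: slim_shift.
  rewrite (_ : (fun n => _) = fun n => (2^-1 : R) *: (c + Y n * Y n)); last by apply/funext => n; rewrite addn1.
  by apply: slimZ; apply: slimD; [exact: slim_cst|exact: (slimM hK hy hy)].
exists (1 - y); split => //.
- have y2 : y * y = y + y - c.
    have := congr1 (fun z => (2 : R) *: z) yE; rewrite scalerA divff// scale1r scaler_nat mulr2n => ->.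
    by rewrite addrC addKr.
  rewrite mulrBl !mulrBr !mul1r mulr1 y2 /c; apply: bopE => u; rewrite !bE.
  by rewrite !opprD !opprK !addrA; rewrite addrAC; do ?[rewrite subrK|rewrite addrK]; rewrite addrC addKr.
- move=> x xa; rewrite mulrBr mulrBl mulr1 mul1r; congr (_ - _).
  apply: (slim_comm hy) => n; apply: (@pcone_comm c) (pY n).
  by rewrite /c mulrBr mulrBl mulr1 mul1r xa.
Qed.

Lemma sqrt_ex a : psd a -> exists s, [/\ psd s, s * s = a & forall x, x * a = a * x -> x * s = s * x].
Proof.
move=> ha; have [K K0 aK] := psd_bounded ha; pose k := K + 1.
have k0 : 0 < k by rewrite ltr_wpDl.
have [||s [ps ss cs]] := @sqrt_ex1 (k^-1 *: a); first by apply: psdZ; rewrite // invr_ge0 ltW.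
  have -> : one = k^-1 *: (k *: one) by rewrite scalerA mulVf ?gt_eqF// scale1r.
  apply: oleZ; first by rewrite invr_ge0 ltW.
  by apply: ole_trans aK _; rewrite /ole -scalerBl /k addrAC subrr add0r scale1r; exact: psd1.
exists (Num.sqrt k *: s); split.
- by apply: psdZ ps; exact: sqrtr_ge0.
- rewrite scAl scAr scalerA -expr2 sqr_sqrtr ?ltW// ss scalerA divff ?scale1r// gt_eqF//.
- by move=> x xa; rewrite scAr scAl cs// scAr scAl xa.
Qed.
Definition bsqrt a : bop := xget (0 : bop) [set s : bop | [/\ psd s, s * s = a & forall x, x * a = a * x -> x * s = s * x]].
Lemma bsqrtP a : psd a -> [/\ psd (bsqrt a), bsqrt a * bsqrt a = a & forall x, x * a = a * x -> x * bsqrt a = bsqrt a * x].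
Proof. by rewrite /bsqrt => /sqrt_ex[s hs]; case: xgetP => [Q _ //|/(_ s)]. Qed.
End Projections.

(** * Spectral projections at 0 and inverses *)

Section Spectral.
Variables (R : realType) (H : completeNormedModType R[i]) (dot : hdot H).
Local Notation bop := (bop H).
Local Notation one := (1 : bop).
Local Notation ip := (rip dot).
Local Notation sa := (sa dot).
Local Notation psd := (psd dot).
Local Notation ole := (ole dot).
Local Notation proj := (proj dot).
Local Notation bsqrt := (bsqrt dot).
Local Notation kproj := (kproj dot).
Implicit Types (a b c e f x y r : bop) (u v w : H).

Lemma psd_mul a b : psd a -> psd b -> a * b = b * a -> psd (a * b).
Proof.
move=> pa pb ab; have [ps ss cs] := bsqrtP pa.
have -> : a * b = bsqrt a * b * bsqrt a by rewrite -mulrA cs// mulrA ss.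
by apply: psd_conjsa => //; exact: ps.1.
Qed.
Lemma psd_eq0 a : psd a -> psd (- a) -> a = 0.
Proof.
move=> pa [_ pn]; apply: bopE => u; rewrite bE; apply: (psd_ker pa).
by have := pn u; have := pa.2 u; rewrite !bE ipNl; lra.
Qed.
Lemma ole_anti a b : ole a b -> ole b a -> a = b.
Proof.
move=> ab ba; apply/eqP; rewrite eq_sym -subr_eq0; apply/eqP; apply: psd_eq0 => //.
by rewrite opprB.
Qed.
Lemma sa_sq0 x : sa x -> x * x = 0 -> x = 0.
Proof.
move=> sx xx; apply: bopE => u; apply: (@nq_eq0 _ _ dot).
by rewrite /sqn sa_ip// -mulE xx bE ip0r.
Qed.
(** With d = x - y, the positive operators d x d and d y d add up to (x^2 - y^2) d = 0, so both
    vanish; their difference is d^3. *)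
Lemma sqrt_uniq x y : psd x -> psd y -> x * y = y * x -> x * x = y * y -> x = y.
Proof.
move=> px py xy xx; pose d := x - y.
have sd : sa d by apply: saB; [exact: px.1|exact: py.1].
have dxd := psd_conjsa px sd; have dyd := psd_conjsa py sd.
have dx : d * x + d * y = 0.
  by rewrite /d !mulrBl xy xx addrC addrA addrNK subrr.
have s0 : d * x * d + d * y * d = 0 by rewrite -mulrDl dx mul0r.
have dxd0 : d * x * d = 0.
  by apply: psd_eq0 => //; rewrite (addr0_eq s0).
have dyd0 : d * y * d = 0 by move: s0; rewrite dxd0 add0r.
have d3 : d * d * d = 0 by rewrite -[X in _ = X](subrr (0 : bop)) -{1}dxd0 -dyd0 -mulrBl -mulrBr.
have d4 : (d * d) * (d * d) = 0 by rewrite !mulrA d3 mul0r.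
have dd : d * d = 0 by apply: sa_sq0 d4; rewrite /sa adjM sd.
by apply/eqP; rewrite -subr_eq0; apply/eqP; exact: sa_sq0.
Qed.

(* 1_{a >= 0}, obtained as the kernel of |a| - a *)
Definition pp a := kproj (bsqrt (a * a) - a).

(** With |a| the root of a^2, the identity (|a| - a) (|a| + a) = 0 puts the range of |a| + a in the
    kernel of |a| - a; orthogonally to that kernel a = -|a|. The last clause records that a is
    strictly negative there, which later pins down spectral families at their jumps. *)
Lemma pp_spec a : sa a -> [/\ proj (pp a), forall x, x * a = a * x -> x * pp a = pp a * x,
  forall u, pp a u = u -> 0 <= ip (a u) u, forall u, pp a u = 0 -> ip (a u) u <= 0
  & forall u, pp a u = 0 -> 0 <= ip (a u) u -> u = 0].
Proof.
move=> sa_; set s := bsqrt (a * a); have [ps ss cs] := bsqrtP (psd_sq sa_).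
rewrite -/s in ps ss cs.
have sas : a * s = s * a by apply: cs; rewrite mulrA.
have hd : sa (s - a) by apply: saB => //; exact: ps.1.
have pe : proj (pp a) := kprojP dot _.
have comm x : x * a = a * x -> x * pp a = pp a * x.
  move=> xa; apply: kproj_comm => //; rewrite mulrBr mulrBl xa cs//.
  by rewrite mulrA xa -mulrA xa mulrA.
have es u : pp a u = u -> s u = a u.
  by move=> /kprojE; rewrite bE => /eqP; rewrite subr_eq0 => /eqP.
have sd : (s - a) * (s + a) = 0 by rewrite mulrBl !mulrDr sas ss [s * a + _]addrC subrr.
have hs u : pp a (s u + a u) = s u + a u.
  by apply/kprojE; rewrite -[s u + a u]/((s + a) u) -mulE sd.
have neg u : pp a u = 0 -> s u = - a u.
  move=> eu; have := hs u; rewrite bopD.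
  have -> : pp a (s u) = 0 by rewrite -mulE -(comm s (esym sas)) mulE eu bop0.
  have -> : pp a (a u) = 0 by rewrite -mulE -(comm a erefl) mulE eu bop0.
  by rewrite addr0 => /esym/eqP; rewrite addr_eq0 => /eqP.
have nn u : pp a u = 0 -> ip (a u) u <= 0.
  by move=> /neg h; have := ps.2 u; rewrite h ipNl oppr_ge0.
split=> //.
- by move=> u /es <-; exact: ps.2.
- move=> u eu h; have z : ip (a u) u = 0 by apply/eqP; rewrite eq_le h nn.
  have su : s u = 0 by apply: (psd_ker ps); rewrite neg// ipNl z oppr0.
  have au : a u = 0 by apply/eqP; rewrite -oppr_eq0 -neg// su.
  have hk : (s - a) u = 0 by rewrite subE su au subrr.
  by move/(kprojE dot): hk => hk; rewrite -hk.
Qed.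

(** Neumann series for c = 1 - a / K. Its partial sums S_n increase, and S_n (1 - c) = 1 - c^n <= 1
    together with 1 - c >= d / K bounds them by K / d, so the order alone gives convergence. *)
Lemma inv_ex a (d : R) : psd a -> 0 < d -> ole (d *: one) a ->
  exists i, [/\ psd i, i * a = 1, a * i = 1, forall x, x * a = a * x -> x * i = i * x
   & ole i (d^-1 *: one)].
Proof.
move=> pa d0 da; have [K0 K00 aK0] := psd_bounded pa.
pose K := K0 + d; have Kp : 0 < K by rewrite ltr_wpDl.
have Ki : 0 <= K^-1 by rewrite invr_ge0 ltW.
have aK : ole a (K *: one).
  by apply: ole_trans aK0 _; rewrite /ole -scalerBl /K addrAC subrr add0r; apply: psdZ; [exact: ltW|exact: psd1].
have oneK : one = K^-1 *: (K *: one) by rewrite scalerA mulVf ?gt_eqF// scale1r.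
pose c := 1 - K^-1 *: a.
have pc : psd c by rewrite /c {1}oneK; exact: oleZ.
have c1 : 1 - c = K^-1 *: a by rewrite /c subKr.
pose S n := \sum_(i < n) c ^+ i.
have pS n : psd (S n) by apply: psd_sum => i _; apply: (@pcone_psd _ _ dot c) => //; exact: pc_pow.
have cS n : c * S n = S n * c by apply: commr_sum => i _; exact: commrX.
have SS n : S n.+1 = 1 + c * S n.
  rewrite /S big_ord_recl expr0 mulr_sumr; congr (_ + _).
  by apply: eq_bigr => i _; rewrite exprS.
have Sc n : S n * (1 - c) = 1 - c ^+ n.
  elim: n => [|n IH]; first by rewrite /S big_ord0 mul0r expr0 subrr.
  by rewrite SS mulrDl mul1r -mulrA IH mulrBr mulr1 -exprS addrA subrK.
pose e := K^-1 * d; have e0 : 0 < e by rewrite mulr_gt0 ?invr_gt0.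
have pce : psd ((1 - c) - e *: one).
  by rewrite c1 /e -scalerA -scalerBr; exact: psdZ.
have SK n : ole (S n) (e^-1 *: one).
  have -> : S n = e^-1 *: (e *: S n) by rewrite scalerA mulVf ?gt_eqF// scale1r.
  apply: oleZ; first by rewrite invr_ge0 ltW.
  apply: (@ole_trans _ _ _ (S n * (1 - c))).
    rewrite /ole; have -> : S n * (1 - c) - e *: S n = S n * ((1 - c) - e *: one).
      by rewrite [RHS]mulrBr scAr mulr1.
    apply: psd_mul => //; rewrite mulrBr mulrBl scAr scAl mulr1 mul1r; congr (_ - _).
    by rewrite mulrBr mulrBl mulr1 mul1r cS.
  rewrite Sc /ole subKr; apply: (@pcone_psd _ _ dot c) => //; exact: pc_pow.
have Sm n : ole (S n) (S n.+1).
  rewrite /ole /S big_ord_recr /= addrAC subrr add0r.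
  by apply: (@pcone_psd _ _ dot c) => //; exact: pc_pow.
have [|j [hj pj _ jK]] := @slim_mono _ _ dot e^-1 S _ pS Sm SK; first by rewrite invr_ge0 ltW.
have jE : j = 1 + c * j.
  apply: (@slim_unique _ _ dot (fun n => S (n + 1)%N)); first exact: slim_shift.
  rewrite (_ : (fun n => _) = fun n => 1 + c * S n); last by apply/funext => n; rewrite addn1 SS.
  by apply: slimD; [exact: slim_cst|exact: slimMl].
have j1 : (1 - c) * j = 1 by rewrite mulrBl mul1r {1}jE addrK.
have cj x : x * a = a * x -> x * j = j * x.
  move=> xa; apply: (slim_comm hj) => n; apply: commr_sum => i _; apply: commrX.
  by rewrite /GRing.comm /c mulrBr mulrBl mulr1 mul1r scAr scAl xa.
exists (K^-1 *: j); split.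
- exact: psdZ.
- by rewrite scAl -cj// -scAl -c1.
- by rewrite scAr -scAl -c1.
- by move=> x xa; rewrite scAr scAl cj.
- have := oleZ Ki jK; rewrite scalerA /e invfM invrK mulrA mulVf ?gt_eqF// mul1r; exact.
Qed.
End Spectral.

(** * Projection-valued measures *)

Section PVM.
Variables (R : realType) (H : completeNormedModType R[i]) (dot : hdot H).
Local Notation bop := (bop H).
Local Notation nq := (sqn dot).
Local Notation scvg := (sconv dot).
Local Notation adjo := (adjo dot).
Local Notation ole := (ole dot).
Local Notation nb := (nb dot).
Local Notation slim := (slim dot).
Local Notation proj := (proj dot).
Implicit Types (a b c e f x y r : bop) (u v w : H).

Lemma proj_le_nq e f : proj e -> proj f -> (forall u, nq (e u) <= nq (f u)) -> ole e f.
Proof.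
move=> pe pf h; apply: oleP => [||u]; [exact: pe.1|exact: pf.1|by rewrite !proj_ip].
Qed.
Lemma proj_eq e f : proj e -> proj f -> (forall u, nq (e u) = nq (f u)) -> e = f.
Proof.
by move=> pe pf h; apply: (@ole_anti _ _ dot); apply: proj_le_nq => // u; rewrite h.
Qed.
Lemma proj_orth e f : proj e -> proj f -> (forall u, nq (e u) + nq (f u) <= nq u) -> e * f = 0.
Proof.
move=> pe pf h; apply: bopE => u; rewrite !bE; apply: (@nq_eq0 _ _ dot).
by have := h (f u); rewrite (proj_fix u pf); have := nq_ge0 dot (e (f u)); lra.
Qed.
Lemma slim_proj en e : (forall n, proj (en n)) -> slim en e -> proj e.
Proof.
move=> pn h; split; first by apply: (slim_sa h) => n; exact: (pn n).1.
have h1 n : nb (en n) 1 by exact: proj_nb.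
apply: (slim_unique _ h); rewrite -[X in slim X _](_ : (fun n => en n * en n) = en); first exact: (slimM h1 h h).
by apply/funext => n; exact: (pn n).2.
Qed.
Lemma proj_sum_orth (p : nat -> bop) : (forall k, proj (p k)) ->
  (forall j k, j != k -> p j * p k = 0) ->
  forall n, proj (\sum_(k < n) p k) /\ forall m, (n <= m)%N -> p m * \sum_(k < n) p k = 0.
Proof.
move=> pp_ orth; elim=> [|n [IH1 IH2]].
  by rewrite big_ord0; split=> [|m _]; [exact: proj0|rewrite mulr0].
rewrite big_ord_recr /=; split=> [|m nm]; last first.
  by rewrite mulrDr IH2 ?(ltnW nm)// orth ?addr0// gtn_eqF.
have h := IH2 n (leqnn n); have h' : (\sum_(k < n) p k) * p n = 0.
  by have := congr1 adjo h; rewrite adjM adj0 IH1.1 (pp_ n).1.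
split; first by apply: saD; [exact: IH1.1|exact: (pp_ n).1].
by rewrite mulrDl !mulrDr IH1.2 (pp_ n).2 h h' addr0 add0r.
Qed.
Lemma proj_series (p : nat -> bop) : (forall k, proj (p k)) ->
  (forall j k, j != k -> p j * p k = 0) ->
  exists e, proj e /\ slim (fun n => \sum_(k < n) p k) e.
Proof.
move=> hp orth; have hs := proj_sum_orth hp orth.
have [|||e [he _ _ _]] := @slim_mono _ _ dot 1 (fun n => \sum_(k < n) p k) ler01.
- by move=> n; apply: proj_psd; exact: (hs n).1.
- by move=> n; rewrite /ole big_ord_recr /= addrAC subrr add0r; exact: proj_psd.
- by move=> n; rewrite scale1r; apply: proj_le1; exact: (hs n).1.
by exists e; split=> //; apply: slim_proj he => n; exact: (hs n).1.
Qed.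
Lemma nq_orth_sum (p : nat -> bop) u n : (forall k, proj (p k)) ->
  (forall j k, j != k -> p j * p k = 0) -> nq ((\sum_(k < n) p k) u) = \sum_(k < n) nq (p k u).
Proof.
move=> hp orth; have hs := proj_sum_orth hp orth.
elim: n => [|n IH]; first by rewrite !big_ord0 nq0.
rewrite !big_ord_recr -IH bE nqD -[p n u](proj_fix u (hp n)) -(sa_ip _ _ (hp n).1).
by rewrite -mulE (hs n).2// bE ip0l mulr0 addr0 (proj_fix u (hp n)).
Qed.

(** A resolution of the identity carried by [0, +oo). Right continuity along one sequence suffices
    by monotonicity, and is what a decreasing strong limit provides. *)
Record specfam (G : R -> bop) : Prop := SpecFam {
  sf_proj : forall t, proj (G t);
  sf_mono : forall s t, s <= t -> ole (G s) (G t);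
  sf_neg : forall t, t < 0 -> G t = 0;
  sf_rc : forall t u, exists2 un : nat -> R, (forall n, 0 < un n) & nq (G (t + un n) u) @[n --> \oo] --> nq (G t u);
  sf_1 : forall u, scvg (fun n : nat => G n%:R u) u }.

Variable G : R -> bop.
Hypothesis hG : specfam G.

Lemma sf_projB s t : s <= t -> proj (G t - G s).
Proof. by move=> st; apply: proj_oleB; [exact: sf_proj|exact: sf_proj|exact: sf_mono]. Qed.
Definition Fdist u (t : R) := nq (G t u).
Lemma Fdist_nd u : nondecreasing (Fdist u).
Proof.
move=> s t st; rewrite /Fdist -!proj_ip; try exact: sf_proj.
by apply: ole_ip; exact: sf_mono.
Qed.
Lemma Fdist_rc u : right_continuous (Fdist u).
Proof.
move=> t; apply/cvgrPdist_le => e e0; have [un un0 hun] := sf_rc hG t u.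
move/cvgrPdist_lt: hun => /(_ e e0)[N _ /(_ N (leqnn N)) /= hN].
near=> s.
have ts : t <= s by [].
have ss : s <= t + un N by near: s; apply: nbhs_right_le; rewrite ltrDl.
have := Fdist_nd u ts; have := Fdist_nd u ss; move: hN; rewrite /Fdist.
rewrite distrC => /(le_lt_trans (ler_norm _)) h h1 h2.
rewrite distrC ger0_norm ?subr_ge0//; lra.
Unshelve. all: by end_near. Qed.
HB.instance Definition _ u := isCumulative.Build R _ R (Fdist u) (@Fdist_nd u) (@Fdist_rc u).

Let spmu0 u := lebesgue_stieltjes_measure (Fdist u : cumulative R R).
Definition spmu u : set R -> \bar R := spmu0 u.
Lemma spmu_0 u : spmu u set0 = 0%E. Proof. exact: (measure0 (spmu0 u)). Qed.
Lemma spmu_ge0 u A : (0 <= spmu u A)%E. Proof. exact: (measure_ge0 (spmu0 u)). Qed.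
Lemma spmu_sigma u : semi_sigma_additive (spmu u).
Proof. exact: (@measure_semi_sigma_additive _ _ _ (spmu0 u)). Qed.

HB.instance Definition _ u := isMeasure.Build _ _ R (spmu u) (spmu_0 u) (@spmu_ge0 u) (@spmu_sigma u).

Lemma spmu_itv u s t : s <= t -> spmu u `]s, t] = (Fdist u t - Fdist u s)%:E.
Proof.
move=> st; rewrite /spmu /spmu0 /lebesgue_stieltjes_measure /measure_extension measurable_mu_extE/=; last exact: is_ocitv.
by rewrite wlength_itv_bnd.
Qed.
Lemma spmuT u : spmu u setT = (nq u)%:E.
Proof.
have h : spmu u `]- n%:R, n%:R] @[n --> \oo] --> spmu u (\bigcup_n `]- (n%:R : R), n%:R]%classic).
  apply: (@nondecreasing_cvg_mu _ _ _ (spmu u) (fun n : nat => `]- (n%:R : R), n%:R]%classic)).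
  - by move=> n; exact: measurable_itv.
  - by apply: bigcup_measurable => n _; exact: measurable_itv.
  - move=> m n mn; rewrite subsetEset => x /=; rewrite !in_itv /= => /andP[h1 h2].
    have mn' : (m%:R : R) <= n%:R by rewrite ler_nat.
    by apply/andP; split; lra.
have UT : \bigcup_n `]- (n%:R : R), n%:R]%classic = setT.
  rewrite -subTset => /= x _ /=.
  have := archi_boundP (normr_ge0 x); rewrite ltr_norml => /andP[h1 h2].
  by exists (Num.bound `|x|) => //=; rewrite in_itv /= h1 ltW.
rewrite UT in h; apply: cvg_unique h _ => //.
apply: (@cvg_trans _ ((fun n : nat => (nq (G n%:R u))%:E) @ \oo)).
  apply: near_eq_cvg; near=> n; rewrite spmu_itv ?ge0_cp// /Fdist.
  rewrite [G (- _)](sf_neg hG) ?bE ?nq0 ?subr0// oppr_lt0 ltr0n.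
  by near: n; exists 1%N.
by apply: cvg_EFin; [near=> n|apply: scvg_nq; exact: sf_1].
Unshelve. all: by end_near. Qed.

Let isp (B : set R) p := proj p /\ forall u, spmu u B = (nq (p u))%:E.

Lemma spmu_orth (B C : set R) p q : measurable B -> measurable C -> B `&` C = set0 ->
  isp B p -> isp C q -> p * q = 0.
Proof.
move=> mB mC BC [pp_ hp] [pq hq]; apply: proj_orth => // u.
rewrite -lee_fin EFinD -hp -hq -spmuT -measureU//.
by apply: le_measure => //; rewrite inE//; exact: measurableU.
Qed.

Lemma pvm_bigcup (F : nat -> set R) (p : nat -> bop) : (forall n, measurable (F n)) ->
  trivIset setT F -> (forall n, isp (F n) (p n)) ->
  exists2 e, isp (\bigcup_k F k) e & slim (fun n => \sum_(k < n) p k) e.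
Proof.
move=> mF tF hp.
have orth j k : j != k -> p j * p k = 0.
  move=> jk; apply: (@spmu_orth (F j) (F k)) => //.
  by have /trivIsetP := tF; apply.
have pp_ k := (hp k).1.
have [e [pe he]] := proj_series pp_ orth.
exists e => //; split=> // u.
have h1 := (@measure_semi_sigma_additive _ _ _ (spmu u) F mF tF (bigcup_measurable (fun n _ => mF n))).
apply: cvg_unique h1 _ => //.
rewrite (_ : (fun n => _) = (fun n : nat => (nq ((\sum_(k < n) p k) u))%:E)).
  by apply: cvg_EFin; [near=> n|apply: scvg_nq; exact: he].
apply/funext => n; rewrite nq_orth_sum// big_mkord -sumEFin; apply: eq_bigr => i _.
exact: (hp i).2.
Unshelve. all: by end_near. Qed.

(** The Borel sets whose mass is |p u|^2 for one projection p and all u contain the intervals ]s, t]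
    and form a Dynkin class: disjoint sets have orthogonal projections because their masses add up
    to at most |u|^2. *)
Lemma isp_ex B : measurable B -> exists p, isp B p.
Proof.
have h := @dynkin_induction _ (measurableTypeR R) (@ocitv R) (fun B => exists p, isp B p) erefl (@ocitvI R).
apply: h.
- by exists 1; split=> [|u]; [exact: proj1|rewrite spmuT].
- move=> _ [[s t] _ <-] /=; case: (leP s t) => st.
    exists (G t - G s); split; first exact: sf_projB.
    move=> u; rewrite spmu_itv// /Fdist; congr (_%:E).
    rewrite -!proj_ip; try (exact: (sf_proj hG)); [by rewrite !bE ipBl|exact: sf_projB].
  exists 0; split=> [|u]; first exact: proj0.
  by rewrite set_itv_ge ?bE ?nq0; [exact: (measure0 (spmu u))|rewrite bnd_simp -leNgt ltW].
- move=> S mS [p [pp_ hp]]; exists (1 - p); split=> [|u]; first exact: projC.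
  have e1 : spmu u setT = (spmu u (~` S) + spmu u S)%E.
    rewrite -(setvU S); apply: (measureU (spmu u)) => //; first exact: measurableC.
    by rewrite setICl.
  have h : (spmu u (~` S) + (nq (p u))%:E)%E = (nq (p u) + nq ((1 - p) u))%:E.
    by rewrite -(proj_pyth u pp_) -hp -e1 spmuT.
  have : spmu u (~` S) \is a fin_num.
    rewrite ge0_fin_numE//; have : (spmu u (~` S) <= spmu u setT)%E by apply: (le_measure (spmu u)); rewrite ?inE//; exact: measurableC.
    by move=> /le_lt_trans; apply; rewrite spmuT ltry.
  move: h; case: (spmu u (~` S)) => //= r [] h _; congr (_%:E).
  by move: h; rewrite addrC => /addrI.
- move=> F mF tF /choice[p hp]; have [e he _] := pvm_bigcup mF tF hp; by exists e.
Qed.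

Definition pvm (B : set R) : bop := xget (0 : bop) [set p : bop | isp B p].
Lemma pvmP B : measurable B -> isp B (pvm B).
Proof. by rewrite /pvm => /isp_ex[p hp]; case: xgetP => [q _ //|/(_ p)]. Qed.
Lemma pvm_uniq B p : measurable B -> isp B p -> pvm B = p.
Proof.
move=> mB [hp hp2]; have [h h2] := pvmP mB; apply: proj_eq => // u.
by have := h2 u; rewrite hp2 => -[].
Qed.
Lemma pvm_add (F : nat -> set R) : (forall n, measurable (F n)) -> trivIset setT F ->
  slim (fun n => \sum_(k < n) pvm (F k)) (pvm (\bigcup_k F k)).
Proof.
move=> mF tF; have [e he hs] := pvm_bigcup mF tF (fun n => pvmP (mF n)).
by rewrite (pvm_uniq (bigcup_measurable (fun n _ => mF n)) he).
Qed.
Lemma pvmT : pvm setT = 1.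
Proof. by apply: pvm_uniq => //; split=> [|u]; [exact: proj1|rewrite spmuT]. Qed.

End PVM.

(** * The resolvent of a closed operator *)

Section Resolvent.
Variables (R : realType) (H : completeNormedModType R[i]) (dot : hdot H).
Local Notation bop := (bop H).
Local Notation ip := (rip dot).
Local Notation nq := (sqn dot).
Local Notation adjo := (adjo dot).
Local Notation sa := (sa dot).
Local Notation psd := (psd dot).
Local Notation ole := (ole dot).
Local Notation adj := (Defs.adj dot).
Implicit Types (a b c e f y r : bop) (u v w : H) (x : set (H * H)).

Lemma scvg2P pn p : scvg2 dot pn p <-> pn n @[n --> \oo] --> p.
Proof.
case: p => u v; split=> [[/scvgP h1 /scvgP h2]|h].
  rewrite (_ : (fun n => pn n) = fun n => ((pn n).1, (pn n).2)); first exact: cvg_pair.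
  by apply/funext => n; case: (pn n).
split; apply/scvgP; [apply: (cvg_comp _ _ h); exact: cvg_fst|apply: (cvg_comp _ _ h); exact: cvg_snd].
Qed.
Lemma closure_seq x p : closure x p <-> exists2 pn, (forall n, x (pn n)) & scvg2 dot pn p.
Proof.
split=> [cl|[pn xp /scvg2P h]]; last first.
  move=> B /h [N _ hN]; exists (pn N); split=> //; exact: (hN N (leqnn N)).
have ex (n : nat) : exists q, x q /\ (nq (q.1 - p.1) < n.+1%:R^-1 /\ nq (q.2 - p.2) < n.+1%:R^-1).
  pose e : R := Num.sqrt n.+1%:R^-1.
  have e0 : 0 < e by rewrite sqrtr_gt0 invr_gt0.
  have e0' : 0 < e%:C :> R[i] by rewrite ltcR.
  have [|q [xq bq]] := cl (ball p e%:C); first exact: nbhsx_ballx.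
  exists q; split=> //; move: bq => [].
  rewrite -!ball_normE /= !(norm_lt dot)// sqr_sqrtr ?invr_ge0// => h1 h2.
  by rewrite nqBC h1 nqBC h2.
have [pn hp] := choice ex; exists pn => [n|]; first by case: (hp n).
split; (apply: squeeze0; [|exact: cvg_harmonic]) => n; rewrite nq_ge0 /= ltW//; by case: (hp n) => _ [].
Qed.
Lemma closedP x : closed x <-> sclosed dot x.
Proof.
split=> [cx pn p xp /scvg2P h|cx p /closure_seq[pn xp h]]; last exact: cx h.
by apply: (closed_cvg _ cx _ _ h); near=> n; exact: xp.
Unshelve. all: by end_near. Qed.

Definition cdd x := closed_densely_defined x.

Lemma cddZ x (c : R[i]) p : linear_graph x -> x p -> x (c *: p).
Proof. by move=> [x0 xl _] xp; rewrite -[_ *: _]addr0; exact: xl. Qed.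
Lemma cddD x p q : linear_graph x -> x p -> x q -> x (p + q).
Proof. by move=> [x0 xl _] xp xq; rewrite -[p]scale1r; exact: xl. Qed.
Lemma cddB x p q : linear_graph x -> x p -> x q -> x (p - q).
Proof. by move=> lx xp xq; apply: cddD => //; rewrite -scaleN1r; exact: cddZ. Qed.
Lemma graph_uniq x u v w : linear_graph x -> x (u, v) -> x (u, w) -> v = w.
Proof.
move=> lx h h'; have := cddB lx h h'; rewrite /= => hh; have [_ _ xu] := lx.
by apply/eqP; rewrite -subr_eq0; apply/eqP/xu; move: hh; rewrite -[(u, v) - _]/(u - u, v - w) subrr.
Qed.

Lemma adj_ipP x p : linear_graph x -> (forall q, x q -> ip q.2 p.1 = ip q.1 p.2) <-> adj x p.
Proof.
move=> lx; split=> [h q xq|h q xq]; last by rewrite /rip h.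
rewrite !dot_ip h//; congr (_ +i* - _)%C.
have := h _ (cddZ 'i%C lx xq); case: q {xq} => q1 q2 /=; exact.
Qed.
Lemma adj_lin x (c : R[i]) p q : adj x p -> adj x q -> adj x (c *: p + q).
Proof.
move=> hp hq z xz; have := hp z xz; have := hq z xz => /= e1 e2.
by rewrite !linearDr !linearZr_LR /= e1 e2.
Qed.
Lemma dense_ip0 x w : dense (dom x) -> (forall u v, x (u, v) -> ip u w = 0) -> w = 0.
Proof.
move=> dx h; apply: (@nq_eq0 _ _ dot); apply/eqP; apply/negP => /negP n0.
have np : 0 < nq w by rewrite lt_def n0 nq_ge0.
have wb : (0 : R[i]) < (Num.sqrt (nq w))%:C by rewrite ltcR sqrtr_gt0.
have ob : open (ball w (Num.sqrt (nq w))%:C) by exact: ball_open.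
have [|u [bu [v xuv]]] := dx _ _ ob; first by exists w; exact: ballxx.
move: bu; rewrite -ball_normE /= (norm_lt dot) ?sqrtr_gt0// sqr_sqrtr ?ltW//.
by rewrite nqB ipC (h _ _ xuv); have := nq_ge0 dot u; lra.
Qed.

(* r = (1 + x^* x)^-1, from the orthogonal projection of (w, 0) onto the graph of x *)
Definition is_res x r := [/\ psd r, ole r 1, forall u, r u = 0 -> u = 0,
  forall w, exists q, x (r w, q) /\ adj x (q, w - r w)
  & forall u q v, x (u, q) -> adj x (q, v) -> u = r (u + v)].

Lemma res_ex x : cdd x -> exists r, is_res x r.
Proof.
move=> [lx cx dx]; have cx' : sclosed dot x by apply/closedP.
have [x0 xl xg] := lx.
have ex w : exists g, x g /\ adj x (g.2, w - g.1).
  have [||||p|g Gg hg] := @riesz _ _ dot x (fun p => ip p.1 w) (nq w) => //.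
  - by split=> // c p q; exact: xl.
  - by move=> c p q /=; rewrite ipDl ipZl.
  - exact: nq_ge0.
  - by apply: le_trans (CS _ _ _) _; rewrite mulrC ler_wpM2l ?nq_ge0// /nq2 /ip2 lerDl nq_ge0.
  exists g; split=> //; apply/adj_ipP => // q xq /=.
  by rewrite ipBr (hg _ xq) /ip2; lra.
have [g hg] := choice ex.
have uniq w p q : x p -> adj x (p.2, w - p.1) -> x q -> adj x (q.2, w - q.1) -> p = q.
  move=> xp hp xq hq; have xd := cddB lx xp xq.
  have h1 := (adj_ipP _ lx).2 hp _ xd; have h2 := (adj_ipP _ lx).2 hq _ xd.
  have n1 := nq_ge0 dot (p.1 - q.1); have n2 := nq_ge0 dot (p.2 - q.2).
  have e1 : nq (p.1 - q.1) + nq (p.2 - q.2) = 0.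
    by move: h1 h2; rewrite /= !(ipBr dot (p.1 - q.1)) /sqn !ipBr; lra.
  have z1 : p.1 - q.1 = 0 by apply: (@nq_eq0 _ _ dot); lra.
  have z2 : p.2 - q.2 = 0 by apply: (@nq_eq0 _ _ dot); lra.
  by apply/eqP; rewrite -subr_eq0; apply/eqP; rewrite -[p - q]/(p.1 - q.1, p.2 - q.2) z1 z2.
pose f w := (g w).1.
have glin : forall (c : R[i]) u v, g (c *: u + v) = c *: g u + g v.
  move=> c u v; apply: (uniq (c *: u + v)); [exact: (hg _).1|exact: (hg _).2|by apply: xl; [exact: (hg u).1|exact: (hg v).1]|].
  have := adj_lin c (hg u).2 (hg v).2; congr (adj x _).
  by rewrite -[LHS]/(_, _) /=; congr pair; rewrite scalerBr opprD addrACA.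
have lf : linear f by move=> c u v; rewrite /f glin.
have fq w p : x p -> ip p.1 w = ip p.1 (g w).1 + ip p.2 (g w).2.
  by move=> xp; have := (adj_ipP _ lx).2 (hg w).2 p xp; rewrite /= ipBr; lra.
have bf_ w : nq (f w) <= 1 * nq w.
  have := fq w _ (hg w).1; have := nq_ge0 dot (w - f w); rewrite nqB (ipC _ w) /f => h1 h2.
  have := nq_ge0 dot (g w).2; move: h1; rewrite h2 /sqn; lra.
pose r := mkbop lf bf_.
have sr : sa r.
  apply: adj_uniq => u v; rewrite [RHS]ipC [r v]/= [r u]/= /f (fq v _ (hg u).1) (fq u _ (hg v).1).
  by rewrite !(ipC _ (g v).1) !(ipC _ (g v).2).
exists r; split.
- split=> // u; rewrite [r u]/= /f (fq u _ (hg u).1); apply: addr_ge0; exact: nq_ge0.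
- apply: oleP => [||u]; [exact: sr|exact: sa1|rewrite bE].
  have h := bf_ u; have h2 := CS2 dot (f u) u ltr01.
  rewrite mul1r in h; rewrite invr1 !mul1r in h2.
  by change (ip (f u) u <= nq u); lra.
- move=> u ru; have [xg1 hg1] := hg u; have g1 : (g u).1 = 0 by [].
  have g2 : (g u).2 = 0 by apply: xg; rewrite -g1 -surjective_pairing.
  apply: (dense_ip0 dx) => p q xpq; have := (adj_ipP _ lx).2 hg1 _ xpq.
  by rewrite g1 g2 /= subr0 ip0r.
- by move=> w; exists (g w).2; rewrite -surjective_pairing; exact: hg.
- move=> u q v xuq hv; rewrite [RHS]/= /f.
  by rewrite -(@uniq (u + v) (u, q) (g (u + v))) //=; [rewrite addrC addKr|exact: (hg _).1|exact: (hg _).2].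
Qed.

Definition res x : bop := xget (0 : bop) [set r : bop | is_res x r].
Lemma resP x : cdd x -> is_res x (res x).
Proof. by rewrite /res => /res_ex[r hr]; case: xgetP => [q _ //|/(_ r)]. Qed.
(** The unbounded composition is encoded by a bounded, positive, injective contraction, on which the
    spectral constructions are carried out. *)
Lemma res_sq x u v : cdd x -> comp_graph (adj x) x (u, v) <-> u = res x (u + v).
Proof.
move=> /resP[_ _ _ h1 h2]; split=> [[q /= xq hq]|e]; first exact: h2 xq hq.
have [q [xq hq]] := h1 (u + v); rewrite -e in xq hq; exists q => //=.
by move: hq; rewrite (addrC u) addrK.
Qed.
Lemma res_comm x (b : bop) : cdd x -> (forall p, x p -> x (b p.1, b p.2)) ->
  (forall p, x p -> x (adjo b p.1, adjo b p.2)) -> b * res x = res x * b.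
Proof.
move=> cx hb hb'; have [_ _ _ h1 h2] := resP cx; have lx := cx; case: lx => lx _ _.
apply: bopE => w; rewrite !bE; have [q [xq hq]] := h1 w.
have := h2 _ _ (b (w - res x w)) (hb _ xq); rewrite /= -bopD (addrC (res x w)) subrK; apply.
apply/adj_ipP => // p xp /=; rewrite !adjPr.
exact: ((adj_ipP _ lx).2 hq _ (hb' _ xp)).
Qed.
End Resolvent.

(** * The spectral family of a positive operator *)

Section Family.
Variables (R : realType) (H : completeNormedModType R[i]) (dot : hdot H).
Local Notation bop := (bop H).
Local Notation one := (1 : bop).
Local Notation ip := (rip dot).
Local Notation nq := (sqn dot).
Local Notation scvg := (sconv dot).
Local Notation adjo := (adjo dot).
Local Notation sa := (sa dot).
Local Notation psd := (psd dot).
Local Notation ole := (ole dot).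
Local Notation proj := (proj dot).
Local Notation pp := (pp dot).
Local Notation bsqrt := (bsqrt dot).
Local Notation adj := (Defs.adj dot).
Implicit Types (b c e f y : bop) (u v w : H) (x : set (H * H)) (s t : R).

(** The value of the resolvent (1 + T^2)^-1 at the spectral value t of T; it decreases on the
    half-line, so T <= t corresponds to r >= phi t. *)
Definition phi t : R := (1 + t ^+ 2)^-1.
Lemma phi_gt0 t : 0 < phi t.
Proof. by rewrite invr_gt0 ltr_pwDl// sqr_ge0. Qed.
Lemma phi_le1 t : phi t <= 1.
Proof. by rewrite invf_le1 ?ltr_pwDl ?sqr_ge0// lerDl sqr_ge0. Qed.
Lemma phi_dec s t : 0 <= s -> s <= t -> phi t <= phi s.
Proof.
move=> s0 st; rewrite lef_pV2 ?posrE ?ltr_pwDl ?sqr_ge0// lerD2l.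
by rewrite ler_sqr ?nnegrE// (le_trans s0).
Qed.
Lemma phiV t : (phi t)^-1 = 1 + t ^+ 2. Proof. by rewrite /phi invrK. Qed.
Lemma phi_cvg t (un : nat -> R) : un n @[n --> \oo] --> t -> phi (un n) @[n --> \oo] --> phi t.
Proof.
move=> h; apply: cvgV; first by rewrite gt_eqF// ltr_pwDl// sqr_ge0.
by apply: cvgD; [exact: cvg_cst|rewrite expr2; under eq_fun do rewrite expr2; exact: cvgM].
Qed.
Lemma phi_cvg0 : phi n%:R @[n --> \oo] --> (0 : R).
Proof.
rewrite -(cvg_shiftS (fun n => phi n%:R)); apply: squeeze0 (@cvg_harmonic R) => n.
rewrite ltW ?phi_gt0//= lef_pV2 ?posrE ?ltr_pwDl ?sqr_ge0//.
have h : (1 : R) <= n.+1%:R by rewrite ler1n.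
by rewrite expr2; nra.
Qed.

Variable r : bop.
Hypotheses (pr : psd r) (r1 : ole r 1) (ri : forall u, r u = 0 -> u = 0).

(* For r = (1 + T^2)^-1, this is the spectral projection of T on [0, t]. *)
Definition sG t : bop := if 0 <= t then pp (r - phi t *: one) else 0.

Lemma sG_sa t : sa (r - phi t *: one).
Proof. by apply: saB; [exact: pr.1|exact/saZ/sa1]. Qed.
Lemma sG_comm t y : y * r = r * y -> y * sG t = sG t * y.
Proof.
rewrite /sG; case: ifP => _ yr; last by rewrite mulr0 mul0r.
have [_ h _ _ _] := pp_spec (sG_sa t); apply: h.
by rewrite mulrBr mulrBl yr scAr scAl mulr1 mul1r.
Qed.
Lemma sG_proj t : proj (sG t).
Proof. by rewrite /sG; case: ifP => _; [have [] := pp_spec (sG_sa t)|exact: proj0]. Qed.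
Lemma sG_r t : r * sG t = sG t * r. Proof. exact: sG_comm. Qed.
Lemma sG_lo t u : 0 <= t -> sG t u = u -> phi t * nq u <= ip (r u) u.
Proof.
rewrite /sG => -> h; have [_ _ h1 _ _] := pp_spec (sG_sa t).
by have := h1 u h; rewrite !bE ipBl ipZl subr_ge0.
Qed.
Lemma sG_hi t u : 0 <= t -> sG t u = 0 -> ip (r u) u <= phi t * nq u.
Proof.
rewrite /sG => -> h; have [_ _ _ h1 _] := pp_spec (sG_sa t).
by have := h1 u h; rewrite !bE ipBl ipZl subr_le0.
Qed.
Lemma sG_strict t u : 0 <= t -> sG t u = 0 -> phi t * nq u <= ip (r u) u -> u = 0.
Proof.
rewrite /sG => -> h h2; have [_ _ _ _ h1] := pp_spec (sG_sa t).
by apply: h1 h _; rewrite !bE ipBl ipZl subr_ge0.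
Qed.
Lemma sGG s t : sG s * sG t = sG t * sG s.
Proof. by apply: sG_comm; rewrite sG_r. Qed.
Lemma sG_neg t : t < 0 -> sG t = 0. Proof. by rewrite /sG leNgt => ->. Qed.
Lemma sG_mul s t : s <= t -> sG t * sG s = sG s.
Proof.
move=> st; have [s0|s0] := ltP s 0; first by rewrite (sG_neg s0) mulr0.
have t0 := le_trans s0 st.
apply: bopE => u; apply/esym/eqP; rewrite -subr_eq0; apply/eqP.
rewrite -[_ - _]/((sG s - sG t * sG s) u); set w := _ u.
have h1 : sG s w = w by rewrite /w -mulE mulrBr mulrA (sGG s t) -mulrA !(sG_proj s).2.
have h2 : sG t w = 0 by rewrite /w -mulE mulrBr mulrA (sG_proj t).2 subrr.
apply: (sG_strict t0 h2); apply: le_trans (sG_lo s0 h1).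
by rewrite ler_wpM2r ?nq_ge0// phi_dec.
Qed.
Lemma sG_mulC s t : s <= t -> sG s * sG t = sG s.
Proof. by move=> st; rewrite sGG sG_mul. Qed.
Lemma sG_mono s t : s <= t -> ole (sG s) (sG t).
Proof. by move=> st; apply/proj_oleP; [exact: sG_proj|exact: sG_proj|exact: sG_mul]. Qed.

(** A nonzero vector fixed by the limit from the right and killed by [sG t] would satisfy r >= phi
    t, which [sG_strict] excludes; one killed by all [sG n] would have a vanishing resolvent form,
    which injectivity of r excludes. *)
Lemma sG_specfam : specfam dot sG.
Proof.
split; [exact: sG_proj|exact: sG_mono|exact: sG_neg| |].
- move=> t u; have [t0|t0] := ltP t 0.
    exists (fun=> - t / 2) => [n|]; first by rewrite divr_gt0 ?oppr_gt0.
    have h : t + - t / 2 < 0 by lra.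
    by rewrite (sG_neg h) (sG_neg t0); exact: cvg_cst.
  exists (fun n => n.+1%:R^-1) => [n|]; first by rewrite invr_gt0.
  have tn n : t <= t + n.+1%:R^-1 by rewrite lerDl invr_ge0.
  have [|||P [hP pP hle]] := @slim_mono_dec _ _ dot 1 (fun n => sG (t + n.+1%:R^-1)) ler01.
  + by move=> n; apply: proj_psd; exact: sG_proj.
  + by move=> n; apply: sG_mono; rewrite lerD2l lef_pV2 ?posrE ?ltr0n// ler_nat.
  + by move=> n; rewrite scale1r; apply: proj_le1; exact: sG_proj.
  have PG : P * sG t = sG t.
    apply: (slim_unique (slimMr (sG t) hP)).
    by rewrite (_ : (fun n => _) = fun=> sG t); [exact: slim_cst|apply/funext => n; rewrite sG_mul].
  have jP : proj P by apply: (slim_proj _ hP) => n; exact: sG_proj.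
  have GP : sG t * P = sG t by have := congr1 adjo PG; rewrite adjM jP.1 (sG_proj t).1.
  have -> : sG t = P.
    apply: bopE => v; apply/esym/eqP; rewrite -subr_eq0 -[_ - _]/((P - sG t) v); apply/eqP; set w := _ v.
    have h1 : P w = w by rewrite /w -mulE mulrBr PG jP.2.
    have h2 : sG t w = 0 by rewrite /w -mulE mulrBr GP (sG_proj t).2 subrr.
    apply: (sG_strict t0 h2).
    have cv : phi (t + n.+1%:R^-1) * nq w @[n --> \oo] --> phi t * nq w.
      apply: cvgM; last exact: cvg_cst.
      apply: phi_cvg; rewrite -[X in _ --> X]addr0; apply: cvgD; [exact: cvg_cst|exact: cvg_harmonic].
    apply: (cvgr_to_le cv); near=> n; apply: sG_lo; first exact: le_trans (tn n).
    rewrite -{1}h1 -mulE (_ : _ * P = P) ?h1//.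
    exact: ((proj_oleP jP (sG_proj _)).1 (hle n)).
  by apply: scvg_nq; exact: hP.
- have [|||P [hP pP hle _]] := @slim_mono _ _ dot 1 (fun n : nat => sG n%:R) ler01.
  + by move=> n; apply: proj_psd; exact: sG_proj.
  + by move=> n; apply: sG_mono; rewrite ler_nat.
  + by move=> n; rewrite scale1r; apply: proj_le1; exact: sG_proj.
  have jP : proj P by apply: (slim_proj _ hP) => n; exact: sG_proj.
  suff P1 : P = 1 by move=> u; rewrite -[X in scvg _ X](@oneE _ H) -P1; exact: hP.
  apply: bopE => v; apply/esym/eqP; rewrite -subr_eq0 -[_ - _]/((one - P) v); apply/eqP; set w := _ v.
  apply/ri/(psd_ker pr)/eqP; rewrite eq_le pr.2 andbT.
  have cv : phi n%:R * nq w @[n --> \oo] --> 0 * nq w.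
    by apply: cvgM; [exact: phi_cvg0|exact: cvg_cst].
  rewrite -[leRHS](mul0r (nq w)); apply: (cvgr_to_ge cv); near=> n; apply: sG_hi => //.
  have PG := (proj_oleP (sG_proj _) jP).1 (hle n).
  have GP : sG n%:R * P = sG n%:R by have := congr1 adjo PG; rewrite adjM jP.1 (sG_proj _).1.
  by rewrite /w -mulE mulrBr mulr1 GP subrr.
Unshelve. all: by end_near. Qed.

(* sc t is the inverse of r on the range of sG t, sb t = T^2 sG t and sa_ t = T sG t *)
Lemma sc_ex t : 0 <= t -> exists c, [/\ psd c, c * r = sG t, c * sG t = c & forall y, y * r = r * y -> y * c = c * y].
Proof.
(* d equals r on the range of [sG t] and 1 on its complement, so it is bounded below by phi t <= 1
   and [inv_ex] applies. *)
move=> t0; pose d := r * sG t + (1 - sG t).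
have pG := proj_psd (sG_proj t); have pG' := proj_psd (projC (sG_proj t)).
have pd : psd d by apply: psdD => //; apply: psd_mul => //; rewrite sG_r.
have dl : ole (phi t *: one) d.
  apply: oleP => [||u]; [exact/saZ/sa1|exact: pd.1|].
  have -> : ip (d u) u = ip (r (sG t u)) (sG t u) + nq ((1 - sG t) u).
    rewrite /d addE ipDl (proj_ip _ (projC (sG_proj t))); congr (_ + _).
    by rewrite -(sa_ip _ _ (sG_proj t).1) -!mulE -sG_r -mulrA (sG_proj t).2.
  rewrite !bE ipZl; change (ip u u) with (nq u); rewrite (proj_pyth u (sG_proj t)) mulrDr.
  apply: lerD; first by apply: sG_lo => //; exact: proj_fix (sG_proj t).
  by rewrite ler_piMl ?nq_ge0// phi_le1.
have [i [pi id_ di ci _]] := inv_ex pd (phi_gt0 t) dl.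
have Gd : sG t * d = r * sG t.
  by rewrite /d mulrDr mulrA -sG_r -mulrA (sG_proj t).2 (projeC (sG_proj t)) addr0.
have dG : d * sG t = r * sG t.
  by rewrite /d mulrDl -mulrA (sG_proj t).2 (projCe (sG_proj t)) addr0.
have Gi : sG t * i = i * sG t by apply: ci; rewrite Gd dG.
exists (i * sG t); split.
- by apply: psd_mul.
- by rewrite -mulrA -sG_r -dG mulrA id_ mul1r.
- by rewrite -mulrA (sG_proj t).2.
- move=> y yr; have yG := sG_comm t yr.
  rewrite mulrA ci ?mulrA; last first.
    by rewrite /d mulrDr mulrDl mulrA yr -!mulrA yG mulrBr mulrBl mulr1 mul1r yG.
  by rewrite -mulrA yG mulrA.
Qed.
Definition sc t : bop := xget (0 : bop) [set c : bop | [/\ psd c, c * r = sG t, c * sG t = c & forall y, y * r = r * y -> y * c = c * y]].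
Lemma scP t : 0 <= t -> [/\ psd (sc t), sc t * r = sG t, sc t * sG t = sc t & forall y, y * r = r * y -> y * sc t = sc t * y].
Proof. by rewrite /sc => /sc_ex[c hc]; case: xgetP => [q _ //|/(_ c)]. Qed.
Lemma sc_r t : 0 <= t -> r * sc t = sG t.
Proof. by move=> /scP[_ h _ hc]; rewrite hc. Qed.
Lemma sG_sc s t : 0 <= t -> sG s * sc t = sc t * sG s.
Proof. by move=> /scP[_ _ _ h]; apply: h; rewrite sG_r. Qed.
Lemma sc_sG t : 0 <= t -> sG t * sc t = sc t.
Proof. by move=> t0; rewrite sG_sc//; have [] := scP t0. Qed.
Lemma sc_mono s t : 0 <= s -> s <= t -> sc t * sG s = sc s.
Proof.
move=> s0 st; have t0 := le_trans s0 st; have [_ _ h2 _] := scP s0; have [_ h4 _ _] := scP t0.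
by rewrite -(sc_r s0) mulrA h4 -{1}(sc_sG s0) mulrA sG_mul// sc_sG.
Qed.
Definition sb t : bop := sc t - sG t.
Lemma sb_def t : sb t = sc t - sG t. Proof. by []. Qed.
Lemma sbE t : 0 <= t -> sb t = sc t * (1 - r).
Proof. by move=> t0; have [_ h _ _] := scP t0; rewrite /sb mulrBr mulr1 h. Qed.
Lemma sb_comm t y : 0 <= t -> y * r = r * y -> y * sb t = sb t * y.
Proof. by move=> t0 yr; have [_ _ _ h] := scP t0; rewrite /sb mulrBr mulrBl h// (sG_comm t yr). Qed.
Lemma sb_psd t : 0 <= t -> psd (sb t).
Proof.
move=> t0; have [p h _ hc] := scP t0; rewrite sbE//; apply: psd_mul => //.
by rewrite mulrBr mulrBl mulr1 mul1r h sc_r.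
Qed.
Lemma sb_mono s t : 0 <= s -> s <= t -> sb t * sG s = sb s.
Proof. by move=> s0 st; rewrite /sb mulrBl sc_mono// sG_mul. Qed.
Lemma sb0 : sb 0 = 0.
Proof.
have h : (1 - r) * sG 0 = 0.
  apply: bopE => u; apply: (@psd_ker _ _ dot (1 - r) (sG 0 u) r1).
  have h1 := sG_lo (lexx 0) (proj_fix u (sG_proj 0)).
  have p0 : phi 0 = 1 by rewrite /phi expr0n addr0 invr1.
  have h2 := r1.2 (sG 0 u).
  by move: h1 h2; rewrite p0 mul1r !subE !oneE ipBl /sqn; lra.
rewrite sbE// -{1}(sc_sG (lexx 0)) sG_sc// -mulrA.
have -> : sG 0 * (1 - r) = 0 by rewrite mulrBr mulr1 -sG_r -[X in X - _]mul1r -mulrBl.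
by rewrite mulr0.
Qed.

Definition sa_ t : bop := bsqrt (sb t).
Lemma sa_P t : 0 <= t -> [/\ psd (sa_ t), sa_ t * sa_ t = sb t & forall y, y * r = r * y -> y * sa_ t = sa_ t * y].
Proof.
move=> t0; have [h1 h2 h3] := bsqrtP (sb_psd t0); split=> // y yr; apply: h3; exact: sb_comm.
Qed.
Lemma sG_sa_ s t : 0 <= t -> sG s * sa_ t = sa_ t * sG s.
Proof. by move=> /sa_P[_ _ h]; apply: h; rewrite sG_r. Qed.
Lemma sa__mono s t : 0 <= s -> s <= t -> sa_ t * sG s = sa_ s.
Proof.
move=> s0 st; have t0 := le_trans s0 st.
have [ps ss cs] := sa_P s0; have [pt tt ct] := sa_P t0.
have csr : sa_ s * r = r * sa_ s by rewrite cs.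
apply: (@sqrt_uniq _ _ dot) => //.
- by apply: psd_mul => //; [apply: proj_psd; exact: sG_proj|rewrite sG_sa_].
- by rewrite -mulrA sG_sa_// !mulrA (ct _ csr).
- rewrite -mulrA (mulrA (sG s)) (sG_sa_ s t0) -!mulrA (sG_proj s).2 mulrA tt sb_mono//.
Qed.
Lemma sa_sG t : 0 <= t -> sG t * sa_ t = sa_ t.
Proof. by move=> t0; rewrite sG_sa_// sa__mono. Qed.
Lemma sa_sG' s t : 0 <= s -> s <= t -> sG t * sa_ s = sa_ s.
Proof. by move=> s0 st; rewrite -{1}(sa_sG s0) mulrA sG_mul// sa_sG. Qed.

Lemma saM s t : 0 <= s -> s <= t -> sa_ t * sa_ s = sb s /\ sa_ s * sa_ t = sb s.
Proof.
move=> s0 st; have t0 := le_trans s0 st.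
have [[ss _] sss _] := sa_P s0; have [[st_ _] _ _] := sa_P t0.
have h1 : sa_ t * sa_ s = sb s by rewrite -{1}(sa_sG s0) mulrA sa__mono.
split=> //; have := congr1 adjo h1; by rewrite adjM ss st_ (sb_psd s0).1.
Qed.

Lemma sG1 u : scvg (fun n : nat => sG n%:R u) u. Proof. exact: sf_1 sG_specfam u. Qed.
Lemma n0 (n : nat) : 0 <= n%:R :> R. Proof. exact: ler0n. Qed.

(** The unbounded T is given through its cuts [sa_ n]: membership of (u, v) is a countable family of
    bounded identities, from which closedness and self-adjointness are read off. *)
Definition sT : set (H * H) := [set p | forall n : nat, sG n%:R p.2 = sa_ n%:R p.1].

Lemma sT_lin : linear_graph sT.
Proof.
split=> [n|c p q hp hq n|v h]; first by rewrite !bop0.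
  by rewrite !bop_lin hp hq.
apply: scvg_unique (sG1 v) _; rewrite (_ : (fun n => _) = fun=> 0); first exact: scvg_cst.
by apply/funext => n; rewrite h bop0.
Qed.
Lemma sT_closed : sclosed dot sT.
Proof.
move=> pn p hp [h1 h2] n; apply: scvg_unique (bop_scvg (sG n%:R) h2) _.
by rewrite (_ : (fun k => _) = fun k => sa_ n%:R (pn k).1); [exact: bop_scvg|apply/funext => k; exact: hp].
Qed.
Lemma sT_G (n : nat) u : sT (sG n%:R u, sa_ n%:R u).
Proof.
move=> m /=; rewrite -!mulE; case: (leqP m n) => mn.
  have mn' : (m%:R : R) <= n%:R by rewrite ler_nat.
  rewrite sG_sa_ ?n0// sa__mono ?n0//; congr (_ u).
  by rewrite -(sa__mono (n0 m) mn') -mulrA sG_mulC// sa__mono ?n0.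
have mn' : (n%:R : R) <= m%:R by rewrite ler_nat ltnW.
by rewrite sa_sG' ?n0// sa__mono ?n0.
Qed.
Lemma sT_dense : dense (dom sT).
Proof.
move=> O [u Ou] oO; have := sG1 u => /scvgP/(_ O) h.
have [|N _ hN] := h; first exact: open_nbhs_nbhs.
exists (sG N%:R u); split; first exact: (hN N (leqnn N)).
by exists (sa_ N%:R u); exact: sT_G.
Qed.
Lemma sT_adj : adj sT = sT.
Proof.
apply/seteqP; split=> [p hp n|p hp].
  apply: (@ip_inj _ _ dot) => z; have := (adj_ipP dot _ sT_lin).2 hp _ (sT_G n z) => /=.
  rewrite (sa_ip _ _ (sG_proj _).1) => <-.
  by have [[ss _] _ _] := sa_P (n0 n); rewrite sa_ip.
apply/(adj_ipP dot _ sT_lin) => q hq.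
have h1 : ip (sG n%:R q.2) p.1 @[n --> \oo] --> ip q.2 p.1 by apply: scvg_ip; [exact: sG1|exact: scvg_cst].
have h2 : ip q.1 (sG n%:R p.2) @[n --> \oo] --> ip q.1 p.2 by apply: scvg_ip; [exact: scvg_cst|exact: sG1].
apply: cvg_unique h1 _ => //; rewrite (_ : (fun n : nat => _) = fun n : nat => ip q.1 (sG n%:R p.2))//.
by apply/funext => n; rewrite hp hq sa_ip//; have [[]] := sa_P (n0 n).
Qed.
Lemma sT_ip p : sT p -> 0 <= ip p.2 p.1.
Proof.
move=> hp; have h1 : ip (sG n%:R p.2) p.1 @[n --> \oo] --> ip p.2 p.1 by apply: scvg_ip; [exact: sG1|exact: scvg_cst].
apply: (cvgr_to_ge h1); near=> n; rewrite hp; by have [[_]] := sa_P (n0 n).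
Unshelve. all: by end_near. Qed.
Lemma sT_cdd : closed_densely_defined sT.
Proof. by split; [exact: sT_lin|apply/(closedP dot); exact: sT_closed|exact: sT_dense]. Qed.
Lemma sT_positive : positive dot sT.
Proof.
split; first by split; [exact: sT_cdd|exact: sT_adj].
move=> p hp; rewrite dot_ip lecE /= sT_ip// andbT.
have hp' : adj sT p by rewrite sT_adj.
have /= h := (adj_ipP dot _ sT_lin).2 hp' _ (cddZ 'i%C sT_lin hp).
by have := ip_iC dot p.2 p.1; rewrite h (ipC dot p.2) ip_iC; lra.
Qed.
(** If u = r (u + v), then [sb n u] equals [sG n v] and converges. By [saM] the squared distances
    between the vectors [sa_ n u] are differences of its forms, so these vectors converge too, and
    their limit is the intermediate vector T u. *)
Lemma sT_sq u v : comp_graph sT sT (u, v) <-> u = r (u + v).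
Proof.
split=> [[w /= h1 h2]|e].
  have h n : r (sG n%:R v) = (1 - r) (sG n%:R u).
    have [_ ss cs] := sa_P (n0 n); have e1 : sG n%:R v = sb n%:R u.
      by rewrite (h2 n) /= -(sa_sG (n0 n)) sG_sa_ ?n0// mulE (h1 n) /= -mulE ss.
    rewrite e1 -!mulE; congr (_ u); rewrite sbE ?n0// mulrA sc_r ?n0//.
    by rewrite mulrBr mulr1 -sG_r mulrBl mul1r.
  have e : r v = (1 - r) u.
    apply: (scvg_unique (bop_scvg r (sG1 v))).
    by rewrite (_ : (fun n => _) = fun n : nat => (1 - r) (sG n%:R u)); [apply: bop_scvg; exact: sG1|apply/funext].
  by rewrite bopD e subE oneE addrC subrK.
have bv n : sb n%:R u = sG n%:R v.
  rewrite sbE ?n0// mulE [in (1 - r) u]e.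
  have -> : (1 - r) (r (u + v)) = r v.
    by rewrite subE oneE -[in X in _ - X]e bopD addrC addKr.
  by rewrite -mulE; have [_ -> _ _] := scP (n0 n).
have dif (m n : nat) : (m <= n)%N -> nq (sa_ n%:R u - sa_ m%:R u) = ip (sG n%:R v - sG m%:R v) u.
  move=> mn; have mn' : (m%:R : R) <= n%:R by rewrite ler_nat.
  have [[sn _] nn cn] := sa_P (n0 n); have [[sm _] mm cm] := sa_P (n0 m).
  rewrite -!bv -subE /sqn sa_ip; last exact: saB.
  rewrite ipC -mulE -subE; congr (ip (_ u) u).
  have [h1 h2] := saM (n0 m) mn'.
  by rewrite mulrBl !mulrBr nn mm h1 h2 subrr subr0.
have [w hw] : exists w, scvg (fun n : nat => sa_ n%:R u) w.
  apply: scauchy => e0 e00.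
  have cv : ip (sG n%:R v) u @[n --> \oo] --> ip v u by apply: scvg_ip; [exact: sG1|exact: scvg_cst].
  move/cvgrPdist_lt: cv => /(_ (e0 / 2)); rewrite divr_gt0// => /(_ isT)[N _ hN].
  have key m n : (m <= n)%N -> (N <= m)%N -> nq (sa_ n%:R u - sa_ m%:R u) < e0.
    move=> mn Nm; rewrite dif// ipBl; have /= := hN n (leq_trans Nm mn); have /= := hN m Nm.
    by rewrite !ltr_norml => /andP[? ?] /andP[? ?]; lra.
  exists N => m n Nm Nn; case: (leqP m n) => mn; first by rewrite nqBC key.
  by rewrite key// ltnW.
have kn (k n : nat) : (n%:R : R) <= (k + n)%:R by rewrite ler_nat leq_addl.
have sh n : scvg (fun k => sa_ (k + n)%:R u) w by move: hw; rewrite /sconv -(cvg_shiftn n).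
exists w => n /=.
  apply: (scvg_unique (bop_scvg (sG n%:R) (sh n))).
  rewrite (_ : (fun k => _) = fun=> sa_ n%:R u); first exact: scvg_cst.
  by apply/funext => k; rewrite -mulE sG_sa_ ?n0// sa__mono ?n0.
rewrite -bv; apply/esym; apply: (scvg_unique (bop_scvg (sa_ n%:R) (sh n))).
rewrite (_ : (fun k => _) = fun=> sb n%:R u); first exact: scvg_cst.
by apply/funext => k; rewrite -mulE; have [_ ->] := saM (n0 n) (kn k n).
Qed.
End Family.

Import HBNNSimple.
(** Integrals are defined for bare set functions but evaluate them on measurable sets only;
    [scalar_measure], arbitrary elsewhere, can thus be exchanged for a true measure. *)
Lemma integral_eq_meas d (T : measurableType d) (R : realType) (m1 m2 : set T -> \bar R) (D : set T) (f : T -> \bar R) :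
  (forall A, measurable A -> m1 A = m2 A) -> (\int[m1]_(x in D) f x = \int[m2]_(x in D) f x)%E.
Proof.
move=> h.
have e (g : T -> \bar R) : ereal_sup [set sintegral m1 k | k in [set k : {nnsfun T >-> R} | forall x, ((k x)%:E <= g x)%E]] =
   ereal_sup [set sintegral m2 k | k in [set k : {nnsfun T >-> R} | forall x, ((k x)%:E <= g x)%E]].
  congr ereal_sup; apply: eq_imagel => k _; rewrite /sintegral; apply: eq_fsbigr => x _.
  by rewrite h.
by rewrite /integral !e.
Qed.

(** On a partition of [0, n] into N + 1 equal parts the increments of D are at most C n / (N + 1)
    times those of F, which telescope; the total tends to 0. *)
Lemma const_of_osc (R : realType) (D F : R -> R) (C n : R) : 0 <= n -> 0 <= C ->
  (forall s t, 0 <= s -> s <= t -> t <= n -> `|D t - D s| <= C * (t - s) * (F t - F s)) -> D n = D 0.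
Proof.
move=> n0 C0 h.
have key (N : nat) : `|D n - D 0| <= (C * n * (F n - F 0)) * N.+1%:R^-1.
  have step j : (j <= N.+1)%N -> `|D (j%:R * (n / N.+1%:R)) - D 0| <= C * (n / N.+1%:R) * (F (j%:R * (n / N.+1%:R)) - F 0).
    elim: j => [|j IH] jN; first by rewrite !mul0r !subrr normr0 mulr0.
    have := IH (ltnW jN); have h0 : 0 <= n / N.+1%:R by rewrite divr_ge0.
    have := h (j%:R * (n / N.+1%:R)) (j.+1%:R * (n / N.+1%:R)).
    rewrite mulr_ge0// ler_wpM2r ?ler_nat// => /(_ isT isT).
    have -> : j.+1%:R * (n / N.+1%:R) <= n.
      by rewrite mulrCA ler_piMr// ler_pdivrMr ?ltr0n// mul1r ler_nat.
    move=> /(_ isT); rewrite -mulrBl -natrB// subSnn mul1r.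
    set d := n / _; set a := D (j.+1%:R * d); set b := D (j%:R * d) => h1 h2.
    rewrite (_ : a - D 0 = (a - b) + (b - D 0)); last by ring.
    apply: le_trans (ler_normD _ _) _; move: h1 h2; set p := F _; set q := F (j%:R * d).
    move=> h1 h2; apply: le_trans (lerD h1 h2) _; rewrite le_eqVlt; apply/orP; left; apply/eqP; ring.
  have := step N.+1 (leqnn _); rewrite (mulrC _ (n / _)) divfK ?pnatr_eq0//.
  by rewrite (_ : C * (n / _) * _ = (C * n * (F n - F 0)) * N.+1%:R^-1)//; ring.
apply/eqP; rewrite -subr_eq0 -normr_eq0 eq_le normr_ge0 andbT.
have cv : (C * n * (F n - F 0)) * k.+1%:R^-1 @[k --> \oo] --> (C * n * (F n - F 0)) * 0.
  by apply: cvgM; [exact: cvg_cst|exact: cvg_harmonic].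
by rewrite mulr0 in cv; apply: (cvgr_to_ge cv); near=> k; exact: key.
Unshelve. all: by end_near. Qed.

(** * Spectral integrals *)

Section SpecMeasure.
Variables (R : realType) (H : completeNormedModType R[i]) (dot : hdot H).
Local Notation bop := (bop H).
Local Notation ip := (rip dot).
Local Notation nq := (sqn dot).
Local Notation sa := (sa dot).
Local Notation psd := (psd dot).
Local Notation ole := (ole dot).
Local Notation bsqrt := (bsqrt dot).
Variable r : bop.
Hypotheses (pr : psd r) (r1 : ole r 1) (ri : forall u, r u = 0 -> u = 0).
Local Notation sG := (sG dot r).
Local Notation sb := (sb dot r).
Local Notation sc := (sc dot r).
Local Notation sa_ := (sa_ dot r).
Implicit Types (u v w : H) (s t : R).

Let hG := sG_specfam pr ri.
Let mu u := spmu hG u.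
Let P := pvm hG.

(** With r z = w and y = r^(1/2) z, the forms of T^2 and of 1 at w become those of 1 - r and of r at
    y, and y lies in the same spectral band as w. *)
Lemma cut_b s t n w : 0 <= s -> s <= t -> t <= n -> sG t w = w -> sG s w = 0 ->
  s ^+ 2 * nq w <= ip (sb n w) w <= t ^+ 2 * nq w.
Proof.
move=> s0 st tn tw sw; have t0 := le_trans s0 st; have n0 := le_trans t0 tn.
have [pbr brr cbr] := bsqrtP pr.
pose z := sc n w; pose y := bsqrt r z.
have [pc cr cG cc] := scP pr n0.
have nw : sG n w = w by rewrite -tw -mulE sG_mul.
have rz : r z = w by rewrite /z -mulE sc_r.
have cy (q : R) : sG q y = bsqrt r (sc n (sG q w)).
  have e1 : sG q * bsqrt r = bsqrt r * sG q by apply: cbr; rewrite sG_r.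
  have e2 : sG q * sc n = sc n * sG q by apply: sG_sc.
  by rewrite /y /z -[LHS]mulE e1 mulE -[sG q (sc n w)]mulE e2.
have ty : sG t y = y by rewrite cy tw.
have sy : sG s y = 0 by rewrite cy sw !bop0.
have h1 := sG_lo pr t0 ty; have h2 := sG_hi pr s0 sy.
have e1 : ip (r y) y = nq w.
  by rewrite -{1}brr mulE (sa_ip _ _ pbr.1) /y -mulE brr rz.
have e2 : nq y = ip z w by rewrite /sqn /y (sa_ip _ _ pbr.1) -mulE brr rz.
rewrite e1 e2 in h1 h2.
have -> : ip (sb n w) w = ip z w - nq w by rewrite sb_def subE nw ipBl.
have pt := phi_gt0 t; have ps := phi_gt0 s.
have k1 : ip z w <= (1 + t ^+ 2) * nq w by rewrite -phiV mulrC ler_pdivlMr// mulrC.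
have k2 : (1 + s ^+ 2) * nq w <= ip z w by rewrite -phiV mulrC ler_pdivrMr// mulrC.
by apply/andP; split; lra.
Qed.

(** The control is on T^2; the chain s^2 |w|^2 <= |T w|^2 <= t <T w, w> gives a lower bound without
    taking another root. The factor t is divided out in [spec_lim_a]. *)
Lemma cut_a s t n w : 0 <= s -> s <= t -> t <= n -> sG t w = w -> sG s w = 0 ->
  s ^+ 2 * nq w <= t * ip (sa_ n w) w /\ ip (sa_ n w) w <= t * nq w.
Proof.
move=> s0 st tn tw sw; have t0 := le_trans s0 st; have n0 := le_trans t0 tn.
have [pa aa ca] := sa_P pr r1 n0.
have up v : sG t v = v -> sG s v = 0 -> ip (sa_ n v) v <= t * nq v.
  move=> tv sv; have /andP[_ h] := cut_b s0 st tn tv sv.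
  have := CS dot (sa_ n v) v.
  have -> : nq (sa_ n v) = ip (sb n v) v by rewrite -aa mulE /sqn (sa_ip _ _ pa.1) ipC.
  move=> h2; have h3 : ip (sa_ n v) v ^+ 2 <= (t * nq v) ^+ 2.
    apply: le_trans h2 _; rewrite exprMn [in leRHS]expr2 [in leRHS]expr2 -expr2 mulrA.
    by rewrite ler_wpM2r ?nq_ge0.
  rewrite -ler_sqr ?nnegrE//; first exact: pa.2.
  by rewrite mulr_ge0 ?nq_ge0.
split; last exact: up.
have ha : nq (sa_ n w) <= t * ip (sa_ n w) w.
  have h := CS_psd w (sa_ n w) pa; change (ip (sa_ n w) (sa_ n w)) with (nq (sa_ n w)) in h.
  have := up (sa_ n w); rewrite -!mulE (sG_sa_ pr r1 _ n0) (sG_sa_ pr r1 _ n0) !mulE tw sw bop0 => /(_ erefl erefl) h2.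
  have a0 := pa.2 w; have q0 := nq_ge0 dot (sa_ n w).
  have h3 : nq (sa_ n w) ^+ 2 <= nq (sa_ n w) * (t * ip (sa_ n w) w).
    by apply: le_trans h _; rewrite (_ : _ * (t * _) = ip (sa_ n w) w * (t * nq (sa_ n w))); [rewrite ler_wpM2l|ring].
  have [->|nz] := eqVneq (nq (sa_ n w)) 0; first by rewrite mulr_ge0.
  by move: h3; rewrite expr2 ler_pM2l// lt_def nz.
apply: le_trans ha; have /andP[h _] := cut_b s0 st tn tw sw.
by apply: le_trans h _; rewrite -aa mulE (sa_ip _ _ pa.1).
Qed.

(* The integral of f against mu u is determined by the values of A on the
   ranges of the increments of sG, up to an oscillation that is summed away. *)
Lemma spec_int u (f : R -> R) (A : bop) (C n : R) : 0 <= n -> 0 <= C ->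
  measurable_fun (setT : set R) f -> (forall t, 0 <= f t) -> 
  (forall s t, 0 <= s -> s <= t -> f s <= f t) ->
  sa A -> (forall t, A * sG t = sG t * A) -> A * sG 0 = 0 -> A * sG n = A ->
  (forall s t w, 0 <= s -> s <= t -> t <= n -> sG t w = w -> sG s w = 0 ->
     `|ip (A w) w - f s * nq w| <= C * (t - s) * nq w /\ f t - f s <= C * (t - s)) ->
  (\int[mu u]_(x in `]0%R, n]) (f x)%:E = (ip (A u) u)%:E)%E.
Proof.
move=> n0 C0 mf f0 fnd sA cA A0 An hA.
have mitv (a b : R) : measurable `]a, b]%classic by exact: measurable_itv.
have mfE (D : set R) : measurable_fun D (EFin \o f) by apply/measurable_EFinP; exact: measurable_funS mf.
have bnd a b : 0 <= a -> a <= b -> ((f a * (nq (sG b u) - nq (sG a u)))%:E <= \int[mu u]_(x in `]a, b]) (f x)%:E <= (f b * (nq (sG b u) - nq (sG a u)))%:E)%E.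
  move=> a0 ab; have e c : (c * (nq (sG b u) - nq (sG a u)))%:E = (\int[mu u]_(x in `]a, b]) (cst c%:E) x)%E.
    by rewrite integral_cst// EFinM -/(Fdist dot sG u b) -/(Fdist dot sG u a) -(spmu_itv hG u ab).
  rewrite !e; apply/andP; split; (apply: ge0_le_integral => //; first
    [by move=> x _; rewrite /= lee_fin | exact: mfE
    | by move=> x; rewrite /= in_itv /= lee_fin => /andP[ax xb]; apply: fnd => //; lra]).
have fin a b : 0 <= a -> a <= b -> (\int[mu u]_(x in `]a, b]) (f x)%:E \is a fin_num)%E.
  move=> a0 ab; have /andP[h1 h2] := bnd a b a0 ab; rewrite fin_numElt.
  by rewrite (lt_le_trans (ltNyr _) h1) (le_lt_trans h2 (ltry _)).
pose k t := fine (\int[mu u]_(x in `]0%R, t]) (f x)%:E)%E.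
pose h t := ip (A (sG t u)) u.
have kinc a b : 0 <= a -> a <= b -> f a * (nq (sG b u) - nq (sG a u)) <= k b - k a <= f b * (nq (sG b u) - nq (sG a u)).
  move=> a0 ab; have b0 := le_trans a0 ab.
  have e : (\int[mu u]_(x in `]0%R, b]) (f x)%:E = \int[mu u]_(x in `]0%R, a]) (f x)%:E + \int[mu u]_(x in `]a, b]) (f x)%:E)%E.
    rewrite -(_ : `]0%R, a]%classic `|` `]a, b]%classic = `]0%R, b]%classic); last first.
      apply/seteqP; split=> x /=; rewrite !in_itv /=; first by case=> /andP[? ?]; apply/andP; split; lra.
      by move=> /andP[? ?]; case: (leP x a) => ?; [left|right]; apply/andP.
    rewrite ge0_integral_setU//=; first
      [by [] | exact: mfE | by move=> x _; rewrite lee_fin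
      | by apply/disj_setPRL => x /=; rewrite !in_itv /= => /andP[h1 h2]; apply/negP; rewrite negb_and -ltNge h1 orbT].
  have ek : k b - k a = fine (\int[mu u]_(x in `]a, b]) (f x)%:E)%E by rewrite /k e fineD ?fin// addrC addKr.
  rewrite ek; have := bnd a b a0 ab.
  by rewrite -{1 2}[(\int[mu u]_(x in `]a, b]) (f x)%:E)%E]fineK ?fin// !lee_fin.
have hinc a b : 0 <= a -> a <= b -> h b - h a = ip (A ((sG b - sG a) u)) ((sG b - sG a) u) /\ nq ((sG b - sG a) u) = nq (sG b u) - nq (sG a u).
  move=> a0 ab; have pb := sf_projB hG ab; split.
    have e : (sG b - sG a) * (A * (sG b - sG a)) = A * (sG b - sG a).
      by rewrite mulrA mulrBl -!cA -mulrBr -mulrA pb.2.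
    rewrite -(sa_ip _ _ pb.1) -[X in ip X u]/(((sG b - sG a) * (A * (sG b - sG a))) u) e.
    by rewrite mulE subE bopB ipBl.
  by rewrite -!proj_ip; [rewrite subE ipBl|exact: sG_proj|exact: sG_proj|exact: pb].
(* The operator form h and the integral k each deviate from f a times the spectral mass by at most C
   (b - a) times that mass, hence 2 C. *)
have D0 := @const_of_osc R (fun t => h t - k t) (fun t => nq (sG t u)) (2 * C) n n0.
have := D0; rewrite mulr_ge0// => /(_ isT) {}D0.
have k0 : k 0 = 0 by rewrite /k set_itvoc0 integral_set0.
have h0 : h 0 = 0 by rewrite /h -mulE A0 bE ip0l.
have : h n - k n = h 0 - k 0.
  apply: D0 => a b a0 ab bn.
  have [hh nn] := hinc a b a0 ab; have /andP[k1 k2] := kinc a b a0 ab.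
  have pb := sf_projB hG ab; set w := _ u in hh nn.
  have bw : sG b w = w by rewrite /w -mulE mulrBr (sG_proj pr b).2 (sG_mul pr ab).
  have aw : sG a w = 0 by rewrite /w -mulE mulrBr (sG_mulC pr ab) (sG_proj pr a).2 subrr.
  have [i1 i2] := hA a b w a0 ab bn bw aw; rewrite -nn in k1 k2 *.
  rewrite (_ : _ - _ - _ = (h b - h a) - (k b - k a)); last by ring.
  rewrite hh; have q0 := nq_ge0 dot w.
  have k3 : f b * nq w <= f a * nq w + C * (b - a) * nq w by rewrite -mulrDl ler_wpM2r//; lra.
  move: i1; rewrite !ler_norml => /andP[i3 i4]; apply/andP; split; nra.
rewrite k0 h0 subrr => /eqP; rewrite subr_eq0 => /eqP e.
rewrite -[LHS]fineK ?fin// -/(k n) -e /h -mulE; congr (_%:E).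
by rewrite An.
Qed.
End SpecMeasure.

Lemma integral_null_eq d (T : measurableType d) (R : realType) (m : {measure set T -> \bar R})
    (A : set T) (f g : T -> \bar R) : measurable A -> m (~` A) = 0 ->
  measurable_fun setT f -> measurable_fun setT g -> (forall x, A x -> f x = g x) ->
  (\int[m]_x f x = \int[m]_x g x)%E.
Proof.
move=> mA A0 mf mg fg; apply: ae_eq_integral => //.
exists (~` A); split=> //; first exact: measurableC.
by move=> x /= h Ax; apply: h => _; exact: fg.
Qed.

Lemma null_neg (R : realType) (m : {measure set R -> \bar R}) :
  (forall n : nat, m `]- n.+1%:R, - n.+1%:R^-1]%classic = 0) -> m `]-oo, 0[%classic = 0.
Proof.
pose F n : set R := `]- n.+1%:R, - n.+1%:R^-1]%classic.
move=> F0; have UF : \bigcup_n F n = `]-oo, 0[%classic.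
  apply/seteqP; split=> [x [n _]|x] /=; rewrite /F /= !in_itv /=.
    by move=> /andP[_ h]; apply: le_lt_trans h _; rewrite oppr_lt0 invr_gt0.
  move=> x0; have a1 := archi_boundP (normr_ge0 x); have a2 := archi_boundP (normr_ge0 x^-1).
  set a := Num.bound _ in a1; set b := Num.bound _ in a2.
  exists (a + b)%N => //=; rewrite in_itv /=; rewrite ltr0_norm// in a1; rewrite normfV ltr0_norm// in a2.
  have xp : 0 < - x by rewrite oppr_gt0.
  apply/andP; split.
    by rewrite ltrNl; apply: lt_trans a1 _; rewrite ltr_nat ltnS leq_addr.
  rewrite lerNr -[leRHS]invrK lef_pV2 ?posrE ?invr_gt0//; apply/ltW/(lt_le_trans a2).
  by rewrite ler_nat; apply: leq_trans (leq_addl _ _) (leqnSn _).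
rewrite -UF; have h : m \o F @ \oo --> m (\bigcup_n F n).
  apply: nondecreasing_cvg_mu.
  - by move=> n; exact: measurable_itv.
  - by apply: bigcup_measurable => n _; exact: measurable_itv.
  - apply/nondecreasing_seqP => n; rewrite subsetEset => x; rewrite /F /= !in_itv /= => /andP[h1 h2].
    apply/andP; split; first by apply: le_lt_trans h1; rewrite lerN2 ler_nat.
    by apply: le_trans h2 _; rewrite lerN2 lef_pV2 ?posrE ?ltr0n// ler_nat.
apply: cvg_unique h _ => //; rewrite (_ : m \o F = fun=> 0); first exact: cvg_cst.
by apply/funext => n /=; exact: F0.
Qed.

Section SpecExists.
Variables (R : realType) (H : completeNormedModType R[i]) (dot : hdot H).
Local Notation bop := (bop H).
Local Notation one := (1 : bop).
Local Notation ip := (rip dot).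
Local Notation nq := (sqn dot).
Local Notation scvg := (sconv dot).
Local Notation psd := (psd dot).
Local Notation ole := (ole dot).
Variable r : bop.
Hypotheses (pr : psd r) (r1 : ole r 1) (ri : forall u, r u = 0 -> u = 0).
Local Notation sG := (sG dot r).
Local Notation sb := (sb dot r).
Local Notation sa_ := (sa_ dot r).
Local Notation sT := (sT dot r).
Implicit Types (u v w : H) (s t : R).

Let hG := sG_specfam pr ri.
Let mu u := spmu hG u.
Let P := pvm hG.

Lemma mu_neg u : mu u `]-oo, 0[%classic = 0.
Proof.
apply: null_neg => n; case: (leP (- n.+1%:R) (- n.+1%:R^-1 : R)) => h.
  have i0 : 0 < n.+1%:R^-1 :> R by rewrite invr_gt0.
  by rewrite -[LHS]/(spmu hG u _) spmu_itv// /Fdist !sG_neg ?bE ?nq0 ?subr0// oppr_lt0.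
by rewrite set_itv_ge ?bnd_simp -?leNgt ?ltW//; exact: (measure0 (mu u)).
Qed.

(** [spec_int] asks for a function nonnegative everywhere, hence F (max x 0); the measure does not
    charge the negative axis ([mu_neg]), and monotone convergence over ]-oo, n] concludes. *)
Lemma spec_int_lim u (F : R -> R) (A : nat -> bop) : measurable_fun (setT : set R) F ->
  F 0 = 0 -> (forall t, 0 <= t -> 0 <= F t) ->
  (forall n, (\int[mu u]_(x in `]0%R, n%:R]) (F (Num.max x 0))%:E = (ip (A n u) u)%:E)%E) ->
  (ip (A n u) u)%:E @[n --> \oo] --> (\int[mu u]_x (F x)%:E)%E.
Proof.
move=> mF F0 Fp hA; pose f x := F (Num.max x 0).
have mf : measurable_fun (setT : set R) f.
  apply: measurableT_comp => //; apply: measurable_maxr; [exact: measurable_id|exact: measurable_cst].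
have mfE (D : set R) : measurable_fun D (EFin \o f) by apply/measurable_EFinP; exact: measurable_funS mf.
have f0 x : 0 <= f x by apply: Fp; rewrite le_max lexx orbT.
have -> : (\int[mu u]_x (F x)%:E = \int[mu u]_x (f x)%:E)%E.
  apply: (@integral_null_eq _ _ _ (mu u) `[0, +oo[%classic).
  - exact: measurable_itv.
  - rewrite (_ : ~` _ = `]-oo, 0[%classic); first exact: mu_neg.
    by rewrite setCitvr.
  - by apply/measurable_EFinP.
  - exact: mfE.
  - by move=> x /=; rewrite in_itv /= andbT => x0; rewrite /f max_l.
pose D (n : nat) : set R := `]-oo, n%:R]%classic.
have UD : \bigcup_n D n = setT.
  rewrite -subTset => x _; have a1 := archi_boundP (normr_ge0 x).
  exists (Num.bound `|x|) => //; rewrite /D /= in_itv /= ltW//; apply: le_lt_trans a1; exact: ler_norm.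
rewrite -UD; have h := @ge0_nondecreasing_set_cvg_integral _ _ _ D (EFin \o f) (mu u).
have e n : (\int[mu u]_(x in D n) (f x)%:E = (ip (A n u) u)%:E)%E.
  rewrite -hA -(_ : `]-oo, 0]%classic `|` `]0%R, n%:R]%classic = D n); last first.
    apply/seteqP; split=> x /=; rewrite /D /= !in_itv /=.
      by case=> [h1|/andP[] //]; apply: le_trans h1 _.
    by move=> xn; case: (leP x 0) => ?; [left|right].
  have -> : (\int[mu u]_(x in `]-oo, 0%R] `|` `]0%R, n%:R]%classic) (f x)%:E = \int[mu u]_(x in `]-oo, 0%R]) (f x)%:E + \int[mu u]_(x in `]0%R, n%:R]) (f x)%:E)%E.
    apply: ge0_integral_setU => //; first [exact: mfE | by move=> x _; rewrite lee_fin |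
    by apply/disj_setPRL => x /=; rewrite !in_itv /= => /andP[h1 _]; apply/negP; rewrite -ltNge].
  have z : (\int[mu u]_(x in `]-oo, 0%R]) (f x)%:E = 0)%E.
    by apply: integral0_eq => x /=; rewrite in_itv /= => x0; rewrite /f max_r// F0.
  transitivity (0 + \int[mu u]_(x in `]0%R, n%:R]) (f x)%:E)%E; [congr (_ + _)%E; exact: z|by rewrite add0e].
rewrite (_ : (fun n => _) = (fun n => \int[mu u]_(x in D n) (f x)%:E)%E); last by apply/funext => n; rewrite e.
apply: h.
- by apply/nondecreasing_seqP => n; rewrite subsetEset => x; rewrite /D /= !in_itv /= => /le_trans; apply; rewrite ler_nat.
- by move=> n; exact: measurable_itv.
- by move=> n; exact: mfE.
- by move=> n x _ /=; rewrite lee_fin.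
Qed.

Lemma spec_lim_b u : (ip (sb n%:R u) u)%:E @[n --> \oo] --> (\int[mu u]_x (x ^+ 2)%:E)%E.
Proof.
apply: (@spec_int_lim u (fun x => x ^+ 2) (fun n => sb n%:R)).
- by apply: measurable_funX; exact: measurable_id.
- by rewrite expr0n.
- by move=> t _; exact: sqr_ge0.
move=> n; apply: (@spec_int _ _ _ r pr ri u (fun x => (Num.max x 0) ^+ 2) (sb n%:R) (2 * n%:R) n%:R) => //.
- apply: measurable_funX; apply: measurable_maxr; [exact: measurable_id|exact: measurable_cst].
- by move=> t; exact: sqr_ge0.
- move=> s t s0 st; rewrite !max_l ?(le_trans s0)// ler_sqr ?nnegrE// ?(le_trans s0)//.
- by have [] := sb_psd pr r1 (n0 R n).
- by move=> t; apply/esym; apply: sb_comm => //; rewrite sG_r.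
- by rewrite sb_mono// sb0.
- by rewrite sb_mono.
- move=> s t w s0 st tn tw sw; have t0 := le_trans s0 st.
  have /andP[h1 h2] := cut_b pr s0 st tn tw sw; have q0 := nq_ge0 dot w.
  have h3 : t ^+ 2 - s ^+ 2 <= 2 * n%:R * (t - s) by rewrite subr_sqr mulrC ler_wpM2r ?subr_ge0//; lra.
  rewrite !max_l//; split=> //; rewrite ger0_norm ?subr_ge0//.
  by apply: (@le_trans _ _ ((t ^+ 2 - s ^+ 2) * nq w)); [lra|rewrite ler_wpM2r].
Qed.

Lemma spec_lim_a u : (ip (sa_ n%:R u) u)%:E @[n --> \oo] --> (\int[mu u]_x x%:E)%E.
Proof.
apply: (@spec_int_lim u id (fun n => sa_ n%:R)) => //.
move=> n; have [ps ss cs] := sa_P pr r1 (n0 R n).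
have s0_ : sa_ 0 = 0.
  have [ps0 ss0 _] := sa_P pr r1 (lexx 0).
  by apply: (@sa_sq0 _ _ dot); [exact: ps0.1|rewrite ss0 sb0].
apply: (@spec_int _ _ _ r pr ri u (fun x => Num.max x 0) (sa_ n%:R) 2 n%:R) => //.
- apply: measurable_maxr; [exact: measurable_id|exact: measurable_cst].
- by move=> t; rewrite le_max lexx orbT.
- by move=> s t s0 st; rewrite !max_l ?(le_trans s0).
- exact: ps.1.
- by move=> t; apply/esym; apply: cs; rewrite sG_r.
- by rewrite sa__mono.
- by rewrite sa__mono.
- move=> s t w s0 st tn tw sw; have t0 := le_trans s0 st.
  have [h1 h2] := cut_a pr r1 s0 st tn tw sw; have q0 := nq_ge0 dot w; have a0 := ps.2 w.
  rewrite !max_l//; split; last lra.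
  rewrite ler_norml; apply/andP; split; last by nra.
  case: (eqVneq t 0) => [tz|tz].
    have sz : s = 0 by apply/eqP; rewrite eq_le s0 andbT -tz.
    by rewrite tz sz subrr mulr0 mul0r; lra.
  have tp : 0 < t by rewrite lt_def tz.
  have h4 : 0 <= t - s by rewrite subr_ge0.
  have h5 : 0 <= (t - s) * nq w by rewrite mulr_ge0.
  have h6 : t * (s * nq w - ip (sa_ n%:R w) w) <= t * ((t - s) * nq w) by nra.
  rewrite ler_pM2l// in h6; lra.
Qed.

Lemma sb_ole s t : 0 <= s -> s <= t -> ole (sb s) (sb t).
Proof.
move=> s0 st; have t0 := le_trans s0 st; rewrite /ole -(sb_mono pr s0 st).
have -> : sb t - sb t * sG s = sb t * (1 - sG s) by rewrite [RHS](mulrBr (sb t) one) mulr1.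
apply: psd_mul; [exact: sb_psd|exact: proj_psd (projC (sG_proj pr s))|].
by rewrite [LHS](mulrBr (sb t) one) [RHS](mulrBl (sb t) one) mulr1 mul1r -(sb_comm pr t0 (esym (sG_r pr s))).
Qed.

(** The squared distances between the vectors [sa_ n u] are increments of the increasing sequence of
    forms of [sb n], here bounded by C, so these vectors are Cauchy. *)
Lemma sT_dom_bound u (C : R) : (forall n : nat, ip (sb n%:R u) u <= C) -> exists v, sT (u, v).
Proof.
move=> hC.
have inc n : ip (sb n%:R u) u <= ip (sb n.+1%:R u) u.
  by apply: ole_ip; apply: sb_ole => //; rewrite ler_nat.
have dif (m n : nat) : (m <= n)%N -> nq (sa_ n%:R u - sa_ m%:R u) = ip (sb n%:R u) u - ip (sb m%:R u) u.
  move=> mn; have mn' : (m%:R : R) <= n%:R by rewrite ler_nat.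
  have [[sn _] nn cn] := sa_P pr r1 (n0 R n); have [[sm _] mm cm] := sa_P pr r1 (n0 R m).
  rewrite -subE /sqn sa_ip; last exact: saB.
  rewrite ipC -mulE -ipBl -subE; congr (ip (_ u) u).
  have [h1 h2] := saM pr r1 (n0 R m) mn'.
  by rewrite mulrBl !mulrBr nn mm h1 h2 subrr subr0.
have [w hw] : exists w, scvg (fun n : nat => sa_ n%:R u) w.
  apply: scauchy => e e0; have [N hN] := mono_cauchy inc hC e0.
  have key m n : (m <= n)%N -> (N <= m)%N -> nq (sa_ n%:R u - sa_ m%:R u) < e.
    by move=> mn Nm; rewrite dif//; apply: le_lt_trans (ler_norm _) _; apply: hN => //; exact: leq_trans mn.
  exists N => m n Nm Nn; case: (leqP m n) => mn; first by rewrite nqBC key.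
  by rewrite key// ltnW.
have kn (k n : nat) : (n%:R : R) <= (k + n)%:R by rewrite ler_nat leq_addl.
exists w => n /=; have sh : scvg (fun k => sa_ (k + n)%:R u) w by move: hw; rewrite /sconv -(cvg_shiftn n).
apply: (scvg_unique (bop_scvg (sG n%:R) sh)).
rewrite (_ : (fun k => _) = fun=> sa_ n%:R u); first exact: scvg_cst.
by apply/funext => k; rewrite -mulE sG_sa_// sa__mono.
Qed.

Lemma sT_dot u v : sT (u, v) -> hd dot v u = (ip v u)%:C.
Proof.
move=> h; have := (sT_positive pr r1 ri).2 _ h => /=; rewrite dot_ip lecE /= => /andP[/eqP -> _].
by [].
Qed.

Lemma spec_exists : spectral_measure dot sT (fun B => bf (P B)).
Proof.
have smE u B : measurable B -> scalar_measure dot (fun B => bf (P B)) u B = mu u B.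
  move=> mB; rewrite /scalar_measure; have [pp_ h] := pvmP hG mB.
  by have := h u; rewrite /mu => ->; congr (_%:E); rewrite -proj_ip.
have eI u (g : R -> \bar R) : (\int[scalar_measure dot (fun B => bf (P B)) u]_l g l = \int[mu u]_l g l)%E.
  by apply: integral_eq_meas => B mB; exact: smE.
split.
- move=> B mB; have [pp_ _] := pvmP hG mB; split; [exact: bfP| |].
    by apply/funext => u; exact: (proj_fix u pp_).
  by apply/adjoint_pairP; rewrite pp_.1.
- by rewrite /P pvmT.
- move=> F mF tF u; have := pvm_add hG mF tF u => /scvgP.
  rewrite (_ : (fun n => _) = fun n => \sum_(0 <= k < n) P (F k) u)//.
  by apply/funext => n; rewrite sumE big_mkord.
- apply/seteqP; split=> u /=; rewrite (eI u (fun l => (l ^+ 2)%:E)).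
    move=> [v h]; apply: (@le_lt_trans _ _ (nq v)%:E); last exact: ltry.
    have cv := @spec_lim_b u.
    apply: (cvge_to_le cv).
    near=> n; rewrite lee_fin; have [ps ss _] := sa_P pr r1 (n0 R n).
    rewrite -ss mulE (sa_ip _ _ ps.1); have := h n; rewrite /= => <-.
    by apply: proj_nq; exact: sG_proj.
  move=> hfin; have [C hC] : exists C : R, (\int[mu u]_x (x ^+ 2)%:E)%E = C%:E.
    have := hfin; have : (0 <= \int[mu u]_x (x ^+ 2)%:E)%E by apply: integral_ge0 => x _; rewrite lee_fin sqr_ge0.
    by case: (\int[mu u]_x (x ^+ 2)%:E)%E => // C _ _; exists C.
  apply: (@sT_dom_bound u C) => n.
  have cv := @spec_lim_b u; rewrite hC in cv.
  rewrite -lee_fin; apply: (cvge_to_ge cv).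
  near=> m; rewrite lee_fin.
  have nm : (n%:R : R) <= m%:R by rewrite ler_nat; near: m; exists n.
  by apply: ole_ip; exact: sb_ole.
- move=> u v h; rewrite (sT_dot h) (eI u (fun l => l%:E)).
  congr (_%:C); have cv := @spec_lim_a u.
  have cv2 : (ip (sa_ n%:R u) u)%:E @[n --> \oo] --> (ip v u)%:E.
    have c1 : ip (sa_ n%:R u) u @[n --> \oo] --> ip v u.
      rewrite (_ : (fun n : nat => _) = fun n : nat => ip (sG n%:R v) u).
        by apply: scvg_ip; [exact: sG1|exact: scvg_cst].
      by apply/funext => n /=; rewrite (h n).
    by apply: cvg_EFin; [apply: nearW|exact: c1].
  by rewrite (cvg_unique _ cv cv2).
Unshelve. all: by end_near. Qed.
End SpecExists.

Lemma bounded_integral (R : realType) (m : {measure set R -> \bar R}) (g : R -> R) (a b M : R) :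
  m setT = M%:E -> measurable_fun (setT : set R) g -> (forall x, a <= g x <= b) ->
  exists2 I : R, (\int[m]_x (g x)%:E = I%:E)%E & a * M <= I <= b * M.
Proof.
move=> mM mg gab; have fin : (m setT < +oo)%E by rewrite mM ltry.
have mgE : measurable_fun (setT : set R) (EFin \o g) by apply/measurable_EFinP.
have bint (f : R -> R) : measurable_fun (setT : set R) f -> (forall x, a <= f x <= b) -> m.-integrable setT (EFin \o f).
  move=> mf fab; apply: measurable_bounded_integrable => //.
  exists (`|a| + `|b|); split; first exact: num_real.
  move=> y hy x _; apply: ltW; apply: le_lt_trans hy; have /andP[h1 h2] := fab x.
  have := ler_norm b; have := ler_norm (- a); rewrite normrN => h3 h4.
  by rewrite ler_norml; have := normr_ge0 a; have := normr_ge0 b; lra.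
have ab : a <= b by have /andP[] := gab 0 => h /(le_trans h).
have ia : m.-integrable setT (EFin \o cst a) by apply: bint => // x /=; rewrite lexx.
have ib : m.-integrable setT (EFin \o cst b) by apply: bint => // x /=; rewrite lexx andbT.
have ig := bint g mg gab.
have h1 : (\int[m]_x (EFin \o cst a) x <= \int[m]_x (EFin \o g) x)%E.
  by apply: le_integral => // x _; rewrite lee_fin; have /andP[] := gab x.
have h2 : (\int[m]_x (EFin \o g) x <= \int[m]_x (EFin \o cst b) x)%E.
  by apply: le_integral => // x _; rewrite lee_fin; have /andP[] := gab x.
have cE (c : R) : (\int[m]_x (EFin \o cst c) x = (c * M)%:E)%E.
  by rewrite EFinM -mM; exact: (integral_cst m measurableT c%:E).
rewrite !cE in h1 h2; exists (fine (\int[m]_x (g x)%:E)%E).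
  rewrite fineK// fin_numElt (lt_le_trans (ltNyr _) h1) (le_lt_trans h2 (ltry _))//.
by rewrite -!lee_fin fineK ?h1// fin_numElt (lt_le_trans (ltNyr _) h1) (le_lt_trans h2 (ltry _)).
Qed.

(** * Uniqueness of the spectral projections *)

Section Unique.
Variables (R : realType) (H : completeNormedModType R[i]) (dot : hdot H).
Local Notation bop := (bop H).
Local Notation one := (1 : bop).
Local Notation ip := (rip dot).
Local Notation nq := (sqn dot).
Local Notation scvg := (sconv dot).
Local Notation adjo := (adjo dot).
Local Notation sa := (sa dot).
Local Notation psd := (psd dot).
Local Notation ole := (ole dot).
Local Notation proj := (proj dot).
Local Notation bsqrt := (bsqrt dot).
Variable r : bop.
Hypotheses (pr : psd r) (r1 : ole r 1) (ri : forall u, r u = 0 -> u = 0).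
Local Notation sG := (sG dot r).
Implicit Types (u v w y z : H) (s t : R) (A B : set R).
Variables (T : set (H * H)) (P : set R -> H -> H).
Hypotheses (hT : positive dot T) (hsq : forall u v, comp_graph T T (u, v) <-> u = r (u + v))
  (hP : spectral_measure dot T P).

Definition sp B : bop := xget (0 : bop) [set e : bop | bf e = P B].
Lemma spE B : measurable B -> bf (sp B) = P B.
Proof.
move=> mB; have [h _ _ _ _] := hP; have [bP _ _] := h B mB.
by rewrite /sp; case: xgetP => [e _ //|/(_ (Bop bP)) h']; exfalso; exact: h'.
Qed.
Lemma sp_proj B : measurable B -> proj (sp B).
Proof.
move=> mB; have [h _ _ _ _] := hP; have [bP ee aP] := h B mB; have e := spE mB.
split; first by apply/esym/adjoint_pairP; rewrite e.
by apply: bopE => u; rewrite mulE e; exact: (congr1 (@^~ u) ee).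
Qed.
Lemma spT : sp setT = 1.
Proof. by apply: bopE => u; rewrite spE//; have [_ -> _ _ _] := hP. Qed.
Definition spm u B : \bar R := if `[< measurable B >] then (nq (sp B u))%:E else 0%E.
Lemma spmE u B : measurable B -> spm u B = (nq (sp B u))%:E.
Proof. by move=> mB; rewrite /spm asboolT. Qed.
Lemma sp_sigma (F : nat -> set R) u : (forall n, measurable (F n)) -> trivIset setT F ->
  (\sum_(0 <= k < n) nq (sp (F k) u)) @[n --> \oo] --> nq (sp (\bigcup_k F k) u).
Proof.
move=> mF tF; have [_ _ h _ _] := hP; have mU : measurable (\bigcup_k F k) by apply: bigcup_measurable.
have /(scvgP dot) cv := h F mF tF u; rewrite -(spE mU) in cv.
rewrite -proj_ip; last exact: sp_proj.
rewrite (_ : (fun n => _) = fun n => ip (\sum_(0 <= k < n) P (F k) u) u).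
  by apply: scvg_ip; [exact: cv|exact: scvg_cst].
apply/funext => n; elim: n => [|n IH]; first by rewrite !big_geq// ip0l.
rewrite !big_nat_recr //= IH ipDl; congr (_ + _).
by rewrite -spE// proj_ip//; exact: sp_proj.
Qed.
Lemma sp0 : sp set0 = 0.
Proof.
apply: bopE => u; apply: (@nq_eq0 _ _ dot).
(* Additivity over copies of the empty set: the partial sums n c tend to c, so 2 c <= c. *)
have h := @sp_sigma (fun=> set0) u (fun=> measurable0) (@trivIset_set0 _ _ setT).
rewrite bigcup0// in h; have c0 := nq_ge0 dot (sp set0 u); set c := nq _ in h c0 *.
suff : 2 * c <= c by lra.
apply: (cvgr_to_ge h); near=> n.
have n2 : (2 <= n)%N by near: n; exists 2%N.
by rewrite sumr_const_nat subn0 -[c *+ n]mulr_natl ler_wpM2r ?ler_nat.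
Unshelve. all: by end_near. Qed.
Lemma spm0 u : spm u set0 = 0%E.
Proof. by rewrite spmE// sp0 zeroE nq0. Qed.
Lemma spm_ge0 u A : (0 <= spm u A)%E.
Proof. by rewrite /spm; case: ifP => // _; rewrite lee_fin nq_ge0. Qed.
Lemma spm_sigma u : semi_sigma_additive (spm u).
Proof.
move=> F mF tF mU; rewrite spmE//.
rewrite (_ : (fun n => _) = fun n => (\sum_(0 <= k < n) nq (sp (F k) u))%:E); last first.
  by apply/funext => n; rewrite -sumEFin; apply: eq_bigr => k _; rewrite spmE.
by apply: cvg_EFin; [apply: nearW|exact: sp_sigma].
Qed.
HB.instance Definition _ u := isMeasure.Build _ _ R (spm u) (spm0 u) (spm_ge0 u) (@spm_sigma u).
Lemma spmT u : spm u setT = (nq u)%:E. Proof. by rewrite spmE// spT. Qed.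

Lemma sp_addnq A B u : measurable A -> measurable B -> A `&` B = set0 ->
  nq (sp (A `|` B) u) = nq (sp A u) + nq (sp B u).
Proof.
move=> mA mB AB; have e : (spm u (A `|` B) = spm u A + spm u B)%E by exact: measureU.
by move: e; rewrite !spmE//; [rewrite -EFinD => -[]|exact: measurableU].
Qed.
Lemma sp_orth A B : measurable A -> measurable B -> A `&` B = set0 -> sp A * sp B = 0.
Proof.
move=> mA mB AB; apply: (@proj_orth _ _ dot); try exact: sp_proj.
move=> u; rewrite -sp_addnq//; apply: proj_nq; apply: sp_proj; exact: measurableU.
Qed.
Lemma sp_add A B : measurable A -> measurable B -> A `&` B = set0 -> sp (A `|` B) = sp A + sp B.
Proof.
move=> mA mB AB; have pA := sp_proj mA; have pB := sp_proj mB.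
have AB0 := sp_orth mA mB AB; have BA0 : sp B * sp A = 0 by apply: sp_orth => //; rewrite setIC.
apply: (@proj_eq _ _ dot); first by apply: sp_proj; exact: measurableU.
  split; first by apply: saD; [exact: pA.1|exact: pB.1].
  by rewrite mulrDl !mulrDr AB0 BA0 pA.2 pB.2 addr0 add0r.
move=> u; rewrite sp_addnq// addE nqD (sa_ip _ _ pA.1) -mulE AB0 zeroE ip0r mulr0 addr0//.
Qed.
Lemma sp_setI A B : measurable A -> measurable B -> sp A * sp B = sp (A `&` B).
Proof.
move=> mA mB; have mI : measurable (A `&` B) by exact: measurableI.
have mAB : measurable (A `\` B) by exact: measurableD.
have mBA : measurable (B `\` A) by exact: measurableD.
have e1 : sp A = sp (A `&` B) + sp (A `\` B).
  by rewrite -sp_add// ?setUIDK// setDE setIACA setICr setI0.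
have e2 : sp B = sp (A `&` B) + sp (B `\` A).
  by rewrite -sp_add// (setIC A) ?setUIDK// setDE setIACA setICr setI0.
rewrite e1 e2 mulrDl !mulrDr (sp_proj mI).2 !sp_orth ?addr0//.
- by apply/seteqP; split=> x //= [[? ?] [? ?]].
- by apply/seteqP; split=> x //= [[? ?] [? ?]].
- by apply/seteqP; split=> x //= [[? ?] [? ?]].
Qed.
Lemma sp_comm A B : measurable A -> measurable B -> sp A * sp B = sp B * sp A.
Proof. by move=> mA mB; rewrite !sp_setI// setIC. Qed.
Lemma sp_setC A : measurable A -> sp (~` A) = 1 - sp A.
Proof.
move=> mA; have := @sp_add A (~` A) mA (measurableC mA); rewrite setICr setUCr spT => /(_ erefl) ->.
by rewrite addrC addKr.
Qed.
Lemma spm_null A w : measurable A -> sp A w = w -> spm w (~` A) = 0%E.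
Proof. by move=> mA h; have mC := measurableC mA; rewrite spmE// sp_setC// subE oneE h subrr nq0. Qed.

Lemma spm_int w (g : R -> \bar R) : (\int[scalar_measure dot P w]_l g l = \int[spm w]_l g l)%E.
Proof.
apply: integral_eq_meas => B mB; rewrite /scalar_measure spmE// -spE//; congr (_%:E).
by rewrite -proj_ip//; exact: sp_proj.
Qed.
Let clamp (a b x : R) : R := Num.max a (Num.min x b).
Lemma clampP a b x : a <= b -> a <= clamp a b x <= b.
Proof. by move=> ab; rewrite /clamp le_max lexx/= ge_max ab ge_min lexx orbT. Qed.
Lemma clampE a b x : a <= x <= b -> clamp a b x = x.
Proof. by move=> /andP[h1 h2]; rewrite /clamp min_l// max_r. Qed.
Lemma measurable_clamp a b : measurable_fun (setT : set R) (clamp a b).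
Proof. by apply: measurable_maxr => //; apply: measurable_minr. Qed.

Lemma T_dom A a b w : measurable A -> A `<=` `[a, b]%classic -> sp A w = w -> exists v, T (w, v).
Proof.
move=> mA Aab Aw; have [_ _ _ hd _] := hP.
suff : dom T w by [].
rewrite hd /= spm_int.
pose K := (`|a| + `|b|) ^+ 2.
have K0 : 0 <= K by exact: sqr_ge0.
have mg : measurable_fun (setT : set R) (fun x => Num.min (x ^+ 2) K).
  by apply: measurable_minr => //; apply: measurable_funX; exact: measurable_id.
have [|I hI _] := @bounded_integral R (spm w) _ 0 K _ (spmT w) mg.
  by move=> x; rewrite le_min sqr_ge0 K0 ge_min lexx orbT.
rewrite (@integral_null_eq _ _ _ (spm w) A (fun x => (x ^+ 2)%:E) (fun x => (Num.min (x ^+ 2) K)%:E)) ?hI ?ltry//.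
- exact: spm_null.
- by apply/measurable_EFinP; apply: measurable_funX; exact: measurable_id.
- exact/measurable_EFinP.
- move=> x /Aab /=; rewrite in_itv /= => /andP[h1 h2]; rewrite min_l//.
  rewrite /K -[x ^+ 2](real_normK (num_real x)) ler_sqr ?nnegrE ?addr_ge0// ler_norml.
  have := ler_norm b; have := ler_norm (- a); rewrite normrN; have := normr_ge0 a; have := normr_ge0 b; lra.
Qed.
Lemma T_form A a b w v : measurable A -> A `<=` `[a, b]%classic -> a <= b -> sp A w = w -> T (w, v) ->
  (ip v w)%:E = (\int[spm w]_x (clamp a b x)%:E)%E /\ a * nq w <= ip v w <= b * nq w.
Proof.
move=> mA Aab ab Aw Tw; have [_ _ _ _ hf] := hP.
have [|I hI hb] := @bounded_integral R (spm w) _ a b _ (spmT w) (measurable_clamp a b); first by move=> x; exact: clampP.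
have := hf _ _ Tw; rewrite spm_int (@integral_null_eq _ _ _ (spm w) A (fun x => x%:E) (fun x => (clamp a b x)%:E)) ?hI//.
- by move=> /(congr1 (@complex.Re R)) => e; rewrite /rip e.
- exact: spm_null.
- by apply/measurable_EFinP; exact: measurable_id.
- by apply/measurable_EFinP; exact: measurable_clamp.
- by move=> x /Aab /=; rewrite in_itv /= => h; rewrite clampE.
Qed.

Let lT : linear_graph T. Proof. by have [[[] ]] := hT. Qed.
Lemma T_sym p q : T p -> T q -> ip p.2 q.1 = ip p.1 q.2.
Proof.
move=> Tp Tq; have [[_ aT] _] := hT; rewrite -aT in Tq.
exact: (adj_ipP dot _ lT).2 Tq _ Tp.
Qed.
Lemma T_ge0 w v : T (w, v) -> 0 <= ip v w.
Proof. by move=> h; have [_ /(_ _ h)] := hT; rewrite /= dot_ip lecE => /andP[]. Qed.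

Lemma sp_neg : sp `]-oo, 0[%classic = 0.
Proof.
apply: bopE => u; apply: (@nq_eq0 _ _ dot).
suff : spm u `]-oo, 0[%classic = 0%E by rewrite spmE; [case|exact: measurable_itv].
apply: null_neg => n; set A := `]_, _]%classic.
have mA : measurable A by exact: measurable_itv.
rewrite -[LHS]/(spm u A) spmE//; have Aw := proj_fix u (sp_proj mA); set w := sp A u in Aw *.
have i0 : 0 < n.+1%:R^-1 :> R by rewrite invr_gt0.
have Aab : A `<=` `[- n.+1%:R, - n.+1%:R^-1]%classic.
  by move=> x /=; rewrite !in_itv /= => /andP[h1 h2]; rewrite ltW.
have ab : - n.+1%:R <= - n.+1%:R^-1 :> R.
  by rewrite lerN2; apply: (@le_trans _ _ 1); rewrite ?invf_le1 ?ler1n.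
have [v Tv] := T_dom mA Aab Aw; have [_ /andP[_ h]] := T_form mA Aab ab Aw Tv.
have := T_ge0 Tv; have q0 := nq_ge0 dot w => h2; congr (_%:E).
apply/eqP; rewrite eq_le q0 andbT -(pmulr_rle0 _ i0).
by rewrite mulNr in h; rewrite -oppr_ge0; exact: le_trans h2 h.
Qed.
Lemma sp_pos : sp `[0, +oo[%classic = 1.
Proof.
have := @sp_setC `]-oo, 0[%classic (measurable_itv _); rewrite sp_neg subr0 => <-.
by rewrite setCitvl.
Qed.
Lemma sp_lim A (F : nat -> set R) w : (forall n, measurable (F n)) -> measurable A ->
  nondecreasing_seq F -> \bigcup_n F n = A -> sp A w = w -> scvg (fun n => sp (F n) w) w.
Proof.
move=> mF mA ndF UF Aw.
have h : (nq (sp (F n) w))%:E @[n --> \oo] --> (nq w)%:E.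
  rewrite -{2}Aw -spmE// -UF (_ : (fun n => _) = spm w \o F); last by apply/funext => n /=; rewrite spmE.
  by apply: nondecreasing_cvg_mu => //; rewrite UF.
move/fine_cvgP: h => [_ h]; rewrite /sconv.
rewrite (_ : (fun n => _) = fun n => nq w - nq (sp (F n) w)); last first.
  apply/funext => n; have pn := sp_proj (mF n).
  by rewrite (proj_pyth w pn) subE oneE nqBC addrAC subrr add0r.
by rewrite -(subrr (nq w)); apply: cvgB; [exact: cvg_cst|exact: h].
Qed.

(** When all spectral pieces of w are orthogonal to z, the scalar measures of w and z add up to that
    of w + z, so the form of T is additive on the pair; by symmetry of T this leaves twice <v, z>
    equal to 0. *)
Lemma form_add K w z v y : 0 <= K -> sp `[0, K]%classic w = w -> sp `[0, K]%classic z = z -> T (w, v) -> T (z, y) ->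
  (forall B, measurable B -> ip (sp B w) z = 0) -> ip v z = 0.
Proof.
move=> K0 Kw Kz Tv Ty orth; have mA : measurable (`[0%R, K]%classic : set R) by exact: measurable_itv.
have Twz : T (w + z, v + y) := cddD lT Tv Ty.
have Kwz : sp `[0, K]%classic (w + z) = w + z by rewrite bopD Kw Kz.
have [e1 _] := T_form mA (@subset_refl _ _) K0 Kw Tv; have [e2 _] := T_form mA (@subset_refl _ _) K0 Kz Ty.
have [e3 _] := T_form mA (@subset_refl _ _) K0 Kwz Twz.
have : (ip (v + y) (w + z))%:E = ((ip v w)%:E + (ip y z)%:E)%E.
  rewrite e1 e2 e3 -ge0_integral_measure_add//.
  - apply: eq_measure_integral => B mB _; apply: etrans (esym (measure_addE (spm w) (spm z) B)).
    rewrite -[LHS]/(spm (w + z) B) -[RHS]/(spm w B + spm z B)%E !spmE// bopD nqD.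
    by rewrite -(sa_ip _ _ (sp_proj mB).1) (proj_fix w (sp_proj mB)) orth// mulr0 addr0 EFinD.
  - by move=> x _; rewrite lee_fin; have /andP[] := clampP x K0.
  - by apply/measurable_EFinP; exact: measurable_clamp.
rewrite -EFinD => -[]; rewrite !ipDl !ipDr.
by have := T_sym Tv Ty => /=; rewrite (ipC dot w y); lra.
Qed.

(** A spectral measure prescribes only quadratic forms on the domain; that T leaves the range of
    [sp A] invariant has to be extracted from [form_add], with test vectors cut to bounded sets. *)
Lemma T_stable K A w v : 0 <= K -> measurable A -> A `<=` `[0, K]%classic -> sp A w = w -> T (w, v) -> sp A v = v.
Proof.
move=> K0 mA AK Aw Tv; have pA := sp_proj mA.
suff h z : sp A z = 0 -> ip v z = 0.
  apply/eqP; rewrite eq_sym -subr_eq0; apply/eqP/(@ip_inj _ _ dot) => u.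
  rewrite ip0r -[v - _]/((1 - sp A) v) ipC (sa_ip _ _ (projC pA).1); apply: h.
  by rewrite -mulE (projeC pA).
move=> Az; pose F (n : nat) : set R := `[0, n%:R + K]%classic.
have mF n : measurable (F n) by exact: measurable_itv.
have cz : scvg (fun n => sp (F n) z) z.
  apply: (@sp_lim `[0, +oo[%classic F z mF (measurable_itv _)).
  - by apply/nondecreasing_seqP => n; rewrite subsetEset => x /=; rewrite /F /= !in_itv /= => /andP[-> /=] /le_trans; apply; rewrite lerD2r ler_nat.
  - apply/seteqP; split=> x /=; rewrite in_itv /= ?andbT; first by move=> [n _]; rewrite /F /= in_itv /= => /andP[].
    move=> x0; have a1 := archi_boundP x0; exists (Num.bound x) => //; rewrite /F /= in_itv /= x0 /=.
    by apply: ltW; apply: lt_le_trans a1 _; rewrite lerDl.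
  - by rewrite sp_pos.
have c0 : ip v (sp (F n) z) @[n --> \oo] --> ip v z by apply: scvg_ip => //; exact: scvg_cst.
apply: cvg_unique c0 _ => //; rewrite (_ : (fun n => _) = fun=> 0); first exact: cvg_cst.
apply/funext => n; have nK : 0 <= n%:R + K by rewrite addr_ge0.
have Fz := proj_fix z (sp_proj (mF n)); have [y Ty] := T_dom (mF n) (@subset_refl _ _) Fz.
have Fw : sp (F n) w = w.
  have AF : F n `&` A = A.
    apply/setIidPr => x /AK /=; rewrite /F /= !in_itv /= => /andP[-> /=] h; apply: le_trans h _.
    by rewrite lerDr.
  by rewrite -Aw -mulE sp_setI// AF.
apply: (form_add nK Fw Fz Tv Ty) => B mB.
rewrite -Aw -[sp B _]mulE sp_comm// mulE (sa_ip _ _ pA.1) -[sp A (sp _ z)]mulE sp_comm// mulE Az bop0 ip0r//.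
Qed.

(** The restriction of T to the range of [sp A], extended by 0, is a bounded self-adjoint c, and (1
    + c^2)^-1 agrees with r on that range by the equation relating T and r. Hence r commutes with
    [sp A], and h = (1 + c^2) w. *)
Lemma T_cut K A : 0 <= K -> measurable A -> A `<=` `[0, K]%classic ->
  r * sp A = sp A * r /\ forall w, sp A w = w -> exists y h,
    [/\ T (w, y), r h = w, ip h w = nq w + nq y & nq y <= K ^+ 2 * nq w].
Proof.
move=> K0 mA AK; have pA := sp_proj mA.
have ex u : exists v, T (sp A u, v) by exact: (T_dom mA AK (proj_fix u pA)).
have [f hf] := choice ex.
have Af u : sp A (f u) = f u by exact: (T_stable K0 mA AK (proj_fix u pA) (hf u)).
have lf : linear f.
  move=> c u v; apply: (graph_uniq lT (hf _)); rewrite bop_lin.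
  by have [_ h _] := lT; exact: (h c _ _ (hf u) (hf v)).
have fn u : nq (f u) <= K ^+ 2 * nq (sp A u).
  have Ty := hf u; have [y2 Ty2] : exists y2, T (f u, y2) by exact: (T_dom mA AK (Af u)).
  have [_ /andP[_ b1]] := T_form mA AK K0 (proj_fix u pA) Ty; have [_ /andP[_ b2]] := T_form mA AK K0 (Af u) Ty2.
  (* Cauchy-Schwarz for the positive form of T at the pair [f u], [sp A u]. *)
  have h : ip (f u) (f u) ^+ 2 <= ip y2 (f u) * ip (f u) (sp A u).
    apply: quad_ge0 => [|t]; first exact: (T_ge0 Ty2).
    have Tt := cddD lT Ty (cddZ t%:C lT Ty2); have := T_ge0 Tt.
    rewrite !ipDl !ipDr !ipZl !ipZr; have := T_sym Ty2 Ty => /= ->.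
    by lra.
  change (ip (f u) (f u)) with (nq (f u)) in h.
  have q0 := nq_ge0 dot (f u); have q1 := nq_ge0 dot (sp A u); have g1 := T_ge0 Ty; have g2 := T_ge0 Ty2.
  have h3 : nq (f u) ^+ 2 <= nq (f u) * (K ^+ 2 * nq (sp A u)).
    apply: le_trans h _; rewrite (_ : nq (f u) * _ = (K * nq (f u)) * (K * nq (sp A u))); last by ring.
    by rewrite ler_pM.
  have [->|nz] := eqVneq (nq (f u)) 0; first by rewrite mulr_ge0// sqr_ge0.
  by move: h3; rewrite expr2 ler_pM2l// lt_def nz.
have fb u : nq (f u) <= K ^+ 2 * nq u.
  by apply: le_trans (fn u) _; rewrite ler_wpM2l ?sqr_ge0// proj_nq.
pose c := mkbop lf fb.
have cE u : c u = f u by [].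
have sc : sa c.
  apply: adj_uniq => u v; rewrite !cE -{1}(Af u) (sa_ip _ _ pA.1).
  by have := T_sym (hf u) (hf v) => /= ->; rewrite (sa_ip _ _ pA.1) Af.
have Ac : sp A * c = c by apply: bopE => u; rewrite mulE cE Af.
have cA : c * sp A = c by have := congr1 adjo Ac; rewrite adjM sc pA.1.
have pcc : psd (c * c) by exact: psd_sq.
have [i [pi i1 i2 ci _]] : exists i, [/\ psd i, i * (1 + c * c) = 1, (1 + c * c) * i = 1, forall x, x * (1 + c * c) = (1 + c * c) * x -> x * i = i * x & ole i ((1 : R)^-1 *: one)].
  apply: inv_ex => //; first by apply: psdD => //; exact: psd1.
  by rewrite scale1r /ole addrAC subrr add0r.
have Ai : sp A * i = i * sp A.
  by apply: ci; rewrite mulrDr mulrDl mulr1 mul1r mulrA Ac -mulrA cA.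
have key u : sp A u = u -> T (i u, c (i u)) /\ i u = r u.
  move=> Au; have Aiu : sp A (i u) = i u by rewrite -mulE Ai mulE Au.
  have T1 := hf (i u); rewrite Aiu in T1.
  have T2 := hf (c (i u)); rewrite [sp A (c _)]Af in T2.
  have e : i u + f (c (i u)) = u by rewrite -[RHS]/(one u) -i2 mulE addE oneE mulE.
  split=> //; have := (hsq (i u) (f (c (i u)))).1; rewrite e.
  by apply; exists (f (i u)).
have rA : r * sp A = i * sp A.
  by apply: bopE => u; rewrite !mulE; have [_ ->] := key _ (proj_fix u pA).
have rA' : sp A * (r * sp A) = r * sp A by rewrite rA mulrA Ai -mulrA pA.2.
split.
  by have := congr1 adjo rA'; rewrite !adjM pA.1 pr.1 -mulrA => <-; rewrite rA'.
move=> w Aw; exists (c w), ((1 + c * c) w).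
have Ah : sp A ((1 + c * c) w) = (1 + c * c) w.
  by rewrite -mulE mulrDr mulr1 mulrA Ac addE Aw addE oneE.
have [T1 e1] := key _ Ah; rewrite -mulE i1 in T1 e1; split=> //.
by rewrite addE ipDl oneE mulE (sa_ip _ _ sc).
Qed.

(** The range of [sp [0, b]] gives T <= b, while vanishing of [sG s] gives r <= phi s. Compared at
    r^(1/2) h with r h = w, the two bounds leave a factor below 1 in front of |w|^2. *)
Lemma sp_alpha b s w : 0 <= b -> b < s -> sp `[0, b]%classic w = w -> sG s w = 0 -> w = 0.
Proof.
move=> b0 bs Aw Gw; have s0 : 0 <= s by rewrite ltW// (le_lt_trans b0).
have [_ /(_ w Aw)[y [h [Ty rh hw hy]]]] := T_cut b0 (measurable_itv `[0, b]) (@subset_refl _ _).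
have [pbr brr cbr] := bsqrtP pr.
have Gh : sG s h = 0 by apply: ri; rewrite -mulE sG_r// mulE rh.
have Gv : sG s (bsqrt r h) = 0 by rewrite -mulE cbr ?sG_r// mulE Gh bop0.
have := sG_hi pr s0 Gv; rewrite -{1}brr mulE (sa_ip _ _ pbr.1) -!mulE brr.
have -> : nq (bsqrt r h) = ip h w by rewrite /sqn (sa_ip _ _ pbr.1) -mulE brr rh ipC.
rewrite [r h]rh hw -/(nq w) => le1.
have q0 := nq_ge0 dot w; apply: (@nq_eq0 _ _ dot).
have p1 : phi s * (1 + b ^+ 2) < 1.
  rewrite -[X in _ < X](@mulVf _ (1 + s ^+ 2)) ?gt_eqF ?ltr_pwDl ?sqr_ge0//.
  by rewrite -/(phi s) ltr_pM2l ?phi_gt0// ltrD2l ltr_pXn2r ?nnegrE.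
have le2 : nq w <= phi s * (1 + b ^+ 2) * nq w.
  apply: le_trans le1 _; rewrite -mulrA (ler_wpM2l (ltW (phi_gt0 s)))//; have := hy; lra.
apply/eqP; rewrite eq_le q0 andbT.
have p2 : 0 < 1 - phi s * (1 + b ^+ 2) by rewrite subr_gt0.
by rewrite -(pmulr_rle0 _ p2) mulrBl mul1r subr_le0.
Qed.
(** The mirror image of [sp_alpha]; the upper end k keeps T bounded on the band, as [T_cut]
    requires. *)
Lemma sp_beta s a k w : 0 <= s -> s < a -> sp `]a, k]%classic w = w -> sG s w = w -> w = 0.
Proof.
move=> s0 sa_ Aw Gw; have a0 : 0 <= a by rewrite ltW// (le_lt_trans s0).
case: (leP a k) => ak; last first.
  by rewrite -Aw set_itv_ge ?sp0// bnd_simp -leNgt ltW.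
have k0 := le_trans a0 ak.
have mA : measurable (`]a, k]%classic : set R) by exact: measurable_itv.
have AK : `]a, k]%classic `<=` `[0, k]%classic by move=> x /=; rewrite !in_itv /= => /andP[h1 ->]; rewrite andbT; lra.
have Aab : `]a, k]%classic `<=` `[a, k]%classic by move=> x /=; rewrite !in_itv /= => /andP[h1 ->]; rewrite andbT; lra.
have [_ /(_ w Aw)[y [h [Ty rh hw hy]]]] := T_cut k0 mA AK.
have [_ /andP[fl _]] := T_form mA Aab ak Aw Ty.
have [pbr brr cbr] := bsqrtP pr.
have Gh : sG s h = h by apply/eqP; rewrite -subr_eq0; apply/eqP/ri; rewrite bopB -mulE sG_r// mulE rh Gw subrr.
have Gv : sG s (bsqrt r h) = bsqrt r h by rewrite -mulE cbr ?sG_r// mulE Gh.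
have := sG_lo pr s0 Gv; rewrite -{2}brr mulE (sa_ip _ _ pbr.1) -!mulE brr.
have -> : nq (bsqrt r h) = ip h w by rewrite /sqn (sa_ip _ _ pbr.1) -mulE brr rh ipC.
rewrite [r h]rh hw => le1; change (ip w w) with (nq w) in le1.
have q0 := nq_ge0 dot w; apply: (@nq_eq0 _ _ dot); apply/eqP/negP => /negP nz.
have qp : 0 < nq w by rewrite lt_def nz.
have cs := CS dot y w; have ya : a ^+ 2 * nq w <= nq y.
  have : (a * nq w) ^+ 2 <= nq y * nq w by apply: le_trans cs; rewrite ler_sqr ?nnegrE ?mulr_ge0//; apply: le_trans fl; rewrite mulr_ge0.
  by rewrite exprMn [nq w ^+ 2]expr2 mulrA ler_pM2r.
have p1 : 1 < phi s * (1 + a ^+ 2).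
  rewrite -[X in X < _](@mulVf _ (1 + s ^+ 2)) ?gt_eqF ?ltr_pwDl ?sqr_ge0//.
  by rewrite -/(phi s) ltr_pM2l ?phi_gt0// ltrD2l ltr_pXn2r ?nnegrE.
have ps := phi_gt0 s; have le2 : phi s * (1 + a ^+ 2) * nq w <= nq w.
  by apply: le_trans le1; rewrite -mulrA ler_pM2l//; lra.
by move: le2; rewrite leNgt -{1}[nq w]mul1r ltr_pM2r// p1.
Qed.

Let mI s : measurable (`]-oo, s]%classic : set R). Proof. exact: measurable_itv. Qed.
Lemma sp_sG_ub b s u : 0 <= b -> b < s -> nq (sp `]-oo, b]%classic u) <= nq (sG s u).
Proof.
move=> b0 bs; have mA : measurable (`[0, b]%classic : set R) by exact: measurable_itv.
have e : sp `]-oo, b]%classic = sp `[0, b]%classic.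
  rewrite -[LHS]mulr1 -sp_pos sp_setI//; congr sp; apply/seteqP; split=> x /=; rewrite !in_itv /=.
    by move=> [h1 h2]; apply/andP; split=> //; move: h2; rewrite andbT.
  by move=> /andP[h1 ->]; rewrite h1.
have [cA _] := T_cut b0 mA (@subset_refl _ _).
have cG : sp `[0, b]%classic * sG s = sG s * sp `[0, b]%classic by exact: (sG_comm pr).
have h : sG s * sp `[0, b]%classic = sp `[0, b]%classic.
  apply: bopE => v; apply/eqP; rewrite eq_sym -subr_eq0; apply/eqP.
  apply: (sp_alpha b0 bs).
    by rewrite bopB (proj_fix v (sp_proj mA)) -[sp `[0, b]%classic ((sG s * sp `[0, b]%classic) v)]mulE mulrA cG -mulrA (sp_proj mA).2.
  by rewrite bopB -[sG s (sp _ v)]mulE -[sG s ((sG s * sp `[0, b]%classic) v)]mulE mulrA (sG_proj pr s).2 subrr.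
by rewrite e -h -cG mulE; apply: proj_nq; exact: sp_proj.
Qed.
Lemma sp_sG_lb a s u : 0 <= s -> s < a -> nq (sG s u) <= nq (sp `]-oo, a]%classic u).
Proof.
move=> s0 sa_; have a0 : 0 <= a by rewrite ltW// (le_lt_trans s0).
have mo : measurable (`]a, +oo[%classic : set R) by exact: measurable_itv.
have mF (n : nat) : measurable (`]a, n%:R]%classic : set R) by exact: measurable_itv.
have h : sG s * sp `]a, +oo[%classic = 0.
  apply: bopE => v; rewrite mulE zeroE; have Az := proj_fix v (sp_proj mo); set z := sp _ v in Az *.
  have cz : scvg (fun n : nat => sp `]a, n%:R]%classic z) z.
    apply: (@sp_lim `]a, +oo[%classic (fun n : nat => `]a, n%:R]%classic) z mF mo _ _ Az).
      apply/nondecreasing_seqP => n; rewrite subsetEset => x /=; rewrite !in_itv /= => /andP[-> /=] /le_trans; apply.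
      by rewrite ler_nat.
    apply/seteqP; split=> x /=; rewrite in_itv /= ?andbT; first by move=> [n _]; rewrite /= in_itv /= => /andP[].
    move=> ax; exists (Num.bound x) => //; rewrite /= in_itv /= ax /=.
    by apply: ltW; apply: archi_boundP; apply: le_trans a0 (ltW ax).
  apply: (scvg_unique (bop_scvg (sG s) cz)).
  rewrite (_ : (fun n => _) = fun=> 0); first exact: scvg_cst.
  apply/funext => n; case: (leP a n%:R) => an; last first.
    by rewrite set_itv_ge ?sp0 ?zeroE ?bop0// bnd_simp -leNgt ltW.
  have sub : `]a, n%:R]%classic `<=` `[0, n%:R]%classic.
    by move=> x /=; rewrite !in_itv /= => /andP[h1 ->]; rewrite andbT; lra.
  have [cA _] := T_cut (le_trans a0 an) (mF n) sub.
  have cG : sp `]a, n%:R]%classic * sG s = sG s * sp `]a, n%:R]%classic by apply: (sG_comm pr).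
  apply: (sp_beta s0 sa_ (k := n%:R)).
    by rewrite -[sG s (sp _ z)]mulE -[sp _ ((sG s * sp `]a, n%:R]%classic) z)]mulE mulrA cG -mulrA (sp_proj (mF n)).2.
  by rewrite -[sG s (sG s _)]mulE (sG_proj pr s).2.
have h2 : sG s * sp `]-oo, a]%classic = sG s.
  have -> : `]-oo, a]%classic = ~` (`]a, +oo[%classic : set R) by rewrite setCitvr.
  by rewrite sp_setC// mulrBr mulr1 h subr0.
by rewrite -h2 mulE; apply: proj_nq; exact: (sG_proj pr).
Qed.
(** [sp_alpha] and [sp_beta] compare the two families at different points; right continuity of both
    closes the gap. *)
Theorem sp_sG s : 0 <= s -> sp `]s, +oo[%classic = 1 - sG s.
Proof.
move=> s0; have -> : `]s, +oo[%classic = ~` (`]-oo, s]%classic : set R) by rewrite setCitvl.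
rewrite sp_setC//; congr (_ - _); apply: (@proj_eq _ _ dot) => [||u]; first exact: sp_proj.
  exact: (sG_proj pr).
apply/eqP; rewrite eq_le; apply/andP; split.
  have [un un0 cu] := sf_rc (sG_specfam pr ri) s u.
  apply: (cvgr_to_ge cu); apply: nearW => n; apply: sp_sG_ub => //.
  by rewrite ltrDl.
pose F (n : nat) : set R := `]-oo, s + n.+1%:R^-1]%classic.
have h : (nq (sp (F n) u))%:E @[n --> \oo] --> (nq (sp `]-oo, s]%classic u))%:E.
  rewrite (_ : (fun n => _) = spm u \o F); last by apply/funext => n /=; rewrite spmE//; exact: mI.
  rewrite -spmE//.
  have -> : `]-oo, s]%classic = \bigcap_n F n.
    apply/seteqP; split=> x /=; rewrite in_itv /=.
      by move=> xs n _; rewrite /F /= in_itv /=; apply: le_trans xs _; rewrite lerDl invr_ge0.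
    move=> hx; apply/ler_addgt0Pr => e e0.
    have [n ne] : exists n : nat, n.+1%:R^-1 < e.
      exists (Num.bound e^-1); rewrite invf_plt ?posrE//.
      by apply: lt_trans (archi_boundP _) _; rewrite ?invr_ge0 ?ltr_nat// ltW.
    by have := hx n I; rewrite /F /= in_itv /= => /le_trans; apply; rewrite lerD2l ltW.
  apply: nonincreasing_cvg_mu => //.
  - by rewrite -[X in (X < _)%E]/(spm u (F 0%N)) spmE ?ltry//; exact: mI.
  - by move=> n; exact: mI.
  - by apply: bigcap_measurable => // n _; exact: mI.
  - apply/nonincreasing_seqP => n; rewrite subsetEset => x /=; rewrite /F /= !in_itv /= => /le_trans; apply.
    by rewrite lerD2l lef_pV2 ?posrE// ler_nat.
move/fine_cvgP: h => [_ h]; apply: (cvgr_to_ge h); apply: nearW => n /=.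
by apply: sp_sG_lb => //; rewrite ltrDl invr_gt0.
Qed.
End Unique.

Section ModulusCut.
Variables (R : realType) (H : completeNormedModType R[i]) (dot : hdot H).
Local Notation bop := (bop H).
Local Notation ip := (rip dot).
Local Notation nq := (sqn dot).
Local Notation sa := (sa dot).
Local Notation psd := (psd dot).
Local Notation ole := (ole dot).
Local Notation bsqrt := (bsqrt dot).

(* T r is the positive square root of r (1 - r), which determines T since
   T (sG n u) = (T r) (sc n u). *)
Lemma sqrt_graph (r : bop) (T : set (H * H)) : psd r -> ole r 1 -> (forall u, r u = 0 -> u = 0) ->
  positive dot T -> (forall u v, comp_graph T T (u, v) <-> u = r (u + v)) ->
  T = [set p | forall n : nat, sG dot r n%:R p.2 = bsqrt (r * (1 - r)) (sc dot r n%:R p.1)].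
Proof.
move=> pr r1 ri [[[lT cT _] aT] gT] hsq.
have symT p q : T p -> T q -> ip p.2 q.1 = ip p.1 q.2.
  by move=> Tp Tq; rewrite -aT in Tq; exact: (adj_ipP dot _ lT).2 Tq _ Tp.
have posT w v : T (w, v) -> 0 <= ip v w by move=> /gT; rewrite /= dot_ip lecE => /andP[].
have ex u : exists a, T (r u, a) /\ T (a, u - r u).
  by have [_ /(_ _)[|a h1 h2]] := hsq (r u) (u - r u); [rewrite addrC subrK|exists a].
have [d hd] := choice ex.
have ld : linear d.
  move=> c u v; apply: (graph_uniq lT (hd _).1); rewrite bop_lin.
  by have [_ h _] := lT; apply: (h c _ _ (hd u).1 (hd v).1).
have nd u : nq (d u) = ip ((r * (1 - r)) u) u.
  have [h1 h2] := hd u; have -> : (r * (1 - r)) u = r (u - r u) by rewrite mulE subE oneE.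
  by rewrite (sa_ip _ _ pr.1) /sqn; exact: (esym (symT _ _ h2 h1)).
have [K K0 hK] := nbP dot (r * (1 - r)).
have bd u : nq (d u) <= (1 + K) * nq u.
  rewrite nd; have := CS2 dot ((r * (1 - r)) u) u ltr01; rewrite invr1 !mul1r.
  have := hK u; have := nq_ge0 dot u; have := mulr_ge0 K0 (nq_ge0 dot u); lra.
pose D := mkbop ld bd; have DE u : D u = d u by [].
have sD : sa D.
  apply: adj_uniq => u v; rewrite !DE; have [h1 h2] := hd u; have [k1 k2] := hd v.
  have eu : u = r u + (u - r u) by rewrite addrC subrK.
  have ev : v = r v + (v - r v) by rewrite addrC subrK.
  rewrite [X in ip (d u) X = _]ev [X in _ = ip X (d v)]eu ipDr ipDl (symT _ _ h1 k1) /=; congr (_ + _).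
  exact: esym (symT _ _ h2 k2).
have pD : psd D.
  split=> // u; rewrite DE; have [h1 h2] := hd u.
  have eu : u = r u + (u - r u) by rewrite addrC subrK.
  rewrite {2}eu ipDr addr_ge0//; [exact: posT h1|rewrite ipC; exact: posT h2].
have DD : D * D = r * (1 - r).
  have p1 : psd (r * (1 - r)) by apply: psd_mul => //; rewrite mulrBl mulrBr mul1r mulr1.
  apply/eqP; rewrite -subr_eq0; apply/eqP.
  have sq : sa (D * D - r * (1 - r)) by apply: saB; [exact: (psd_sq sD).1|exact: p1.1].
  have z u : ip ((D * D - r * (1 - r)) u) u = 0 by rewrite subE ipBl mulE (sa_ip _ _ sD) -[ip (D u) _]/(nq (d u)) nd subrr.
  by apply: (@psd_eq0 _ _ dot); split=> [|u]; [exact: sq|rewrite z|exact: saN|rewrite oppE ipNl z oppr0].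
have rD : r * D = D * r.
  apply: bopE => u; rewrite !mulE !DE; have [h1 h2] := hd u; have [k1 k2] := hd (r u).
  have rdu : r (d u) = d (r u).
    have h := cddB lT h1 k1; have := (hsq (d (r u)) (d u - d (r u))).1.
    rewrite [d (r u) + _]addrC subrK => -> //; exists (r u - r (r u)); first exact: k2.
    exact: h.
  exact: rdu.
have p1 : psd (r * (1 - r)) by apply: psd_mul => //; rewrite mulrBl mulrBr mul1r mulr1.
have [pb bb cb] := bsqrtP p1.
have Db : D = bsqrt (r * (1 - r)).
  apply: (@sqrt_uniq _ _ dot) => //; last by rewrite DD bb.
  by apply: cb; rewrite -DD mulrA.
rewrite -Db.
have Tr u : T (r u, D u) by exact: (hd u).1.
have scr (n : nat) : r * sc dot r n%:R = sG dot r n%:R by exact: (sc_r pr).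
have key (n : nat) u : T (sG dot r n%:R u, D (sc dot r n%:R u)) by rewrite -scr mulE; exact: Tr.
have [_ _ _ cc] := scP pr (n0 R 0).
apply/seteqP; split=> -[u v] /=.
  move=> Tuv n; have [psc _ _ csc] := scP pr (n0 R n).
  have Gsa := (sG_proj pr n%:R).1.
  have DG : D * sG dot r n%:R = sG dot r n%:R * D by apply: (sG_comm pr).
  apply/eqP; rewrite -subr_eq0; apply/eqP/ri/(@ip_inj _ _ dot) => z; rewrite ip0r -(sa_ip _ _ pr.1).
  rewrite ipBr; apply/eqP; rewrite subr_eq0; apply/eqP.
  have := symT _ _ (Tr (sG dot r n%:R z)) Tuv => /= e1.
  rewrite -(sa_ip _ _ Gsa) -[sG _ _ _ (r z)]mulE -sG_r// mulE -e1 -(sa_ip _ _ sD) -(sa_ip _ _ psc.1).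
  have e : D * sG dot r n%:R = sc dot r n%:R * (D * r).
    by rewrite -rD mulrA DG; have [_ -> _ _] := scP pr (n0 R n).
  by rewrite -[d _]/(D (sG dot r n%:R z)) -!mulE e mulrA.
move=> hn; apply: ((closedP dot T).1 cT (fun n => (sG dot r n%:R u, sG dot r n%:R v))) => [n|].
  by rewrite hn; exact: key.
by split; exact: (sG1 pr ri).
Qed.

Lemma modulusP (x : set (H * H)) : cdd x ->
  positive dot (modulus dot x) /\ comp_graph (modulus dot x) (modulus dot x) = comp_graph (adj dot x) x.
Proof.
move=> hx; have [pr r1 ri _] := resP dot hx.
rewrite /modulus; case: xgetP => [T -> //|/(_ (sT dot (res dot x)))] h; exfalso; apply: h; split.
  exact: sT_positive.
apply/seteqP; split=> -[u v]; first by move=> /(sT_sq pr r1 ri) h; apply/(res_sq dot) => //; exact: h.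
by move=> /(res_sq dot) h; apply/(sT_sq pr r1 ri) => //; exact: h.
Qed.

(** The choices behind [modulus] and [spectral_projection] are settled here: distribution functions
    of operators become traces of 1 - [sG] for the resolvent. *)
Theorem spectral_projection_modulus (x : set (H * H)) s : cdd x -> 0 <= s ->
  spectral_projection dot (modulus dot x) `]s, +oo[%classic = bf (1 - sG dot (res dot x) s).
Proof.
move=> hx s0; have [pr r1 ri _] := resP dot hx; have [hT hTT] := modulusP hx.
have hsq u v : comp_graph (modulus dot x) (modulus dot x) (u, v) <-> u = res dot x (u + v).
  by rewrite hTT; exact: res_sq.
have eT : modulus dot x = sT dot (res dot x).
  rewrite (sqrt_graph pr r1 ri hT hsq) [RHS](@sqrt_graph (res dot x))//; first exact: sT_positive.
  by move=> u v; exact: sT_sq.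
have hP : spectral_measure dot (modulus dot x) (spectral_projection dot (modulus dot x)).
  rewrite /spectral_projection; case: xgetP => [P hP //|hno].
  by exfalso; apply: (hno _ _); rewrite /= eT; exact: (spec_exists pr r1 ri).
by move=> _; rewrite -(sp_sG pr ri hT hsq hP s0) (spE hP)//; exact: measurable_itv.
Qed.
End ModulusCut.

(** * Trace and measure topology *)

Record vna (R : realType) (H : completeNormedModType R[i]) (dot : hdot H) := Vna {
  vM : set (H -> H); vMP : von_neumann dot vM }.
Record tvna (R : realType) (H : completeNormedModType R[i]) (dot : hdot H) := Tvna {
  va :> vna dot; vtau : (H -> H) -> \bar R; vtP : nsf_trace dot (vM va) vtau }.

Section VonNeumann.
Variables (R : realType) (H : completeNormedModType R[i]) (dot : hdot H) (A : vna dot).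
Local Notation bop := (bop H).
Local Notation adjo := (adjo dot).
Local Notation sa := (sa dot).
Local Notation psd := (psd dot).
Local Notation ole := (ole dot).
Local Notation proj := (proj dot).
Local Notation slim := (slim dot).
Local Notation bsqrt := (bsqrt dot).
Local Notation kproj := (kproj dot).
Implicit Types (a b c e f g p : bop) (u v w : H).

Definition inM a : Prop := vM A (bf a).
Definition com c : Prop := forall b, inM b -> c * b = b * c.

Lemma vM_bop h : vM A h -> exists2 a : bop, bf a = h & inM a.
Proof.
move=> Mh; have [_ eM] := vMP A; have := Mh; rewrite -eM => -[bh _].
by exists (Bop bh).
Qed.
(** M is its own bicommutant by definition, so membership is a commutation test, and an operator
    built so as to commute with everything commuting with its data stays in M. *)
Lemma inMP a : inM a <-> forall c, com c -> a * c = c * a.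
Proof.
have [_ eM] := vMP A; split=> [Ma c hc|h]; first by rewrite hc.
rewrite /inM -eM; split=> [|c [bc hc]]; first exact: bfP.
have hc' : com (Bop bc) by move=> b Mb; apply: bopE => u; exact: esym (congr1 (@^~ u) (hc _ Mb)).
by apply/funext => u /=; have := congr1 (fun x : bop => x u) (h _ hc'); rewrite !mulE => /= ->.
Qed.
Lemma com_commutant c : com c -> commutant (vM A) c.
Proof.
move=> hc; split=> [|h /vM_bop[a <- Ma]]; first exact: bfP.
by apply/funext => u /=; have := congr1 (fun x : bop => x u) (hc a Ma); rewrite !mulE => /= ->.
Qed.
Lemma commutant_com h : commutant (vM A) h -> exists2 c : bop, bf c = h & com c.
Proof.
move=> [bh hc]; exists (Bop bh) => // b Mb; apply: bopE => u; rewrite !mulE.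
by have /(congr1 (@^~ u)) /= := hc _ Mb.
Qed.
Lemma inM_adj a : inM a -> inM (adjo a).
Proof.
move=> Ma; have [h _] := vMP A; have [b' Mb] := h _ Ma.
by have [b <- Mb'] := vM_bop Mb => /adjoint_pairP <-.
Qed.
Lemma com_adj c : com c -> com (adjo c).
Proof. by move=> hc b /inM_adj /hc /(congr1 adjo); rewrite !adjM adjK. Qed.

Lemma inM1 : inM 1. Proof. by apply/inMP => c _; rewrite mul1r mulr1. Qed.
Lemma inM0 : inM 0. Proof. by apply/inMP => c _; rewrite mul0r mulr0. Qed.
Lemma inMD a b : inM a -> inM b -> inM (a + b).
Proof. by move=> /inMP ha /inMP hb; apply/inMP => c hc; rewrite mulrDl mulrDr ha// hb. Qed.
Lemma inMN a : inM a -> inM (- a).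
Proof. by move=> /inMP ha; apply/inMP => c hc; rewrite mulNr mulrN ha. Qed.
Lemma inMB a b : inM a -> inM b -> inM (a - b).
Proof. by move=> ha hb; apply: inMD => //; exact: inMN. Qed.
Lemma inMM a b : inM a -> inM b -> inM (a * b).
Proof. by move=> /inMP ha /inMP hb; apply/inMP => c hc; rewrite -mulrA hb// mulrA ha// mulrA. Qed.
Lemma inMZ (k : R) a : inM a -> inM (k *: a).
Proof. by move=> /inMP ha; apply/inMP => c hc; rewrite scAl scAr ha. Qed.
Lemma inM_sum I (s : seq I) (P : pred I) (F : I -> bop) :
  (forall i, P i -> inM (F i)) -> inM (\sum_(i <- s | P i) F i).
Proof. by move=> h; apply: (big_ind inM) => //; [exact: inM0|exact: inMD]. Qed.
Lemma inM_slim (an : nat -> bop) a : slim an a -> (forall n, inM (an n)) -> inM a.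
Proof.
move=> h ha; apply/inMP => c hc; apply/esym; apply: (slim_comm h) => n.
exact: hc.
Qed.
Lemma inM_comm a b : inM a -> (forall x, x * a = a * x -> x * b = b * x) -> inM b.
Proof. by move=> Ma h; apply/inMP => c hc; rewrite h// hc. Qed.
Lemma inM_kproj a : sa a -> inM a -> inM (kproj a).
Proof. by move=> ha Ma; apply: (inM_comm Ma) => x; exact: kproj_comm. Qed.
Lemma inM_pp a : sa a -> inM a -> inM (pp dot a).
Proof. by move=> ha Ma; have [_ h _ _ _] := pp_spec ha; exact: inM_comm Ma h. Qed.
Lemma inM_bsqrt a : psd a -> inM a -> inM (bsqrt a).
Proof. by move=> ha Ma; have [_ _ h] := bsqrtP ha; exact: inM_comm Ma h. Qed.

(** The infimum of a sequence of projections, as the projection onto the common fixed vectors. *)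
Definition pmeets (f : nat -> bop) : bop := sproj dot [set u | forall n, f n u = u].
Lemma csub_fix (f : nat -> bop) : csub dot [set u | forall n, f n u = u].
Proof.
split=> [n|c u v hu hv n|un u h hu n] /=; first exact: bop0.
  by rewrite bop_lin hu hv.
apply: (scvg_unique (bop_scvg (f n) hu)).
by rewrite (_ : (fun n0 => _) = un)//; apply/funext => k; rewrite h.
Qed.
Lemma pmeets_proj (f : nat -> bop) : proj (pmeets f). Proof. exact: (sprojP (csub_fix f)).1. Qed.
Lemma pmeetsE (f : nat -> bop) u : (forall n, f n u = u) <-> pmeets f u = u.
Proof. exact: (sprojP (csub_fix f)).2. Qed.
Lemma inM_pmeets (f : nat -> bop) : (forall n, inM (f n)) -> inM (pmeets f).
Proof.
move=> h; apply/inMP => c hc; apply/esym.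
have hs x : com x -> forall u, pmeets f u = u -> pmeets f (x u) = x u.
  move=> hx u /pmeetsE hu; apply/pmeetsE => n.
  by rewrite -mulE -hx// mulE hu.
by apply: (proj_comm (pmeets_proj f)); apply: hs => //; exact: com_adj.
Qed.
Definition pmeet e f : bop := pmeets (fun n => if n is 0%N then e else f).
Lemma pmeet_proj e f : proj (pmeet e f). Proof. exact: pmeets_proj. Qed.
Lemma pmeetE e f u : (e u = u /\ f u = u) <-> pmeet e f u = u.
Proof.
split=> [[h1 h2]|/pmeetsE h]; first by apply/pmeetsE => -[|n].
by split; [exact: (h 0%N)|exact: (h 1%N)].
Qed.
Lemma inM_pmeet e f : inM e -> inM f -> inM (pmeet e f).
Proof. by move=> he hf; apply: inM_pmeets => -[|n]. Qed.
Lemma proj_ole_fix e f : proj e -> proj f -> (forall u, e u = u -> f u = u) -> ole e f.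
Proof.
move=> pe pf h; apply/(proj_oleP pe pf); apply: bopE => u; rewrite mulE; exact: h (proj_fix u pe).
Qed.

End VonNeumann.

(** * The trace and comparison of projections *)

Section Trace.
Variables (R : realType) (H : completeNormedModType R[i]) (dot : hdot H) (A : tvna dot).
Local Notation bop := (bop H).
Local Notation one := (1 : bop).
Local Notation ip := (rip dot).
Local Notation nq := (sqn dot).
Local Notation adjo := (adjo dot).
Local Notation psd := (psd dot).
Local Notation ole := (ole dot).
Local Notation proj := (proj dot).
Local Notation slim := (slim dot).
Local Notation bsqrt := (bsqrt dot).
Local Notation inM := (inM A).
Local Notation pmeets := (pmeets dot).
Local Notation pmeet := (pmeet dot).
Implicit Types (a b c e f g p : bop) (u v w : H).

Definition tr a : \bar R := vtau A (bf a).
Arguments tr a%_R.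
Lemma pos_coneP a : pos_cone dot (vM A) a <-> inM a /\ psd a.
Proof. by split=> -[h1 /op_ge0P h2]. Qed.
Lemma tr_ge0 a : inM a -> psd a -> (0 <= tr a)%E.
Proof. by move=> Ma pa; apply: (trace_ge0 (vtP A)); apply/pos_coneP. Qed.
Lemma trD a b : inM a -> psd a -> inM b -> psd b -> tr (a + b) = (tr a + tr b)%E.
Proof.
move=> Ma pa Mb pb; have /pos_coneP h1 := conj Ma pa; have /pos_coneP h2 := conj Mb pb.
rewrite /tr -(traceD (vtP A) h1 h2); congr vtau; apply/funext => u; exact: addE.
Qed.
Lemma trZ (k : R) a : 0 <= k -> inM a -> psd a -> tr (k *: a) = (k%:E * tr a)%E.
Proof.
move=> k0 Ma pa; have /pos_coneP h1 := conj Ma pa.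
by rewrite /tr -(traceZ (vtP A) k0 h1); congr vtau; apply/funext => u; exact: scaleE.
Qed.
Lemma tr0 : tr 0 = 0%E.
Proof. by rewrite -(scale0r one) trZ ?mul0e//; [exact: inM1|exact: psd1]. Qed.
Lemma tr_mono a b : inM a -> psd a -> inM b -> ole a b -> (tr a <= tr b)%E.
Proof.
move=> Ma pa Mb ab; rewrite -(subrK a b) addrC trD//; last exact: inMB.
by rewrite leeDl// tr_ge0//; exact: inMB.
Qed.
Lemma tr_comm a : inM a -> tr (adjo a * a) = tr (a * adjo a).
Proof.
move=> Ma; have h : adjoint_pair dot a (adjo a) by apply/adjoint_pairP.
have := trace_comm (vtP A) Ma (inM_adj Ma) h.
by rewrite /tr => e; apply: etrans (etrans _ e) _; congr vtau; apply/funext => u; rewrite ?mulE.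
Qed.
Lemma tr_faithful a : inM a -> psd a -> tr a = 0%E -> a = 0.
Proof.
move=> Ma pa h; have /pos_coneP h1 := conj Ma pa; have := trace_faithful (vtP A) h1 h => e.
by apply: bopE => u; rewrite e zeroE.
Qed.
Lemma tr_sum I (s : seq I) (P : pred I) (F : I -> bop) : (forall i, P i -> inM (F i) /\ psd (F i)) ->
  tr (\sum_(i <- s | P i) F i) = (\sum_(i <- s | P i) tr (F i))%E.
Proof.
move=> h; elim: s => [|x s IH]; first by rewrite !big_nil tr0.
rewrite !big_cons; case: ifPn => // Px; have [h1 h2] := h x Px; rewrite trD ?IH//.
  by apply: inM_sum => i /h[].
by apply: psd_sum => i /h[].
Qed.
Lemma op_leP a b : op_le dot a b <-> ole a b.
Proof.
rewrite /ole -op_ge0P; split=> h u; have := h u; rewrite -[hd dot (bf (b - a) u) u]/(hd dot ((b - a) u) u) subE linearBl /= subr_ge0 //.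
Qed.
(** Normality speaks of directed sets; the range of an increasing strongly convergent sequence is
    one, and its least upper bound is the strong limit. *)
Lemma increasing_slim (an : nat -> bop) a : slim an a -> (forall n, inM (an n)) -> (forall n, psd (an n)) ->
  (forall n, ole (an n) (an n.+1)) -> increasing_to dot (vM A) [set bf (an n) | n in setT] (bf a).
Proof.
move=> ha Ma pa inc; have hom := ole_homo inc; split.
- by exists (bf (an 0%N)); exists 0%N.
- by move=> _ [n _ <-]; apply/pos_coneP.
- move=> _ _ [m _ <-] [n _ <-]; exists (bf (an (maxn m n))); split; first by exists (maxn m n).
    by apply/op_leP; apply: hom; rewrite leq_maxl.
  by apply/op_leP; apply: hom; rewrite leq_maxr.
- split; first by apply/pos_coneP; split; [exact: inM_slim ha Ma|exact: slim_psd ha pa].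
    move=> _ [n _ <-]; apply/op_leP; apply: (slim_ole (N := n) ha) => m; exact: hom.
  move=> c [/vM_bop[c' <- Mc'] pc'] h; apply/op_leP; apply: (slim_ole_le ha) => n.
  by apply/op_leP; apply: h; exists n.
Qed.
Lemma tr_sup (an : nat -> bop) a (c : \bar R) : slim an a -> (forall n, inM (an n)) -> (forall n, psd (an n)) ->
  (forall n, ole (an n) (an n.+1)) -> (forall n, (tr (an n) <= c)%E) -> (tr a <= c)%E.
Proof.
move=> ha Ma pa inc hc; rewrite /tr (trace_normal (vtP A) (increasing_slim ha Ma pa inc)).
by apply: ub_ereal_sup => _ [_ [n _ <-] <-]; exact: hc.
Qed.
Lemma tr_sup_lt (an : nat -> bop) a (c : \bar R) : slim an a -> (forall n, inM (an n)) -> (forall n, psd (an n)) ->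
  (forall n, ole (an n) (an n.+1)) -> (c < tr a)%E -> exists n, (c < tr (an n))%E.
Proof.
move=> ha Ma pa inc ca; apply: contrapT => h; move: ca; rewrite ltNge => /negP; apply.
apply: (tr_sup ha Ma pa inc) => n; rewrite leNgt; apply/negP => h2; apply: h; by exists n.
Qed.
(** Normality concerns increasing families, so it is applied to e_0 - e_n; the finite trace of e_0
    allows the subtraction. *)
Lemma tr_dec0 (en : nat -> bop) (t : R) : slim en 0 -> (forall n, inM (en n)) -> (forall n, psd (en n)) ->
  (forall n, ole (en n.+1) (en n)) -> (tr (en 0%N) < +oo)%E -> 0 < t -> exists n, (tr (en n) <= t%:E)%E.
Proof.
move=> h0 Me pe dec fin t0.
have hom n : ole (en n) (en 0%N).
  elim: n => [|n IH]; first by rewrite /ole subrr; exact: psd0.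
  exact: ole_trans (dec n) IH.
pose d n := en 0%N - en n.
have Md n : inM (d n) by exact: inMB.
have ld : slim d (en 0%N).
  by have := slimB (slim_cst dot (en 0%N)) h0; rewrite subr0.
have incd n : ole (d n) (d n.+1).
  have e : d n.+1 - d n = en n - en n.+1 by rewrite /d opprB [LHS]addrC addrA subrK.
  rewrite /ole e; exact: dec.
have e n : tr (en 0%N) = (tr (d n) + tr (en n))%E.
  rewrite -trD//; [by rewrite /d subrK|exact: hom].
have fin0 : (0 <= tr (en 0%N))%E by exact: tr_ge0.
have fi : tr (en 0%N) \is a fin_num by rewrite ge0_fin_numE.
have [|n hn] := @tr_sup_lt d (en 0%N) (tr (en 0%N) - t%:E)%E ld Md hom incd.
  by rewrite -(fineK fi) -EFinB lte_fin ltrBlDr ltrDl.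
exists n; move: hn (e n) fi; have := tr_ge0 (Me n) (pe n); have := tr_ge0 (Md n) (hom n).
move: (tr (en 0%N)) (tr (d n)) (tr (en n)) => [x| |] [y| |] [z| |]//=.
rewrite !lee_fin -EFinB lte_fin => _ _ h [e0] _; rewrite e0 in h; lra.
Qed.

(** All operators commute, and the difference is (t - s) b (b + s)^-1 (b + t)^-1. *)
Lemma res_dec (b i j : bop) (s t : R) : psd b -> psd i -> psd j -> 0 < s -> s <= t ->
  i * (b + s *: one) = 1 -> (b + s *: one) * i = 1 -> j * (b + t *: one) = 1 -> (b + t *: one) * j = 1 ->
  ole (s *: i) (t *: j).
Proof.
move=> pb pi pj s0 st i1 i2 j1 j2.
have ib : i * b = b * i.
  have : i * (b + s *: one) = (b + s *: one) * i by rewrite i1.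
  by rewrite mulrDr mulrDl scAr scAl mulr1 mul1r => /addIr.
have jb : j * b = b * j.
  have : j * (b + t *: one) = (b + t *: one) * j by rewrite j1.
  by rewrite mulrDr mulrDl scAr scAl mulr1 mul1r => /addIr.
have ij : i * j = j * i.
  have jc : j * (b + s *: one) = (b + s *: one) * j by rewrite mulrDr mulrDl scAr scAl mulr1 mul1r jb.
  by rewrite -[i * j]mulr1 -i2 -!mulrA (mulrA j) jc mulrA (mulrA i) i1 mul1r.
have -> : s *: i = s *: (i * (j * (b + t *: one))) by rewrite j1 mulr1.
have -> : t *: j = t *: (i * (b + s *: one) * j) by rewrite i1 mul1r.
have -> : i * (b + s *: one) * j = i * j * (b + s *: one).
  by rewrite !(mulrDr, mulrDl) !scAr !scAl !mulr1 -!mulrA jb.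
rewrite /ole mulrA !mulrDr !scAr !mulr1 !scalerDr !scalerA [t * s]mulrC opprD addrACA subrr addr0 -scalerBl.
apply: psdZ; first by rewrite subr_ge0.
by apply: psd_mul => //; [exact: psd_mul|rewrite -mulrA jb !mulrA ib].
Qed.

(* The range projection of a is the increasing limit of a a* (a a* + s)^-1, as
   s decreases to 0, whose trace is that of a* a (a* a + s)^-1 <= p. *)
Lemma tr_range a p f : inM a -> inM p -> proj p -> a * p = a -> inM f -> proj f ->
  (forall u, adjo a u = 0 -> f u = 0) -> (tr f <= tr p)%E.
Proof.
move=> Ma Mp pp_ ap Mf pf hf; pose b := a * adjo a.
have Mb : inM b by apply: inMM => //; exact: inM_adj.
have pb : psd b by rewrite /b -{1}(adjK dot a); exact: psd_adjM.
have inv (c : bop) n : psd c -> exists i, [/\ psd i, i * (c + n.+1%:R^-1 *: one) = 1, (c + n.+1%:R^-1 *: one) * i = 1,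
    forall x, x * (c + n.+1%:R^-1 *: one) = (c + n.+1%:R^-1 *: one) * x -> x * i = i * x & ole i ((n.+1%:R^-1)^-1 *: one)].
  move=> pc; apply: inv_ex; last by rewrite /ole addrK.
    by apply: psdD => //; apply: psdZ => //; exact: psd1.
  by rewrite invr_gt0.
have [i hi] := choice (fun n => inv b n pb).
have cshift (c x : bop) (s : R) : x * c = c * x -> x * (c + s *: one) = (c + s *: one) * x.
  by move=> h; rewrite mulrDr mulrDl scAr scAl mulr1 mul1r h.
pose y n := n.+1%:R^-1 *: i n.
have yE n : 1 - y n = i n * b.
  have [_ h _ _ _] := hi n; rewrite /y -{1}h mulrDr scAr mulr1 addrK //.
have ib n : i n * b = b * i n.
  by have [_ _ _ h _] := hi n; apply/esym/h; apply: cshift.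
have py n : psd (y n) by have [h _ _ _ _] := hi n; apply: psdZ.
have y1 n : ole (y n) (1 *: one).
  by rewrite scale1r /ole yE; apply: psd_mul => //; have [] := hi n.
have ydec n : ole (y n.+1) (y n).
  have [h1 h2 h3 _ _] := hi n; have [k1 k2 k3 _ _] := hi n.+1.
  by apply: (res_dec pb) => //; rewrite lef_pV2 ?posrE// ler_nat.
have [e [ye pe _]] := slim_mono_dec ler01 py ydec y1.
have [K K0 bK] := nbP dot b.
have by0 : slim (fun n => b * y n) 0.
  move=> u; rewrite zeroE /sconv.
  apply: (@squeeze0 _ _ (fun n => n.+1%:R^-1 * nq u)) => [n|]; last first.
    by rewrite -(mul0r (nq u)); apply: cvgMl; exact: cvg_harmonic.
  rewrite subr0 nq_ge0 andTb.
  have [h1 h2 h3 _ _] := hi n; have s1 : (0 : R) < n.+1%:R^-1 by rewrite invr_gt0.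
  have -> : (b * y n) u = n.+1%:R^-1%:C *: ((1 - y n) u) by rewrite yE ib /y scAr scaleE.
  rewrite nqZ expr2 -mulrA (ler_wpM2l (ltW s1))//.
  have : nq ((1 - y n) u) <= nq u.
    have := @psd_nb _ _ dot 1 (1 - y n) ler01; rewrite expr1n => h.
    rewrite -[nq u]mul1r; apply: h; first by rewrite yE; apply: psd_mul => //.
    by rewrite scale1r /ole opprB addrC subrK.
  have s2 : n.+1%:R^-1 <= 1 :> R by rewrite invf_le1// ler1n.
  move=> h; have := ler_pM (ltW s1) (nq_ge0 dot ((1 - y n) u)) s2 h; rewrite mul1r //.
have be0 : b * e = 0 by apply: (slim_unique (slimMl b ye)).
have Mi n : inM (i n).
  have [_ _ _ h _] := hi n; apply: inM_comm Mb _ => x xb; apply: h; exact: cshift.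
have fe : f * e = 0.
  apply: bopE => u; rewrite mulE zeroE; apply: hf.
  have : b (e u) = 0 by rewrite -mulE be0 zeroE.
  move=> h; apply: (@nq_eq0 _ _ dot); by rewrite /sqn -adjPr -[a (adjo a _)]mulE -/b h ip0r.
have l1 : slim (fun n => 1 - y n) (1 - e) by apply: slimB => //; exact: slim_cst.
have fle : ole f (1 - e).
  have pe1 : psd (1 - e) by apply: (slim_psd l1) => n; have := y1 n; rewrite scale1r.
  have ef : e * f = 0 by have := congr1 adjo fe; rewrite adjM adj0 pf.1 pe.1.
  apply: oleP => [||u]; [exact: pf.1|exact: pe1.1|].
  have -> : ip (f u) u = ip ((1 - e) (f u)) (f u).
    by rewrite subE oneE -[e (f u)]mulE ef zeroE subr0 -[RHS](sa_ip _ _ pf.1) (proj_fix u pf).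
  have -> : ip ((1 - e) (f u)) (f u) = ip ((f * (1 - e) * f) u) u.
    by rewrite !mulE (sa_ip _ _ pf.1).
  have -> : f * (1 - e) * f = (1 - e) * f by rewrite mulrBr mulr1 fe subr0 mulrBl mul1r ef subr0 pf.2.
  have -> : (1 - e) * f = f by rewrite mulrBl mul1r ef subr0.
  have h : f * (1 - e) = (1 - e) * f by rewrite mulrBr mulr1 fe mulrBl mul1r ef.
  rewrite -subr_ge0 -ipBl -subE; suff : psd ((1 - e) * (1 - f)).
    by move=> [_ /(_ u)]; rewrite mulrBr mulr1 mulrBl mul1r ef subr0.
  by apply: psd_mul => //; [exact/proj_psd/projC|rewrite mulrBr mulr1 -h mulrBl mul1r].
apply: (@le_trans _ _ (tr (1 - e))).
  apply: tr_mono => //; first exact: proj_psd.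
  by apply: (inM_slim l1) => n; rewrite yE; exact: inMM.
apply: (tr_sup l1) => n.
- by rewrite yE; exact: inMM.
- by have := y1 n; rewrite scale1r.
- by rewrite /ole opprB addrC addrA subrK; exact: ydec.
pose c := adjo a * a; have pc : psd c by exact: psd_adjM.
have Mc : inM c by apply: inMM => //; exact: inM_adj.
have [j [pj j1 j2 jc _]] := inv c n pc; have [pi_ i1 i2 _ _] := hi n.
have Mj : inM j by apply: (inM_comm Mc) => x xc; apply: jc; exact: cshift.
have [ps ss cs] := bsqrtP pj; set s := bsqrt j in ps ss cs.
have Ms : inM s by exact: inM_bsqrt.
have cj : c * j = j * c by apply: jc; exact: cshift.
have aj : a * j = i n * a.
  rewrite -[a * j]mul1r -i1 -mulrA [(_ + _) * (a * j)]mulrA mulrDl scAl mul1r /b -mulrA -/c.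
  have -> : a * c + n.+1%:R^-1 *: a = a * (c + n.+1%:R^-1 *: one) by rewrite mulrDr scAr mulr1.
  by rewrite -mulrA j2 mulr1.
(* With s the root of j = (c + 1 / (n + 1))^-1 and a j = i a, the operator 1 - y n is a product that
   the trace property turns into c j, which lives under p. *)
have e1 : 1 - y n = (a * s) * adjo (a * s).
  by rewrite yE adjM ps.1 -!mulrA (mulrA s) ss mulrA aj mulrA.
have e2 : adjo (a * s) * (a * s) = c * j.
  have -> : adjo (a * s) * (a * s) = s * c * s by rewrite adjM ps.1 /c !mulrA.
  by rewrite -(cs c cj) -[LHS]mulrA ss.
rewrite e1 -tr_comm ?e2; last exact: inMM.
have jcp : j * c * p = j * c by rewrite -mulrA /c -mulrA ap.
have pcj : psd (c * j) by apply: psd_mul.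
have cjp : p * (c * j) * p = c * j.
  have h1 : c * j * p = c * j by rewrite cj jcp.
  have h2 := congr1 adjo h1; rewrite adjM pp_.1 pcj.1 in h2.
  by rewrite h2 h1.
apply: tr_mono => //; first exact: inMM.
have -> : p = p * 1 * p by rewrite mulr1 pp_.2.
rewrite -cjp; apply: (ole_conjsa pp_.1).
rewrite /ole -{1}j2 mulrDl scAl mul1r addrAC subrr add0r; exact: psdZ.
Qed.

(** The adjoint of g (1 - e) kills only vectors v with g v in the range of e, hence with g v = 0. So
    the range projection of g (1 - e) is g, while the operator itself is supported under 1 - e. *)
Lemma tr_meet0 e g : inM e -> proj e -> inM g -> proj g -> (forall u, e u = u -> g u = u -> u = 0) ->
  (tr g <= tr (1 - e))%E.
Proof.
move=> Me pe Mg pg h; have pe' := projC pe; have Me' : inM (1 - e) by apply: inMB => //; exact: inM1.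
apply: (@tr_range (g * (1 - e))) => //; [exact: inMM|by rewrite -mulrA pe'.2|move=> u].
rewrite adjM pg.1 pe'.1 mulE subE oneE => /eqP; rewrite subr_eq0 => /eqP hu.
exact: h (esym hu) (proj_fix u pg).
Qed.
(** The ranges of f and of e minus the meet intersect in 0, so [tr_meet0] bounds the trace of that
    difference by the trace of 1 - f. *)
Lemma tr_pmeet e f : inM e -> proj e -> inM f -> proj f ->
  (tr (1 - pmeet e f) <= tr (1 - e) + tr (1 - f))%E.
Proof.
move=> Me pe Mf pf; have pm := pmeet_proj dot e f; have Mm := inM_pmeet Me Mf.
have me : ole (pmeet e f) e by apply: proj_ole_fix => // u /pmeetE[].
have pem := proj_oleB pm pe me.
have -> : 1 - pmeet e f = (1 - e) + (e - pmeet e f) by rewrite addrA subrK.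
have M1 := inM1; rewrite trD; [|exact: inMB|exact/proj_psd/projC|exact: inMB|exact: proj_psd].
rewrite leeD2l//; apply: tr_meet0 => //; first exact: inMB.
move=> u fu emu; have eu : e u = u.
  rewrite -emu -mulE mulrBr pe.2; move/proj_oleP: me => -> //.
have mu : pmeet e f u = u by apply/pmeetE.
by rewrite -emu subE eu mu subrr.
Qed.
Lemma tr_proj0 (g : bop) : inM g -> proj g -> (forall t : R, 0 < t -> (tr g <= t%:E)%E) -> g = 0.
Proof.
move=> Mg pg h; have g0 := tr_ge0 Mg (proj_psd pg); apply: tr_faithful => //; first exact: proj_psd.
apply/eqP; rewrite eq_le g0 andbT; apply/lee_addgt0Pr => t t0; rewrite add0e; exact: h.
Qed.
(** The meet of the complements has arbitrarily small trace, so it vanishes by faithfulness. This is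
    the tool for showing that closures of graphs are univalent and domains dense. *)
Lemma good_sep (f : nat -> bop) (u : H) : (forall n, inM (f n)) -> (forall n, proj (f n)) ->
  (forall t : R, 0 < t -> exists n, (tr (1 - f n) <= t%:E)%E) -> (forall n, f n u = 0) -> u = 0.
Proof.
move=> Mf pf h fu; pose g := pmeets (fun n => 1 - f n).
have Mg : inM g by apply: inM_pmeets => n; apply: inMB => //; exact: inM1.
have pg : proj g by exact: pmeets_proj.
have g0 : g = 0.
  apply: tr_proj0 => // t t0; have [n hn] := h t t0; apply: le_trans hn.
  apply: tr_mono => //; [exact: proj_psd|apply: inMB => //; exact: inM1|].
  by apply: proj_ole_fix => //; [exact: projC|move=> v /pmeetsE].
by have : g u = u; [apply/pmeetsE => n; rewrite subE oneE fu subr0|rewrite g0 zeroE].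
Qed.
End Trace.
Arguments tr {R H dot} A a%_R.

(** * The measure topology *)

Section Near.
Variables (R : realType) (H : completeNormedModType R[i]) (dot : hdot H) (A : tvna dot).
Local Notation bop := (bop H).
Local Notation one := (1 : bop).
Local Notation ip := (rip dot).
Local Notation nq := (sqn dot).
Local Notation scvg := (sconv dot).
Local Notation adjo := (adjo dot).
Local Notation psd := (psd dot).
Local Notation ole := (ole dot).
Local Notation proj := (proj dot).
Local Notation slim := (slim dot).
Local Notation bsqrt := (bsqrt dot).
Local Notation kproj := (kproj dot).
Local Notation inM := (inM A).
Local Notation tr := (tr A).
Local Notation sadd := (@strong_add R H).
Local Notation ssb := (@strong_sub R H).
Local Notation mu := (op_mu dot (vtau A)).
Local Notation od := (op_dist dot (vtau A)).
Local Notation tmeas := (tau_measurable dot (vM A) (vtau A)).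
Local Notation aff := (affiliated (vM A)).
Implicit Types (a b c e f g : bop) (u v w : H) (x y z : set (H * H)) (s t k : R).

Lemma nq_add_le u v (k l q : R) : 0 <= k -> 0 <= l -> 0 <= q -> nq u <= k ^+ 2 * q -> nq v <= l ^+ 2 * q ->
  nq (u + v) <= (k + l) ^+ 2 * q.
Proof.
move=> k0 l0 q0 h1 h2; pose r := Num.sqrt q; have r0 : 0 <= r by exact: sqrtr_ge0.
have rq : r ^+ 2 = q by rewrite sqr_sqrtr.
have := @CS_le _ _ dot u v (k * r) (l * r); rewrite !exprMn rq !mulr_ge0// => /(_ isT isT h1 h2).
rewrite ler_norml => /andP[_ h3]; rewrite nqD.
have -> : (k + l) ^+ 2 * q = k ^+ 2 * q + 2 * (k * r * (l * r)) + l ^+ 2 * q by rewrite -rq; ring.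
lra.
Qed.

(* x is within k of a on the range of a projection e in M with trace (1 - e) <= t;
   these are the entourages of the measure topology. *)
Definition near x a k t : Prop := exists e, [/\ inM e, proj e, (tr (1 - e) <= t%:E)%E &
  forall u, e u = u -> exists2 w, x (u, w) & nq (w - a u) <= k ^+ 2 * nq u].
Definition nearb a b k t : Prop := near (graph a) b k t.
Lemma nearbP a b k t : nearb a b k t <-> exists e, [/\ inM e, proj e, (tr (1 - e) <= t%:E)%E &
  forall u, e u = u -> nq (a u - b u) <= k ^+ 2 * nq u].
Proof.
split=> -[e [h1 h2 h3 h4]]; exists e; split=> // u /h4; first by move=> [w]; rewrite /graph /= => ->.
by move=> h; exists (a u).
Qed.
Lemma near_mono x a k k' t t' : 0 <= k -> k <= k' -> t <= t' -> near x a k t -> near x a k' t'.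
Proof.
move=> k0 kk tt [e [h1 h2 h3 h4]]; exists e; split=> // [|u /h4[w xw hw]].
  by apply: le_trans h3 _; rewrite lee_fin.
exists w => //; apply: le_trans hw _; apply: ler_wpM2r; first exact: nq_ge0.
by rewrite ler_pXn2r ?nnegrE// (le_trans k0).
Qed.
Lemma near_meet x y a b k l s t : near x a k s -> near y b l t -> exists e,
  [/\ inM e, proj e, (tr (1 - e) <= (s + t)%:E)%E & forall u, e u = u ->
   (exists2 w, x (u, w) & nq (w - a u) <= k ^+ 2 * nq u) /\ exists2 w, y (u, w) & nq (w - b u) <= l ^+ 2 * nq u].
Proof.
move=> [e [e1 e2 e3 e4]] [f [f1 f2 f3 f4]]; exists (pmeet dot e f); split.
- exact: inM_pmeet.
- exact: pmeet_proj.
- by apply: le_trans (tr_pmeet _ _ _ _) _ => //; rewrite EFinD; exact: leeD.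
- by move=> u /pmeetE[/e4 h1 /f4 h2].
Qed.
Lemma near_add x y a b k l s t : 0 <= k -> 0 <= l -> near x a k s -> near y b l t ->
  near (sadd x y) (a + b) (k + l) (s + t).
Proof.
move=> k0 l0 hx hy; have [e [h1 h2 h3 h4]] := near_meet hx hy; exists e; split=> // u /h4[[w xw hw] [v yv hv]].
exists (w + v); first by apply: subset_closure; exists w, v.
rewrite addE opprD addrACA; apply: nq_add_le => //; exact: nq_ge0.
Qed.
Lemma near_opp x a k t : near x a k t -> near [set p | x (p.1, - p.2)] (- a) k t.
Proof.
move=> [e [h1 h2 h3 h4]]; exists e; split=> // u /h4[w xw hw]; exists (- w); first by rewrite /= opprK.
by rewrite oppE -opprD nqN.
Qed.
Lemma near_sub x y a b k l s t : 0 <= k -> 0 <= l -> near x a k s -> near y b l t ->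
  near (ssb x y) (a - b) (k + l) (s + t).
Proof. by move=> k0 l0 hx hy; apply: near_add => //; exact: near_opp. Qed.
Lemma near_tri x a b k l s t : 0 <= k -> 0 <= l -> near x a k s -> nearb a b l t -> near x b (k + l) (s + t).
Proof.
move=> k0 l0 hx hy; have [e [h1 h2 h3 h4]] := near_meet hx hy; exists e; split=> // u /h4[[w xw hw] [v yv hv]].
exists w => //; rewrite -[w - _](subrKA (a u)); apply: nq_add_le => //; first exact: nq_ge0.
by rewrite -yv.
Qed.
Lemma near_near x y a b k l s t : 0 <= k -> 0 <= l -> near x a k s -> near x b l t -> linear_graph x -> nearb a b (k + l) (s + t).
Proof.
move=> k0 l0 hx hy lx; have [e [h1 h2 h3 h4]] := near_meet hx hy; exists e; split=> // u /h4[[w xw hw] [v yv hv]].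
exists (a u) => //; rewrite -(graph_uniq lx xw yv) in hv.
rewrite -[a u - _](subrKA w); apply: nq_add_le => //; [exact: nq_ge0|by rewrite nqBC].
Qed.
Lemma near_refl a : 0%E = tr (1 - 1) -> nearb a a 0 0.
Proof.
move=> h; exists 1; split; [exact: inM1|exact: proj1|by rewrite -h|].
by move=> u _; exists (a u) => //; rewrite subrr nq0 expr2 !mul0r.
Qed.
Lemma nearb_norm a b k t : 0 <= t -> (forall u, nq (a u - b u) <= k ^+ 2 * nq u) -> nearb a b k t.
Proof.
move=> t0 h; exists 1; split; [exact: inM1|exact: proj1|by rewrite subrr tr0 lee_fin|].
by move=> u _; exists (a u).
Qed.

Lemma affP x : aff x <-> forall c, com A c -> forall p, x p -> x (c p.1, c p.2).
Proof.
split=> h c hc p xp; first exact: (h _ (com_commutant hc)).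
by have [c' <- hc'] := commutant_com hc; exact: h.
Qed.

Section Cut.
Variable x : set (H * H).
Hypotheses (cx : cdd x) (ax : aff x).
Local Notation r := (res dot x).
Let pr : psd r. Proof. by have [] := resP dot cx. Qed.
Let r1 : ole r 1. Proof. by have [] := resP dot cx. Qed.
Let ri u : r u = 0 -> u = 0. Proof. by have [_ _ h _ _] := resP dot cx; exact: h. Qed.
Let lx : linear_graph x. Proof. by have [] := cx. Qed.
Local Notation G := (sG dot r).
Lemma inM_res : inM r.
Proof.
apply/inMP => c hc; apply/esym; apply: res_comm => //; first exact: (affP x).1.
by apply: (affP x).1 => //; exact: com_adj.
Qed.
Lemma inM_sG t : inM (G t).
Proof. by apply: (inM_comm inM_res) => y; exact: (sG_comm pr). Qed.
Lemma inM_sc t : 0 <= t -> inM (sc dot r t).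
Proof. by move=> t0; have [_ _ _ h] := scP pr t0; apply: (inM_comm inM_res). Qed.
Lemma opdistE s : 0 <= s -> od x s = tr (1 - G s).
Proof. by move=> s0; rewrite /op_dist spectral_projection_modulus. Qed.

(** x r is everywhere defined and contractive, since |x r u|^2 = <r u, u - r u>; all bounded cuts of
    x are built from it. *)
Lemma xres_ex : exists d, inM d /\ forall u, x (r u, d u) /\ adj dot x (d u, u - r u).
Proof.
have [_ _ _ h _] := resP dot cx; have [d hd] := choice h.
have ld : linear d.
  move=> c u v; apply: (graph_uniq lx (hd _).1); rewrite bop_lin.
  by have [_ hl _] := lx; exact: (hl c _ _ (hd u).1 (hd v).1).
have adjx p q : x p -> adj dot x q -> ip p.2 q.1 = ip p.1 q.2.
  by move=> xp aq; exact: (adj_ipP dot _ lx).2 aq _ xp.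
have bd u : nq (d u) <= 1 * nq u.
  have [h1 h2] := hd u; rewrite /sqn (adjx _ _ h1 h2) /= ipBr mul1r.
  have := CS2 dot (r u) u ltr01; rewrite invr1 !mul1r; change (ip (r u) (r u)) with (nq (r u)).
  change (ip u u) with (nq u); have := nq_ge0 dot (r u); have := nq_ge0 dot u; lra.
pose D := mkbop ld bd; exists D; split; last exact: hd.
apply/inMP => c hc; apply: bopE => u; rewrite !mulE.
have [h1 _] := hd u; have [h2 _] := hd (c u).
have rc : r (c u) = c (r u).
  by have /inMP /(_ c hc) := inM_res => /(congr1 (fun z : bop => z u)); rewrite !mulE.
rewrite rc in h2; apply: (graph_uniq lx h2); exact: (affP x).1 ax c hc _ h1.
Qed.
Definition xd : bop := xget (0 : bop) [set d : bop | inM d /\ forall u, x (r u, d u) /\ adj dot x (d u, u - r u)].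
Lemma xdP : inM xd /\ forall u, x (r u, xd u) /\ adj dot x (xd u, u - r u).
Proof. by rewrite /xd; case: xgetP => [d -> //|h]; have [d hd] := xres_ex; have := h d hd. Qed.
Lemma adjx p q : x p -> adj dot x q -> ip p.2 q.1 = ip p.1 q.2.
Proof. by move=> xp aq; exact: (adj_ipP dot _ lx).2 aq _ xp. Qed.

(* xc t is the bounded operator x (sG t). *)
Definition xc t : bop := xd * sc dot r t.

Lemma xcP t u : 0 <= t -> x (G t u, xc t u) /\ adj dot x (xc t u, sb dot r t u).
Proof.
move=> t0; have [_ h] := xdP; have := h (sc dot r t u).
by rewrite -[r (sc _ _ _ _)]mulE sc_r// /xc mulE /sb subE.
Qed.
Lemma xc_nq t u : 0 <= t -> nq (xc t u) = ip (sb dot r t u) u.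
Proof.
move=> t0; have [h1 h2] := xcP u t0; rewrite /sqn (adjx h1 h2) /=.
change (ip (G t u) (sb dot r t u) = ip (sb dot r t u) u).
rewrite (sa_ip _ _ (sG_proj pr t).1) -mulE ipC; congr (ip (bf _ u) u).
by rewrite /sb mulrBr sc_sG// (sG_proj pr t).2.
Qed.
Lemma sb_upper t u : 0 <= t -> ip (sb dot r t u) u <= t ^+ 2 * nq (G t u).
Proof.
move=> t0; have [psc scr scG csc] := scP pr t0.
have [pb bb cb] := bsqrtP psc; set h := bsqrt (sc dot r t) u.
have Gh : G t h = h.
  rewrite /h -mulE; congr (bf _ u).
  have cG : G t * sc dot r t = sc dot r t * G t by rewrite sG_sc.
  have z : psd ((1 - G t) * bsqrt (sc dot r t)).
    apply: psd_mul => //; first exact: (proj_psd (projC (sG_proj pr t))).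
    by rewrite mulrBl mulrBr mul1r mulr1 (cb _ cG).
  suff : (1 - G t) * bsqrt (sc dot r t) = 0 by rewrite mulrBl mul1r => /eqP; rewrite subr_eq0 => /eqP.
  apply: (@sa_sq0 _ _ dot); first exact: z.1.
  have k : (1 - G t) * bsqrt (sc dot r t) = bsqrt (sc dot r t) * (1 - G t).
    by rewrite mulrBl mulrBr mul1r mulr1 (cb _ cG).
  by rewrite {2}k mulrA -(mulrA (1 - G t)) bb mulrBl mul1r cG scG subrr mul0r.
have := sG_lo pr t0 Gh.
have -> : nq h = ip (sc dot r t u) u by rewrite /h /sqn (sa_ip _ _ pb.1) -mulE bb ipC.
have rb : r * bsqrt (sc dot r t) = bsqrt (sc dot r t) * r.
  by apply: cb; rewrite sc_r// scr.
have -> : ip (r h) h = nq (G t u).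
  by rewrite /h -mulE rb mulE (sa_ip _ _ pb.1) -!mulE bb (sa_ip _ _ pr.1) -mulE sc_r// ipC proj_ip//; exact: (sG_proj pr).
move=> hle; rewrite /sb subE ipBl (proj_ip u (sG_proj pr t)).
have : ip (sc dot r t u) u <= (phi t)^-1 * nq (G t u) by rewrite ler_pdivlMl ?phi_gt0.
by rewrite phiV mulrDl mul1r; lra.
Qed.
Lemma xc_upper t u : 0 <= t -> nq (xc t u) <= t ^+ 2 * nq (G t u).
Proof. by move=> t0; rewrite xc_nq//; exact: sb_upper. Qed.
Lemma sb_lower s (n : nat) u : 0 <= s -> G s u = 0 -> s ^+ 2 * nq (G n%:R u) <= ip (sb dot r n%:R u) u.
Proof.
move=> s0 Gu; have n0 := n0 R n; have [psc scr scG csc] := scP pr n0.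
have [pb bb cb] := bsqrtP psc; set h := bsqrt (sc dot r n%:R) u.
have cG : G s * sc dot r n%:R = sc dot r n%:R * G s by rewrite sG_sc.
have Gh : G s h = 0 by rewrite /h -mulE (cb _ cG) mulE Gu bop0.
have := sG_hi pr s0 Gh.
have -> : nq h = ip (sc dot r n%:R u) u by rewrite /h /sqn (sa_ip _ _ pb.1) -mulE bb ipC.
have rb : r * bsqrt (sc dot r n%:R) = bsqrt (sc dot r n%:R) * r.
  by apply: cb; rewrite sc_r// scr.
have -> : ip (r h) h = nq (G n%:R u).
  by rewrite /h -mulE rb mulE (sa_ip _ _ pb.1) -!mulE bb (sa_ip _ _ pr.1) -mulE sc_r// ipC proj_ip//; exact: (sG_proj pr).
move=> hle; rewrite /sb subE ipBl (proj_ip u (sG_proj pr n%:R)).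
rewrite lerBrDr -{2}[nq (G n%:R u)]mul1r -mulrDl addrC -phiV mulrC ler_pdivrMr ?phi_gt0// mulrC.
exact: hle.
Qed.
Lemma sb_le_nq u w t : 0 <= t -> x (u, w) -> ip (sb dot r t u) u <= nq w.
Proof.
move=> t0 xuw; have [h1 h2] := xcP u t0; have := adjx xuw h2 => /= e.
have := CS dot w (xc t u); rewrite e xc_nq// (ipC dot u); set q := ip _ _ => h.
have q0 : 0 <= q by exact: (sb_psd pr r1 t0).2.
have [->|nz] := eqVneq q 0; first exact: nq_ge0.
by move: h; rewrite expr2 ler_pM2r// lt_def nz.
Qed.
Lemma xc_dist t u w : 0 <= t -> x (u, w) -> nq (w - xc t u) = nq w - ip (sb dot r t u) u.
Proof.
move=> t0 xuw; have [h1 h2] := xcP u t0; have := adjx xuw h2 => /= e.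
by rewrite nqB e xc_nq// (ipC dot u); lra.
Qed.
(** The cuts recover x on its whole domain: their squared distances are increments of the bounded
    increasing forms of [sb n], and closedness identifies the limit. *)
Lemma xc_cvg u w : x (u, w) -> scvg (fun n : nat => xc n%:R u) w.
Proof.
move=> xuw; pose q (n : nat) := ip (sb dot r n%:R u) u.
have qm n : q n <= q n.+1 by apply: ole_ip; apply: (sb_ole pr r1); rewrite ?ler_nat ?ler0n.
have qb n : q n <= nq w by apply: sb_le_nq.
have [|y hy] := @scauchy _ _ dot (fun n : nat => xc n%:R u).
  move=> e /(mono_cauchy qm qb)[N hN]; exists N => m n Nm Nn.
  have key i j : (i <= j)%N -> nq (xc j%:R u - xc i%:R u) = q j - q i.
    move=> ij; have ijR : i%:R <= j%:R :> R by rewrite ler_nat.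
    have := xc_dist (n0 R i) (xcP u (n0 R j)).1; rewrite xc_nq; last exact: n0.
    have bG : sb dot r i%:R * G j%:R = sb dot r i%:R.
      have := sb_mono pr (n0 R i) (lexx i%:R) => /(congr1 (fun c : bop => c * G j%:R)).
      by rewrite -mulrA (sG_mulC pr ijR) => <-; exact: (sb_mono pr (n0 R i) (lexx i%:R)).
    have -> : ip (sb dot r i%:R (G j%:R u)) (G j%:R u) = q i.
      rewrite -mulE bG; have := (sb_psd pr r1 (n0 R i)).1 => sb_sa.
      by rewrite (sa_ip _ _ sb_sa) -mulE bG -(sa_ip _ _ sb_sa).
    have xG : xc i%:R (G j%:R u) = xc i%:R u.
      rewrite -mulE /xc -mulrA; congr (bf (_ * _) u).
      have := sc_sG pr (n0 R i) => cG; have [_ _ cG' _] := scP pr (n0 R i).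
      by rewrite -{1}cG' -mulrA (sG_mulC pr ijR) cG'.
    by rewrite xG.
  have /orP[h|h] := leq_total m n.
    by rewrite nqBC key//; apply: le_lt_trans (ler_norm _) (hN _ _ Nn Nm).
  by rewrite key//; apply: le_lt_trans (ler_norm _) (hN _ _ Nm Nn).
have xuy : x (u, y).
  have [_ clx _] := cx; apply: ((closedP dot x).1 clx (fun n : nat => (G n%:R u, xc n%:R u))) => [n|].
    exact: (xcP u (n0 R n)).1.
  by split => //=; exact: (sG1 pr ri).
by rewrite (graph_uniq lx xuw xuy).
Qed.

Lemma tr_cut_small t : tmeas x -> 0 < t -> exists2 s, 0 <= s & (tr (1 - G s) <= t%:E)%E.
Proof.
move=> [_ _ [v v0 hv]] t0; rewrite (opdistE (ltW v0)) in hv.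
have [N vN] : exists N : nat, v <= N%:R.
  by exists (Num.bound v); apply: ltW; apply: archi_boundP; exact: ltW.
have [||||||n hn] := @tr_dec0 _ _ _ A (fun n => 1 - G (n + N)%:R) t.
- have := slimB (slim_cst dot one) (slim_shift N (_ : slim (fun n : nat => G n%:R) 1)); rewrite subrr; apply.
  exact: (sG1 pr ri).
- by move=> n; apply: inMB; [exact: inM1|exact: inM_sG].
- by move=> n; apply/proj_psd/projC/(sG_proj pr).
- by move=> n; rewrite /ole opprB addrC addrA subrK; apply: (sG_mono pr); rewrite ler_nat.
- apply: le_lt_trans hv; apply: tr_mono.
  + by apply: inMB; [exact: inM1|exact: inM_sG].
  + exact/proj_psd/projC/(sG_proj pr).
  + by apply: inMB; [exact: inM1|exact: inM_sG].
  by rewrite /ole opprB addrC addrA subrK; apply: (sG_mono pr).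
- exact: t0.
by exists (n + N)%:R => //; exact: ler0n.
Qed.

Lemma cut_near s t : 0 <= s -> (tr (1 - G s) <= t%:E)%E -> near x (xc s) 0 t.
Proof.
move=> s0 h; exists (G s); split; [exact: inM_sG|exact: (sG_proj pr)|exact: h|].
move=> u Gu; exists (xc s u); first by have [] := xcP u s0; rewrite Gu.
by rewrite subrr nq0 mulr_ge0// ?sqr_ge0 ?nq_ge0.
Qed.
Lemma tmeas_near t : tmeas x -> 0 < t -> exists2 k, 0 <= k & near x 0 k t.
Proof.
move=> hx t0; have [s s0 hs] := tr_cut_small hx t0; exists s => //.
exists (G s); split; [exact: inM_sG|exact: (sG_proj pr)|exact: hs|].
move=> u Gu; exists (xc s u); first by have [] := xcP u s0; rewrite Gu.
by rewrite zeroE subr0; have := xc_upper u s0; rewrite Gu.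
Qed.

(* x (1 - sG s) has range projection of trace at most tr (1 - sG s), and x - x
   (1 - sG s) is bounded. *)
Lemma tmeas_left t : tmeas x -> 0 < t -> exists f c, [/\ inM f, proj f, (tr (1 - f) <= t%:E)%E &
  forall u w, x (u, w) -> f w = c u].
Proof.
move=> hx t0; have [s s0 hs] := tr_cut_small hx t0.
have [Md hd] := xdP; have M1 := inM1 A; have MG := inM_sG s; have pG := sG_proj pr s.
have pG' := projC pG; have MG' : inM (1 - G s) by exact: inMB.
pose a := xd * (1 - G s); have Ma : inM a by exact: inMM.
pose f := kproj (a * adjo a).
have pb : psd (a * adjo a) by rewrite -{1}(adjK dot a); exact: psd_adjM.
have Mf : inM f by apply: inM_kproj; [exact: pb.1|apply: inMM => //; exact: inM_adj].
have pf : proj f by exact: kprojP.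
have fE u : f u = u -> adjo a u = 0.
  move=> /(kprojE dot) h; apply: (@nq_eq0 _ _ dot).
  by rewrite /sqn -adjPr -[a (adjo a _)]mulE h ip0r.
have fE' u : adjo a u = 0 -> f u = u by move=> h; apply/(kprojE dot); rewrite mulE h bop0.
exists f, (f * xc s); split=> //.
  apply: le_trans hs; apply: (@tr_range _ _ _ _ a) => //.
  - by rewrite /a -mulrA pG'.2.
  - exact: inMB.
  - exact: projC.
  - by move=> u /fE' h; rewrite subE oneE h subrr.
move=> u w xuw.
have xG : x (u - G s u, w - xc s u) := cddB lx xuw (xcP u s0).1.
rewrite mulE; apply/eqP; rewrite -subr_eq0 -bopB; apply/eqP.
apply: (@ip_inj _ _ dot) => z; rewrite ip0r -(sa_ip _ _ pf.1).
have fz := fE _ (proj_fix z pf).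
have cv := xc_cvg xG.
have c2 : ip (f z) (xc n%:R (u - G s u)) @[n --> \oo] --> ip (f z) (w - xc s u).
  by apply: scvg_ip => //; exact: scvg_cst.
apply: cvg_unique c2 _ => //; rewrite (_ : (fun n => _) = fun=> 0); first exact: cvg_cst.
apply/funext => n.
have -> : xc n%:R (u - G s u) = a (sc dot r n%:R u).
  rewrite -[u - G s u]/((1 - G s) u) -!mulE /xc /a -!mulrA; congr (bf (_ * _) u).
  by rewrite mulrBr mulrBl mulr1 mul1r sG_sc//; exact: n0.
by rewrite adjPr fz ip0l.
Qed.
Lemma mu_lt_near k t : (mu x t < k%:E)%E -> near x 0 k t.
Proof.
move=> /ereal_inf_lt[_ [s /= [s0 hs] <-]]; rewrite lte_fin => sk.
apply: (@near_mono _ _ s _ t) => //; [exact: ltW|exact: ltW|].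
rewrite (opdistE (ltW s0)) in hs; exists (G s); split; [exact: inM_sG|exact: (sG_proj pr)|exact: hs|].
move=> u Gu; exists (xc s u); first by have [] := xcP u (ltW s0); rewrite Gu.
by rewrite zeroE subr0; have := xc_upper u (ltW s0); rewrite Gu.
Qed.
(** A vector fixed by e and killed by [sG k'] satisfies k' |u| <= |x u| <= k |u|, so it is 0 and
    [tr_meet0] compares the traces. With [mu_lt_near] this identifies singular numbers with
    distances to 0 in the measure topology. *)
Lemma near_od k k' t : 0 <= k -> k < k' -> near x 0 k t -> (od x k' <= t%:E)%E.
Proof.
move=> k0 kk [e [Me pe te he]]; have k'0 : 0 <= k' by rewrite ltW// (le_lt_trans k0).
rewrite opdistE//; apply: le_trans te; apply: tr_meet0 => //.
- by apply: inMB; [exact: inM1|exact: inM_sG].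
- by apply: projC; exact: (sG_proj pr).
move=> u eu; rewrite subE oneE => /eqP; rewrite -subr_eq0 addrAC subrr sub0r oppr_eq0 => /eqP Gu.
have [w xw] := he u eu; rewrite zeroE subr0 => hw.
have le n : k' ^+ 2 * nq (G n%:R u) <= k ^+ 2 * nq u.
  apply: le_trans (sb_lower _ _ _) _ => //; apply: le_trans hw; exact: sb_le_nq.
have c : k' ^+ 2 * nq (G n%:R u) @[n --> \oo] --> k' ^+ 2 * nq u.
  by apply: cvgMr; apply: scvg_nq; exact: (sG1 pr ri).
have h : k' ^+ 2 * nq u <= k ^+ 2 * nq u by apply: (cvgr_to_le c); apply: nearW.
apply: (@nq_eq0 _ _ dot); apply/eqP; rewrite eq_le nq_ge0 andbT leNgt; apply/negP => q0.
by move: h; rewrite ler_pM2r// leNgt ltr_pXn2r ?nnegrE// kk.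
Qed.
Lemma near_mu k t : 0 <= k -> near x 0 k t -> (mu x t <= k%:E)%E.
Proof.
move=> k0 h; apply/lee_addgt0Pr => d d0; rewrite -EFinD; apply: ereal_inf_lbound.
exists (k + d) => //; split; first by rewrite ltr_wpDl.
by apply: near_od h => //; rewrite ltrDl.
Qed.
Lemma near_tmeas k t : 0 <= k -> near x 0 k t -> tmeas x.
Proof.
move=> k0 h; split => //; exists (k + 1); first by rewrite ltr_wpDl.
by apply: le_lt_trans (near_od k0 _ h) (ltry _); rewrite ltrDl.
Qed.
End Cut.

Lemma dense_orth (D : set H) : D 0 -> (forall (c : R[i]) u v, D u -> D v -> D (c *: u + v)) ->
  (forall w, (forall u, D u -> ip u w = 0) -> w = 0) -> dense D.
Proof.
move=> D0 Dl Dz; pose S := [set u | exists2 dn : nat -> H, (forall n, D (dn n)) & scvg dn u].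
have cS : csub dot S.
  split=> [|c u v [dn hd cd] [en he ce]|un u hu cu].
  - by exists (fun=> 0) => // n; exact: scvg_cst.
  - by exists (fun n => c *: dn n + en n) => [n|]; [exact: Dl|apply: scvgD => //; exact: scvgZ].
  - have ex n : exists d, D d /\ nq (d - un n) < n.+1%:R^-1.
      have [dn hd cd] := hu n; have [|N hN] := cvg0_bound cd (_ : 0 < n.+1%:R^-1); first by rewrite invr_gt0.
      by exists (dn N); split => //; exact: hN.
    have [d hd] := choice ex; exists d => [n|]; first by case: (hd n).
    apply: (@squeeze0 _ _ (fun n => 2 * (n.+1%:R^-1 + nq (un n - u)))) => [n|].
      rewrite nq_ge0 andTb; apply: le_trans (nq_tri dot _ (un n) _) _.
      by rewrite ler_pM2l// lerD2r ltW//; case: (hd n).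
    rewrite -(mulr0 2) -[X in 2 * X](addr0 0); apply: cvgMr; apply: cvgD => //; exact: cvg_harmonic.
have [pS hS] := sprojP cS.
have ST u : S u.
  apply/hS; apply/eqP; rewrite eq_sym -subr_eq0; apply/eqP; apply: Dz => v Dv.
  have Sv : sproj dot S v = v by apply/hS; exists (fun=> v) => // n; exact: scvg_cst.
  by rewrite -{1}Sv (sa_ip _ _ pS.1) bopB (proj_fix u pS) subrr ip0r.
move=> O [u Ou] oO; have [dn hd /scvgP/(_ O) h] := ST u.
have [|N _ hN] := h; first exact: open_nbhs_nbhs.
by exists (dn N); split => //; exact: (hN N (leqnn N)).
Qed.

Lemma tmeas_cdd x : tmeas x -> cdd x. Proof. by case. Qed.
Lemma tmeas_aff x : tmeas x -> aff x. Proof. by case. Qed.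

(** If (u_n, v_n + w_n) tends to (0, z), a projection f with f x and f y bounded gives f z = 0; such
    f exist with complements of arbitrarily small trace, so z = 0 by [good_sep] and the closure is a
    graph. Its domain is dense by the same lemma, now with projections on whose ranges both
    operators are bounded. *)
Lemma sadd_tmeas x y : tmeas x -> tmeas y -> tmeas (sadd x y).
Proof.
move=> hx hy; have [cx ax _] := hx; have [cy ay _] := hy.
have [lx _ _] := cx; have [ly _ _] := cy.
pose S := [set p : H * H | exists v w, [/\ x (p.1, v), y (p.1, w) & p.2 = v + w]].
have S0 : S 0 by exists 0, 0; split; [exact: (let: And3 h _ _ := lx in h)|exact: (let: And3 h _ _ := ly in h)|rewrite addr0].
have Sl (c : R[i]) p q : S p -> S q -> S (c *: p + q).
  move=> [v [w [h1 h2 h3]]] [v' [w' [h1' h2' h3']]]; exists (c *: v + v'), (c *: w + w').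
  have [_ hl _] := lx; have [_ hl' _] := ly; split.
  - exact: (hl c _ _ h1 h1').
  - exact: (hl' c _ _ h2 h2').
  - by rewrite /= h3 h3' scalerDr addrACA.
have eS : sadd x y = closure S by [].
have cl : closed (sadd x y) by rewrite eS; exact: closed_closure.
have t0 (n : nat) : (0 : R) < n.+1%:R^-1 by rewrite invr_gt0.
have small (t : R) : 0 < t -> exists n : nat, n.+1%:R^-1 + n.+1%:R^-1 <= t.
  move=> tp; exists (Num.bound (2 / t)); have h := archi_boundP (divr_ge0 (ler0n R 2) (ltW tp)).
  have := @lt_trans _ _ _ _ (Num.bound (2 / t)).+1%:R h; rewrite ltr_nat => /(_ (ltnSn _)).
  rewrite ltr_pdivrMr// => h2; rewrite -mulr2n -[X in X <= _]mulr_natl ler_pdivrMr// mulrC; exact: ltW.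
have gl : linear_graph (sadd x y).
  split; first by rewrite eS; exact: subset_closure.
    move=> c p q; rewrite eS => /(closure_seq dot)[pn hp [cp1 cp2]] /(closure_seq dot)[qn hq [cq1 cq2]].
    apply/(closure_seq dot); exists (fun n => c *: pn n + qn n) => [n|]; first exact: Sl.
    by split => /=; apply: scvgD => //; exact: scvgZ.
  move=> z; rewrite eS => /(closure_seq dot)[pn hp [/= cp1 cp2]].
  have exf n : exists f, [/\ inM f, proj f, (tr (1 - f) <= (n.+1%:R^-1 + n.+1%:R^-1)%:E)%E & f z = 0].
    have [f [c [Mf pf tf hf]]] := tmeas_left cx ax hx (t0 n).
    have [g [d [Mg pg tg hg]]] := tmeas_left cy ay hy (t0 n).
    exists (pmeet dot f g); split; [exact: inM_pmeet|exact: pmeet_proj| |].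
      by apply: le_trans (tr_pmeet _ _ _ _) _ => //; rewrite EFinD; exact: leeD.
    set m := pmeet dot f g; have pm : proj m by exact: pmeet_proj.
    have mf : m * f = m.
      have : f * m = m by apply: bopE => u; rewrite mulE; have /pmeetE[] := proj_fix u pm.
      by move=> /(congr1 adjo); rewrite adjM pm.1 pf.1.
    have mg : m * g = m.
      have : g * m = m by apply: bopE => u; rewrite mulE; have /pmeetE[] := proj_fix u pm.
      by move=> /(congr1 adjo); rewrite adjM pm.1 pg.1.
    have cz : scvg (fun k : nat => m ((pn k).2)) (m z) by exact: bop_scvg.
    apply: (scvg_unique cz).
    have -> : (fun k : nat => m ((pn k).2)) = fun k : nat => (m * c + m * d) (pn k).1.
      apply/funext => k; have [v [w [h1 h2 ->]]] := hp k.
      by rewrite bopD addE !mulE -(hf _ _ h1) -(hg _ _ h2) -!mulE mf mg.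
    by rewrite -(bop0 (m * c + m * d)); exact: bop_scvg.
  have [f hf] := choice exf; apply: (@good_sep _ _ _ A f z).
  - by move=> n; case: (hf n).
  - by move=> n; case: (hf n).
  - by move=> t /small[n hn]; exists n; case: (hf n) => _ _ h _; apply: le_trans h _; rewrite lee_fin.
  - by move=> n; case: (hf n).
have exe n : exists e, [/\ inM e, proj e, (tr (1 - e) <= (n.+1%:R^-1 + n.+1%:R^-1)%:E)%E & forall u, e u = u -> dom (sadd x y) u].
  have [k k0 hk] := tmeas_near cx ax hx (t0 n); have [l l0 hl] := tmeas_near cy ay hy (t0 n).
  have [e [h1 h2 h3 h4]] := near_meet hk hl; exists e; split => // u /h4[[w xw _] [v yv _]].
  by exists (w + v); rewrite eS; apply: subset_closure; exists w, v.
have dd : dense (dom (sadd x y)).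
  apply: dense_orth.
  - by exists 0; case: gl.
  - move=> c u v [u' hu] [v' hv]; exists (c *: u' + v'); have [_ h _] := gl; exact: (h c _ _ hu hv).
  move=> z hz; have [e he] := choice exe; apply: (@good_sep _ _ _ A e z).
  - by move=> n; case: (he n).
  - by move=> n; case: (he n).
  - by move=> t /small[n hn]; exists n; case: (he n) => _ _ h _; apply: le_trans h _; rewrite lee_fin.
  move=> n; have [_ pe _ hd] := he n; apply: (@ip_inj _ _ dot) => v; rewrite ip0r -(sa_ip _ _ pe.1).
  by apply: hz; apply: hd; exact: (proj_fix v pe).
have cs : cdd (sadd x y) by split.
have as_ : aff (sadd x y).
  apply/affP => c hc p; rewrite eS => /(closure_seq dot)[pn hp [cp1 cp2]]; apply/(closure_seq dot).
  exists (fun n => (c (pn n).1, c (pn n).2)) => [n|]; last by split; exact: bop_scvg.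
  have [v [w [h1 h2 h3]]] := hp n; exists (c v), (c w); split => /=.
  - exact: ((affP x).1 ax c hc _ h1).
  - exact: ((affP y).1 ay c hc _ h2).
  - by rewrite h3 bopD.
have [k k0 hk] := tmeas_near cx ax hx ltr01; have [l l0 hl] := tmeas_near cy ay hy ltr01.
have := near_add k0 l0 hk hl; rewrite addr0; apply: near_tmeas => //; exact: addr_ge0.
Qed.
End Near.

Lemma ler_sqr_dbl (R : realFieldType) (x y : R) : 0 <= x -> x <= y -> (2 * x + 2 * x) ^+ 2 <= (2 * (2 * y)) ^+ 2.
Proof. by move=> x0 xy; rewrite ler_pXn2r ?nnegrE//; lra. Qed.

(** * Completeness in measure *)

Section Complete.
Variables (R : realType) (H : completeNormedModType R[i]) (dot : hdot H) (A : tvna dot).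
Local Notation bop := (bop H).
Local Notation one := (1 : bop).
Local Notation ip := (rip dot).
Local Notation nq := (sqn dot).
Local Notation scvg := (sconv dot).
Local Notation adjo := (adjo dot).
Local Notation sa := (sa dot).
Local Notation ole := (ole dot).
Local Notation proj := (proj dot).
Local Notation inM := (inM A).
Local Notation tr := (tr A).
Local Notation near := (near A).
Local Notation nearb := (nearb A).
Local Notation tmeas := (tau_measurable dot (vM A) (vtau A)).
Local Notation pmeets := (pmeets dot).
Implicit Types (b c f g : bop) (u v w : H).

Lemma ip_conj (c : R[i]) u v : ip (c *: u) v = ip u (Num.conj c *: v).
Proof.
have h : hd dot (c *: u) v = hd dot u (Num.conj c *: v).
  by rewrite dotZl [RHS]dotC dotZl rmorphM /= conjCK -dotC.
by rewrite /rip h.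
Qed.

Lemma tr_pmeets (e : nat -> bop) (t : nat -> R) (T : R) :
  (forall n, [/\ inM (e n), proj (e n) & (tr (1 - e n) <= (t n)%:E)%E]) ->
  (forall k, \sum_(i < k) t i <= T) -> (tr (1 - pmeets e) <= T%:E)%E.
Proof.
move=> he hT; pose g := fix g (n : nat) := if n is k.+1 then pmeet dot (g k) (e k) else 1.
have gS k : g k.+1 = pmeet dot (g k) (e k) by [].
have hg k : [/\ inM (g k), proj (g k) & (tr (1 - g k) <= (\sum_(i < k) t i)%:E)%E].
  elim: k => [|k [h1 h2 h3]].
    by rewrite big_ord0 subrr tr0; split; [exact: inM1|exact: proj1|].
  have [k1 k2 k3] := he k; rewrite gS big_ord_recr /=; split; [exact: inM_pmeet|exact: pmeet_proj|].
  by apply: le_trans (tr_pmeet _ _ _ _) _ => //; rewrite EFinD; exact: leeD.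
have pg k : proj (g k) by case: (hg k).
have dec k : ole (g k.+1) (g k).
  by apply: proj_ole_fix => // u; rewrite gS => /pmeetE[].
have g1 k : ole (g k) (1 *: one) by rewrite scale1r; exact: proj_le1.
have [ginf [gc pgi gle]] := slim_mono_dec ler01 (fun k => proj_psd (pg k)) dec g1.
have pgp : proj ginf by exact: slim_proj gc.
have fixg u : ginf u = u -> forall k, g k u = u.
  by move=> h k; have /(proj_oleP pgp (pg k)) := gle k => e1; rewrite -h -mulE e1.
have ginf_le : ole ginf (pmeets e).
  apply: proj_ole_fix => //; first exact: pmeets_proj.
  by move=> u /fixg h; apply/pmeetsE => k; have := h k.+1; rewrite gS => /pmeetE[].
have M1 := inM1 A; have Mg : inM ginf by apply: (inM_slim gc) => k; case: (hg k).
have Mp : inM (pmeets e) by apply: inM_pmeets => k; case: (he k).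
apply: (@le_trans _ _ (tr (1 - ginf))).
  apply: tr_mono; [exact: inMB|exact/proj_psd/projC/pmeets_proj|exact: inMB|].
  by rewrite /ole opprB addrC addrA subrK.
apply: (@tr_sup _ _ _ A (fun k => 1 - g k)).
- by apply: slimB => //; exact: slim_cst.
- by move=> k; apply: inMB => //; case: (hg k).
- by move=> k; exact/proj_psd/projC.
- by move=> k; rewrite /ole opprB addrC addrA subrK; exact: dec.
- by move=> k; case: (hg k) => _ _ h; apply: le_trans h _; rewrite lee_fin.
Qed.

Section Limit.
Variables (a e : nat -> bop).
Let q : R := 2^-1.
Hypotheses (Ma : forall n, inM (a n)) (sa_a : forall n, sa (a n)).
Hypothesis he : forall n, [/\ inM (e n), proj (e n) & (tr (1 - e n) <= (q ^+ n)%:E)%E].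
Hypothesis hd_ : forall n u, e n u = u -> nq (a n.+1 u - a n u) <= (q ^+ n) ^+ 2 * nq u.

Let q0 : 0 < q. Proof. by rewrite /q invr_gt0. Qed.
Let qlt1 : q < 1. Proof. by rewrite /q invf_lt1// ltr1n. Qed.
Let q1 : q <= 1. Proof. exact: ltW. Qed.
Let f m := pmeets (fun k => e (m + k)).
Let Mf m : inM (f m). Proof. by apply: inM_pmeets => k; case: (he (m + k)). Qed.
Let pf m : proj (f m). Proof. exact: pmeets_proj. Qed.
Let geo m k : \sum_(i < k) q ^+ (m + i) <= 2 * q ^+ m.
Proof.
suff -> : \sum_(i < k) q ^+ (m + i) = 2 * q ^+ m - 2 * q ^+ (m + k).
  by rewrite lerBlDr lerDl mulr_ge0// exprn_ge0// ltW.
elim: k => [|k IH]; first by rewrite big_ord0 addn0 subrr.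
by rewrite big_ord_recr /= IH addnS exprS /q; field.
Qed.
Let trf m : (tr (1 - f m) <= (2 * q ^+ m)%:E)%E.
Proof. by apply: (@tr_pmeets _ (fun k => q ^+ (m + k))) => //; exact: geo. Qed.
Let fix_e m n u : f m u = u -> (m <= n)%N -> e n u = u.
Proof. by move=> /pmeetsE h mn; have := h (n - m)%N; rewrite subnKC. Qed.
Let near_m m k u : f m u = u -> nq (a (m + k) u - a m u) <= (2 * q ^+ m - 2 * q ^+ (m + k)) ^+ 2 * nq u.
Proof.
move=> fu; elim: k => [|k IH]; first by rewrite addn0 !subrr nq0 expr2 mul0r mul0r.
have := hd_ (fix_e fu (leq_addr k m)); rewrite addnS => h.
rewrite -[a (m + k).+1 u - _](subrKA (a (m + k) u)) [_ + _]addrC.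
have -> : 2 * q ^+ m - 2 * q ^+ (m + k).+1 = (2 * q ^+ m - 2 * q ^+ (m + k)) + q ^+ (m + k).
  by rewrite exprS /q; field.
apply: nq_add_le => //; [|by rewrite exprn_ge0// ltW|exact: nq_ge0].
by rewrite subr_ge0 ler_pM2l//; exact: (ler_wiXn2l (ltW q0) q1 (leq_addr _ _)).
Qed.
Let near_m2 m k u : f m u = u -> nq (a (m + k) u - a m u) <= (2 * q ^+ m) ^+ 2 * nq u.
Proof.
move=> fu; apply: le_trans (near_m k fu) _; apply: ler_wpM2r; first exact: nq_ge0.
have h : 0 <= q ^+ (m + k) by rewrite exprn_ge0// ltW.
have h2 : 2 * q ^+ (m + k) <= 2 * q ^+ m.
  by rewrite ler_pM2l//; exact: (ler_wiXn2l (ltW q0) q1 (leq_addr _ _)).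
rewrite ler_pXn2r ?nnegrE//; [lra|lra|by rewrite mulr_ge0// exprn_ge0// ltW].
Qed.
Let q_small (t : R) : 0 < t -> exists n, 2 * q ^+ n < t.
Proof.
move=> t0; have := @cvg_geometric _ 2 q; rewrite ger0_norm ?ltW// => /(_ _).
have : q < 1 by rewrite /q invf_lt1// ltr1n.
move=> h /(_ h) c; have [N hN] := cvg0_bound c t0; exists N; exact: hN.
Qed.
Let fmono m n u : (m <= n)%N -> f m u = u -> f n u = u.
Proof. by move=> mn fu; apply/pmeetsE => k; apply: (fix_e fu); apply: leq_trans mn (leq_addr _ _). Qed.
Let lim_ex m u : f m u = u -> exists l, scvg (fun n => a n u) l.
Proof.
move=> fu; apply: (@scauchy _ _ dot) => t t0.
have [k hk] : exists k, (2 * (2 * q ^+ k)) ^+ 2 * nq u < t.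
  have c : (2 * (2 * q ^+ k)) ^+ 2 * nq u @[k --> \oo] --> (0 : R).
    rewrite -(mul0r (nq u)); apply: cvgMl.
    have -> : (0 : R) = 0 * 0 by rewrite mul0r.
    rewrite (_ : (fun k => _) = (fun k => (4 * q ^+ k) * (4 * q ^+ k))); last first.
      by apply/funext => k; ring.
    have c1 : 4 * q ^+ k @[k --> \oo] --> (0 : R).
      by apply: cvg_geometric; rewrite ger0_norm ?ltW// /q invf_lt1// ltr1n.
    exact: cvgM.
  by have [N hN] := cvg0_bound c t0; exists N; exact: hN.
exists (maxn m k) => i j; rewrite !geq_max => /andP[mi ki] /andP[mj kj].
have fu' : f (maxn m k) u = u by apply: fmono fu; rewrite leq_maxl.
set N := maxn m k in fu'.
have hi : nq (a i u - a N u) <= (2 * q ^+ N) ^+ 2 * nq u.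
  by rewrite -(subnKC (_ : (N <= i)%N)) ?geq_max ?mi//; exact: near_m2.
have hj : nq (a N u - a j u) <= (2 * q ^+ N) ^+ 2 * nq u.
  by rewrite nqBC -(subnKC (_ : (N <= j)%N)) ?geq_max ?mj//; exact: near_m2.
have p0 : 0 <= 2 * q ^+ N by rewrite mulr_ge0// exprn_ge0// ltW.
have := nq_add_le p0 p0 (nq_ge0 dot u) hi hj; rewrite subrKA => h.
apply: le_lt_trans h _; apply: le_lt_trans hk; apply: ler_wpM2r; first exact: nq_ge0.
have p1 : q ^+ N <= q ^+ k.
  exact: (ler_wiXn2l (ltW q0) q1 (leq_maxr _ _)).
have p2 : 0 <= q ^+ N by rewrite exprn_ge0// ltW.
exact: ler_sqr_dbl.
Qed.

(* The domain of the measure limit contains the ranges of the f m; its graph is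
   the orthogonality relation against them, so that it is closed. *)
Let Y : set (H * H) := [set p | forall m z l, f m z = z -> scvg (fun n => a n z) l -> ip p.2 z = ip p.1 l].
Let Yf m u l : f m u = u -> scvg (fun n => a n u) l -> Y (u, l).
Proof.
move=> fu cl k z l' fz cl' /=.
have c1 : ip (a n u) z @[n --> \oo] --> ip l z by apply: scvg_ip => //; exact: scvg_cst.
have c2 : ip u (a n z) @[n --> \oo] --> ip u l' by apply: scvg_ip => //; exact: scvg_cst.
apply: cvg_unique c1 _ => //; rewrite (_ : (fun n => _) = fun n => ip u (a n z))//.
by apply/funext => n; rewrite sa_ip.
Qed.
Let f_small (t : R) : 0 < t -> exists n, (tr (1 - f n) <= t%:E)%E.
Proof. by move=> /q_small[n hn]; exists n; apply: le_trans (trf n) _; rewrite lee_fin ltW. Qed.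
Let lY : linear_graph Y.
Proof.
split.
- by move=> m z l fz cl; rewrite !ip0l.
- move=> c p p' hp hp' m z l fz cl /=; rewrite !ipDl !ip_conj (hp' m z l)//; congr (_ + _).
  apply: (hp m); first by rewrite bopZ fz.
  by rewrite (_ : (fun n => _) = fun n => Num.conj c *: a n z); [exact: scvgZ|apply/funext => n; rewrite bopZ].
- move=> v hv; apply: (@good_sep _ _ _ A f v) => // n; apply: (@ip_inj _ _ dot) => w; rewrite ip0r -(sa_ip _ _ (pf n).1) ipC.
  have [l hl] := lim_ex (proj_fix w (pf n)).
  by rewrite (hv n _ l (proj_fix w (pf n)) hl) ip0l.
Qed.
Let cY : cdd Y.
Proof.
split=> //.
  apply/(closedP dot) => pn p hp [c1 c2] m z l fz cl.
  have d1 : ip (pn n).2 z @[n --> \oo] --> ip p.2 z by apply: scvg_ip => //; exact: scvg_cst.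
  have d2 : ip (pn n).1 l @[n --> \oo] --> ip p.1 l by apply: scvg_ip => //; exact: scvg_cst.
  apply: cvg_unique d1 _ => //; rewrite (_ : (fun n => _) = fun n => ip (pn n).1 l)//.
  by apply/funext => n; apply: (hp n m).
apply: (@dense_orth _ _ dot).
- by exists 0; case: lY.
- move=> c u v [u' hu] [v' hv]; exists (c *: u' + v'); have [_ h _] := lY; exact: (h c _ _ hu hv).
move=> w hw; apply: (@good_sep _ _ _ A f w) => // n; apply: (@ip_inj _ _ dot) => v; rewrite ip0r -(sa_ip _ _ (pf n).1).
apply: hw; have [l hl] := lim_ex (proj_fix v (pf n)); exists l; exact: Yf (proj_fix v (pf n)) hl.
Qed.
Let aY : affiliated (vM A) Y.
Proof.
apply/affP => c hc p hp m z l fz cl /=.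
have hc' := com_adj hc; rewrite !adjP; apply: (hp m).
  by rewrite -mulE -hc'// mulE fz.
rewrite (_ : (fun n => _) = fun n => adjo c (a n z)); first exact: bop_scvg.
by apply/funext => n; rewrite -!mulE hc'.
Qed.
(** The geometric errors from m on sum to 2 2^-m, both in norm and in trace. *)
Lemma limit_near m : near Y (a m) (2 * q ^+ m) (2 * q ^+ m).
Proof.
exists (f m); split=> // u fu; have [l hl] := lim_ex fu; exists l; first exact: Yf fu hl.
have c : nq (a (n + m)%N u - a m u) @[n --> \oo] --> nq (l - a m u).
  apply: scvg_nq; apply: scvgB; last exact: scvg_cst.
  by rewrite /sconv (cvg_shiftn m (fun n => nq (a n u - l))).
by apply: (cvgr_to_le c); apply: nearW => n; rewrite addnC; exact: near_m2.
Qed.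
Lemma limit_ex : exists2 Y, tmeas Y & forall m, near Y (a m) (2 * q ^+ m) (2 * q ^+ m).
Proof.
exists Y; last exact: limit_near.
have [K K0 hK] := nbP dot (a 0%N); pose k := Num.sqrt K.
have := limit_near 0; rewrite expr0 mulr1 => h.
have hb : nearb (a 0%N) 0 k 0.
  by apply: nearb_norm => // u; rewrite zeroE subr0 sqr_sqrtr.
have := near_tri (ler0n R 2) (sqrtr_ge0 K) h hb; apply: (near_tmeas cY aY).
by rewrite addr_ge0// sqrtr_ge0.
Qed.
End Limit.

Theorem meas_complete (a : nat -> bop) : (forall n, inM (a n)) -> (forall n, sa (a n)) ->
  (forall t : R, 0 < t -> exists N, forall m n, (N <= m)%N -> (N <= n)%N -> nearb (a m) (a n) t t) ->
  exists2 Y, tmeas Y & forall t : R, 0 < t -> exists N, forall n, (N <= n)%N -> near Y (a n) t t.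
Proof.
move=> Ma sa_a ca; have q0 (n : nat) : 0 < (2^-1 : R) ^+ n by rewrite exprn_gt0// invr_gt0.
have [N hN] := choice (fun n => ca _ (q0 n)).
(* A nondecreasing index map above n and above N n, so that the subsequence has steps of size
   2^-n. *)
pose phi n := (n + \sum_(i < n.+1) N i)%N.
have phiN n : (N n <= phi n)%N by rewrite /phi big_ord_recr /= addnA leq_addl.
have phiS n : (phi n <= phi n.+1)%N by rewrite /phi [X in (_ <= _ + X)%N]big_ord_recr /= leq_add ?leq_addr.
have st n : exists e, [/\ inM e, proj e, (tr (1 - e) <= ((2^-1) ^+ n)%:E)%E &
    forall u, e u = u -> nq (a (phi n.+1) u - a (phi n) u) <= ((2^-1) ^+ n) ^+ 2 * nq u].
  by apply/nearbP; apply: hN => //; apply: leq_trans (phiN n) (phiS n).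
have [e he] := choice st.
have [||||Y tY hY] := @limit_ex (a \o phi) e.
- by move=> n; exact: Ma.
- by move=> n; exact: sa_a.
- by move=> n; case: (he n).
- by move=> n; case: (he n).
exists Y => // t t0; have t2 : 0 < t / 2 by rewrite divr_gt0.
have [N1 hN1] := ca _ t2.
have c : 2 * (2^-1 : R) ^+ k @[k --> \oo] --> (0 : R).
  by apply: cvg_geometric; rewrite ger0_norm ?invr_ge0// invf_lt1// ltr1n.
have [N2 hN2] := cvg0_bound c t2.
pose m := maxn N1 N2.
have hm : 2 * 2^-1 ^+ m <= t / 2 by rewrite ltW// hN2// leq_maxr.
have p0 : 0 <= 2 * (2^-1 : R) ^+ m by rewrite mulr_ge0// ltW.
exists N1 => n n1; rewrite [t]splitr; apply: (near_tri (a := a (phi m))); try exact: ltW.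
  exact: (near_mono p0 hm hm (hY m)).
apply: hN1 => //; rewrite /phi; apply: leq_trans (leq_addr _ _); exact: leq_maxl.
Qed.
End Complete.

Lemma addr_telescope (V : zmodType) (a c z y : V) : a + y = z + ((a - c) - (z - y)) + c.
Proof. by rewrite opprB [z + _]addrC addrA subrK addrAC subrK. Qed.

(** * Conditional expectations on the algebra *)

Section CondExp.
Variables (R : realType) (H : completeNormedModType R[i]) (dot : hdot H) (A : tvna dot).
Local Notation bop := (bop H).
Local Notation one := (1 : bop).
Local Notation ip := (rip dot).
Local Notation nq := (sqn dot).
Local Notation sa := (sa dot).
Local Notation psd := (psd dot).
Local Notation ole := (ole dot).
Local Notation proj := (proj dot).
Local Notation bsqrt := (bsqrt dot).
Local Notation tr := (tr A).
Implicit Types (a b c e x : bop) (u v w : H).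

Section Pairing.
(* trace (a b), for positive a and b *)
Definition pairing a b : \bar R := tr (bsqrt a * b * bsqrt a).
Arguments pairing a%_R b%_R.
Let Ms a : inM A a -> psd a -> inM A (bsqrt a). Proof. by move=> Ma pa; exact: inM_bsqrt. Qed.
Let ss a : psd a -> sa (bsqrt a). Proof. by move=> /bsqrtP[[]]. Qed.
Let sq a : psd a -> bsqrt a * bsqrt a = a. Proof. by move=> /bsqrtP[]. Qed.
Let Mc a b : inM A a -> psd a -> inM A b -> inM A (bsqrt a * b * bsqrt a).
Proof. by move=> *; apply: inMM; [apply: inMM|]; try exact: Ms. Qed.
Let pc a b : psd a -> psd b -> psd (bsqrt a * b * bsqrt a).
Proof. by move=> pa pb; apply: psd_conjsa => //; exact: ss. Qed.
Lemma pairing_ge0 a b : inM A a -> psd a -> inM A b -> psd b -> (0 <= pairing a b)%E.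
Proof. by move=> *; apply: tr_ge0; [exact: Mc|exact: pc]. Qed.
Lemma pairingC a b : inM A a -> psd a -> inM A b -> psd b -> pairing a b = pairing b a.
Proof.
move=> Ma pa Mb pb; have Mx : inM A (bsqrt b * bsqrt a) by apply: inMM; exact: Ms.
have := tr_comm Mx; rewrite adjM (ss pa) (ss pb) => e.
have e1 : bsqrt a * b * bsqrt a = bsqrt a * bsqrt b * (bsqrt b * bsqrt a) by rewrite -{1}(sq pb) !mulrA.
have e2 : bsqrt b * a * bsqrt b = bsqrt b * bsqrt a * (bsqrt a * bsqrt b) by rewrite -{1}(sq pa) !mulrA.
by rewrite /pairing e1 e2.
Qed.
Lemma pairingDr a b c : inM A a -> psd a -> inM A b -> psd b -> inM A c -> psd c ->
  pairing a (b + c) = (pairing a b + pairing a c)%E.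
Proof. by move=> *; rewrite /pairing mulrDr mulrDl trD//; [exact: Mc|exact: pc|exact: Mc|exact: pc]. Qed.
Lemma pairingDl a b c : inM A a -> psd a -> inM A b -> psd b -> inM A c -> psd c ->
  pairing (b + c) a = (pairing b a + pairing c a)%E.
Proof.
move=> Ma pa Mb pb Mc' pc'; rewrite pairingC//; [|exact: inMD|exact: psdD].
by rewrite pairingDr// (pairingC Ma pa Mb) // (pairingC Ma pa Mc').
Qed.
Lemma pairingZr (k : R) a b : 0 <= k -> inM A a -> psd a -> inM A b -> psd b ->
  pairing a (k *: b) = (k%:E * pairing a b)%E.
Proof. by move=> *; rewrite /pairing scAr scAl trZ//; [exact: Mc|exact: pc]. Qed.
Lemma pairing_sumr I (s : seq I) (P : pred I) (F : I -> bop) a : inM A a -> psd a ->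
  (forall i, P i -> inM A (F i) /\ psd (F i)) ->
  pairing a (\sum_(i <- s | P i) F i) = (\sum_(i <- s | P i) pairing a (F i))%E.
Proof.
move=> Ma pa h; rewrite /pairing mulr_sumr mulr_suml tr_sum// => i /h[h1 h2]; split; [exact: Mc|exact: pc].
Qed.
Lemma pairing_mono a b c : inM A a -> psd a -> inM A b -> psd b -> inM A c -> ole b c ->
  (pairing a b <= pairing a c)%E.
Proof. by move=> *; apply: tr_mono; [exact: Mc|exact: pc|exact: Mc|apply: ole_conjsa => //; exact: ss]. Qed.
Lemma pairing_monol a b c : inM A a -> psd a -> inM A b -> psd b -> inM A c -> ole b c ->
  (pairing b a <= pairing c a)%E.
Proof.
move=> Ma pa Mb pb Mc' bc; have pc' := ole_psd pb bc.
by rewrite (pairingC Mb)// (pairingC Mc')//; exact: pairing_mono.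
Qed.
Lemma pairing1 a : inM A a -> psd a -> pairing a 1 = tr a.
Proof. by move=> Ma pa; rewrite /pairing mulr1 sq. Qed.
Lemma pairing_le_tr a b : inM A a -> psd a -> inM A b -> psd b -> ole b 1 -> (pairing a b <= tr a)%E.
Proof. by move=> *; rewrite -pairing1//; apply: pairing_mono => //; exact: inM1. Qed.
Lemma bsqrt_proj e : proj e -> bsqrt e = e.
Proof.
move=> pe; have pse := proj_psd pe; have [p1 s1 c1] := bsqrtP pse.
by apply: (@sqrt_uniq _ _ dot) => //; [apply/esym/c1|rewrite s1 pe.2].
Qed.
Lemma pairing_proj e b : proj e -> pairing e b = tr (e * b * e).
Proof. by move=> pe; rewrite /pairing bsqrt_proj. Qed.
End Pairing.

Section One.
Variables (N : vna dot) (NM : vM N `<=` vM A) (Eps : (H -> H) -> H -> H).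
Hypothesis hE : cond_expectation dot (vM A) (vtau A) (vM N) Eps.
Definition ce a : bop := xget (0 : bop) [set b : bop | bf b = Eps (bf a)].
Lemma inNM a : inM N a -> inM A a. Proof. exact: NM. Qed.
Lemma ceE a : inM A a -> bf (ce a) = Eps (bf a).
Proof.
move=> Ma; have := cexp_in hE Ma => /(@vM_bop _ _ _ N)[b eb _].
by rewrite /ce; case: xgetP => [c _ //|/(_ b)].
Qed.
Lemma inN_ce a : inM A a -> inM N (ce a).
Proof. by move=> Ma; rewrite /inM ceE//; exact: (cexp_in hE). Qed.
Lemma inM_ce a : inM A a -> inM A (ce a). Proof. by move=> /inN_ce/inNM. Qed.
Lemma ce_lin (c : R[i]) a b h : inM A a -> inM A b -> inM A h -> (forall u, h u = c *: a u + b u) ->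
  forall u, ce h u = c *: ce a u + ce b u.
Proof.
move=> Ma Mb Mh e u; rewrite !ceE//; have := cexp_linear hE c Ma Mb => /(congr1 (@^~ u)) <-.
by congr (Eps _ u); apply/funext.
Qed.
Lemma ce_id b : inM N b -> ce b = b.
Proof. by move=> Nb; apply: bopE => u; rewrite ceE ?(cexp_id hE)//; exact: NM. Qed.
Lemma ceD a b : inM A a -> inM A b -> ce (a + b) = ce a + ce b.
Proof.
move=> Ma Mb; apply: bopE => u; rewrite (@ce_lin 1 a b)//; [by rewrite scale1r addE|exact: inMD|].
by move=> v; rewrite addE scale1r.
Qed.
Lemma ceZ (k : R) a : inM A a -> ce (k *: a) = k *: ce a.
Proof.
move=> Ma; apply: bopE => u; rewrite (@ce_lin k%:C a 0)//; [|exact: inM0|exact: inMZ|].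
  by rewrite (ce_id (inM0 N)) zeroE addr0 scaleE.
by move=> v; rewrite scaleE zeroE addr0.
Qed.
Lemma ceB a b : inM A a -> inM A b -> ce (a - b) = ce a - ce b.
Proof.
move=> Ma Mb; rewrite ceD//; last exact: inMN.
by congr (_ + _); rewrite -scaleN1r ceZ// scaleN1r.
Qed.
Lemma ce1 : ce 1 = 1. Proof. by apply: ce_id; exact: inM1. Qed.
Lemma ce_psd a : inM A a -> psd a -> psd (ce a).
Proof. by move=> Ma pa; apply/op_ge0P; rewrite ceE//; apply: (cexp_ge0 hE); apply/pos_coneP. Qed.
Lemma ce_mono a b : inM A a -> inM A b -> ole a b -> ole (ce a) (ce b).
Proof. by move=> Ma Mb h; rewrite /ole -ceB//; apply: ce_psd => //; exact: inMB. Qed.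
Lemma ce_mod b a c : inM N b -> inM A a -> inM N c -> ce (b * a * c) = b * ce a * c.
Proof.
move=> Nb Ma Nc; have Mb := inNM Nb; have Mc := inNM Nc.
apply: bopE => u; rewrite ceE; last by apply: inMM => //; exact: inMM.
by rewrite !mulE ceE// -[RHS]/((bf b \o Eps (bf a) \o bf c) u) -(cexp_module hE).
Qed.
Lemma ce_tr a : inM A a -> psd a -> tr (ce a) = tr a.
Proof. by move=> Ma pa; rewrite /tr ceE//; apply: (cexp_trace hE); apply/pos_coneP. Qed.
(** Adding k + 1 makes a positive, and the image of a positive operator is positive, hence
    self-adjoint. *)
Lemma ce_sa a : inM A a -> sa a -> sa (ce a).
Proof.
move=> Ma ha; have [k k0 hk] := nbP dot a.
have p : psd (a + (k + 1) *: one).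
  split=> [|u]; first by apply: saD => //; exact/saZ/sa1.
  rewrite addE scaleE oneE ipDl ipZl; have := CS2 dot (a u) (- u) ltr01; rewrite invr1 !mul1r nqN ipNr.
  by have := hk u; change (ip u u) with (nq u); have := nq_ge0 dot u; have := mulr_ge0 k0 (nq_ge0 dot u); lra.
have M1 := inM1 A; have Mp : inM A (a + (k + 1) *: one) by apply: inMD => //; exact: inMZ.
have -> : ce a = ce (a + (k + 1) *: one) - (k + 1) *: one.
  by rewrite ceD ?ceZ ?ce1 ?addrK//; exact: inMZ.
by apply: saB; [exact: (ce_psd Mp p).1|exact/saZ/sa1].
Qed.
(** Both sides equal the pairing of E(e) with E(x): the root of E(e) lies in the subalgebra, so the
    module property moves it inside the expectation, which preserves the trace. *)
Lemma pairing_ce e x : inM A e -> psd e -> inM A x -> psd x -> pairing e (ce x) = pairing (ce e) x.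
Proof.
move=> Me pe Mx px; have M1 := inM_ce Mx; have p1 := ce_psd Mx px; have M2 := inM_ce Me; have p2 := ce_psd Me pe.
have key a b : inM A a -> psd a -> inM A b -> psd b -> pairing (ce a) b = pairing (ce a) (ce b).
  move=> Ma pa Mb pb; have pca := ce_psd Ma pa; have [[ps1 _] _ _] := bsqrtP pca.
  have Ns : inM N (bsqrt (ce a)) by apply: inM_bsqrt => //; exact: inN_ce.
  rewrite /pairing -ce_mod// ce_tr//; last exact: psd_conjsa.
  by apply: inMM; [apply: inMM => //|]; exact: inNM.
by rewrite pairingC// key// [RHS]key// pairingC.
Qed.
End One.
End CondExp.
Arguments pairing {R H dot} A a%_R b%_R.

(** * Dual Doob inequality for bounded operators *)

Section Doob.
Variables (R : realType) (H : completeNormedModType R[i]) (dot : hdot H) (A : tvna dot).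
Local Notation bop := (bop H).
Local Notation one := (1 : bop).
Local Notation ip := (rip dot).
Local Notation nq := (sqn dot).
Local Notation sa := (sa dot).
Local Notation psd := (psd dot).
Local Notation ole := (ole dot).
Local Notation proj := (proj dot).
Local Notation pp := (pp dot).
Local Notation tr := (tr A).
Local Notation pairing := (pairing A).
Implicit Types (a b c d e : bop) (u v w : H).
Variables (N : nat -> vna dot) (NM : forall k, vM (N k) `<=` vM A) (NS : forall k, vM (N k) `<=` vM (N k.+1)).
Variable Eps : nat -> (H -> H) -> H -> H.
Hypothesis hE : forall k, cond_expectation dot (vM A) (vtau A) (vM (N k)) (Eps k).
Local Notation E k := (ce (Eps k)).
Let M1 := inM1 A.

(** Inductively q is replaced by q - p, with p the spectral projection of q E_n(e) q on [l, +oo).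
    The removed p satisfies l p <= p E_n(e) p and lies in the n-th algebra, so its trace is bounded
    against e itself; these bounds add up over the removed projections. *)
Lemma cuculescu (e : bop) (l : R) n : inM A e -> psd e -> 0 < l -> exists q,
  [/\ inM (N n) q, proj q, forall k, (k < n)%N -> forall u, q u = u -> ip (E k e u) u <= l * nq u &
   (l%:E * tr (1 - q) <= pairing (1 - q) e)%E].
Proof.
move=> Me pe l0; elim: n => [|n [q [Nq pq hq tq]]].
  exists 1; split=> //; [exact: inM1|exact: proj1|].
  by rewrite subrr tr0 mule0; apply: pairing_ge0 => //; [exact: inM0|exact: psd0].
have NT := inN_ce (hE n) Me; have pT := ce_psd (hE n) Me pe; set T := E n e in NT pT *.
pose b := q * T * q; have pb : psd b by apply: psd_conjsa => //; exact: pq.1.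
have Nb : inM (N n) b by apply: inMM => //; exact: inMM.
have sb : sa (b - l *: one) by apply: saB; [exact: pb.1|exact/saZ/sa1].
have Nbl : inM (N n) (b - l *: one) by apply: inMB => //; apply: inMZ; exact: inM1.
have [ppp cp gp kp _] := pp_spec sb; set p := pp (b - l *: one) in ppp cp gp kp.
have Np : inM (N n) p by exact: inM_pp.
have qb : q * b = b * q by rewrite /b -!mulrA pq.2 !mulrA pq.2.
have qp : q * p = p * q by apply: cp; rewrite mulrBr mulrBl scAr scAl mulr1 mul1r qb.
(* On the complement of q the operator b - l equals -l, so its nonnegative part lives under q. *)
have qpp : q * p = p.
  apply: bopE => u; rewrite mulE; apply/eqP; rewrite eq_sym -subr_eq0 -[p u - _]/((1 - q) (p u)).
  apply/eqP; set w := (1 - q) (p u).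
  have qw : q w = 0 by rewrite /w -mulE (projeC pq) zeroE.
  have pw : p w = w.
    have c1 : p * (1 - q) = (1 - q) * p by rewrite mulrBr mulrBl mulr1 mul1r qp.
    by rewrite /w -mulE c1 mulE (proj_fix u ppp).
  have := gp _ pw; rewrite subE ipBl scaleE oneE ipZl /b !mulE qw !bop0 ip0l sub0r oppr_ge0.
  rewrite pmulr_rle0// => h; apply: (@nq_eq0 _ _ dot); apply/eqP; rewrite eq_le nq_ge0 andbT; exact: h.
have lpq : ole p q by apply/(proj_oleP ppp pq).
have pqp := proj_oleB ppp pq lpq.
have fixq u : (q - p) u = u -> q u = u /\ p u = 0.
  move=> h; have qu : q u = u by rewrite -h -mulE mulrBr pq.2 qpp.
  by split=> //; move: h; rewrite subE qu => /eqP; rewrite -subr_eq0 addrAC subrr sub0r oppr_eq0 => /eqP.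
exists (q - p); split.
- by apply: NS; exact: inMB.
- exact: pqp.
- move=> k; rewrite ltnS leq_eqVlt => /orP[/eqP->|kn] u /fixq[qu pu]; last exact: hq.
  have := kp _ pu; rewrite subE ipBl scaleE oneE ipZl /b !mulE qu (sa_ip _ _ pq.1) qu subr_le0.
  exact.
have Mq := NM Nq; have Mp := NM Np; have MT := NM NT; have Mq' : inM A (1 - q) by exact: inMB.
have -> : 1 - (q - p) = (1 - q) + p by rewrite opprB addrA addrAC.
have pq' := proj_psd (projC pq); have ps := proj_psd ppp.
rewrite trD// ge0_muleDr ?tr_ge0// pairingDl//; apply: leeD => //.
rewrite pairing_proj// -(trZ (ltW l0))//.
have -> : tr (p * e * p) = tr (p * T * p).
  rewrite -(ce_mod (NM (k := n)) (hE n))// (ce_tr (hE n))//; first by apply: inMM => //; exact: inMM.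
  by apply: psd_conjsa => //; exact: ppp.1.
apply: tr_mono; [exact: inMZ|by apply: psdZ => //; exact: ltW|by apply: inMM => //; exact: inMM|].
apply: oleP => [||u]; [exact/saZ/ppp.1|exact: (psd_conjsa pT ppp.1).1|].
have := gp _ (proj_fix u ppp); rewrite subE ipBl scaleE oneE ipZl subr_ge0 => h.
rewrite scaleE ipZl proj_ip// (le_trans h)// /b !mulE.
have qpu : q (p u) = p u by rewrite -mulE qpp.
by rewrite qpu !(sa_ip _ _ pq.1) qpu (sa_ip (T (p u)) _ ppp.1)// -(sa_ip _ _ ppp.1).
Qed.

(** Weighted Cauchy-Schwarz for a positive form: the cross terms of a decomposition that does not
    commute with T are traded for the sum of the weights. *)
Lemma form_CS (T : bop) (w : nat -> R) (z : nat -> H) n : psd T -> (forall i, 0 < w i) ->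
  ip (T (\sum_(i < n) z i)) (\sum_(i < n) z i) <= (\sum_(i < n) w i) * \sum_(i < n) (w i)^-1 * ip (T (z i)) (z i).
Proof.
move=> pT w0; have [sT_ hT] := pT; elim: n => [|n IH]; first by rewrite !big_ord0 bop0 ip0l mul0r.
rewrite !big_ord_recr /=; case: n IH => [|n] IH.
  by rewrite !big_ord0 !add0r mulrA divff ?gt_eqF// mul1r.
set x := \sum_(i < n.+1) z i in IH *; set W := \sum_(i < n.+1) w i in IH *; set F := \sum_(i < n.+1) _ in IH *.
have Wp : 0 < W by rewrite /W big_ord_recr /= ltr_wpDl// sumr_ge0// => i _; exact: ltW.
set y := z n.+1; set v := w n.+1; have vp : 0 < v by exact: w0.
have h := hT (v%:C *: x - W%:C *: y).
have yx : ip (T y) x = ip (T x) y by rewrite (sa_ip _ _ sT_) ipC.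
rewrite bopB !bopZ !ipBl !ipBr !ipZl !ipZr yx in h.
rewrite bopD !ipDl !ipDr yx.
set fx := ip (T x) x in IH h *; set fy := ip (T y) y in h *; set fxy := ip (T x) y in h *.
have k : (2 * fxy) <= (v / W) * fx + (W / v) * fy.
  rewrite -(ler_pM2l (mulr_gt0 vp Wp)).
  have -> : v * W * (v / W * fx + W / v * fy) = v * (v * fx) + W * (W * fy) by field; rewrite !gt_eqF.
  lra.
have k2 : (1 + v / W) * fx <= (1 + v / W) * (W * F).
  by rewrite ler_wpM2l// addr_ge0// divr_ge0// ltW.
have e : (W + v) * (F + v^-1 * fy) = (1 + v / W) * (W * F) + (1 + W / v) * fy by field; rewrite !gt_eqF.
rewrite e; lra.
Qed.

(** A discrete form of the bound of trace (d b) by the integral of mu(b) over (0, s): b is peeled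
    off at the levels g(2^-i s), and the layer number i is paired with a projection of trace at most
    2^(1-i) s, or with d when i = 0. *)
Lemma tr_proj_pair_le d b (s : R) : inM A d -> proj d -> inM A b -> psd b -> (tr d <= s%:E)%E -> 
  forall (K : R) (g : R -> R) m, 0 <= K -> ole b (K *: one) -> (forall t, 0 <= g t) -> 0 < s ->
  (forall t, 0 < t -> (tr (pp (b - g t *: one)%R) <= t%:E)%E) ->
  (pairing d b <= (s * (2 * (\sum_(i < m.+1) 2^-1 ^+ i * g (2^-1 ^+ i * s)) + K * 2^-1 ^+ m))%R%:E)%E.
Proof.
move=> Md pd Mb pb ds K g m K0 bK g0 s0 hg.
pose h i : R := 2^-1 ^+ i; have h0 i : 0 < h i by rewrite exprn_gt0// invr_gt0.
pose p i := pp (b - g (h i * s) *: one).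
have sbg i : sa (b - g (h i * s) *: one) by apply: saB; [exact: pb.1|exact/saZ/sa1].
have hp i := pp_spec (sbg i); have pp_ i : proj (p i) by case: (hp i).
have Mp i : inM A (p i) by apply: inM_pp => //; apply: inMB => //; exact: inMZ.
have bp i : b * p i = p i * b.
  by have [_ c _ _ _] := hp i; apply: c; rewrite mulrBr mulrBl scAr scAl mulr1 mul1r.
have pcom i j : p i * p j = p j * p i.
  by have [_ c _ _ _] := hp j; apply: c; rewrite mulrBr mulrBl scAr scAl mulr1 mul1r -bp.
(* Products of the commuting cut projections are nested by construction, and [r k.+1] inherits the
   trace bound of [p k]. *)
pose r := fix r n := if n is k.+1 then r k * p k else 1.
have rS k : r k.+1 = r k * p k by [].
have hr k : [/\ inM A (r k), proj (r k), b * r k = r k * b & forall j, p j * r k = r k * p j].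
  elim: k => [|k [k1 k2 k3 k4]]; first by split; [|exact: proj1|rewrite mulr1 mul1r|move=> j; rewrite mulr1 mul1r].
  rewrite rS; split; [exact: inMM|by apply: proj_commM => //; rewrite k4|by rewrite mulrA k3 -mulrA bp mulrA|].
  by move=> j; rewrite mulrA k4 -mulrA pcom mulrA.
have prk k : proj (r k) by case: (hr k).
have Mr k : inM A (r k) by case: (hr k).
have step i : ole (b * r i) (g (h i * s) *: r i + b * r i.+1).
  have [Mri pri bri pir] := hr i; have [_ _ _ kp _] := hp i.
  have -> : g (h i * s) *: r i + b * r i.+1 = b * r i + (g (h i * s) *: (r i * (1 - p i)) - (b * (r i * (1 - p i)))) + g (h i * s) *: (r i * p i).
    by rewrite !mulrBr mulr1 scalerBr rS; exact: addr_telescope.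
  rewrite /ole addrAC [_ + _ - _]addrAC subrr add0r.
  have pq : proj (r i * (1 - p i)).
    by apply: proj_commM => //; [exact: projC|rewrite mulrBr mulrBl mulr1 mul1r pir].
  apply: psdD; last by apply: psdZ => //; apply: proj_psd; rewrite -rS.
  set q := r i * (1 - p i) in pq *; have bq : b * q = q * b.
    by rewrite /q mulrA bri -!mulrA mulrBr mulrBl mulr1 mul1r bp.
  have -> : b * q = q * b * q by rewrite -bq -mulrA pq.2.
  apply: oleP => [||u]; [exact: (psd_conjsa pb pq.1).1|exact/saZ/pq.1|].
  have qk : p i (q u) = 0.
    by rewrite -mulE /q mulrA pir -mulrA (projeC (pp_ i)) mulr0 zeroE.
  have := kp _ qk; rewrite subE ipBl scaleE oneE ipZl subr_le0 => hh.
  by rewrite !mulE (sa_ip _ _ pq.1) scaleE ipZl proj_ip.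
have sumb k : ole b (\sum_(i < k) g (h i * s) *: r i + b * r k).
  elim: k => [|k IH]; first by rewrite big_ord0 add0r mulr1 /ole subrr; exact: psd0.
  apply: ole_trans IH _; rewrite big_ord_recr /= -addrA; apply: oleD; first by rewrite /ole subrr; exact: psd0.
  exact: step.
have trr k : (tr (r k.+1) <= (h k * s)%:E)%E.
  have [k1 k2 k3 k4] := hr k.+1; have hks : 0 < h k * s by rewrite mulr_gt0.
  apply: le_trans (hg _ hks); apply: tr_mono => //; [exact: proj_psd|exact: Mp|].
  by apply/(proj_oleP (prk k.+1) (pp_ k)); rewrite k4 rS -mulrA (pp_ k).2.
have e1 : (pairing d b <= pairing d (\sum_(i < m.+1) g (h i * s) *: r i + b * r m.+1))%E.
  have [k1 k2 k3 k4] := hr m.+1; have dp := proj_psd pd.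
  apply: pairing_mono => //.
  by apply: inMD; [apply: inM_sum => i _; exact: inMZ|exact: inMM].
apply: le_trans e1 _.
have [k1 k2 k3 k4] := hr m.+1; have dp := proj_psd pd.
have pbr : psd (b * r m.+1).
  have -> : b * r m.+1 = r m.+1 * b * r m.+1 by rewrite -k3 -mulrA k2.2.
  by apply: psd_conjsa => //; exact: k2.1.
have le0 (i : 'I_m.+1) : inM A (g (h i * s) *: r i) /\ psd (g (h i * s) *: r i).
  by split; [exact: inMZ|apply: psdZ => //; exact: proj_psd].
rewrite pairingDr//; last 3 first.
- by apply: inM_sum => i _; case: (le0 i).
- by apply: psd_sum => i _; case: (le0 i).
- exact: inMM.
rewrite pairing_sumr// mulrDr EFinD; apply: leeD; last first.
  have brK : ole (b * r m.+1) (K *: r m.+1).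
    have -> : b * r m.+1 = r m.+1 * b * r m.+1 by rewrite -k3 -mulrA k2.2.
    have -> : K *: r m.+1 = r m.+1 * (K *: one) * r m.+1 by rewrite scAr mulr1 scAl k2.2.
    by apply: ole_conjsa => //; exact: k2.1.
  apply: (@le_trans _ _ (pairing d (K *: r m.+1))).
    by apply: pairing_mono => //; [exact: inMM|exact: inMZ].
  rewrite pairingZr//; last exact: proj_psd.
  have h1 : (pairing d (r m.+1) <= (h m * s)%:E)%E.
    rewrite pairingC//; last exact: proj_psd.
    apply: le_trans (trr m); apply: pairing_le_tr => //; [exact: proj_psd|exact: proj_le1].
  have -> : s * (K * 2^-1 ^+ m) = K * (h m * s) by rewrite /h; ring.
  by rewrite EFinM; apply: lee_wpmul2l => //; rewrite lee_fin.
rewrite mulrCA mulr_sumr mulr_sumr -sumEFin; apply: lee_sum => i _.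
rewrite pairingZr//; last exact: proj_psd.
have h1 : (pairing d (r i) <= (2 * (h i * s))%:E)%E.
  case: (nat_of_ord i) => [|j].
    by rewrite pairing1//; apply: le_trans ds _; rewrite lee_fin /h expr0 mul1r; lra.
  rewrite pairingC//; last exact: proj_psd.
  have -> : 2 * (h j.+1 * s) = h j * s by rewrite /h exprS; field.
  apply: le_trans (trr j); apply: pairing_le_tr => //; [exact: proj_psd|exact: proj_le1].
apply: le_trans (_ : _ <= (g (h i * s))%:E * (2 * (h i * s))%:E)%E _; first by apply: lee_wpmul2l; rewrite ?lee_fin.
by rewrite -EFinM lee_fin /h le_eqVlt; apply/orP; left; apply/eqP; ring.
Qed.

(** On the range of Q j every E_k(e) is at most 2^-j, but the d j need not commute with E_k(e).
    [form_CS] with weights rho^-j decouples them, which multiplies 2^-j by rho^j and costs the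
    geometric sum (1 - rho^-1)^-1. *)
Lemma levels (e : bop) (t rho : R) n m : inM A e -> proj e -> (tr e <= t%:E)%E -> 0 < t -> 1 < rho ->
  exists (d : nat -> bop) (Q : bop), [/\ forall j, inM A (d j) /\ proj (d j), inM A Q /\ proj Q,
    forall j, (tr (d j) <= (2 ^+ j.+2 * t)%:E)%E &
    forall k, (k < n)%N -> ole (E k e) ((1 - rho^-1)^-1 *:
      (\sum_(j < m) (rho / 2) ^+ j *: d j + (rho / 2) ^+ m *: Q))].
Proof.
move=> Me pe te t0 rho1; have pse := proj_psd pe; have te0 := tr_ge0 Me pse.
have l0 j : 0 < (2^-1 : R) ^+ j by rewrite exprn_gt0// invr_gt0.
have [q hq] := choice (fun j => @cuculescu e (2^-1 ^+ j) n Me pse (l0 j)).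
have Mq j : inM A (q j) by case: (hq j) => [h _ _ _]; exact: NM h.
have pq j : proj (q j) by case: (hq j).
have tq j : (tr (1 - q j) <= (2 ^+ j * t)%:E)%E.
  have [_ _ _ h] := hq j.
  have h2 : ((2^-1 ^+ j)%:E * tr (1 - q j) <= t%:E)%E.
    apply: le_trans h _; apply: le_trans te; rewrite pairingC//; last 2 first.
    - exact: inMB.
    - exact/proj_psd/projC.
    apply: pairing_le_tr => //; [exact: inMB|exact/proj_psd/projC|exact/proj_le1/projC].
  have : ((2 ^+ j)%:E * ((2^-1 ^+ j)%:E * tr (1 - q j)) <= (2 ^+ j)%:E * t%:E)%E.
    by apply: lee_wpmul2l => //; rewrite lee_fin exprn_ge0.
  by rewrite muleA -!EFinM exprVn mulfV ?expf_neq0// mul1e.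
(* Q starts at 1 because E_k(e) <= 1 is already the bound of level 2^0. *)
pose Q := fix Q j := if j is i.+1 then pmeet dot (Q i) (q i.+1) else 1.
have QS j : Q j.+1 = pmeet dot (Q j) (q j.+1) by [].
have pQ j : proj (Q j) by case: j => [|j]; [exact: proj1|exact: pmeet_proj].
have MQ j : inM A (Q j) by elim: j => [|j IH] //; rewrite QS; exact: inM_pmeet.
have tQ j : (tr (1 - Q j) <= (2 ^+ j.+1 * t)%:E)%E.
  elim: j => [|j IH].
    by rewrite /= subrr tr0 lee_fin mulr_ge0// ltW.
  rewrite QS; apply: le_trans (tr_pmeet (MQ j) (pQ j) (Mq j.+1) (pq j.+1)) _.
  apply: le_trans (leeD IH (tq j.+1)) _; rewrite -EFinD lee_fin [2 ^+ j.+2]exprS; have := exprn_ge0 j.+1 (ler0n R 2); nra.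
have Qle j : ole (Q j.+1) (Q j) by apply: proj_ole_fix => // u; rewrite QS => /pmeetE[].
pose d j := Q j - Q j.+1.
have pd j : proj (d j) by exact: proj_oleB.
have Md j : inM A (d j) by exact: inMB.
exists d, (Q m); split=> //.
  move=> j; apply: le_trans (tQ j.+1); apply: tr_mono; [exact: Md|exact: proj_psd|exact: inMB|].
  apply: oleD; last by rewrite /ole subrr; exact: psd0.
  exact: proj_le1.
move=> k kn; have MT := inM_ce (NM (k := k)) (hE k) Me; have pT := ce_psd (hE k) Me pse; set T := E k e in MT pT *.
have T1 : ole T 1 by have := ce_mono (NM (k := k)) (hE k) Me M1 (proj_le1 pe); rewrite (ce1 (NM (k := k)) (hE k)).
have QT j u : Q j u = u -> ip (T u) u <= 2^-1 ^+ j * nq u.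
  case: j => [_|j]; first by rewrite expr0 mul1r; have := ole_ip u T1; rewrite oneE.
  by rewrite QS => /pmeetE[_ h]; have [_ _ hk _] := hq j.+1; exact: hk.
have dQ j u : d j u = u -> Q j u = u.
  move=> h; rewrite -h -mulE /d mulrBr (pQ j).2; congr (bf (_ - _) u).
  by apply/(proj_oleP (pQ j.+1) (pQ j)).
pose z u j := if (j < m)%N then d j u else Q m u.
have zE u : \sum_(j < m.+1) z u j = u.
  rewrite big_ord_recr /= /z ltnn (eq_bigr (fun j : 'I_m => d j u)); last by move=> j _; rewrite ltn_ord.
  have s i : \sum_(j < i) d j u + Q i u = u.
    elim: i => [|i IH]; first by rewrite big_ord0 add0r.
    by rewrite big_ord_recr /= -addrA subrK.
  exact: s.
have zT u j : (j <= m)%N -> ip (T (z u j)) (z u j) <= 2^-1 ^+ j * nq (z u j).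
  rewrite /z leq_eqVlt => /orP[/eqP->|jm]; first by rewrite ltnn; apply: QT; exact: (proj_fix u (pQ m)).
  by rewrite jm; apply: QT; apply: dQ; exact: (proj_fix u (pd j)).
have rho0 : 0 < rho by rewrite (lt_trans ltr01).
have c0 : 0 < 1 - rho^-1 by rewrite subr_gt0 invf_lt1.
have geo i : \sum_(j < i) rho^-1 ^+ j <= (1 - rho^-1)^-1.
  have h1 : (1 - rho^-1) * \sum_(j < i) rho^-1 ^+ j = 1 - rho^-1 ^+ i by rewrite -[LHS]opprK -mulNr opprB -subrX1 opprB.
  by rewrite -(ler_pM2l c0) h1 mulfV ?gt_eqF// gerBl exprn_ge0// invr_ge0 ltW.
have w0 j : 0 < rho^-1 ^+ j by rewrite exprn_gt0// invr_gt0.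
have psum : psd (\sum_(j < m) (rho / 2) ^+ j *: d j + (rho / 2) ^+ m *: Q m).
  have r2 i : 0 <= (rho / 2) ^+ i by rewrite exprn_ge0// divr_ge0// ltW.
  by apply: psdD; [apply: psd_sum => j _|]; apply: psdZ => //; exact: proj_psd.
apply: oleP => [||u]; [exact: pT.1|by apply: saZ; exact: psum.1|].
rewrite -{1 2}(zE u); apply: le_trans (form_CS _ _ pT w0) _.
rewrite scaleE ipZl; apply: ler_pM.
- by apply: sumr_ge0 => j _; exact: ltW.
- by apply: sumr_ge0 => j _; apply: mulr_ge0; [rewrite invr_ge0 ltW|exact: pT.2].
- exact: geo.
have F j : (j <= m)%N -> (rho^-1 ^+ j)^-1 * ip (T (z u j)) (z u j) <= (rho / 2) ^+ j * nq (z u j).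
  move=> jm; have -> : (rho / 2) ^+ j * nq (z u j) = (rho^-1 ^+ j)^-1 * (2^-1 ^+ j * nq (z u j)).
    by rewrite exprMn exprVn invrK mulrA.
  by apply: ler_wpM2l; [rewrite invr_ge0 ltW|exact: zT].
rewrite addE sumE ipDl (big_ord_recr m); apply: lerD; last first.
  rewrite scaleE ipZl (proj_ip u (pQ m)); apply: le_trans (F m (leqnn m)) _.
  by rewrite /z ltnn.
have ip_sum (I : finType) (f : I -> H) : ip (\sum_(i in I) f i) u = \sum_(i in I) ip (f i) u.
  by apply: (big_morph (fun x => ip x u)) => [x y|]; [rewrite ipDl|rewrite ip0l].
rewrite ip_sum; apply: ler_sum => j _.
rewrite scaleE ipZl (proj_ip u (pd j)); apply: le_trans (F j (ltnW (ltn_ord j))) _.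
by rewrite /z ltn_ord.
Qed.

(** The weight (rho / 2)^j of [levels] times the trace 2^(j+2) t is 4 rho^j t, and [tr_proj_pair_le]
    contributes a factor 2: hence 8. *)
Definition hardy (rho : R) (m : nat) (g : R -> R) (t : R) : R :=
  8 * (1 - rho^-1)^-1 * \sum_(j < m) \sum_(i < m.+1) rho ^+ j * 2^-1 ^+ i * g (2^-1 ^+ i * (2 ^+ j.+2 * t)).

(** m levels and l + 1 layers are kept. The two remainders are controlled by the norm bound K and
    the trace bound L of B, which is why B is bounded and of finite trace at this stage. *)
Lemma doob_step (n : nat) (x : nat -> bop) (e : bop) (v t K rho L : R) (g : R -> R) m l : 1 < rho -> rho < 2 ->
  (forall k, inM A (x k) /\ psd (x k)) -> inM A e -> proj e -> 0 <= v -> 0 < t -> tr e = t%:E ->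
  (forall u, e u = u -> v * nq u <= ip ((\sum_(k < n) E k (x k)) u) u) ->
  let B := \sum_(k < n) x k in
  0 <= K -> ole B (K *: one) -> 0 <= L -> (tr B <= L%:E)%E -> (forall s, 0 <= g s) ->
  (forall s, 0 < s -> (tr (pp (B - g s *: one)%R) <= s%:E)%E) ->
  v * t <= (1 - rho^-1)^-1 * (\sum_(j < m) (rho / 2) ^+ j * (2 ^+ j.+2 * t * (2 * (\sum_(i < l.+1) 2^-1 ^+ i * g (2^-1 ^+ i * (2 ^+ j.+2 * t))) + K * 2^-1 ^+ l)) + (rho / 2) ^+ m * L).
Proof.
move=> rho1 rho2 hx Me pe v0 t0 te ev B K0 BK L0 BL g0 hg.
have pse := proj_psd pe; have MB : inM A B by apply: inM_sum => k _; case: (hx k).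
have pB : psd B by apply: psd_sum => k _; case: (hx k).
have hEx k : inM A (E k (x k)) /\ psd (E k (x k)).
  by have [h1 h2] := hx k; split; [exact: (inM_ce (NM (k := k)) (hE k))|exact: (ce_psd (hE k))].
have te' : (tr e <= t%:E)%E by rewrite te.
have [d [Q [hd [MQ pQ] td hT]]] := levels n m Me pe te' t0 rho1.
have c0 : 0 < (1 - rho^-1)^-1 by rewrite invr_gt0 subr_gt0 invf_lt1// (lt_trans ltr01).
have r0 i : 0 <= (rho / 2) ^+ i by rewrite exprn_ge0// divr_ge0// (le_trans ler01)// ltW.
set Z := (_ *: _) in hT; set C := (1 - rho^-1)^-1 in c0 Z hT *.
pose Z0 := \sum_(j < m) (rho / 2) ^+ j *: d j + (rho / 2) ^+ m *: Q.
have hdj (j : 'I_m) : inM A ((rho / 2) ^+ j *: d j) /\ psd ((rho / 2) ^+ j *: d j).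
  by have [h1 h2] := hd j; split; [exact: inMZ|apply: psdZ => //; exact: proj_psd].
have MS : inM A (\sum_(j < m) (rho / 2) ^+ j *: d j) by apply: inM_sum => j _; case: (hdj j).
have pS : psd (\sum_(j < m) (rho / 2) ^+ j *: d j) by apply: psd_sum => j _; case: (hdj j).
have pQ' : psd ((rho / 2) ^+ m *: Q) by apply: psdZ => //; exact: proj_psd.
have MQ' : inM A ((rho / 2) ^+ m *: Q) by exact: inMZ.
have MZ0 : inM A Z0 by exact: inMD.
have pZ0 : psd Z0 by exact: psdD.
have MZ : inM A Z by exact: inMZ.
have pZ : psd Z by apply: psdZ => //; exact: ltW.
have s1 : ((v * t)%:E <= pairing e (\sum_(k < n) E k (x k)))%E.
  rewrite pairing_proj// EFinM -te -trZ//; apply: tr_mono; [exact: inMZ|exact: psdZ| |].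
    by apply: inMM => //; apply: inMM => //; apply: inM_sum => k _; case: (hEx k).
  have pA : psd (\sum_(k < n) E k (x k)) by apply: psd_sum => k _; case: (hEx k).
  apply: oleP => [||u]; [exact/saZ/pe.1|exact: (psd_conjsa pA pe.1).1|].
  rewrite scaleE ipZl (proj_ip u pe) !mulE (sa_ip _ _ pe.1); apply: ev; exact: (proj_fix u pe).
have s2 : (pairing e (\sum_(k < n) E k (x k)) <= pairing Z B)%E.
  rewrite pairing_sumr//.
  rewrite (pairing_sumr _ _ (F := fun k : 'I_n => x k))//; apply: lee_sum => k _.
  have [h1 h2] := hx k; rewrite (pairing_ce (NM (k := k)) (hE k))//.
  apply: pairing_monol => //; [exact: (inM_ce (NM (k := k)) (hE k))|exact: (ce_psd (hE k))|].
  by apply: hT; exact: ltn_ord.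
rewrite -lee_fin; apply: le_trans s1 _; apply: le_trans s2 _.
rewrite pairingC// /Z (pairingZr (ltW c0))// EFinM; apply: lee_wpmul2l; first by rewrite lee_fin ltW.
rewrite pairingDr// EFinD; apply: leeD.
  rewrite pairing_sumr// -sumEFin; apply: lee_sum => j _; have [h1 h2] := hd j.
  rewrite pairingZr//; last exact: proj_psd.
  rewrite EFinM; apply: lee_wpmul2l; first by rewrite lee_fin.
  rewrite pairingC//; last exact: proj_psd.
  apply: (tr_proj_pair_le h1 h2 MB pB (td j) _ K0 BK g0 _ hg).
  by rewrite mulr_gt0// exprn_gt0.
rewrite pairingZr//; last exact: proj_psd.
rewrite EFinM; apply: lee_wpmul2l; first by rewrite lee_fin.
by apply: le_trans BL; apply: pairing_le_tr => //; [exact: proj_psd|exact: proj_le1].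
Qed.

(** If the trace t of the spectral projection exceeded t0, then [doob_step] would bound V' t by t
    times the Hardy operator at t, plus remainders. That operator is at most V at t, as it is at t0,
    because g decreases; the gap V' - V absorbs the remainders. *)
Theorem dual_doob (n : nat) (x : nat -> bop) (t0 rho V V' : R) (g : R -> R) : 1 < rho -> rho < 2 ->
  (forall k, inM A (x k) /\ psd (x k)) -> (forall k, (tr (x k) < +oo)%E) ->
  let B := \sum_(k < n) x k in
  (forall s, 0 <= g s) -> (forall s t, 0 < s -> s <= t -> g t <= g s) ->
  (forall s, 0 < s -> (tr (pp (B - g s *: one)%R) <= s%:E)%E) ->
  0 < t0 -> 0 <= V -> (forall m, hardy rho m g t0 <= V) -> V < V' ->
  (tr (pp (\sum_(k < n) E k (x k) - V' *: one)%R) <= t0%:E)%E.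
Proof.
move=> rho1 rho2 hx trx B g0 gdec hg t00 V0 hV VV.
have hEx k : inM A (E k (x k)) /\ psd (E k (x k)).
  by have [h1 h2] := hx k; split; [exact: (inM_ce (NM (k := k)) (hE k))|exact: (ce_psd (hE k))].
set S := \sum_(k < n) E k (x k).
have MS : inM A S by apply: inM_sum => k _; case: (hEx k).
have pS : psd S by apply: psd_sum => k _; case: (hEx k).
have sS : sa (S - V' *: one) by apply: saB; [exact: pS.1|exact/saZ/sa1].
have [pe _ hge _ _] := pp_spec sS; set e := pp (S - V' *: one) in pe hge *.
have Me : inM A e by apply: inM_pp => //; apply: inMB => //; exact: inMZ.
have V'0 : 0 < V' by rewrite (le_lt_trans V0).
have ev u : e u = u -> V' * nq u <= ip (S u) u.
  by move=> /hge; rewrite subE ipBl scaleE oneE ipZl subr_ge0.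
have finB : (tr B < +oo)%E.
  rewrite tr_sum; last by move=> k _; exact: hx.
  by apply: lte_sum_pinfty => k _; exact: trx.
have trS : tr S = tr B.
  rewrite /S /B !tr_sum; [|by move=> k _; exact: hx|by move=> k _; exact: hEx].
  by apply: eq_bigr => k _; have [h1 h2] := hx k; rewrite (ce_tr (hE k)).
have MB : inM A B by apply: inM_sum => k _; case: (hx k).
have pB : psd B by apply: psd_sum => k _; case: (hx k).
(* Chebyshev's inequality together with the preserved trace; it makes the trace of e finite, so that
   t is a real number. *)
have te1 : (V'%:E * tr e <= tr S)%E.
  rewrite -(trZ (ltW V'0))//; last exact: proj_psd.
  apply: (@le_trans _ _ (tr (e * S * e))).
    apply: tr_mono; [exact: inMZ|by apply: psdZ; [exact: ltW|exact: proj_psd]|by apply: inMM => //; exact: inMM|].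
    apply: oleP => [||u]; [exact/saZ/pe.1|exact: (psd_conjsa pS pe.1).1|].
    by rewrite scaleE ipZl (proj_ip u pe) !mulE (sa_ip _ _ pe.1); apply: ev; exact: (proj_fix u pe).
  rewrite -pairing_proj// pairingC//; last exact: proj_psd.
  by apply: pairing_le_tr => //; [exact: proj_psd|exact: proj_le1].
have e0 := tr_ge0 Me (proj_psd pe).
have B0 := tr_ge0 MB pB.
have fe : tr e \is a fin_num.
  rewrite ge0_fin_numE//; rewrite ltNge leye_eq; apply/negP => /eqP h.
  by move: te1; rewrite h trS gt0_muley ?lte_fin// leye_eq => /eqP h2; rewrite h2 in finB.
have fB : tr B \is a fin_num by rewrite ge0_fin_numE.
rewrite -(fineK fe) lee_fin; set t := fine (tr e) in fe *; have te : tr e = t%:E by rewrite /t fineK.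
rewrite leNgt; apply/negP => tt0; have tp : 0 < t := lt_trans t00 tt0.
have [K K0 BK] := psd_bounded pB.
pose L := fine (tr B); have BL : (tr B <= L%:E)%E by rewrite /L fineK.
have L0 : 0 <= L by exact: fine_ge0.
set C := (1 - rho^-1)^-1; have c0 : 0 < C by rewrite invr_gt0 subr_gt0 invf_lt1// (lt_trans ltr01).
have step m l := doob_step m l rho1 rho2 hx Me pe (ltW V'0) tp te ev K0 BK L0 BL g0 hg.
pose eta := V' - V; have eta0 : 0 < eta by rewrite subr_gt0.
(* First m, then l is chosen so large that the two remainders are small. *)
have q0 : 0 <= rho / 2 by rewrite divr_ge0// (le_trans ler01)// ltW.
have q1 : rho / 2 < 1 by rewrite ltr_pdivrMr// mul1r.
have ep : 0 < eta / 2 * t by rewrite mulr_gt0// divr_gt0.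
have [m hm] : exists m, C * ((rho / 2) ^+ m * L) < eta / 2 * t.
  have c : (C * L) * (rho / 2) ^+ m @[m --> \oo] --> (0 : R) by apply: cvg_geometric; rewrite ger0_norm.
  have [M hM] := cvg0_bound c ep.
  by exists M; have := hM M (leqnn M); congr (_ < _); ring.
pose S1 := \sum_(j < m) (rho / 2) ^+ j * (2 ^+ j.+2 * t).
have S10 : 0 <= S1 by apply: sumr_ge0 => j _; rewrite mulr_ge0 ?exprn_ge0// mulr_ge0 ?exprn_ge0// ltW.
have [l [ml hl]] : exists l, (m <= l)%N /\ C * (S1 * (K * 2^-1 ^+ l)) < eta / 2 * t.
  have c : (C * S1 * K) * 2^-1 ^+ l @[l --> \oo] --> (0 : R).
    by apply: cvg_geometric; rewrite ger0_norm ?invr_ge0// invf_lt1// ltr1n.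
  have [M hM] := cvg0_bound c ep.
  exists (maxn m M); split; first exact: leq_maxl.
  by have := hM _ (leq_maxr m M); congr (_ < _); ring.
have := step m l; rewrite -/C.
set X := \sum_(j < m) _ => hstep.
have XE : X = 8 * t * (\sum_(j < m) \sum_(i < l.+1) rho ^+ j * 2^-1 ^+ i * g (2^-1 ^+ i * (2 ^+ j.+2 * t))) + S1 * (K * 2^-1 ^+ l).
  rewrite /X /S1 mulr_suml mulr_sumr -big_split /=; apply: eq_bigr => j _.
  rewrite mulrDr mulrDr; congr (_ + _); last by ring.
  rewrite !mulr_sumr; apply: eq_bigr => i _; rewrite exprMn !exprVn !exprS.
  by field; rewrite !expf_neq0.
have le1 : 8 * C * (\sum_(j < m) \sum_(i < l.+1) rho ^+ j * 2^-1 ^+ i * g (2^-1 ^+ i * (2 ^+ j.+2 * t))) <= V.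
  apply: le_trans (hV l); rewrite /hardy -/C; apply: ler_wpM2l; first by rewrite mulr_ge0// ltW.
  have term0 j i s : 0 <= rho ^+ j * 2^-1 ^+ i * g s.
    by rewrite !mulr_ge0 ?exprn_ge0 ?invr_ge0// (le_trans ler01)// ltW.
  apply: (@le_trans _ _ (\sum_(j < m) \sum_(i < l.+1) rho ^+ j * 2^-1 ^+ i * g (2^-1 ^+ i * (2 ^+ j.+2 * t0)))).
    apply: ler_sum => j _; apply: ler_sum => i _; apply: ler_wpM2l.
      by rewrite mulr_ge0 ?exprn_ge0 ?invr_ge0// (le_trans ler01)// ltW.
    apply: gdec; first by apply: mulr_gt0; [rewrite exprn_gt0// invr_gt0|apply: mulr_gt0 => //; rewrite exprn_gt0].
    apply: ler_wpM2l; first by rewrite exprn_ge0// invr_ge0.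
    by apply: ler_wpM2l; [exact: exprn_ge0|exact: ltW].
  rewrite -(big_mkord xpredT (fun j => \sum_(i < l.+1) rho ^+ j * 2^-1 ^+ i * g (2^-1 ^+ i * (2 ^+ j.+2 * t0)))).
  rewrite -(big_mkord xpredT (fun j => \sum_(i < l.+1) rho ^+ j * 2^-1 ^+ i * g (2^-1 ^+ i * (2 ^+ j.+2 * t0)))).
  rewrite [leRHS](big_cat_nat _ (n := m))//= lerDl; apply: sumr_ge0 => j _; exact: sumr_ge0.
move: hstep; rewrite XE => hstep.
have : V' * t < V * t + eta * t; last by rewrite -mulrDl /eta addrC subrK ltxx.
apply: le_lt_trans hstep _; rewrite !mulrDr.
have -> : C * (8 * t * (\sum_(j < m) \sum_(i < l.+1) rho ^+ j * 2^-1 ^+ i * g (2^-1 ^+ i * (2 ^+ j.+2 * t)))) =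
  (8 * C * (\sum_(j < m) \sum_(i < l.+1) rho ^+ j * 2^-1 ^+ i * g (2^-1 ^+ i * (2 ^+ j.+2 * t)))) * t by ring.
have := ler_wpM2r (ltW tp) le1; set Y := _ * t => hY.
have e2 : eta * t = eta / 2 * t + eta / 2 * t by field.
lra.
Qed.
End Doob.

(** * Symmetric function spaces *)

Section Decreasing.
Variable R : realType.
Implicit Types (f g h : R -> R) (t s v : R).
Local Notation leb := (@lebesgue_measure R).

Lemma lebU2 (A B : set R) : measurable A -> measurable B -> (leb (A `|` B)%R <= leb A + leb B)%E.
Proof. by move=> mA mB; exact: measureU2. Qed.
Lemma lebU0 (A : set R) : measurable A -> (leb (A `|` [set 0])%R <= leb A)%E.
Proof.
move=> mA; have m0 : measurable ([set 0] : set R) by exact: measurable_set1.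
by apply: le_trans (lebU2 mA m0) _; rewrite lebesgue_measure_set1 adde0.
Qed.

(** Monotone on ]0, +oo[ only: at 0 an infinite singular number is turned into a default real
    value. *)
Definition dec f := (forall t, 0 <= f t) /\ forall s t, 0 < s -> s <= t -> f t <= f s.

Lemma dec_measurable f : dec f -> measurable_fun (`[0%R, +oo[%classic : set R) f.
Proof.
move=> [f0 fd]; pose g := f \_ (`]0%R, +oo[%classic : set R).
have m0 : measurable (`]0%R, +oo[%classic : set R) by exact: measurable_itv.
have mf : measurable_fun (`]0%R, +oo[%classic : set R) f.
  apply: (measurability _ (RGenOInfty.measurableE R)) => _ [_ [v ->] <-].
  apply: is_interval_measurable => x y /= [hx fx] [hy fy] z /andP[xz zy].
  rewrite !in_itv /= !andbT in hx hy fx fy *.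
  have z0 : 0 < z by exact: lt_le_trans xz.
  by split=> //; apply: lt_le_trans fy _; apply: fd.
have -> : (`[0%R, +oo[%classic : set R) = [set 0] `|` `]0%R, +oo[%classic.
  apply/seteqP; split=> t /=; rewrite !in_itv /= !andbT.
    by move=> t0; have [->|tn0] := eqVneq t 0; [left|right; rewrite lt_neqAle eq_sym tn0].
  by move=> [->|/ltW].
by apply/measurable_funU => //; split => //; exact: measurable_fun_set1.
Qed.

Lemma measurable_super f v : measurable_fun (`[0%R, +oo[%classic : set R) f -> measurable [set t | 0 <= t /\ v < `|f t|].
Proof.
move=> mf; have mg : measurable_fun (`[0%R, +oo[%classic : set R) (fun t => `|f t|).
  by apply: measurableT_comp => //; exact: measurable_normr.
rewrite (_ : [set t | _] = `[0%R, +oo[%classic `&` (fun t => `|f t|) @^-1` `]v, +oo[%classic).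
  by apply: mg; exact: measurable_itv.
by apply/seteqP; split=> t /=; rewrite !in_itv /= !andbT.
Qed.
Lemma rearr_dist (d d' : R -> \bar R) t : (forall v, 0 < v -> (d v <= d' v)%E) ->
  (rearrangement d t <= rearrangement d' t)%E.
Proof.
move=> h; apply: ereal_inf_le_tmp => _ [v [v0 hv] <-]; exists v => //; split=> //.
by apply: le_trans hv; exact: h.
Qed.

Lemma dec_super f v t : dec f -> 0 < t -> v < f t -> (t%:E <= fun_dist f v)%E.
Proof.
move=> fd t0 h; have [f0 fdec] := fd; have := @lebesgue_measure_itv R `]0, t]; rewrite /= lte_fin t0 oppr0 adde0 => <-.
apply: le_measure; rewrite ?inE; [exact: measurable_itv|apply: measurable_super; exact: dec_measurable|].
move=> s /=; rewrite in_itv /= => /andP[s0 st]; split; first exact: ltW.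
by rewrite ger0_norm//; apply: lt_le_trans h _; exact: fdec.
Qed.
Lemma dec_sub f v (L : R) : dec f -> (fun_dist f v <= L%:E)%E -> forall t, 0 < t -> v < f t -> t <= L.
Proof. by move=> fd h t t0 vt; rewrite -lee_fin; apply: le_trans h; exact: dec_super. Qed.
Lemma leb_itv0 (L : R) : 0 <= L -> leb `[0, L]%classic = L%:E.
Proof.
move=> L0; rewrite lebesgue_measure_itv /= lte_fin; case: ltP => [_|h]; first by rewrite oppr0 adde0.
by congr (_%:E); apply/eqP; rewrite eq_le L0 h.
Qed.
Lemma fun_dist_le f v (L : R) : 0 <= L -> measurable_fun (`[0%R, +oo[%classic : set R) f ->
  (forall t, 0 < t -> v < `|f t| -> t <= L) -> (fun_dist f v <= L%:E)%E.
Proof.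
move=> L0 mf h; rewrite -(leb_itv0 L0); apply: le_measure; rewrite ?inE; [exact: measurable_super|exact: measurable_itv|].
move=> t [t0 vt] /=; rewrite in_itv /= t0 /=; have [->//|tn0] := eqVneq t 0.
by apply: h => //; rewrite lt_neqAle eq_sym tn0.
Qed.
Lemma fun_dist_ge0 f v : (0 <= fun_dist f v)%E. Proof. exact: measure_ge0. Qed.

Lemma leb_bigcup0 (F : nat -> set R) : (forall n, measurable (F n)) -> (forall n, leb (F n) = 0%E) ->
  leb (\bigcup_n F n) = 0%E.
Proof.
move=> mF F0; have mU : measurable (\bigcup_n F n) by apply: bigcup_measurable => n _; exact: mF.
apply: measure_negligible => //; apply: negligible_bigcup => n; exists (F n); split; [exact: mF|exact: F0|by []].
Qed.
Lemma dec_scale f a : 0 < a -> dec f -> dec (fun t => f (a * t)).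
Proof.
move=> a0 [f0 fd]; split=> // s t s0 st; apply: fd; first by rewrite mulr_gt0.
by rewrite ler_pM2l.
Qed.
Lemma decZ f c : 0 <= c -> dec f -> dec (fun t => c * f t).
Proof. by move=> c0 [f0 fd]; split=> [t|s t s0 st]; [rewrite mulr_ge0|rewrite ler_wpM2l// fd]. Qed.
Lemma decD f g : dec f -> dec g -> dec (fun t => f t + g t).
Proof. by move=> [f0 fd] [g0 gd]; split=> [t|s t s0 st]; [rewrite addr_ge0|rewrite lerD ?fd ?gd]. Qed.
Lemma dec_sum (f : nat -> R -> R) n : (forall i, dec (f i)) -> dec (fun t => \sum_(i < n) f i t).
Proof. by move=> h; split=> [t|s t s0 st]; [apply: sumr_ge0 => i _; exact: (h i).1|apply: ler_sum => i _; exact: (h i).2]. Qed.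
Definition ind t : R -> R := fun s => if s <= t then 1 else 0.
Lemma dec_ind t : dec (ind t).
Proof.
split=> [s|s u s0 su]; rewrite /ind; first by case: ifP.
case: (leP u t) => ut; last by case: ifP.
by rewrite (le_trans su ut).
Qed.

(* A = union of [2^k, 3/2 2^k): both A and its complement have density at most
   2/3 in every interval (0, L). *)
Definition halfset (b : bool) : set R := [set t | exists k : int, 2 ^ k <= t < 2 ^ (k + 1) /\ (t < 3 / 2 * 2 ^ k) = b].
Definition piece (b : bool) (k : int) : set R := if b then `[2 ^ k, 3 / 2 * 2 ^ k[%classic else `[3 / 2 * 2 ^ k, 2 * 2 ^ k[%classic.
Lemma pow2_gt0 (k : int) : 0 < (2 : R) ^ k. Proof. by rewrite exprz_gt0. Qed.
Lemma pow2S (k : int) : (2 : R) ^ (k + 1) = 2 * 2 ^ k.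
Proof. by rewrite exprzDr ?unitfE ?pnatr_eq0// expr1z; exact: mulrC. Qed.
Lemma halfsetE b : halfset b = \bigcup_(k in [set: int]) piece b k.
Proof.
apply/seteqP; split=> t /=.
  move=> [k [/andP[h1 h2] h3]]; exists k => //; rewrite pow2S in h2; rewrite /piece; case: b h3 => h3; rewrite /= in_itv /=.
    by rewrite h1 h3.
  by rewrite h2 andbT leNgt h3.
move=> [k _]; rewrite /piece; have := pow2_gt0 k => p0; case: b; rewrite /= in_itv /= => /andP[h1 h2]; exists k; rewrite pow2S.
  by split; [apply/andP; split=> //; lra|].
by split; [apply/andP; split=> //; lra|apply/negbTE; rewrite -leNgt].
Qed.
Lemma measurable_piece b k : measurable (piece b k).
Proof. by rewrite /piece; case: b; exact: measurable_itv. Qed.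
Lemma measurable_halfset b : measurable (halfset b).
Proof.
have -> : halfset b = (\bigcup_(n : nat) piece b n%:Z) `|` \bigcup_(n : nat) piece b (Negz n).
  rewrite halfsetE; apply/seteqP; split=> t /=.
    by move=> [[n|n] _ h]; [left|right]; exists n.
  by move=> [[n _ h]|[n _ h]]; [exists n%:Z|exists (Negz n)].
by apply: measurableU; apply: bigcup_measurable => n _; exact: measurable_piece.
Qed.
Lemma piece_bounds b k t : piece b k t -> 2 ^ k <= t < 2 ^ (k + 1).
Proof.
by rewrite pow2S /piece; have := pow2_gt0 k; case: b => ?; rewrite /= in_itv /= => /andP[h1 h2]; apply/andP; split; lra.
Qed.
Lemma leb_piece b k : leb (piece b k) = (2^-1 * 2 ^ k)%:E.
Proof.
have p0 := pow2_gt0 k; rewrite /piece; case: b; rewrite lebesgue_measure_itv /= lte_fin.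
  by rewrite ifT; [rewrite -EFinB; congr (_%:E); field|lra].
by rewrite ifT; [rewrite -EFinB; congr (_%:E); field|lra].
Qed.
Lemma floor2 t : 0 < t -> exists k : int, 2 ^ k <= t < 2 ^ (k + 1).
Proof.
move=> t0; pose n := Num.bound t; pose m := Num.bound t^-1.
have hn : t < 2 ^+ n.
  by apply: lt_trans (archi_boundP (ltW t0)) _; rewrite -natrX ltr_nat ltn_expl.
have hm : 2 ^- m < t.
  rewrite invf_plt ?posrE ?exprn_gt0//; apply: lt_trans (archi_boundP _) _; first by rewrite invr_ge0 ltW.
  by rewrite -natrX ltr_nat ltn_expl.
have ex : exists i : nat, t < 2 ^ ((i : int) - (m : int)).
  by exists (n + m)%N; rewrite PoszD addrK.
case: (ex_minnP ex) => -[|i] hi min.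
  by move: hi; rewrite sub0r -exprnN ltNge (ltW hm).
exists ((i : int) - (m : int)); rewrite (_ : _ + 1 = (i.+1 : int) - (m : int)) ?hi ?andbT; last by rewrite -addn1 PoszD; lia.
by rewrite leNgt; apply/negP => /min; rewrite ltnn.
Qed.
(** Below 2^k the set consists of half of [2^(k-1), 2^k) and of its part below 2^(k-1); n such steps
    leave the crude remainder 2^(k-n), sent to 0 in [halfset_pow]. *)
Lemma halfset_small b k (n : nat) : (leb (halfset b `&` `]0, 2 ^ k[)%R <= (2^-1 * 2 ^ k + 2 ^ (k - n%:Z))%R%:E)%E.
Proof.
have mk j : measurable (halfset b `&` `]0, 2 ^ j[) by apply: measurableI; [exact: measurable_halfset|exact: measurable_itv].
elim: n k => [|n IH] k.
  apply: (@le_trans _ _ (leb `]0, 2 ^ k[%classic)).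
    by apply: le_measure; rewrite ?inE; [exact: mk|exact: measurable_itv|move=> t []].
  rewrite lebesgue_measure_itv /= lte_fin pow2_gt0 oppr0 adde0 lee_fin subr0.
  by have := pow2_gt0 k; lra.
have e2 : (2 : R) ^ k = 2 * 2 ^ (k - 1) by rewrite -pow2S subrK.
have sub : halfset b `&` `]0, 2 ^ k[ `<=` (halfset b `&` `]0, 2 ^ (k - 1)[) `|` piece b (k - 1).
  move=> t [ht /=]; rewrite in_itv /= => /andP[t0 tk]; have ht' := ht; rewrite halfsetE in ht'; case: ht' => j _ hj.
  have [jk|jk] := ltP j (k - 1).
    left; split=> //; rewrite /= in_itv /= t0 /=.
    have t2 : t < 2 ^ (j + 1).
      by have /andP[] := piece_bounds hj.
    by apply: lt_le_trans t2 _; rewrite ler_eXz2l ?ltr1n//; lia.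
  right; suff -> : k - 1 = j by [].
  have h1 : 2 ^ j <= t.
    by have /andP[] := piece_bounds hj.
  have : (2 : R) ^ j < 2 ^ k by exact: le_lt_trans h1 tk.
  by rewrite ltr_eXz2l ?ltr1n//; lia.
apply: (@le_trans _ _ (leb ((halfset b `&` `]0, 2 ^ (k - 1)[) `|` piece b (k - 1)))).
  by apply: le_measure; rewrite ?inE; [exact: mk|apply: measurableU; [exact: mk|exact: measurable_piece]|].
have hU := lebU2 (mk (k - 1)) (measurable_piece b (k - 1)); apply: le_trans hU _.
rewrite leb_piece; apply: le_trans (leeD (IH (k - 1)) (lexx _)) _.
rewrite -EFinD lee_fin (_ : k - 1 - n%:Z = k - n.+1%:Z); last by lia.
by rewrite e2; lra.
Qed.
Lemma halfset_pow b k : (leb (halfset b `&` `]0, 2 ^ k[)%R <= (2^-1 * 2 ^ k)%R%:E)%E.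
Proof.
apply/lee_addgt0Pr => e e0; have [n hn] : exists n : nat, 2 ^ (k - n%:Z) <= e.
  have p0 := pow2_gt0 k; exists (Num.bound (2 ^ k / e)).
  have h := archi_boundP (divr_ge0 (ltW p0) (ltW e0)); set N := Num.bound _ in h *.
  rewrite exprzDr ?unitfE ?pnatr_eq0// -exprnN ler_pdivrMr ?exprn_gt0//.
  rewrite ltr_pdivrMr// in h; apply: ltW; apply: lt_trans h _; rewrite mulrC ltr_pM2l//.
  by rewrite -natrX ltr_nat ltn_expl.
by apply: le_trans (halfset_small b k n) _; rewrite -EFinD lee_fin lerD2l.
Qed.
(** The density is largest at L = 3/2 2^k for the lower halves, where a measure 2^k out of 3/2 2^k
    is filled: this is the origin of 2/3. *)
Lemma halfset_density b (L : R) : 0 <= L -> (leb (halfset b `&` `]0, L])%R <= (2 / 3 * L)%R%:E)%E.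
Proof.
rewrite le_eqVlt => /orP[/eqP <-|L0].
  by rewrite set_itv_ge ?bnd_simp ?ltxx// setI0 measure0 mulr0.
have mh := measurable_halfset b.
have [k /andP[k1 k2]] := floor2 L0; rewrite pow2S in k2; have p0 := pow2_gt0 k.
pose J := (if b then `[2 ^ k, Num.min L (3 / 2 * 2 ^ k)]%classic else `[3 / 2 * 2 ^ k, L]%classic) : set R.
have sub : halfset b `&` `]0, L] `<=` (halfset b `&` `]0, 2 ^ k[) `|` J.
  move=> t [ht /=]; rewrite in_itv /= => /andP[t0 tL]; have [tk|tk] := ltP t (2 ^ k).
    by left; split=> //; rewrite /= in_itv /= t0.
  right; have ht' := ht; rewrite halfsetE in ht'; case: ht' => j _ hj.
  have jk : j = k.
    have h1 : 2 ^ j <= t.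
      by have /andP[] := piece_bounds hj.
    have t2 : t < 2 ^ (j + 1).
      by have /andP[] := piece_bounds hj.
    have : (2 : R) ^ j < 2 ^ (k + 1) by rewrite pow2S; lra.
    have : (2 : R) ^ k < 2 ^ (j + 1) by lra.
    by rewrite !ltr_eXz2l ?ltr1n//; lia.
  rewrite jk in hj; move: hj; rewrite /piece /J; case: (b); rewrite /= !in_itv /= => /andP[h1 h2].
    by rewrite h1 le_min tL ltW.
  by rewrite h1 tL.
have mJ : measurable J by rewrite /J; case: (b); exact: measurable_itv.
have mk : measurable (halfset b `&` `]0, 2 ^ k[) by apply: measurableI => //; exact: measurable_itv.
apply: (@le_trans _ _ (leb ((halfset b `&` `]0, 2 ^ k[) `|` J))).
  apply: le_measure; rewrite ?inE//; last exact: measurableU.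
  by apply: measurableI => //; exact: measurable_itv.
have hU := lebU2 mk mJ; apply: le_trans hU _.
apply: le_trans (leeD (halfset_pow b k) (lexx _)) _.
rewrite /J; case: (b); rewrite lebesgue_measure_itv /= lte_fin.
  case: ltP => h; last by rewrite adde0 lee_fin; lra.
  rewrite -EFinB -EFinD lee_fin; have := ge_min L L (3 / 2 * 2 ^ k); have := ge_min (3 / 2 * 2 ^ k) L (3 / 2 * 2 ^ k).
  rewrite !lexx orbT /=; lra.
case: ltP => h; last by rewrite adde0 lee_fin; lra.
by rewrite -EFinB -EFinD lee_fin; lra.
Qed.
End Decreasing.

(** * Dilations in a symmetric space *)

Section SymSpace.
Variables (R : realType) (E : symmetricSpace R).
Implicit Types (f g h : R -> R) (t s v : R).
Local Notation leb := (@lebesgue_measure R).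
Local Notation qn := (qnorm E).
Local Notation car := (carrier E).
Local Notation mfun f := (measurable_fun (`[0%R, +oo[%classic : set R) f).

Lemma car_measurable f : car f -> mfun f. Proof. by move=> /carrier_S[]. Qed.
Lemma fun_dist_pos f g v : mfun f -> mfun g -> (forall t, 0 < t -> v < `|f t| -> v < `|g t|) ->
  (fun_dist f v <= fun_dist g v)%E.
Proof.
move=> mf mg h; have mF := measurable_super v mf; have mG := measurable_super v mg.
have m0 : measurable ([set 0] : set R) by exact: measurable_set1.
apply: le_trans (lebU0 mG); apply: le_measure; rewrite ?inE//; first exact: measurableU.
move=> t [t0 vt]; have [->|tn0] := eqVneq t 0; first by right.
by left; split=> //; apply: h => //; rewrite lt_neqAle eq_sym tn0.
Qed.
Lemma carrier_dist f g : mfun f -> car g -> (forall v, 0 < v -> (fun_dist f v <= fun_dist g v)%E) ->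
  car f /\ qn f <= qn g.
Proof.
move=> mf cg h; have [_ [v v0 hv]] := carrier_S cg; apply: qnorm_symm => //.
  by split=> //; exists v => //; apply: le_lt_trans hv; exact: h.
by move=> t _; exact: rearr_dist.
Qed.
Lemma carrier_le f g : mfun f -> car g -> (forall t, 0 < t -> `|f t| <= `|g t|) -> car f /\ qn f <= qn g.
Proof.
move=> mf cg h; apply: carrier_dist => // v v0; apply: fun_dist_pos => //; first exact: car_measurable.
by move=> t t0 /lt_le_trans; apply; exact: h.
Qed.
Lemma dec_le f g : dec f -> dec g -> car g -> (forall t, 0 < t -> f t <= g t) -> car f /\ qn f <= qn g.
Proof.
move=> df dg cg h; apply: carrier_le => //; first exact: dec_measurable.
by move=> t t0; rewrite !ger0_norm ?df.1 ?dg.1//; exact: h.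
Qed.

Lemma quasi_const : exists K, 1 <= K /\ forall f g, car f -> car g -> qn (fun t => f t + g t) <= K * (qn f + qn g).
Proof.
have [K hK] := qnormD E; exists (Num.max 1 K); split; first by rewrite le_max lexx.
move=> f g cf cg; apply: le_trans (hK _ _ cf cg) _.
by apply: ler_wpM2r; [rewrite addr_ge0// qnorm_ge0|rewrite le_max lexx orbT].
Qed.

(** Symmetry gives membership by comparing distributions. Restricted to either half set, the dilated
    g exceeds v on measure at most 2/3 (3/2 L) = L, where L is the measure on which g exceeds v; the
    two restrictions add up to the dilation. *)
Lemma carrier_dil23 g : dec g -> car g -> car (fun t => g (2 / 3 * t)).
Proof.
move=> dg cg; have dg' := dec_scale (_ : 0 < 2 / 3) dg.
have d' : dec (fun t => g (2 / 3 * t)) by apply: dg'; lra.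
have mh b := @measurable_halfset R b.
pose f b t : R := g (2 / 3 * t) * \1_(halfset b) t.
have mf b : mfun (f b).
  by apply: measurable_funM; [exact: dec_measurable|apply: measurable_funTS; exact: measurable_indic].
have cf b : car (f b).
  apply: (carrier_dist (mf b) cg _).1 => v v0.
  have [->|] := eqVneq (fun_dist g v) +oo%E; first exact: leey.
  rewrite -ltey => fin; have gv0 := fun_dist_ge0 g v.
  have fi : fun_dist g v \is a fin_num by rewrite ge0_fin_numE.
  pose L := fine (fun_dist g v); have LE : fun_dist g v = L%:E by rewrite /L fineK.
  have L0 : 0 <= L by exact: fine_ge0.
  have L30 : 0 <= 3 / 2 * L by rewrite mulr_ge0.
  have m1 : measurable (halfset b `&` `]0, 3 / 2 * L]) by apply: measurableI => //; exact: measurable_itv.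
  have m0 : measurable ([set 0] : set R) by exact: measurable_set1.
  have hU := lebU0 m1.
  rewrite LE; have := halfset_density b L30; rewrite (_ : 2 / 3 * (3 / 2 * L) = L); last by field.
  apply: le_trans; apply: le_trans hU; apply: le_measure; rewrite ?inE; [exact: measurable_super|exact: measurableU|].
  move=> t [t0 vt]; have [->|tn0] := eqVneq t 0; [by right|left].
  have tp : 0 < t by rewrite lt_neqAle eq_sym tn0.
  move: vt; rewrite /f indicE; case: (boolP (t \in halfset b)) => [|_]; last first.
    by rewrite mulr0 normr0 ltNge (ltW v0).
  rewrite inE mulr1 ger0_norm ?dg.1// => ht vt; split=> //; rewrite /= in_itv /= tp /=.
  have ge : (fun_dist g v <= L%:E)%E by rewrite LE.
  have := dec_sub dg ge (_ : 0 < 2 / 3 * t) vt; rewrite mulr_gt0//; lra.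
have cs := carrierD (cf true) (cf false).
apply: (carrier_le _ cs _).1; first exact: dec_measurable.
move=> t t0; rewrite ger0_norm ?dg.1// ger0_norm; last by rewrite addr_ge0// mulr_ge0 ?dg.1// indicE.
have [k hk] := floor2 t0; case: (boolP (t < 3 / 2 * 2 ^ k)) => hh.
  have -> : f true t = g (2 / 3 * t).
    by rewrite /f indicE mem_set ?mulr1//; exists k; rewrite hh.
  by rewrite lerDl mulr_ge0 ?dg.1// indicE.
have -> : f false t = g (2 / 3 * t).
  by rewrite /f indicE mem_set ?mulr1//; exists k; rewrite (negbTE hh).
by rewrite lerDr mulr_ge0 ?dg.1// indicE.
Qed.
Lemma carrier_dil a g : 0 < a -> dec g -> car g -> car (fun t => g (a * t)).
Proof.
move=> a0 dg cg.
have it n : car (fun t => g ((2 / 3) ^+ n * t)) /\ dec (fun t => g ((2 / 3) ^+ n * t)).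
  elim: n => [|n [IH1 IH2]].
    by rewrite (_ : (fun t => _) = g)//; apply/funext => t; rewrite expr0 mul1r.
  have e : (fun t => g ((2 / 3) ^+ n.+1 * t)) = (fun t => g ((2 / 3) ^+ n * (2 / 3 * t))).
    by apply/funext => t; rewrite exprSr -mulrA.
  rewrite e; split; first exact: (carrier_dil23 IH2 IH1).
  by apply: (dec_scale _ IH2); lra.
have [n hn] : exists n, (2 / 3) ^+ n <= a.
  have c : 1 * (2 / 3 : R) ^+ n @[n --> \oo] --> (0 : R) by apply: cvg_geometric; rewrite ger0_norm; lra.
  by have [N hN] := cvg0_bound c a0; exists N; have := hN N (leqnn N); rewrite mul1r => /ltW.
have [c d] := it n; apply: (dec_le (dec_scale a0 dg) d c _).1 => t t0.
by apply: dg.2; [rewrite mulr_gt0// exprn_gt0//; lra|rewrite ler_pM2r].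
Qed.

Definition dil_set a := [set qn (fun u => f (a * u)) | f in [set f | car f /\ qn f <= 1]].
(** [has_sup] is asked because an unbounded set has supremum 0 by convention; stability of the
    carrier comes from [carrier_dil]. *)
Lemma dil_norm_le a g : 0 < a -> has_sup (dil_set a) -> dec g -> car g ->
  qn (fun t => g (a * t)) <= dilation_norm E a * qn g.
Proof.
move=> a0 [ne ub] dg cg; have D : 0 <= dilation_norm E a.
  have c0 := carrier0 E; have q0 : qn (fun=> 0) = 0 by apply/(qnorm_eq0 c0); apply/aeW.
  by rewrite /dilation_norm -q0; apply: (ub_le_sup ub); exists (fun=> 0) => //; rewrite /= q0.
have ca := carrier_dil a0 dg cg; have qg := qnorm_ge0 cg.
(* Normalization is by c > qn g, since qn g itself may vanish. *)
have key c : qn g < c -> qn (fun t => g (a * t)) <= c * dilation_norm E a.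
  move=> qc; have c0 : 0 < c by exact: le_lt_trans qc.
  have ci : 0 <= c^-1 by rewrite invr_ge0 ltW.
  rewrite -ler_pdivrMl// -[c^-1](ger0_norm ci) -qnormZ//.
  apply: (ub_le_sup ub); exists (fun t => c^-1 * g t) => //; split; first exact: carrierZ.
  by rewrite qnormZ// (ger0_norm ci) ler_pdivrMl// mulr1 ltW.
apply/ler_addgt0Pr => e e0; have D1 : 0 < dilation_norm E a + 1 by rewrite ltr_wpDl.
have ed : 0 < e / (dilation_norm E a + 1) by rewrite divr_gt0.
apply: le_trans (key (qn g + e / (dilation_norm E a + 1)) _) _; first by rewrite ltrDl.
rewrite mulrDl mulrC lerD2l mulrAC ler_pdivrMr// ler_pM2l//; lra.
Qed.

(** * Consequences of the Boyd indices *)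

Section Boyd.
Hypotheses (p_gt1 : (1 < lower_boyd E)%E) (p_le_q : (lower_boyd E <= upper_boyd E)%E)
  (q_fin : (upper_boyd E < +oo)%E).
(** A divergent limit takes the default value 0, so a nonzero value proves convergence; bounds on
    the Boyd indices thus carry the existence of the limits. *)
Lemma lim_neq0_cvg T (F : set_system T) (FF : Filter F) (f : T -> \bar R) : lim (f x @[x --> F]) != 0%E -> 
  f x @[x --> F] --> lim (f x @[x --> F]).
Proof.
have [c|nc] := pselect (cvg (f x @[x --> F])) => //.
suff -> : lim (f x @[x --> F]) = 0%E by rewrite eqxx.
rewrite /lim_in; apply: xgetPN => l hl; apply: nc; apply/cvg_ex; by exists l.
Qed.
(** If the set were unbounded, its supremum would be 0 by default, the logarithm of 0 is 0, and the
    quotient would be +oo. *)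
Lemma has_sup_dil u : (boyd_quotient E u != +oo)%E -> has_sup (dil_set u^-1) /\ 0 < dilation_norm E u^-1.
Proof.
rewrite /boyd_quotient; case: ifP => // /negbT l0 _; split.
  apply: contrapT => h; move: l0; rewrite /dilation_norm (sup_out h) ln0 ?eqxx//.
by rewrite ltNge; apply/negP => h; move: l0; rewrite ln0 ?eqxx.
Qed.
(** At u = 2^i a quotient above r > 1 bounds the norm of the dilation by 2^-i by 2^(i/r), and
    2^(1/r) < 2. *)
Lemma boyd_p : exists rho i0, [/\ 1 < rho, rho < 2 & forall i, (i0 <= i)%N ->
  has_sup (dil_set (2^-1 ^+ i)) /\ dilation_norm E (2^-1 ^+ i) <= rho ^+ i].
Proof.
have c := @lim_neq0_cvg _ (pinfty_nbhs R) _ (boyd_quotient E); rewrite -/(lower_boyd E) in c.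
have p0 : (lower_boyd E != 0)%E by rewrite gt_eqF// (lt_trans _ p_gt1)// lte_fin.
have {}c : boyd_quotient E x @[x --> +oo%R] --> lower_boyd E by apply: c.
have fp : lower_boyd E \is a fin_num.
  by rewrite fin_numElt (lt_trans _ p_gt1) ?ltNyr//= (le_lt_trans p_le_q).
pose p := fine (lower_boyd E); have pE : lower_boyd E = p%:E by rewrite fineK.
have p1 : 1 < p by rewrite -lte_fin -pE.
rewrite pE in c; move/fine_cvgP: c => [fin c].
pose r := (1 + p) / 2; have r1 : 1 < r by rewrite /r; lra.
have rp : r < p by rewrite /r; lra.
have [M [_ hM]] : \forall u \near +oo, boyd_quotient E u \is a fin_num /\ r < fine (boyd_quotient E u).
  near=> u; split; first by near: u.
  by near: u; apply: (cvgr_gt _ c).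
have ln2 : 0 < ln (2 : R) by rewrite ln_gt0// ltr1n.
have r0 : 0 < r by lra.
exists (expR (ln 2 / r)), (Num.bound M).+1; split.
- by rewrite expR_gt1 divr_gt0.
- by rewrite -[X in _ < X](@lnK _ 2) ?posrE// ltr_expR ltr_pdivrMr// ltr_pMr.
move=> i hi; have i2 : M < 2 ^+ i.
  apply: le_lt_trans (ler_norm _) _; apply: lt_trans (archi_boundP (normr_ge0 M)) _.
  rewrite -natrX ltr_nat; apply: leq_trans (ltn_expl i (leqnn 2)).
  move: hi; rewrite (_ : Num.bound `|M| = Num.bound M)//; first exact: ltnW.
  by rewrite /Num.bound normr_id.
have [q1 q2] := hM _ i2; have [] := @has_sup_dil (2 ^+ i).
  by apply/eqP => h; move: q1; rewrite h.
rewrite -exprVn => hs D0; split=> //.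
have i0 : (0 < i)%N by exact: leq_trans hi.
move: q1 q2; rewrite /boyd_quotient exprVn -exprVn; case: ifP => // /negbT l0 _ /=.
set l := ln _ in l0 *; have lni : 0 < ln ((2 : R) ^+ i) by rewrite ln_gt0// exprn_egt1 ?ltr1n// -lt0n.
move=> rl; have lp : 0 < l.
  rewrite lt_def l0 leNgt; apply/negP => ln0_.
  have : ln ((2 : R) ^+ i) / l < 0 by rewrite pmulr_rlt0// invr_lt0.
  lra.
rewrite ltr_pdivlMr// in rl.
have lle : l <= i%:R * (ln 2 / r).
  rewrite mulrA ler_pdivlMr// mulrC; apply: le_trans (ltW rl) _.
  by rewrite lnXn// mulr_natl.
rewrite -(@lnK _ (dilation_norm E _)) ?posrE// -expRM_natl ler_expR.
exact: lle.
Unshelve. all: by end_near. Qed.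

(** At u = 2^-j a quotient between 0 and q + 1 forces the logarithm of the norm to be negative, and
    at most - j ln 2 / (q + 1). *)
Lemma boyd_q : exists sig j0, [/\ 0 < sig, sig < 1 & forall j, (j0 <= j)%N ->
  has_sup (dil_set (2 ^+ j)) /\ dilation_norm E (2 ^+ j) <= sig ^+ j].
Proof.
have q1 : (1 < upper_boyd E)%E by exact: lt_le_trans p_le_q.
have c := @lim_neq0_cvg _ ((0 : R)^'+) _ (boyd_quotient E); rewrite -/(upper_boyd E) in c.
have p0 : (upper_boyd E != 0)%E by rewrite gt_eqF// (lt_trans _ q1)// lte_fin.
have {}c : boyd_quotient E x @[x --> (0 : R)^'+] --> upper_boyd E by apply: c.
have fq : upper_boyd E \is a fin_num by rewrite fin_numElt (lt_trans _ q1) ?ltNyr.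
pose q := fine (upper_boyd E); have qE : upper_boyd E = q%:E by rewrite fineK.
have q1' : 1 < q by rewrite -lte_fin -qE.
rewrite qE in c; move/fine_cvgP: c => [fin c].
have [d /= d0 hd] : \forall u \near (0 : R)^'+, [/\ boyd_quotient E u \is a fin_num, 0 < fine (boyd_quotient E u) & fine (boyd_quotient E u) < q + 1].
  near=> u; split; first by near: u.
    by near: u; apply: (cvgr_gt _ c); lra.
  by near: u; apply: (cvgr_lt _ c); lra.
have ln2 : 0 < ln (2 : R) by rewrite ln_gt0// ltr1n.
have r0 : 0 < q + 1 by lra.
exists (expR (- (ln 2 / (q + 1)))), (Num.bound d^-1).+1; split.
- exact: expR_gt0.
- by rewrite expR_lt1 oppr_lt0 divr_gt0.
move=> j hj; have j2 : (2^-1 : R) ^+ j < d.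
  rewrite exprVn invf_plt ?posrE ?exprn_gt0//; apply: lt_trans (archi_boundP _) _; first by rewrite invr_ge0 ltW.
  by rewrite -natrX ltr_nat; apply: leq_trans (ltn_expl j (leqnn 2)); exact: ltnW.
have u0 : 0 < (2^-1 : R) ^+ j by rewrite exprn_gt0// invr_gt0.
have [] := hd (2^-1 ^+ j); rewrite /ball_ /= ?sub0r ?normrN ?gtr0_norm//.
move=> f1 f2 f3; have [] := @has_sup_dil (2^-1 ^+ j).
  by apply/eqP => h; move: f1; rewrite h.
rewrite {1 2}exprVn invrK => hs D0; split=> //.
have j0 : (0 < j)%N by exact: leq_trans hj.
have ej : ((2^-1 : R) ^+ j)^-1 = 2 ^+ j by rewrite exprVn invrK.
move: f1 f2 f3; rewrite /boyd_quotient ej; case: ifP => // /negbT l0 _ /=.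
set l := ln _ in l0 *.
have lnE : ln ((2^-1 : R) ^+ j) = - (j%:R * ln 2).
  by rewrite exprVn lnV ?posrE ?exprn_gt0// lnXn// mulr_natl.
have lnj : ln ((2^-1 : R) ^+ j) < 0 by rewrite lnE oppr_lt0 mulr_gt0// ltr0n.
move=> f2 f3; have lp : l < 0.
  rewrite lt_def eq_sym l0 leNgt; apply/negP => ln0_.
  have : ln ((2^-1 : R) ^+ j) / l < 0 by rewrite pmulr_llt0// invr_gt0.
  lra.
rewrite ltr_ndivrMr// lnE in f3.
have lle : l <= j%:R * (- (ln 2 / (q + 1))).
  by rewrite mulrN mulrA -mulNr ler_pdivlMr// mulrC ltW.
rewrite -(@lnK _ (dilation_norm E _)) ?posrE// -expRM_natl ler_expR.
exact: lle.
Unshelve. all: by end_near. Qed.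

(** The finitely many i below i0 are absorbed into C: by monotonicity g(2^-i t) is below g(2^-i0
    t). *)
Lemma dil_small : exists rho C, [/\ 1 < rho, rho < 2, 0 < C & forall i g, dec g -> car g ->
  qn (fun t => g (2^-1 ^+ i * t)) <= C * rho ^+ i * qn g].
Proof.
have [rho [i0 [r1 r2 h]]] := boyd_p; have r0 : 0 < rho by lra.
have h0 i : 0 < (2^-1 : R) ^+ i by rewrite exprn_gt0// invr_gt0.
have big i g : (i0 <= i)%N -> dec g -> car g -> qn (fun t => g (2^-1 ^+ i * t)) <= rho ^+ i * qn g.
  move=> hi dg cg; have [h1 h2] := h i hi; apply: le_trans (dil_norm_le (h0 i) h1 dg cg) _.
  by apply: ler_wpM2r => //; exact: qnorm_ge0.
exists rho, (rho ^+ i0); split=> //; first exact: exprn_gt0.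
move=> i g dg cg; have q0 := qnorm_ge0 cg; have re k : 1 <= rho ^+ k by rewrite exprn_ege1// ltW.
have [hi|hi] := leqP i0 i.
  apply: le_trans (big _ _ hi dg cg) _; apply: ler_wpM2r => //.
  by rewrite ler_peMl// exprn_ge0// ltW.
have le_g t : 0 < t -> g (2^-1 ^+ i * t) <= g (2^-1 ^+ i0 * t).
  move=> t0; apply: dg.2; first exact: mulr_gt0.
  rewrite ler_pM2r//; apply: ler_wiXn2l; [by rewrite invr_ge0|by rewrite invf_le1// ler1n|exact: ltnW].
have [c1 q1] := dec_le (dec_scale (h0 i) dg) (dec_scale (h0 i0) dg) (carrier_dil (h0 i0) dg cg) le_g.
apply: le_trans q1 _; apply: le_trans (big _ _ (leqnn i0) dg cg) _; apply: ler_wpM2r => //.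
by rewrite ler_peMr// exprn_ge0// ltW.
Qed.
Lemma dil_big : exists sig C, [/\ 0 < sig, sig < 1, 0 < C & forall j g, dec g -> car g ->
  qn (fun t => g (2 ^+ j * t)) <= C * sig ^+ j * qn g].
Proof.
have [sig [j0 [r1 r2 h]]] := boyd_q.
have h0 i : 0 < (2 : R) ^+ i by rewrite exprn_gt0.
exists sig, (sig ^- j0); split=> //; first by rewrite invr_gt0 exprn_gt0.
move=> j g dg cg; have q0 := qnorm_ge0 cg.
have s0 : 0 < sig ^+ j0 by exact: exprn_gt0.
have [hj|hj] := leqP j0 j.
  have [h1 h2] := h j hj; apply: le_trans (dil_norm_le (h0 j) h1 dg cg) _.
  apply: ler_wpM2r => //; apply: le_trans h2 _; rewrite ler_peMl ?exprn_ge0 ?(ltW r1)//.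
  by rewrite invf_ge1// exprn_ile1 ?ltW.
have le_g t : 0 < t -> g (2 ^+ j * t) <= g t.
  by move=> t0; apply: dg.2 => //; rewrite ler_peMl ?(ltW t0) ?exprn_ege1 ?ler1n.
have [c1 q1] := dec_le (dec_scale (h0 j) dg) dg cg le_g.
apply: le_trans q1 _; rewrite ler_peMl// mulrC ler_pdivlMr// mul1r.
by apply: ler_wiXn2l; [exact: ltW|exact: ltW|exact: ltnW].
Qed.

Lemma ind_ex : exists t, 0 < t /\ car (ind t).
Proof.
have [f0 c0 nz] := carrier_neq0 E; have mf := car_measurable c0.
have [d [d0 hd]] : exists d, 0 < d /\ (0 < fun_dist f0 d)%E.
  apply: contrapT => hn; move: nz; suff -> : qn f0 = 0 by rewrite eqxx.
  apply/(qnorm_eq0 c0).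
  pose N (n : nat) := [set t | 0 <= t /\ n.+1%:R^-1 < `|f0 t|].
  have mN n : measurable (N n) by exact: measurable_super.
  have N0 n : leb (N n) = 0%E.
    apply/eqP; rewrite eq_le measure_ge0 andbT leNgt; apply/negP => h; apply: hn.
    by exists n.+1%:R^-1; rewrite invr_gt0.
  exists (\bigcup_n N n); split.
  - by apply: bigcup_measurable => n _; exact: mN.
  - exact: leb_bigcup0.
  move=> t /= ht; have [t0 ft] : 0 <= t /\ f0 t <> 0 by apply/not_implyP.
  have ft0 : 0 < `|f0 t| by rewrite normr_gt0; apply/eqP.
  exists (Num.bound `|f0 t|^-1) => //; split=> //.
  rewrite invf_plt ?posrE//; apply: lt_trans (archi_boundP _) _; first by rewrite invr_ge0.
  by rewrite ltr_nat.
have [t [t0 ht]] : exists t, 0 < t /\ (t%:E <= fun_dist f0 d)%E.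
  have := hd; case: (fun_dist f0 d) => [x| |] //; last by exists 1; rewrite leey.
  by rewrite lte_fin => x0; exists x.
exists t; split=> //; have ci : car (fun s => d * ind t s).
  apply: (carrier_dist _ c0 _).1 => [|v v0].
    by apply: dec_measurable; apply: decZ; [exact: ltW|exact: dec_ind].
  have [vd|dv] := ltP v d.
    apply: (@le_trans _ _ t%:E).
      apply: fun_dist_le; [exact: ltW|by apply: dec_measurable; apply: decZ; [exact: ltW|exact: dec_ind]|].
      move=> s s0; rewrite /ind; case: ifP => // _; rewrite mulr0 normr0 => h; lra.
    apply: le_trans ht _; apply: le_measure; rewrite ?inE; [exact: measurable_super|exact: measurable_super|].
    by move=> s [s0 h]; split=> //; exact: lt_trans h.
  apply: le_trans (fun_dist_ge0 _ _); apply: fun_dist_le => //.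
    by apply: dec_measurable; apply: decZ; [exact: ltW|exact: dec_ind].
  move=> s s0; rewrite /ind; case: ifP => _; last by rewrite mulr0 normr0 => h; lra.
  by rewrite mulr1 gtr0_norm// => h; lra.
have := carrierZ d^-1 ci; congr (car _); apply/funext => s; rewrite mulrA mulVf ?gt_eqF// mul1r.
by [].
Qed.
Lemma car_ind t : 0 < t -> car (ind t).
Proof.
move=> t0; have [s [s0 cs]] := ind_ex.
have a0 : 0 < s / t by rewrite divr_gt0.
have := carrier_dil a0 (dec_ind s) cs; congr (car _); apply/funext => u; rewrite /ind.
by rewrite mulrAC ler_pdivrMr// ler_pM2l.
Qed.
Lemma qn_ind t : 0 < t -> 0 < qn (ind t).
Proof.
move=> t0; rewrite lt_def qnorm_ge0 ?andbT; last exact: car_ind.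
apply/eqP => /(qnorm_eq0 (car_ind t0)) [N [mN N0 hN]].
have z : leb `[0, t]%classic = 0%E.
  apply: measure_negligible; first exact: measurable_itv.
  exists N; split=> // s /=; rewrite in_itv /= => /andP[s0 st]; apply: hN => /= h.
  by have := h s0; rewrite /ind st => /eqP; rewrite oner_eq0.
by move: z; rewrite leb_itv0 ?(ltW t0)// => -[h]; move: t0; rewrite h ltxx.
Qed.
(** Chebyshev's inequality in E: a decreasing f is above f t on ]0, t]. *)
Lemma dec_le_ind f t : dec f -> car f -> 0 < t -> f t * qn (ind t) <= qn f.
Proof.
move=> df cf t0; rewrite -[f t](ger0_norm (df.1 t)) -qnormZ; last exact: car_ind.
apply: (dec_le _ df cf _).2; first by apply: decZ; [exact: df.1|exact: dec_ind].
move=> s s0; rewrite /ind; case: ifP => st; rewrite ?mulr1 ?mulr0 ?df.1//.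
exact: df.2.
Qed.
Lemma ind_scale a t : 0 < a -> (fun s => ind t (a * s)) = ind (a^-1 * t).
Proof. by move=> a0; apply/funext => s; rewrite /ind ler_pdivlMl. Qed.

(** [dec_le_ind] bounds f at 2^-i by qn f over the norm of [ind (2^-i)], and [dil_small] applied to
    indicators bounds that norm from below. With rho < 2 this is integrability near 0. *)
Lemma dec_bound_small : exists rho C, [/\ 1 < rho, rho < 2, 0 < C & forall i f, dec f -> car f ->
  f (2^-1 ^+ i) <= C * rho ^+ i * qn f].
Proof.
have [rho [C [r1 r2 C0 h]]] := dil_small; have q1 := qn_ind ltr01.
exists rho, (C / qn (ind 1)); split=> //; first by rewrite divr_gt0.
move=> i f df cf; have h0 : 0 < (2^-1 : R) ^+ i by rewrite exprn_gt0// invr_gt0.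
have := h i _ (dec_ind _) (car_ind h0); rewrite ind_scale// mulVf ?gt_eqF// => h1.
have h2 := dec_le_ind df cf h0; have qi := qn_ind h0.
rewrite -(ler_pM2r qi); apply: le_trans h2 _.
have : qn f * qn (ind 1) <= qn f * (C * rho ^+ i * qn (ind (2^-1 ^+ i))).
  by apply: ler_wpM2l => //; exact: qnorm_ge0.
rewrite -ler_pdivlMr// => h3; apply: le_trans h3 _; rewrite le_eqVlt; apply/orP; left; apply/eqP; field.
by rewrite gt_eqF.
Qed.
Lemma dec_bound_big : exists sig C, [/\ 0 < sig, sig < 1, 0 < C & forall j f, dec f -> car f ->
  f (2 ^+ j) <= C * sig ^+ j * qn f].
Proof.
have [sig [C [r1 r2 C0 h]]] := dil_big; have q1 := qn_ind ltr01.
exists sig, (C / qn (ind 1)); split=> //; first by rewrite divr_gt0.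
move=> i f df cf; have h0 : 0 < (2 : R) ^+ i by rewrite exprn_gt0.
have := h i _ (dec_ind _) (car_ind h0); rewrite ind_scale// mulVf ?gt_eqF// => h1.
have h2 := dec_le_ind df cf h0; have qi := qn_ind h0.
rewrite -(ler_pM2r qi); apply: le_trans h2 _.
have : qn f * qn (ind 1) <= qn f * (C * sig ^+ i * qn (ind (2 ^+ i))).
  by apply: ler_wpM2l => //; exact: qnorm_ge0.
rewrite -ler_pdivlMr// => h3; apply: le_trans h3 _; rewrite le_eqVlt; apply/orP; left; apply/eqP; field.
by rewrite gt_eqF.
Qed.

Lemma car_sum (f : nat -> R -> R) n : (forall i, car (f i)) -> car (fun t => \sum_(i < n) f i t).
Proof.
move=> h; elim: n => [|n IH].
  by rewrite (_ : (fun t => _) = fun=> 0); [exact: carrier0|apply/funext => t; rewrite big_ord0].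
by rewrite (_ : (fun t => _) = fun t => \sum_(i < n) f i t + f n t); [exact: carrierD|apply/funext => t; rewrite big_ord_recr].
Qed.
(* A quasi-norm has no infinite triangle inequality; with K its constant, blocks
   of L terms are summed, where K a^L <= 1/2. *)
Lemma block_sum a : 0 < a -> a < 1 -> exists B, 0 < B /\ forall n (f : nat -> R -> R) c, 0 <= c -> (forall i, car (f i)) ->
  (forall i, qn (f i) <= c * a ^+ i) -> qn (fun t => \sum_(i < n) f i t) <= B * c.
Proof.
move=> a0 a1; have [K [K1 hK]] := quasi_const; have K0 : 0 < K by exact: lt_le_trans K1.
have [L hL] : exists L, K * a ^+ L.+1 <= 2^-1.
  have c : K * a ^+ n @[n --> \oo] --> (0 : R) by apply: cvg_geometric; rewrite ger0_norm ?ltW.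
  have h2 : 0 < (2^-1 : R) by rewrite invr_gt0.
  have [N hN] := cvg0_bound c h2.
  by exists N; apply: ltW; apply: hN.
have fin m : exists B, 0 < B /\ forall (f : nat -> R -> R) c, 0 <= c -> (forall i, car (f i)) ->
  (forall i, qn (f i) <= c * a ^+ i) -> qn (fun t => \sum_(i < m) f i t) <= B * c.
  elim: m => [|m [B [B0 hB]]].
    exists 1; split=> // f c c0 _ _; rewrite (_ : (fun t => _) = fun=> 0); last by apply/funext => t; rewrite big_ord0.
    by rewrite (_ : qn _ = 0) ?mul1r//; apply/(qnorm_eq0 (carrier0 E)); exact: aeW.
  exists (K * (B + 1)); split; first by rewrite mulr_gt0// addr_gt0.
  move=> f c c0 cf hf; rewrite (_ : (fun t => _) = fun t => \sum_(i < m) f i t + f m t); last by apply/funext => t; rewrite big_ord_recr.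
  apply: le_trans (hK _ _ (car_sum _ cf) (cf m)) _; rewrite -mulrA ler_pM2l// mulrDl mul1r; apply: lerD; first exact: hB.
  by apply: le_trans (hf m) _; rewrite ler_piMr// exprn_ile1// ltW.
have fin2 : exists B, 0 < B /\ forall m, (m <= L.+1)%N -> forall (f : nat -> R -> R) c, 0 <= c -> (forall i, car (f i)) ->
  (forall i, qn (f i) <= c * a ^+ i) -> qn (fun t => \sum_(i < m) f i t) <= B * c.
  have [B hB] := choice fin; exists (\sum_(m < L.+2) B m); split.
    by rewrite big_ord_recr /= ltr_wpDl ?(hB _).1// sumr_ge0// => i _; exact/ltW/(hB _).1.
  move=> m mL f c c0 cf hf; apply: le_trans ((hB m).2 f c c0 cf hf) _; apply: ler_wpM2r => //.
  rewrite (bigD1 (Ordinal (_ : m < L.+2)%N)) //= lerDl; apply: sumr_ge0 => i _; exact/ltW/(hB _).1.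
have [B [B0 hB]] := fin2; exists (2 * K * B); split; first by rewrite !mulr_gt0.
move=> n; elim/ltn_ind: n => n IH f c c0 cf hf.
have Kc : B * c <= 2 * K * B * c by rewrite ler_wpM2r// ler_peMl ?ltW//; lra.
have [nL|Ln] := leqP n L.+1; first by apply: le_trans Kc; exact: hB.
have e : (fun t => \sum_(i < n) f i t) = fun t => \sum_(i < L.+1) f i t + \sum_(i < n - L.+1) f (i + L.+1)%N t.
  apply/funext => t; rewrite -(big_mkord xpredT (fun i => f i t)) (big_cat_nat _ (n := L.+1))//=; last exact: ltnW.
  by rewrite big_mkord; congr (_ + _); rewrite -{1}[L.+1]add0n big_addn big_mkord.
have cf' i : car (f (i + L.+1)%N) by [].
rewrite e; apply: le_trans (hK _ _ (car_sum _ cf) (car_sum _ cf')) _.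
have h1 := hB _ (leqnn L.+1) f c c0 cf hf.
have h2 : qn (fun t => \sum_(i < n - L.+1) f (i + L.+1)%N t) <= 2 * K * B * (c * a ^+ L.+1).
  apply: (IH (n - L.+1)%N _ (fun i => f (i + L.+1)%N)) => //.
  - by rewrite ltn_subrL/= (leq_trans _ Ln).
  - by rewrite mulr_ge0// exprn_ge0// ltW.
  - by move=> i; rewrite -mulrA -exprD addnC.
have h3 : K * (2 * K * B * (c * a ^+ L.+1)) <= K * B * c.
  have -> : K * (2 * K * B * (c * a ^+ L.+1)) = (2 * K * B * c) * (K * a ^+ L.+1) by ring.
  have -> : K * B * c = (2 * K * B * c) * 2^-1 by field.
  by apply: ler_wpM2l => //; rewrite mulr_ge0// !mulr_ge0// ltW.
rewrite mulrDr; have := ler_wpM2l (ltW K0) h1; have := ler_wpM2l (ltW K0) h2; lra.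
Qed.

Lemma sup_finite (s : nat -> R -> R) (C : R) : (forall n, dec (s n) /\ car (s n)) -> (forall n, qn (s n) <= C) ->
  forall t, 0 < t -> has_sup (range (fun n => s n t)).
Proof.
move=> hs hC t t0; split; first by exists (s 0%N t); exists 0%N.
exists (C / qn (ind t)) => _ [n _ <-]; rewrite ler_pdivlMr ?qn_ind//.
by apply: le_trans (hC n); apply: dec_le_ind => //; case: (hs n).
Qed.

(** Completeness provides a limit g in quasi-norm, whereas a pointwise majorant that decreases is
    wanted. Convergence in E implies convergence in measure, so the supremum F of the partial sums
    is at most |g| almost everywhere and inherits its norm. *)
Lemma series_E a : 0 < a -> a < 1 -> exists B, 0 < B /\ forall (f : nat -> R -> R) c, 0 <= c ->
  (forall i, dec (f i) /\ car (f i)) -> (forall i, qn (f i) <= c * a ^+ i) ->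
  exists F, [/\ dec F, car F, qn F <= B * c & forall n t, 0 < t -> \sum_(i < n) f i t <= F t].
Proof.
move=> a0 a1; have [B [B0 hB]] := block_sum a0 a1; have [K [K1 hK]] := quasi_const; have K0 : 0 < K by exact: lt_le_trans K1.
exists (K * B); split; first exact: mulr_gt0.
move=> f c c0 hf hfc; pose s n t := \sum_(i < n) f i t.
have cf i : car (f i) by case: (hf i).
have cs n : car (s n) by exact: car_sum.
have ds n : dec (s n) by apply: dec_sum => i; case: (hf i).
have qs n : qn (s n) <= B * c by exact: hB.
have sup_ := sup_finite (fun n => conj (ds n) (cs n)) qs.
have tail n m : qn (fun t => s (n + m)%N t - s n t) <= B * (c * a ^+ n).
  have -> : (fun t => s (n + m)%N t - s n t) = fun t => \sum_(i < m) f (i + n)%N t.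
    apply/funext => t; rewrite /s -(big_mkord xpredT (fun i => f i t)) (big_cat_nat _ (n := n))//=; last exact: leq_addr.
    by rewrite big_mkord addrAC subrr add0r -{1}[n]add0n big_addn addKn big_mkord.
  apply: (hB m (fun i => f (i + n)%N)) => //; first by rewrite mulr_ge0// exprn_ge0// ltW.
  by move=> i; rewrite -mulrA -exprD addnC.
have small e : 0 < e -> exists N, forall n, (N <= n)%N -> B * (c * a ^+ n) < e.
  move=> e0; have cv : (B * c) * a ^+ n @[n --> \oo] --> (0 : R) by apply: cvg_geometric; rewrite ger0_norm ?ltW.
  by have [N hN] := cvg0_bound cv e0; exists N => n /hN; rewrite mulrA.
have symq g h : car (fun t => g t - h t) -> qn (fun t => h t - g t) = qn (fun t => g t - h t).
  move=> cgh; have := qnormZ (-1) cgh; rewrite normrN1 mul1r => <-.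
  by congr qn; apply/funext => t; rewrite mulN1r opprB.
have csub m n : car (fun t => s m t - s n t).
  have := carrierD (cs m) (carrierZ (-1) (cs n)); congr (car _); apply/funext => t; rewrite mulN1r.
  by [].
have [|g cg hg] := @qnorm_complete _ E s cs.
  move=> e /small[N hN]; exists N => m n Nm Nn; have [mn|nm] := leqP m n.
    by rewrite symq//; have := tail m (n - m)%N; rewrite subnKC// => /le_lt_trans; apply; exact: hN.
  by have := tail n (m - n)%N; rewrite (subnKC (ltnW nm)) => /le_lt_trans; apply; exact: hN.
pose F t := if 0 < t then sup (range (fun n => s n t)) else 0.
have leF n t : 0 < t -> s n t <= F t.
  by move=> t0; rewrite /F t0; apply: (ub_le_sup (sup_ t t0).2); exists n.
have dF : dec F.
  split=> [t|u t u0 ut].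
    by rewrite /F; case: ifP => // t0; have := leF 0%N t t0; rewrite /F t0; apply: le_trans; exact: (ds _).1.
  have t0 := lt_le_trans u0 ut; rewrite /F u0 t0; apply: sup_le_ub; first exact: (sup_ t t0).1.
  by move=> _ [n _ <-]; apply: le_trans ((ds n).2 u t u0 ut) _; have := leF n u u0; rewrite /F u0.
have cgs n : car (fun t => s n t - g t).
  have := carrierD (cs n) (carrierZ (-1) cg); congr (car _); apply/funext => t; rewrite mulN1r.
  by [].
have mg := car_measurable cg.
(* An exceedance set of measure above e would dominate, in distribution, d times the indicator of
   ]0, e]. *)
have meas0 d e : 0 < d -> 0 < e -> exists N, forall n, (N <= n)%N -> (fun_dist (fun t => (s n t - g t)%R) d <= e%:E)%E.
  move=> d0 e0; have qe := qn_ind e0; have [N hN] := cvg0_bound hg (mulr_gt0 d0 qe).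
  exists N => n Nn; rewrite leNgt; apply/negP => h.
  have := hN n Nn; rewrite ltNge => /negP; apply.
  rewrite -[d](ger0_norm (ltW d0)) -qnormZ; last exact: car_ind.
  have mi : mfun (fun t => d * ind e t) by apply: dec_measurable; apply: decZ; [exact: ltW|exact: dec_ind].
  apply: (carrier_dist mi (cgs n) _).2 => v v0.
  have [vd|dv] := ltP v d.
    apply: (@le_trans _ _ e%:E).
      apply: fun_dist_le => //; first exact: ltW.
      by move=> u u0; rewrite /ind; case: ifP => // _; rewrite mulr0 normr0 => h'; lra.
    apply: le_trans (ltW h) _; apply: le_measure; rewrite ?inE; [by apply: measurable_super; exact: car_measurable|by apply: measurable_super; exact: car_measurable|].
    by move=> u [u0 h']; split=> //; exact: lt_trans h'.
  apply: le_trans (fun_dist_ge0 _ _); apply: fun_dist_le => //.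
  move=> u u0; rewrite /ind; case: ifP => _; last by rewrite mulr0 normr0 => h'; lra.
  by rewrite mulr1 gtr0_norm// => h'; lra.
have smono m n t : (m <= n)%N -> s m t <= s n t.
  move=> mn; rewrite /s -!(big_mkord xpredT (fun i => f i t)) [leRHS](big_cat_nat _ (n := m))//= lerDl.
  by apply: sumr_ge0 => i _; case: (hf i) => -[h _].
(* Null sets: where the partial sum number [k.1] exceeds |g| by more than 1 / ([k.2] + 1). *)
pose Nk (k : nat * nat) := [set t | 0 <= t /\ k.2.+1%:R^-1 < `|Num.max (s k.1 t - `|g t|) 0| ].
have mNk k : measurable (Nk k).
  apply: measurable_super; apply: measurable_maxr => //; apply: measurable_funB; first exact: car_measurable.
  by apply: measurableT_comp => //; exact: measurable_normr.
have Nk0 k : leb (Nk k) = 0%E.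
  apply/eqP; rewrite eq_le measure_ge0 andbT; apply/lee_addgt0Pr => e e0; rewrite add0e.
  have [|N hN] := meas0 k.2.+1%:R^-1 e _ e0; first by rewrite invr_gt0.
  apply: le_trans (hN (maxn N k.1) (leq_maxl _ _)); apply: le_measure; rewrite ?inE; [exact: mNk|by apply: measurable_super; exact: car_measurable|].
  move=> t [t0 ht]; split=> //; apply: lt_le_trans ht _.
  have h1 := smono _ _ t (leq_maxr N k.1); have h2 := ler_norm (g t).
  have h3 := ler_norm (s (maxn N k.1) t - g t); have h4 := normr_ge0 (s (maxn N k.1) t - g t).
  rewrite ger0_norm; last by rewrite le_max lexx orbT.
  by rewrite ge_max h4 andbT; lra.
pose U := \bigcup_n \bigcup_k Nk (n, k).
have mU' n : measurable (\bigcup_k Nk (n, k)) by apply: bigcup_measurable => k _; exact: mNk.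
have mU : measurable U by apply: bigcup_measurable => n _; exact: mU'.
have U0 : leb U = 0%E.
  by apply: leb_bigcup0 => // n; apply: leb_bigcup0 => // k; exact: Nk0.
have [cF qF] : car F /\ qn F <= qn g.
  apply: carrier_dist => //; first exact: dec_measurable.
  move=> v v0; have mG := measurable_super v mg.
  have mF := measurable_super v (dec_measurable dF).
  have m1 := measurableU _ _ mG mU.
  have h1 : (leb ([set t | 0 <= t /\ v < `|g t|] `|` U)%R <= fun_dist g v)%E.
    by apply: le_trans (lebU2 mG mU) _; rewrite U0 adde0.
  apply: le_trans h1; apply: le_trans (lebU0 m1); apply: le_measure; rewrite ?inE//.
    by apply: measurableU => //; exact: measurable_set1.
  move=> t [t0 vt]; have [->|tn0] := eqVneq t 0; [by right|left].
  have tp : 0 < t by rewrite lt_neqAle eq_sym tn0.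
  have [vg|gv] := ltP v `|g t|; [by left|right].
  rewrite ger0_norm ?dF.1// in vt.
  have gF : `|g t| < F t by exact: le_lt_trans gv vt.
  rewrite /F tp in gF; have [_ [n _ <-] hn] := sup_gt (sup_ t tp).1 gF.
  have d0 : 0 < s n t - `|g t| by rewrite subr_gt0.
  exists n => //; exists (Num.bound (s n t - `|g t|)^-1) => //; split=> //=.
  rewrite [X in _ < X]ger0_norm; last by rewrite le_max lexx orbT.
  rewrite lt_max; apply/orP; left; rewrite invf_plt ?posrE//.
  by apply: lt_trans (archi_boundP _) _; [rewrite invr_ge0 ltW|rewrite ltr_nat].
exists F; split=> //.
apply: le_trans qF _; apply/ler_addgt0Pr => e e0; have eK : 0 < e / K by rewrite divr_gt0.
have [N hN] := cvg0_bound hg eK; have hNN := hN N (leqnn N).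
have cgN : car (fun t => g t - s N t).
  have := carrierZ (-1) (cgs N); congr (car _); apply/funext => t; rewrite mulN1r opprB.
  by [].
have := hK _ _ (cs N) cgN; rewrite (_ : (fun t => s N t + (g t - s N t)) = g); last by apply/funext => t; rewrite addrC subrK.
move=> h; apply: le_trans h _; rewrite symq// -mulrA mulrDr; apply: lerD.
  by rewrite ler_pM2l.
by rewrite mulrC -ler_pdivlMr// ltW.
Qed.

(** The inner series has ratio rp / 2 < 1 because p_E > 1, the outer one ratio rho sig < 1 because
    q_E < +oo; [series_E] sums each, the outer one being applied to the majorant G of the inner
    one. *)
Theorem hardy_E : exists rho C, [/\ 1 < rho, rho < 2, 0 < C & forall g, dec g -> car g ->
  exists F, [/\ dec F, car F, qn F <= C * qn g & forall m t, 0 < t -> 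
   8 * (1 - rho^-1)^-1 * \sum_(j < m) \sum_(i < m.+1) rho ^+ j * 2^-1 ^+ i * g (2^-1 ^+ i * (2 ^+ j.+2 * t)) <= F t]].
Proof.
have [rp [Cp [rp1 rp2 Cp0 hp]]] := dil_small; have [sig [Cq [s0 s1 Cq0 hq]]] := dil_big.
(* The midpoint between 1 and the smaller of 2 and sig^-1, so that 1 < rho < 2 and rho sig < 1. *)
pose rho := Num.min (3 / 2) ((1 + sig^-1) / 2).
have si1 : 1 < sig^-1 by rewrite invf_gt1.
have r1 : 1 < rho by rewrite /rho lt_min; apply/andP; split; lra.
have r2 : rho < 2 by rewrite /rho gt_min; apply/orP; left; lra.
have rs : rho * sig < 1.
  rewrite -ltr_pdivlMr// mul1r /rho gt_min; apply/orP; right; lra.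
have r0 : 0 < rho by lra.
have a0 : 0 < rp / 2 by rewrite divr_gt0//; lra.
have a1 : rp / 2 < 1 by rewrite ltr_pdivrMr// mul1r.
have rs0 : 0 < rho * sig by exact: mulr_gt0.
have [B1 [B10 h1]] := series_E a0 a1; have [B2 [B20 h2]] := series_E rs0 rs.
have c8 : 0 < 8 * (1 - rho^-1)^-1 by rewrite mulr_gt0// invr_gt0 subr_gt0 invf_lt1.
exists rho, (8 * (1 - rho^-1)^-1 * (B2 * (Cq * (B1 * Cp)))); split=> //; first by apply: mulr_gt0 => //; rewrite !mulr_gt0.
move=> g dg cg; have q0 := qnorm_ge0 cg.
have h20 i : 0 < (2^-1 : R) ^+ i by rewrite exprn_gt0// invr_gt0.
have h2p i : 0 < (2 : R) ^+ i by rewrite exprn_gt0.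
have [|i|i|G [dG cG qG hG]] := h1 (fun i t => 2^-1 ^+ i * g (2^-1 ^+ i * t)) (Cp * qn g).
- by rewrite mulr_ge0// ltW.
- split; first by apply: decZ; [exact: ltW|exact: dec_scale].
  by apply: carrierZ; exact: carrier_dil.
- rewrite qnormZ; last exact: carrier_dil.
  rewrite (ger0_norm (ltW (h20 i))); have := ler_wpM2l (ltW (h20 i)) (hp i g dg cg).
  by congr (_ <= _); rewrite exprMn; ring.
have qG0 := qnorm_ge0 cG.
have [|j|j|F [dF cF qF hF]] := h2 (fun j t => rho ^+ j * G (2 ^+ j.+2 * t)) (Cq * qn G).
- by rewrite mulr_ge0// ltW.
- split; first by apply: decZ; [rewrite exprn_ge0// ltW|exact: dec_scale].
  by apply: carrierZ; exact: carrier_dil.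
- have cj := carrier_dil (h2p j) dG cG; have cj2 := carrier_dil (h2p j.+2) dG cG.
  rewrite qnormZ// ger0_norm ?exprn_ge0 ?(ltW r0)//.
  have le_ t : 0 < t -> G (2 ^+ j.+2 * t) <= G (2 ^+ j * t).
    move=> t0; apply: dG.2; first exact: mulr_gt0.
    by rewrite ler_pM2r//; apply: ler_weXn2l; [rewrite ler1n|rewrite -addn2 leq_addr].
  have [_ l1] := dec_le (dec_scale (h2p j.+2) dG) (dec_scale (h2p j) dG) cj le_.
  have l2 := hq j G dG cG.
  rewrite exprMn mulrCA; apply: ler_wpM2l; first by rewrite exprn_ge0// ltW.
  by apply: le_trans l1 _; apply: le_trans l2 _; rewrite mulrAC.
exists (fun t => 8 * (1 - rho^-1)^-1 * F t); split.
- by apply: decZ => //; exact: ltW.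
- exact: carrierZ.
- rewrite qnormZ// ger0_norm ?(ltW c8)//.
  have l1 : qn F <= B2 * (Cq * (B1 * (Cp * qn g))).
    by apply: le_trans qF _; rewrite ler_pM2l// ler_pM2l.
  by have := ler_wpM2l (ltW c8) l1; congr (_ <= _); ring.
move=> m t t0; rewrite ler_pM2l//; apply: le_trans (hF m t t0); apply: ler_sum => j _.
have t4 : 0 < 2 ^+ j.+2 * t by exact: mulr_gt0.
apply: (@le_trans _ _ (rho ^+ j * \sum_(i < m.+1) 2^-1 ^+ i * g (2^-1 ^+ i * (2 ^+ j.+2 * t)))).
  by rewrite mulr_sumr; apply: ler_sum => i _; rewrite -[leLHS]mulrA.
by apply: ler_wpM2l; [rewrite exprn_ge0// ltW|exact: hG].
Qed.
End Boyd.
End SymSpace.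

(** * Conditional expectations of unbounded operators *)

Section DyadicIntegral.
Variable R : realType.
Local Notation leb := (@lebesgue_measure R).
Local Notation D0 := (`[0%R, +oo[%classic : set R).
Implicit Types (g : R -> \bar R) (t s : R).

Lemma mD0 : measurable D0. Proof. exact: measurable_itv. Qed.
Lemma edec_measurable g : (forall s t, 0 <= s -> s <= t -> (g t <= g s)%E) -> measurable_fun D0 g.
Proof.
move=> gd; apply: (measurability _ (ErealGenOInfty.measurableE R)) => _ [_ [v ->] <-].
apply: is_interval_measurable => x y /= [hx fx] [hy fy] z /andP[xz zy].
rewrite !in_itv /= !andbT in hx hy fx fy *.
have z0 : 0 <= z by exact: le_trans xz.
by split=> //; apply: lt_le_trans fy _; apply: gd.
Qed.
Lemma leb_set0r (L : R) : 0 <= L -> leb ([set t | t <= L] `&` D0) = L%:E.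
Proof.
move=> L0; rewrite -(leb_itv0 L0); congr (leb _).
by apply/seteqP; split=> t /=; rewrite !in_itv /= ?andbT; [move=> [-> ->]|move=> /andP[-> ->]].
Qed.

Lemma integral_step (c : R) (S : set R) : 0 <= c -> measurable S ->
  (\int[leb]_(t in D0) (c * \1_S t)%:E = c%:E * leb (S `&` D0))%E.
Proof.
move=> c0 mS; under eq_integral do rewrite EFinM.
have m1 : measurable_fun D0 (fun t => (\1_S t)%:E : \bar R) by apply/measurable_EFinP; exact: measurable_indic.
by rewrite (@ge0_integralZl_EFin _ _ R leb D0 mD0 _ _ m1 c c0) ?integral_indic// => t _; rewrite lee_fin indicE.
Qed.
(** D k bounds the measure of the set where g exceeds 2^k, and 8 times the sum of the 2^k with t <=
    D k majorizes g t. The integers are enumerated as pairs i, [Negz i] to form a series over the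
    naturals. *)
Lemma integral_dyadic g (D : int -> R) (S : R) : measurable_fun D0 g -> (forall t, (0 <= g t)%E) ->
  (forall k, 0 <= D k) -> (forall k t, D k < t -> (g t <= (2 ^ k)%:E)%E) -> 
  (forall n, \sum_(i < n) (2 ^ (i : int) * D i + 2 ^ (Negz i) * D (Negz i)) <= S) ->
  (\int[leb]_(t in D0) g t <= (8 * S)%:E)%E.
Proof.
move=> mg g0 Dk0 hD hS.
pose c (k : int) t : R := 8 * 2 ^ k * \1_[set u : R | u <= D k] t.
pose F (i : nat) t : \bar R := (c i t + c (Negz i) t)%:E.
have p2 k : 0 < (2 : R) ^ k by exact: pow2_gt0.
have c0 k t : 0 <= c k t by rewrite /c !mulr_ge0// ?(ltW (p2 k))// indicE.
have F0 i t : (0 <= F i t)%E by rewrite lee_fin addr_ge0.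
have mset k : measurable ([set u : R | u <= D k] : set R).
  by rewrite (_ : [set u | _] = `]-oo, D k]%classic); [exact: measurable_itv|apply/seteqP; split=> u /=; rewrite in_itv].
have mc k : measurable_fun D0 (c k).
  by apply: measurable_funM; [exact: measurable_cst|exact: measurable_indic].
have mF i : measurable_fun D0 (F i).
  by apply/measurable_EFinP; apply: measurable_funD.
have ic k : (\int[leb]_(t in D0) (c k t)%:E = (8 * 2 ^ k * D k)%:E)%E.
  have p8 : 0 <= 8 * (2 : R) ^ k by rewrite mulr_ge0// ltW.
  by rewrite (integral_step p8 (mset k)) [X in (_ * X)%E](leb_set0r (Dk0 k)) EFinM.
have me k : measurable_fun D0 (fun t => (c k t)%:E) by apply/measurable_EFinP; exact: mc.
have iF i : (\int[leb]_(t in D0) F i t = (8 * (2 ^ (i : int) * D i + 2 ^ (Negz i) * D (Negz i)))%:E)%E.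
  under eq_integral do rewrite /F EFinD.
  rewrite (@ge0_integralD _ _ R leb D0 mD0 (fun t => (c i t)%:E) (fun t => (c (Negz i) t)%:E)) ?ic; try exact: me; try (by move=> t _; rewrite lee_fin).
  by rewrite -EFinD; congr (_%:E); ring.
have ser0 t : (0 <= \sum_(i <oo) F i t)%E by apply: nneseries_ge0.
have serge i t : (F i t <= \sum_(i <oo) F i t)%E.
  have := @nneseries_lim_ge R (fun i => F i t) xpredT 0 i.+1 (fun n _ _ => F0 n t).
  apply: le_trans; rewrite big_nat_recr//= leeDr//; apply: sume_ge0 => j _; exact: F0.
have ck t k : (t <= D k) -> ((8 * 2 ^ k)%:E <= \sum_(i <oo) F i t)%E.
  move=> tD; have ckE : c k t = 8 * 2 ^ k by rewrite /c indicE mem_set// mulr1.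
  case: k tD ckE => n tD ckE; apply: le_trans (serge n t); rewrite /F lee_fin -ckE.
    by rewrite lerDl.
  by rewrite lerDr.
have dom t : (g t <= \sum_(i <oo) F i t)%E.
  rewrite leNgt; apply/negP => lt; have := ser0 t; move: lt; have := ck t.
  move: (\sum_(i <oo) F i t)%E => [X| |] ckt lt // X0; last by move: lt; rewrite ltNge leey.
  rewrite lee_fin le_eqVlt in X0; case/orP: X0 => [/eqP X0|X0].
    have [k hk] : exists k : int, ((2 ^ k)%:E < g t)%E.
      move: lt; rewrite -X0; case: (g t) => [y| |] //; last by exists 0; rewrite ltry.
      rewrite lte_fin => y0; have [k /andP[h1 h2]] := floor2 y0; exists (k - 1); rewrite lte_fin.
      by apply: lt_le_trans h1; rewrite ltr_eXz2l ?ltr1n//; lia.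
    have tD : t <= D k by rewrite leNgt; apply/negP => /hD; rewrite leNgt hk.
    by have := ckt k tD; rewrite -X0 lee_fin leNgt mulr_gt0.
  have [k /andP[h1 h2]] := floor2 X0.
  have tD : t <= D k.
    rewrite leNgt; apply/negP => /hD; rewrite leNgt => /negP; apply.
    by apply: le_lt_trans lt; rewrite lee_fin.
  have := ckt k tD; rewrite lee_fin => h3; move: h2; rewrite pow2S; have := p2 k; lra.
apply: (@le_trans _ _ (\int[leb]_(t in D0) (\sum_(i <oo) F i t))%E).
  apply: ge0_le_integral => //.
  by apply: ge0_emeasurable_sum => *; first [exact: F0|exact: mF].
rewrite (@integral_nneseries _ _ R leb D0 mD0 F mF (fun n t _ => F0 n t)).
apply: lime_le; first by apply: is_cvg_nneseries => n _ _; apply: integral_ge0.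
apply: nearW => n; rewrite big_mkord.
under eq_bigr do rewrite iF.
by rewrite sumEFin lee_fin -mulr_sumr ler_pM2l.
Qed.

Lemma leb_lt_ereal (x : \bar R) : (0 <= x)%E -> leb ([set t | (t%:E < x)%E] `&` D0) = x.
Proof.
case: x => [x| |] //; rewrite ?lee_fin => x0.
  have -> : ([set t | (t%:E < x%:E)%E] `&` D0) = `[0, x[%classic.
    by apply/seteqP; split=> t /=; rewrite !in_itv /= ?andbT lte_fin; [move=> [-> ->]|move=> /andP[-> ->]].
  rewrite lebesgue_measure_itv /= lte_fin; case: ltP => [_|h]; first by rewrite oppr0 adde0.
  by congr (_%:E); apply/eqP; rewrite eq_le x0 h.
have -> : ([set t : R | (t%:E < +oo)%E] `&` D0) = D0.
  by apply/setIidPr => t _ /=; rewrite ltry.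
by rewrite lebesgue_measure_itv /=; case: ifP => //; rewrite ltry.
Qed.

(** At a point t the terms th 2^j with t < d j form part of a geometric sum, so they add up to at
    most twice the last of them, which is below g t. *)
Lemma dyadic_le_integral g (d : nat -> \bar R) (th : R) n : measurable_fun D0 g -> (forall t, (0 <= g t)%E) -> 0 < th ->
  (forall j, (0 <= d j)%E) -> (forall j t, (t%:E < d j)%E -> ((th * 2 ^+ j)%:E <= g t)%E) ->
  (\sum_(j < n) (th * 2 ^+ j)%:E * d j <= 2%:E * \int[leb]_(t in D0) g t)%E.
Proof.
move=> mg g0 th0 d0 hd; have thj j : 0 <= th * 2 ^+ j by rewrite mulr_ge0 ?exprn_ge0// ltW.
have mset j : measurable ([set t : R | (t%:E < d j)%E] : set R).
  case: (d j) => [x| |].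
  - rewrite (_ : [set u | _] = `]-oo, x[%classic); first exact: measurable_itv.
    by apply/seteqP; split=> u /=; rewrite in_itv /= lte_fin.
  - by rewrite (_ : [set u : R | _] = setT)//; apply/seteqP; split=> u //= _; rewrite ltry.
  - by rewrite (_ : [set u : R | _] = set0)//; apply/seteqP; split=> u.
pose h j t : \bar R := ((th * 2 ^+ j) * \1_[set t : R | (t%:E < d j)%E] t)%:E.
have h0 j t : (0 <= h j t)%E by rewrite lee_fin mulr_ge0// indicE.
have mh j : measurable_fun D0 (h j).
  by apply/measurable_EFinP; apply: measurable_funM; [exact: measurable_cst|exact: measurable_indic].
have ih j : (\int[leb]_(t in D0) h j t = (th * 2 ^+ j)%:E * d j)%E.
  by rewrite (integral_step (thj j) (mset j)) [X in (_ * X)%E](leb_lt_ereal (d0 j)).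
under eq_bigr do rewrite -ih.
rewrite -(big_mkord xpredT (fun j => \int[leb]_(t in D0) h j t)%E) -(@ge0_integral_sum _ _ R leb D0 mD0 _ h mh) => [|j t _]; last exact: h0.
have g0' t : D0 t -> (0 <= g t)%E by move=> _; exact: g0.
rewrite -(@ge0_integralZl_EFin _ _ R leb D0 mD0 g g0' mg 2 (ler0n _ 2)).
apply: ge0_le_integral => //.
- by move=> t _; apply: sume_ge0.
- by apply: emeasurable_sum.
- by apply: measurable_funeM.
move=> t _; rewrite big_mkord.
have fs m : (\sum_(j < m) h j t <= (th * 2 ^+ m)%:E)%E.
  elim: m => [|m IH]; first by rewrite big_ord0 lee_fin.
  rewrite big_ord_recr /=; apply: le_trans (leeD IH (_ : _ <= (th * 2 ^+ m)%:E)%E) _.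
    by rewrite lee_fin indicE; case: (_ \in _); rewrite ?mulr1 ?mulr0.
  by rewrite -EFinD lee_fin exprS; have := thj m; lra.
elim: n => [|m IH]; first by rewrite big_ord0 mule_ge0// lee_fin.
have [td|td] := boolP (t%:E < d m)%E.
  apply: le_trans (fs m.+1) _; rewrite exprS mulrCA EFinM.
  by apply: lee_wpmul2l; [rewrite lee_fin|exact: hd].
rewrite big_ord_recr /= (_ : h m t = 0%E) ?adde0//.
by rewrite /h indicE memNset ?mulr0//; exact/negP.
Qed.
End DyadicIntegral.

(** * Spectral layers of bounded operators *)

Section Layers.
Variables (R : realType) (H : completeNormedModType R[i]) (dot : hdot H) (A : tvna dot).
Local Notation bop := (bop H).
Local Notation one := (1 : bop).
Local Notation ip := (rip dot).
Local Notation nq := (sqn dot).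
Local Notation sa := (sa dot).
Local Notation psd := (psd dot).
Local Notation ole := (ole dot).
Local Notation proj := (proj dot).
Local Notation pp := (pp dot).
Local Notation tr := (tr A).
Local Notation inM := (inM A).
Local Notation nearb := (nearb A).
Implicit Types (a b c e h : bop) (u v w : H).

(* the spectral projection of h on [l, +oo) *)
Definition spr h (l : R) := pp (h - l *: one).
Lemma sa_shift h l : sa h -> sa (h - l *: one).
Proof. by move=> hh; apply: saB => //; exact/saZ/sa1. Qed.
Lemma shiftE h l u : ip ((h - l *: one) u) u = ip (h u) u - l * nq u.
Proof. by rewrite subE ipBl scaleE oneE ipZl. Qed.
Lemma sprP h l : sa h -> [/\ proj (spr h l), forall x, x * h = h * x -> x * spr h l = spr h l * x,
  forall u, spr h l u = u -> l * nq u <= ip (h u) u, forall u, spr h l u = 0 -> ip (h u) u <= l * nq u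
  & forall u, spr h l u = 0 -> l * nq u <= ip (h u) u -> u = 0].
Proof.
move=> hh; have [h1 h2 h3 h4 h5] := pp_spec (sa_shift l hh); split=> //.
- by move=> x xh; apply: h2; rewrite mulrBr mulrBl scAr scAl mulr1 mul1r xh.
- by move=> u /h3; rewrite shiftE subr_ge0.
- by move=> u /h4; rewrite shiftE subr_le0.
- by move=> u hu hl; apply: h5 => //; rewrite shiftE subr_ge0.
Qed.
Lemma inM_spr h l : sa h -> inM h -> inM (spr h l).
Proof.
by move=> hh Mh; apply: inM_pp; [exact: sa_shift|apply: inMB => //; apply: inMZ; exact: inM1].
Qed.
Lemma spr_comm h l : sa h -> h * spr h l = spr h l * h.
Proof. by move=> hh; have [_ c _ _ _] := sprP l hh; exact: c. Qed.
Lemma spr_commp h l l' : sa h -> spr h l * spr h l' = spr h l' * spr h l.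
Proof. by move=> hh; have [_ c _ _ _] := sprP l' hh; apply: c; rewrite spr_comm. Qed.
(** The two projections need not commute; a vector in the range of [spr h l] that is killed by
    [spr h' l'] vanishes, and [tr_meet0] compares the traces. *)
Lemma spr_tr_mono h h' l l' : sa h -> sa h' -> inM h -> inM h' -> ole h h' -> l' <= l ->
  (tr (spr h l) <= tr (spr h' l'))%E.
Proof.
move=> hh hh' Mh Mh' le ll; have [p1 _ g1 _ _] := sprP l hh; have [p2 _ _ _ z2] := sprP l' hh'.
have M2 := inM_spr l' hh' Mh'; have -> : spr h' l' = 1 - (1 - spr h' l') by rewrite opprB addrC subrK.
apply: tr_meet0; [by apply: inMB => //; exact: inM1|exact: projC|exact: inM_spr|exact: p1|].
move=> u; rewrite subE oneE => /eqP; rewrite -subr_eq0 addrAC subrr sub0r oppr_eq0 => /eqP h2 h1.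
apply: z2 => //; apply: le_trans (_ : l * nq u <= _); first by rewrite ler_wpM2r// nq_ge0.
by apply: le_trans (g1 u h1) _; exact: ole_ip.
Qed.
Lemma spr_mono h l l' : sa h -> l' <= l -> spr h l' * spr h l = spr h l.
Proof.
move=> hh ll; have [p1 _ g1 _ _] := sprP l hh; have [p2 c2 _ _ z2] := sprP l' hh.
apply: bopE => u; rewrite mulE; apply/eqP; rewrite eq_sym -subr_eq0; apply/eqP.
apply: z2; first by rewrite bopB (proj_fix _ p2) subrr.
have fixl : spr h l (spr h l u - spr h l' (spr h l u)) = spr h l u - spr h l' (spr h l u).
  by rewrite bopB (proj_fix u p1) -[spr h l (spr h l' (spr h l u))]mulE (spr_commp l l' hh) mulE (proj_fix u p1).
by apply: le_trans (g1 _ fixl); rewrite ler_wpM2r// nq_ge0.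
Qed.
Lemma spr_projB h l l' : sa h -> l' <= l -> proj (spr h l' - spr h l).
Proof.
move=> hh ll; have [p1 _ _ _ _] := sprP l hh; have [p2 _ _ _ _] := sprP l' hh.
by apply: proj_oleB => //; apply/(proj_oleP p1 p2); exact: spr_mono.
Qed.
Lemma comm_form (h q : bop) u : sa h -> proj q -> h * q = q * h -> ip ((h * q) u) u = ip (h (q u)) (q u).
Proof. by move=> hh pq hq; rewrite -{1}pq.2 mulrA hq -mulrA mulE (sa_ip _ _ pq.1) mulE. Qed.

(** Summation by parts: [key] keeps the part of h above the n-th level as a remainder, which is
    nonpositive at n = m by the bound on h. *)
Lemma layer_up h (l : nat -> R) m : sa h -> (forall j, l j <= l j.+1) -> ole h (l m *: one) ->
  ole h (l 0%N *: one + \sum_(j < m) (l j.+1 - l j) *: spr h (l j)).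
Proof.
move=> hh lm hm.
have hp j := sprP (l j) hh.
have ss n : sa (l 0%N *: one + \sum_(j < n) (l j.+1 - l j) *: spr h (l j)).
  apply: saD; first exact/saZ/sa1.
  by apply: (big_ind sa) => [|a b|j _]; [exact: (psd0 dot).1|exact: saD|apply: saZ; case: (hp j) => -[]].
have key n u : ip (h u) u <= ip ((l 0%N *: one + \sum_(j < n) (l j.+1 - l j) *: spr h (l j)) u) u +
   (ip (h (spr h (l n) u)) (spr h (l n) u) - l n * nq (spr h (l n) u)).
  elim: n => [|n IH].
    rewrite big_ord0 addr0 scaleE oneE ipZl; change (ip u u) with (nq u).
    have [p0 _ _ k0 _] := hp 0%N; have := k0 ((1 - spr h (l 0%N)) u).
    rewrite -mulE (projeC p0) zeroE => /(_ erefl); rewrite (proj_pyth u p0).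
    have c0 := spr_comm (l 0%N) hh.
    have -> : ip (h u) u = ip (h (spr h (l 0%N) u)) (spr h (l 0%N) u) + ip (h ((1 - spr h (l 0%N)) u)) ((1 - spr h (l 0%N)) u).
      have c1 : h * (1 - spr h (l 0%N)) = (1 - spr h (l 0%N)) * h by rewrite mulrBr mulrBl mulr1 mul1r c0.
      rewrite -!comm_form//; last exact: projC.
      by rewrite mulrBr mulr1 subE ipBl addrC subrK.
    lra.
  have eS : l 0%N *: one + \sum_(j < n.+1) (l j.+1 - l j) *: spr h (l j) =
    (l 0%N *: one + \sum_(j < n) (l j.+1 - l j) *: spr h (l j)) + (l n.+1 - l n) *: spr h (l n) by rewrite big_ord_recr addrA.
  apply: le_trans IH _; rewrite eS [X in _ <= ip X _ + _]addE ipDl -addrA lerD2l.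
  have [p0 _ _ _ _] := hp n; have [p1 _ _ k1 _] := hp n.+1; have pd := spr_projB hh (lm n).
  set q := spr h (l n) - spr h (l n.+1) in pd.
  rewrite scaleE ipZl (proj_ip u p0).
  have c0 := spr_comm (l n) hh; have c1 := spr_comm (l n.+1) hh.
  have cq : h * q = q * h by rewrite mulrBr mulrBl c0 c1.
  have q0 : spr h (l n.+1) (q u) = 0.
    by rewrite -mulE mulrBr p1.2 spr_commp// spr_mono// subrr zeroE.
  have := k1 _ q0.
  have e1 : ip (h (spr h (l n) u)) (spr h (l n) u) = ip (h (spr h (l n.+1) u)) (spr h (l n.+1) u) + ip (h (q u)) (q u).
    by rewrite -!comm_form// -ipDl -addE -mulrDr addrC subrK.
  have e2 : nq (spr h (l n) u) = nq (spr h (l n.+1) u) + nq (q u).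
    by rewrite -!proj_ip// -ipDl -addE addrC subrK.
  rewrite e1 e2; lra.
apply: oleP => [//||u]; first exact: ss.
apply: le_trans (key m u) _; rewrite gerDl subr_le0.
by have := ole_ip (spr h (l m) u) hm; rewrite scaleE oneE ipZl.
Qed.
(** The same summation by parts; positivity of h and l 0 = 0 start the induction, and h >= l m on
    the top layer ends it. *)
Lemma layer_low h (l : nat -> R) m : psd h -> l 0%N = 0 -> (forall j, l j <= l j.+1) ->
  ole (\sum_(j < m) (l j.+1 - l j) *: spr h (l j.+1)) h.
Proof.
move=> ph l00 lm; have hh := ph.1; have hp j := sprP (l j) hh.
have ss n : sa (\sum_(j < n) (l j.+1 - l j) *: spr h (l j.+1)).
  by apply: (big_ind sa) => [|a b|j _]; [exact: (psd0 dot).1|exact: saD|apply: saZ; case: (hp j.+1) => -[]].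
have key n u : ip ((\sum_(j < n) (l j.+1 - l j) *: spr h (l j.+1)) u) u <=
   ip (h u) u - ip (h (spr h (l n) u)) (spr h (l n) u) + l n * nq (spr h (l n) u).
  elim: n => [|n IH].
    rewrite big_ord0 zeroE ip0l [X in _ + X * _]l00 mul0r addr0 subr_ge0; have [p0 _ _ k0 _] := hp 0%N.
    have c0 := spr_comm (l 0%N) hh; rewrite -(comm_form u hh p0 c0) -subr_ge0 -ipBl -subE -{1}[h]mulr1 -mulrBr.
    have c1 : h * (1 - spr h (l 0%N)) = (1 - spr h (l 0%N)) * h by rewrite mulrBr mulrBl mulr1 mul1r c0.
    by rewrite (comm_form u hh (projC p0) c1); exact: ph.2.
  have eS : \sum_(j < n.+1) (l j.+1 - l j) *: spr h (l j.+1) =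
    \sum_(j < n) (l j.+1 - l j) *: spr h (l j.+1) + (l n.+1 - l n) *: spr h (l n.+1) by rewrite big_ord_recr.
  rewrite eS [X in ip X _ <= _]addE ipDl.
  have [p0 _ g0 _ _] := hp n; have [p1 _ _ k1 _] := hp n.+1; have pd := spr_projB hh (lm n).
  set q := spr h (l n) - spr h (l n.+1) in pd.
  rewrite scaleE ipZl (proj_ip u p1).
  have c0 := spr_comm (l n) hh; have c1 := spr_comm (l n.+1) hh.
  have cq : h * q = q * h by rewrite mulrBr mulrBl c0 c1.
  have q0 : spr h (l n) (q u) = q u.
    by rewrite -mulE mulrBr p0.2 spr_mono.
  have := g0 _ q0.
  have e1 : ip (h (spr h (l n) u)) (spr h (l n) u) = ip (h (spr h (l n.+1) u)) (spr h (l n.+1) u) + ip (h (q u)) (q u).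
    by rewrite -!comm_form// -ipDl -addE -mulrDr addrC subrK.
  have e2 : nq (spr h (l n) u) = nq (spr h (l n.+1) u) + nq (q u).
    by rewrite -!proj_ip// -ipDl -addE addrC subrK.
  rewrite e1 e2 in IH; lra.
apply: oleP => [||u]; [exact: ss|exact: hh|].
apply: le_trans (key m u) _; rewrite -addrA gerDl addrC subr_le0.
by have [p0 _ g0 _ _] := hp m; exact: g0 (proj_fix u p0).
Qed.
Lemma chebyshev b (l : R) : inM b -> psd b -> 0 < l -> (l%:E * tr (spr b l) <= tr b)%E.
Proof.
move=> Mb pb l0; have hb := pb.1; have [p1 _ g1 _ _] := sprP l hb; have Mp := inM_spr l hb Mb.
rewrite -(trZ (ltW l0))//; last exact: proj_psd.
apply: tr_mono => //; [exact: inMZ|by apply: psdZ; [exact: ltW|exact: proj_psd]|].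
have := @layer_low b (fun j => if j is 0%N then 0 else l) 1 pb erefl; rewrite big_ord1 /= subr0; apply.
by move=> [|j] //=; exact: ltW.
Qed.
Lemma nearb_spr h (v : R) (t s : R) : sa h -> inM h -> 0 <= v -> (tr (spr h v) <= t%:E)%E -> (tr (spr (- h)%R v) <= s%:E)%E ->
  nearb h 0 v (t + s).
Proof.
move=> hh Mh v0 h1 h2; have hn := saN hh; have [p1 c1 _ k1 _] := sprP v hh; have [p2 c2 _ k2 _] := sprP v hn.
have M1 := inM1 A; set p := spr h v in h1 p1 c1 k1; set q := spr (- h) v in h2 p2 c2 k2.
have Mp : inM p by exact: inM_spr.
have Mq : inM q by apply: inM_spr => //; exact: inMN.
have pq : p * q = q * p by apply: c2; rewrite mulrN mulNr c1.
have hq : h * q = q * h by apply: c2; rewrite mulrN mulNr.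
have hp : h * p = p * h by exact: c1.
pose e := (1 - p) * (1 - q).
have ce : (1 - p) * (1 - q) = (1 - q) * (1 - p).
  by rewrite !mulrBr !mulrBl !mulr1 !mul1r pq !opprB !addrA addrAC [RHS]addrAC; congr (_ + _); exact: addrAC.
have pe : proj e by apply: proj_commM => //; exact: projC.
have he : h * e = e * h.
  have x1 : h * (1 - p) = (1 - p) * h by rewrite mulrBr mulrBl mulr1 mul1r hp.
  have x2 : h * (1 - q) = (1 - q) * h by rewrite mulrBr mulrBl mulr1 mul1r hq.
  by rewrite /e [LHS]mulrA x1 -[LHS]mulrA x2 mulrA.
have fix_ u : e u = u -> p u = 0 /\ q u = 0.
  move=> eu; split; first by rewrite -eu /e mulE -[p _]mulE (projeC p1) zeroE.
  by rewrite -eu /e ce mulE -[q _]mulE (projeC p2) zeroE.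
apply/nearbP; exists e; split.
- by apply: inMM; exact: inMB.
- exact: pe.
- apply: le_trans (_ : (tr p + tr q <= _)%E); last by rewrite EFinD; exact: leeD.
  have -> : 1 - e = p + (1 - p) * q by rewrite /e mulrBr mulr1 opprB addrA addrAC opprB addrCA subrr addr0 addrC.
  have pqp : proj ((1 - p) * q) by apply: proj_commM => //; [exact: projC|rewrite mulrBl mulrBr mul1r mulr1 pq].
  have Mpq : inM ((1 - p) * q) by apply: inMM => //; exact: inMB.
  rewrite trD//; [|exact: proj_psd|exact: proj_psd].
  rewrite leeD2l//; apply: tr_mono => //; first exact: proj_psd.
  have qc : q * (1 - p) = (1 - p) * q by rewrite mulrBr mulrBl mulr1 mul1r pq.
  by apply/(proj_oleP pqp p2); rewrite mulrA qc -mulrA p2.2.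
move=> u eu; rewrite zeroE subr0.
(* On the range of e, - v <= h <= v, and (v - h) (v + h) >= 0. *)
pose hv := (v *: one - h) * e; pose hw := (v *: one + h) * e.
have P1 : psd hv.
  have ce1 : (v *: one - h) * e = e * (v *: one - h) by rewrite mulrBr mulrBl scAr scAl mulr1 mul1r he.
  have sv : sa (v *: one - h) by apply: saB => //; exact/saZ/sa1.
  split=> [|w]; first by rewrite /sa /hv adjM sv pe.1 ce1.
  rewrite /hv comm_form// subE ipBl scaleE oneE ipZl subr_ge0.
  by apply: k1; have [] := fix_ (e w) (proj_fix w pe).
have P2 : psd hw.
  have ce1 : (v *: one + h) * e = e * (v *: one + h) by rewrite mulrDr mulrDl scAr scAl mulr1 mul1r he.
  have sv : sa (v *: one + h) by apply: saD => //; exact/saZ/sa1.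
  split=> [|w]; first by rewrite /sa /hw adjM sv pe.1 ce1.
  rewrite /hw comm_form// addE ipDl scaleE oneE ipZl -lerBlDr sub0r -ipNl -oppE.
  by apply: k2; have [] := fix_ (e w) (proj_fix w pe).
have P3 : psd (hv * hw).
  apply: psd_mul => //; rewrite /hv /hw.
  have x1 : (v *: one - h) * (v *: one + h) = (v *: one + h) * (v *: one - h).
    by rewrite !mulrBl !mulrBr !mulrDl !mulrDr !scAr !scAl !mulr1 !mul1r; rewrite opprD !addrA; congr (_ - _); rewrite addrAC.
  have L (y z : bop) : z * e = e * z -> y * e * (z * e) = y * z * e.
    by move=> ze; rewrite -mulrA [e * _]mulrA -ze -[z * e * e]mulrA pe.2 mulrA.
  have ce1 : (v *: one - h) * e = e * (v *: one - h) by rewrite mulrBr mulrBl scAr scAl mulr1 mul1r he.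
  have ce2 : (v *: one + h) * e = e * (v *: one + h) by rewrite mulrDr mulrDl scAr scAl mulr1 mul1r he.
  by rewrite !L// x1.
have [_ /(_ u)] := P3.
have ehu : e (h u) = h u by rewrite -mulE -he mulE eu.
have hvu : hv u = v%:C *: u - h u by rewrite /hv mulE eu subE scaleE oneE.
have hwu : hw u = v%:C *: u + h u by rewrite /hw mulE eu addE scaleE oneE.
rewrite mulE (sa_ip _ _ P1.1) hvu hwu.
rewrite ipDl !ipBr !ipZl !ipZr (ipC dot (h u) u); change (ip u u) with (nq u); change (ip (h u) (h u)) with (nq (h u)).
lra.
Qed.
End Layers.

(** * Singular numbers of measurable operators *)

Section Measurable.
Variables (R : realType) (H : completeNormedModType R[i]) (dot : hdot H) (A : tvna dot).
Local Notation bop := (bop H).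
Local Notation ip := (rip dot).
Local Notation nq := (sqn dot).
Local Notation sa := (sa dot).
Local Notation psd := (psd dot).
Local Notation ole := (ole dot).
Local Notation proj := (proj dot).
Local Notation inM := (inM A).
Local Notation tr := (tr A).
Local Notation near := (near A).
Local Notation nearb := (nearb A).
Local Notation sadd := (@strong_add R H).
Local Notation ssb := (@strong_sub R H).
Local Notation mu := (op_mu dot (vtau A)).
Local Notation od := (op_dist dot (vtau A)).
Local Notation tmeas := (tau_measurable dot (vM A) (vtau A)).
Local Notation aff := (affiliated (vM A)).
Implicit Types (a b c e f g z : bop) (u v w : H) (x y : set (H * H)) (s t k : R).

Lemma mu_ge0 x t : (0 <= mu x t)%E.
Proof. by apply/le_ereal_inf_tmp => _ [v [v0 _] <-]; rewrite lee_fin ltW. Qed.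
Lemma mu_dec x s t : s <= t -> (mu x t <= mu x s)%E.
Proof.
move=> st; apply: ereal_inf_le_tmp => _ [v [v0 h] <-]; exists v => //; split=> //.
by apply: le_trans h _; rewrite lee_fin.
Qed.
Lemma op_mu_fin x t : tmeas x -> 0 < t -> mu x t \is a fin_num.
Proof.
move=> hx t0; have [k k0 hk] := tmeas_near (tmeas_cdd hx) (tmeas_aff hx) hx t0.
have := near_mu (tmeas_cdd hx) (tmeas_aff hx) k0 hk; have := mu_ge0 x t.
by case: (mu x t).
Qed.
Definition fmu x t : R := fine (mu x t).
Lemma fmuE x t : tmeas x -> 0 < t -> mu x t = (fmu x t)%:E.
Proof. by move=> hx t0; rewrite /fmu fineK//; exact: op_mu_fin. Qed.
Lemma fmu_dec x : tmeas x -> dec (fmu x).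
Proof.
move=> hx; split=> [t|s t s0 st]; first by rewrite fine_ge0// mu_ge0.
by rewrite -lee_fin -!fmuE//; [exact: mu_dec|exact: lt_le_trans st].
Qed.
Lemma fmu_lt_near x k t : tmeas x -> 0 < t -> fmu x t < k -> near x 0 k t.
Proof. by move=> hx t0 h; apply: (mu_lt_near (tmeas_cdd hx) (tmeas_aff hx)); rewrite fmuE// lte_fin. Qed.
Lemma fmu_le x k t : tmeas x -> 0 < t -> 0 <= k -> near x 0 k t -> fmu x t <= k.
Proof.
move=> hx t0 k0 h; rewrite -lee_fin -fmuE//.
by have := near_mu (tmeas_cdd hx) (tmeas_aff hx) k0 h.
Qed.
Lemma fmu_le_eps x k s t : tmeas x -> 0 < s -> s < t -> (forall e : R, 0 < e -> near x 0 (k + e) (s + e)) -> 0 <= k -> fmu x t <= k.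
Proof.
move=> hx s0 st h k0; apply/ler_addgt0Pr => e e0.
have t0 : 0 < t by exact: lt_trans st.
apply: fmu_le => //; first by rewrite addr_ge0// ltW.
have d0 : 0 < Num.min e (t - s) by rewrite lt_min e0 subr_gt0.
apply: (near_mono _ _ _ (h _ d0)); first by rewrite addr_ge0// ltW.
  by rewrite lerD2l ge_min lexx.
by rewrite -lerBrDl ge_min lexx orbT.
Qed.

Lemma graph_linear b : linear_graph (graph b).
Proof.
split=> [|c p q|v]; rewrite /graph /=; first by rewrite bop0.
  by move=> -> ->; rewrite bop_lin.
by rewrite bop0.
Qed.
Lemma near_graph b : near (graph b) b 0 0.
Proof. by apply: near_refl; rewrite subrr tr0. Qed.
Lemma near_graph_bound b : exists2 k, 0 <= k & near (graph b) 0 k 0.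
Proof.
have [k k0 hk] := nbP dot b; exists (k + 1); first by rewrite addr_ge0.
apply: nearb_norm => // u; rewrite zeroE subr0; apply: le_trans (hk u) _.
by rewrite ler_wpM2r ?nq_ge0//; nra.
Qed.
Lemma graph_cdd b : cdd (graph b).
Proof.
split; first exact: graph_linear.
  apply/(closedP dot) => pn p h [h1 h2].
  apply: (scvg_unique h2); rewrite (_ : (fun n => _) = fun n => b (pn n).1); first exact: bop_scvg.
  by apply/funext => n; exact: h.
by move=> O [u Ou] _; exists u; split=> //; exists (b u).
Qed.
Lemma graph_aff b : inM b -> aff (graph b).
Proof.
move=> Mb; apply/affP => c hc p; rewrite /graph /= => ->; rewrite -!mulE; congr (bf _ _).
exact: hc.
Qed.
Lemma graph_tmeas b : inM b -> tmeas (graph b).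
Proof.
move=> Mb; have [k k0 h] := near_graph_bound b.
by apply: near_tmeas k0 h; [exact: graph_cdd|exact: graph_aff].
Qed.
Lemma near_scvg_closed x pn p : cdd x -> (forall n, x (pn n)) -> scvg2 dot pn p -> x p.
Proof. by move=> [_ cx _] h1 h2; move/(closedP dot): cx; apply; [exact: h1|exact: h2]. Qed.

(** With a bounded summand the algebraic sum is already closed, so strong sums with graphs are
    explicit. *)
Lemma sadd_graph x z : cdd x -> sadd x (graph z) = [set p | x (p.1, p.2 - z p.1)].
Proof.
move=> cx; apply/seteqP; split=> p.
  move=> /(closure_seq dot)[pn hp [c1 c2]]; change (x (p.1, p.2 - z p.1)); apply: (near_scvg_closed cx (pn := fun n => ((pn n).1, (pn n).2 - z (pn n).1))) => //.
    by move=> n; have [v [w [h1 h2 ->]]] := hp n; move: h2; rewrite /graph /= => ->; rewrite addrK.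
  by split=> //=; apply: scvgB => //; exact: bop_scvg.
by move=> /= h; apply: subset_closure; exists (p.2 - z p.1), (z p.1); split=> //; rewrite subrK.
Qed.
Lemma graph_opp z : [set p | graph z (p.1, - p.2)] = graph (- z)%R.
Proof.
apply/seteqP; split=> p; rewrite /graph /= => h; first by rewrite -h opprK.
by rewrite h opprK.
Qed.
Lemma ssb_graph x z : cdd x -> ssb x (graph z) = [set p | x (p.1, p.2 + z p.1)].
Proof.
move=> cx; rewrite /strong_sub graph_opp sadd_graph//; apply/seteqP; split=> p /=; by rewrite opprK.
Qed.
Lemma ssb_graphl b x : cdd x -> ssb (graph b) x = [set p | x (p.1, b p.1 - p.2)].
Proof.
move=> cx; apply/seteqP; split=> p.
  move=> /(closure_seq dot)[pn hp [c1 c2]]; change (x (p.1, b p.1 - p.2)); apply: (near_scvg_closed cx (pn := fun n => ((pn n).1, b (pn n).1 - (pn n).2))) => //.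
    move=> n; have [v [w [h1 h2 ->]]] := hp n; move: h1 h2; rewrite /graph /= => -> h2.
    by rewrite opprD addrA subrr sub0r.
  by split=> //=; apply: scvgB => //; exact: bop_scvg.
move=> /= h; apply: subset_closure; exists (b p.1), (p.2 - b p.1); split=> //=; first by rewrite opprB.
by rewrite addrC subrK.
Qed.
Lemma ssb_graphK x z : cdd x -> cdd (ssb x (graph z)) -> sadd (ssb x (graph z)) (graph z) = x.
Proof.
move=> cx cy; rewrite sadd_graph// ssb_graph//; apply/seteqP; split=> -[p q] /=; by rewrite subrK.
Qed.
Lemma near_ssbl b x k t : cdd x -> near (ssb (graph b) x) 0 k t -> near x b k t.
Proof.
move=> cx [e [h1 h2 h3 h4]]; exists e; split=> // u /h4[w]; rewrite ssb_graphl//= subr0 => xw hw.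
by exists (b u - w) => //; rewrite addrAC subrr sub0r -[- w]scaleN1r -[-1]/(-1%:C) -rmorphN nqZ sqrrN expr1n mul1r.
Qed.
Lemma ssb_near b x k t : cdd x -> near x b k t -> near (ssb (graph b) x) 0 k t.
Proof.
move=> cx [e [h1 h2 h3 h4]]; exists e; split=> // u /h4[w xw hw]; exists (b u - w); last by rewrite zeroE subr0 nqBC.
by rewrite ssb_graphl//= opprB addrC subrK.
Qed.

Lemma near_ssbr b x k t : cdd x -> near (ssb x (graph b)) 0 k t -> near x b k t.
Proof.
move=> cx [e [h1 h2 h3 h4]]; exists e; split=> // u /h4[w]; rewrite ssb_graph//= subr0 => xw hw.
by exists (w + b u) => //; rewrite addrK.
Qed.
Lemma opp_tmeas x : tmeas x -> tmeas [set p | x (p.1, - p.2)].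
Proof.
move=> hx; have cx := tmeas_cdd hx; have ax := tmeas_aff hx; have [lx _ _] := cx.
have [k k0 hk] := tmeas_near cx ax hx ltr01.
have h : near [set p | x (p.1, - p.2)] 0 k 1 by rewrite -[0]oppr0; exact: near_opp.
apply: near_tmeas k0 h.
  split.
  - have [x0 xl xu] := lx; split=> [|c p q hp hq|v hv] /=; first by rewrite oppr0.
      by have h := xl c _ _ hp hq; rewrite opprD -scalerN; exact: h.
    by apply/oppr_inj; rewrite oppr0; exact: xu.
  - apply/(closedP dot) => pn p hp [c1 c2]; apply: (near_scvg_closed cx (pn := fun n => ((pn n).1, - (pn n).2))) => //.
    by split=> //=; rewrite -[- p.2]sub0r (_ : (fun n => _) = fun n => 0 - (pn n).2); [apply: scvgB => //; exact: scvg_cst|apply/funext => n; rewrite sub0r].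
  - have [_ _ dx] := cx; have -> : dom [set p | x (p.1, - p.2)] = dom x; last exact: dx.
    by apply/seteqP; split=> u [v hv]; exists (- v) => //=; rewrite opprK.
apply/affP => c hc p /= hp; have := (affP A x).1 ax c hc _ hp => /=.
by rewrite bopN.
Qed.
Lemma ssb_tmeas x y : tmeas x -> tmeas y -> tmeas (ssb x y).
Proof. by move=> hx hy; apply: sadd_tmeas => //; exact: opp_tmeas. Qed.

Lemma fmu_sadd x y t : tmeas x -> tmeas y -> 0 < t -> fmu (sadd x y) (2 * t) <= fmu x t + fmu y t.
Proof.
move=> hx hy t0; apply/ler_addgt0Pr => e e0; have e2 : 0 < e / 2 by rewrite divr_gt0.
have h1 : near x 0 (fmu x t + e / 2) t by apply: fmu_lt_near => //; rewrite ltrDl.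
have h2 : near y 0 (fmu y t + e / 2) t by apply: fmu_lt_near => //; rewrite ltrDl.
have p1 : 0 <= fmu x t + e / 2 by rewrite addr_ge0 ?(fmu_dec hx).1// ltW.
have p2 : 0 <= fmu y t + e / 2 by rewrite addr_ge0 ?(fmu_dec hy).1// ltW.
have := near_add p1 p2 h1 h2; rewrite addr0 => h.
apply: fmu_le; [exact: sadd_tmeas|lra|lra|].
apply: (near_mono _ _ _ h); lra.
Qed.
Lemma fmu_opp x t : tmeas x -> 0 < t -> fmu [set p | x (p.1, - p.2)] t <= fmu x t.
Proof.
move=> hx t0; apply/ler_addgt0Pr => e e0; have p1 : 0 <= fmu x t + e by rewrite addr_ge0 ?(fmu_dec hx).1// ltW.
apply: fmu_le => //; first exact: opp_tmeas.
by rewrite -[0]oppr0; apply: near_opp; apply: fmu_lt_near => //; rewrite ltrDl.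
Qed.
Lemma od_dec x s t : cdd x -> aff x -> 0 <= s -> s <= t -> (od x t <= od x s)%E.
Proof.
move=> cx ax s0 st; have t0 := le_trans s0 st; rewrite !opdistE//.
have [pr r1 ri _ _] := resP dot cx.
apply: tr_mono.
- by apply: inMB; [exact: inM1|exact: inM_sG].
- by apply: proj_psd; apply: projC; exact: sG_proj.
- by apply: inMB; [exact: inM1|exact: inM_sG].
have := sG_mono pr st; rewrite /ole => h; by rewrite opprB addrC addrA subrK.
Qed.
Lemma od_near x s t : cdd x -> aff x -> 0 < s -> (od x s <= t%:E)%E -> near x 0 (2 * s) t.
Proof.
move=> cx ax s0 h; apply: mu_lt_near => //; apply: (@le_lt_trans _ _ s%:E); last by rewrite lte_fin; lra.
by apply: ereal_inf_lbound; exists s.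
Qed.
Lemma od_lt_mu x s t : cdd x -> aff x -> 0 <= s -> (t%:E < od x s)%E -> (s%:E <= mu x t)%E.
Proof.
move=> cx ax s0 h; apply/le_ereal_inf_tmp => _ [v [v0 hv] <-]; rewrite lee_fin leNgt; apply/negP => vs.
by have := le_lt_trans hv h; rewrite ltNge od_dec// ltW.
Qed.
Lemma od_ge0 x s : cdd x -> aff x -> 0 <= s -> (0 <= od x s)%E.
Proof.
move=> cx ax s0; rewrite opdistE//; have [pr r1 ri _ _] := resP dot cx.
apply: tr_ge0; first by apply: inMB; [exact: inM1|exact: inM_sG].
by apply: proj_psd; apply: projC; exact: sG_proj.
Qed.

Lemma tr_spr_le h k l e : sa h -> inM h -> inM e -> proj e -> k < l ->
  (forall u, e u = u -> ip (h u) u <= k * nq u) -> (tr (spr dot h l) <= tr (1 - e)%R)%E.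
Proof.
move=> hh Mh Me pe kl he; have [p1 _ g1 _ _] := sprP l hh.
apply: tr_meet0 => //; first exact: inM_spr.
move=> u eu gu; apply: (@nq_eq0 _ _ dot); have h1 := he u eu; have h2 := g1 u gu; have h3 := nq_ge0 dot u; nra.
Qed.
Lemma nearb_form h k l t : sa h -> inM h -> 0 <= k -> k < l -> nearb h 0 k t -> (tr (spr dot h l) <= t%:E)%E.
Proof.
move=> hh Mh k0 kl /nearbP[e [Me pe te he]]; apply: le_trans te; apply: (tr_spr_le hh Mh Me pe kl) => u /he.
rewrite zeroE subr0 => hu; have := CS dot (h u) u.
have := nq_ge0 dot u; have := nq_ge0 dot (h u); move: hu; set X := nq (h u); set Y := nq u; set Z := ip _ _ => hX X0 Y0 hZ.
have : Z ^+ 2 <= (k * Y) ^+ 2 by rewrite exprMn; nra.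
by move=> h2; apply: le_trans (ler_norm _) _; rewrite -(ger0_norm (mulr_ge0 k0 Y0)) -ler_sqr ?nnegrE// !real_normK ?num_real.
Qed.
Lemma nearb_psd h k t : psd h -> inM h -> 0 < k -> (tr (spr dot h k) <= t%:E)%E -> nearb h 0 k t.
Proof.
move=> ph Mh k0 h1; rewrite -[t]addr0; apply: nearb_spr => //; [exact: ph.1|exact: ltW|].
have -> : spr dot (- h) k = 0; last by rewrite tr0.
have hn := saN ph.1; have [p1 _ g1 _ _] := sprP k hn.
apply: bopE => u; rewrite zeroE; have := g1 _ (proj_fix u p1); rewrite oppE ipNl.
have := ph.2 (spr dot (- h) k u); set v := spr _ _ _ _ => h2 h3; apply: (@nq_eq0 _ _ dot).
by have := nq_ge0 dot v; nra.
Qed.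
Lemma nearb_opp b k t : nearb b 0 k t -> nearb (- b) 0 k t.
Proof.
move=> /nearbP[e [h1 h2 h3 h4]]; apply/nearbP; exists e; split=> // u /h4; rewrite zeroE !subr0 oppE.
by rewrite -[- b u]sub0r nqBC subr0.
Qed.
Lemma nearb_sub b c k t : nearb b c k t -> nearb (b - c) 0 k t.
Proof.
move=> /nearbP[e [h1 h2 h3 h4]]; apply/nearbP; exists e; split=> // u /h4; rewrite zeroE subr0 subE.
by [].
Qed.
Lemma nearb_sub0 b c k t : nearb (b - c) 0 k t -> nearb b c k t.
Proof.
by move=> /nearbP[e [h1 h2 h3 h4]]; apply/nearbP; exists e; split=> // u /h4; rewrite zeroE subr0 subE.
Qed.
Lemma nearb_add b c k l s t : 0 <= k -> 0 <= l -> nearb b 0 k s -> nearb c 0 l t -> nearb (b + c) 0 (k + l) (s + t).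
Proof.
move=> k0 l0 /nearbP[e [Me pe te he]] /nearbP[f [Mf pf tf hf]]; apply/nearbP; exists (pmeet dot e f); split.
- exact: inM_pmeet.
- exact: pmeet_proj.
- by apply: le_trans (tr_pmeet _ _ _ _) _ => //; rewrite EFinD; exact: leeD.
move=> u /pmeetE[/he h1 /hf h2]; move: h1 h2; rewrite !zeroE !subr0 addE; apply: nq_add_le => //; exact: nq_ge0.
Qed.
Lemma nearb_tri b c d k l s t : 0 <= k -> 0 <= l -> nearb b c k s -> nearb c d l t -> nearb b d (k + l) (s + t).
Proof.
move=> k0 l0 h1 h2; apply: nearb_sub0; rewrite -(subrKA c); apply: nearb_add => //; exact: nearb_sub.
Qed.
Lemma nearb_sym b c k t : nearb b c k t -> nearb c b k t.
Proof. by move=> /nearb_sub/nearb_opp; rewrite opprB => /nearb_sub0. Qed.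

End Measurable.

Lemma geometric_sum_le (R : realFieldType) (q : R) d : 0 < q -> q < 1 -> \sum_(i < d) q ^+ i <= (1 - q)^-1.
Proof.
move=> q0 q1; have q1' : 0 < 1 - q by lra.
rewrite -[(1 - q)^-1]mul1r ler_pdivlMr// mulrC; have := subrX1 q d.
have : 0 <= q ^+ d by rewrite exprn_ge0// ltW.
set S := \sum_(i < d) _; set Q := q ^+ d; nra.
Qed.

(** * Cuts of a positive operator *)

Section PositiveOperators.
Variables (R : realType) (H : completeNormedModType R[i]) (dot : hdot H) (A : tvna dot).
Local Notation bop := (bop H).
Local Notation one := (1 : bop).
Local Notation ip := (rip dot).
Local Notation nq := (sqn dot).
Local Notation psd := (psd dot).
Local Notation ole := (ole dot).
Local Notation inM := (inM A).
Local Notation tr := (tr A).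
Local Notation near := (near A).
Local Notation nearb := (nearb A).
Local Notation od := (op_dist dot (vtau A)).
Local Notation tmeas := (tau_measurable dot (vM A) (vtau A)).
Implicit Types (a b c e f g z : bop) (u v w : H) (s t k : R).
Variable x : set (H * H).
Hypotheses (px : positive dot x) (hx : tmeas x).
Let cx : cdd x := tmeas_cdd hx.
Let ax := tmeas_aff hx.
Local Notation r := (res dot x).
Local Notation G := (sG dot r).
(* x (sG t) *)
Definition pcut t : bop := sa_ dot r t.
Let pr : psd r. Proof. by have [] := resP dot cx. Qed.
Let r1 : ole r 1. Proof. by have [] := resP dot cx. Qed.
Let ri u : r u = 0 -> u = 0. Proof. by have [_ _ h _ _] := resP dot cx; exact: h. Qed.
Let cutP t (t0 : 0 <= t) := sa_P pr r1 t0.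

(** x and the model [sT] of its resolvent are positive roots of the same operator, and [sqrt_graph]
    describes both by one formula. *)
Lemma positive_sT : x = sT dot r.
Proof.
have sq u v : comp_graph x x (u, v) <-> u = r (u + v).
  have [[_ ex] _] := px; rewrite -(res_sq dot u v cx) -[X in comp_graph X x _]ex //.
by apply: etrans (sqrt_graph pr r1 ri px sq) _; apply/esym; exact: (sqrt_graph pr r1 ri (sT_positive pr r1 ri) (sT_sq pr r1 ri)).
Qed.
Lemma pcut_graph t u : 0 <= t -> x (G t u, pcut t u).
Proof.
move=> t0; suff : sT dot r (G t u, pcut t u) by rewrite -positive_sT.
move=> n /=; rewrite -!mulE /pcut; have n0 : (0 : R) <= n%:R by rewrite ler0n.
case/orP: (le_total t n%:R) => tn; congr (bf _ u).
  by rewrite (sa_sG' pr r1 t0 tn) (sa__mono pr r1 t0 tn).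
by rewrite (sG_sa_ pr r1 _ t0) (sa__mono pr r1 n0 tn) -(sG_sa_ pr r1 _ n0) (sa_sG' pr r1 n0 tn).
Qed.
Lemma pcut_psd t : 0 <= t -> psd (pcut t). Proof. by move=> t0; have [] := cutP t0. Qed.
Lemma inM_pcut t : 0 <= t -> inM (pcut t).
Proof.
move=> t0; apply: inM_bsqrt; first exact: sb_psd.
by apply: inMB; [exact: inM_sc|exact: inM_sG].
Qed.
Lemma pcut_nq t u : 0 <= t -> nq (pcut t u) <= t ^+ 2 * nq u.
Proof.
move=> t0; have [p1 p2 _] := cutP t0; have -> : nq (pcut t u) = ip (sb dot r t u) u.
  by rewrite -p2 mulE (sa_ip _ _ p1.1).
apply: le_trans (sb_upper dot cx u t0) _; apply: ler_wpM2l; first exact: sqr_ge0.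
by apply: proj_nq; exact: sG_proj.
Qed.
Lemma psd_norm_ole a t : 0 <= t -> psd a -> (forall u, nq (a u) <= t ^+ 2 * nq u) -> ole a (t *: one).
Proof.
move=> t0 pa h; apply: oleP => [||u]; [exact: pa.1|exact/saZ/sa1|]; rewrite scaleE oneE ipZl; change (ip u u) with (nq u).
have := CS dot (a u) u; have := h u; have := nq_ge0 dot u; have := nq_ge0 dot (a u).
set X := nq (a u); set Y := nq u; set Z := ip _ _ => X0 Y0 hX hZ.
have : Z ^+ 2 <= (t * Y) ^+ 2 by rewrite exprMn; nra.
move=> h2; apply: le_trans (ler_norm _) _; rewrite -(ger0_norm (mulr_ge0 t0 Y0)) -ler_sqr ?nnegrE//.
by rewrite !real_normK ?num_real.
Qed.
Lemma pcut_le t : 0 <= t -> ole (pcut t) (t *: one).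
Proof. by move=> t0; apply: psd_norm_ole => // [|u]; [exact: pcut_psd|exact: pcut_nq]. Qed.
Lemma pcutB s t : 0 <= s -> s <= t -> pcut t - pcut s = (1 - G s) * pcut t * (1 - G s).
Proof.
move=> s0 st; have t0 := le_trans s0 st; have ps := sG_proj pr s.
have e1 : pcut t * G s = pcut s by exact: (sa__mono pr r1 s0 st).
have e2 : G s * pcut t = pcut s by rewrite -e1; exact: (sG_sa_ pr r1 _ t0).
have e3 : G s * pcut s = pcut s by exact: (sa_sG pr r1 s0).
by rewrite mulrBl mul1r e2 mulrBr mulr1 mulrBl e1 -e1 -mulrA ps.2 subrr subr0.
Qed.
Lemma pcutB_psd s t : 0 <= s -> s <= t -> psd (pcut t - pcut s).
Proof.
move=> s0 st; rewrite pcutB//; apply: psd_conjsa; first by apply: pcut_psd; exact: le_trans st.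
exact: (projC (sG_proj pr s)).1.
Qed.
Lemma pcutB_tr s t d : 0 <= s -> s <= t -> (tr (1 - G s)%R <= d%:E)%E -> (tr (pcut t - pcut s)%R <= (t * d)%:E)%E.
Proof.
move=> s0 st hd; have t0 := le_trans s0 st; have ps := projC (sG_proj pr s).
have Mp : inM (1 - G s) by apply: inMB; [exact: inM1|exact: inM_sG].
apply: (@le_trans _ _ (tr (t *: (1 - G s))%R)).
  apply: tr_mono.
  - by apply: inMB; apply: inM_pcut.
  - exact: pcutB_psd.
  - exact: inMZ.
  rewrite pcutB//; have := ole_conjsa ps.1 (pcut_le t0).
  by rewrite scAr mulr1 scAl ps.2.
rewrite trZ//; last exact: proj_psd.
by rewrite EFinM; apply: lee_wpmul2l; rewrite ?lee_fin.
Qed.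
Lemma pcut_near t d : 0 <= t -> (tr (1 - G t)%R <= d%:E)%E -> near x (pcut t) 0 d.
Proof.
move=> t0 hd; exists (G t); split; [exact: inM_sG|exact: (sG_proj pr)|exact: hd|].
move=> u gu; exists (pcut t u); first by rewrite -{1}gu; exact: pcut_graph.
by rewrite subrr /sqn ip0l expr0n mul0r.
Qed.

Lemma od_le_fmu k t : 0 < t -> fmu A x t < k -> (tr (1 - G k)%R <= t%:E)%E.
Proof.
move=> t0 h; have k0 : 0 <= k by apply: le_trans (ltW h); exact: (fmu_dec hx).1.
rewrite -(opdistE A cx k0); pose k' := (fmu A x t + k) / 2.
have k1 : fmu A x t < k' by rewrite /k'; lra.
have k2 : k' < k by rewrite /k'; lra.
apply: (near_od cx ax _ k2); first by apply: le_trans (ltW k1); exact: (fmu_dec hx).1.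
exact: fmu_lt_near.
Qed.

Variables (q K : R) (v : nat -> R).
Hypotheses (q0 : 0 < q) (q1 : q < 1) (K0 : 0 <= K).
Hypothesis (v0 : forall i, 0 <= v i) (vS : forall i, v i <= v i.+1).
Hypothesis (vq : forall i, v i.+1 * 2^-1 ^+ i <= K * q ^+ i).
Hypothesis hv : forall i, (tr (1 - G (v i))%R <= (2^-1 ^+ i)%:E)%E.

Lemma v_mono m n : (m <= n)%N -> v m <= v n.
Proof. by move=> mn; apply: (homo_leq (@lexx _ _) (@le_trans _ _) vS mn). Qed.
(** The slice of x between v i and v (i + 1) has norm at most v (i + 1) and a support of trace at
    most 2^-i, so its trace is at most K q^i; the slices sum geometrically. This is what puts x
    minus a cut in L^1. *)
Lemma pcut_tail n m : (n <= m)%N -> (tr (pcut (v m) - pcut (v n))%R <= (K / (1 - q) * q ^+ n)%:E)%E.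
Proof.
move=> nm; rewrite -(subnK nm) addnC; move: (m - n)%N => d {nm}.
have M i : inM (pcut (v i)) by exact: inM_pcut.
suff : (tr (pcut (v (n + d)) - pcut (v n))%R <= (\sum_(i < d) K * q ^+ (n + i))%:E)%E.
  move/le_trans; apply; rewrite lee_fin.
  have -> : \sum_(i < d) K * q ^+ (n + i) = K * q ^+ n * \sum_(i < d) q ^+ i.
    by rewrite mulr_sumr; apply: eq_bigr => i _; rewrite exprD mulrA.
  have h : \sum_(i < d) q ^+ i <= (1 - q)^-1.
    exact: geometric_sum_le.
  have h2 : 0 <= K * q ^+ n by rewrite mulr_ge0// exprn_ge0// ltW.
  by apply: le_trans (ler_wpM2l h2 h) _; rewrite mulrAC.
elim: d => [|d IH]; first by rewrite addn0 subrr tr0 big_ord0.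
rewrite big_ord_recr EFinD -(subrKA (pcut (v (n + d)))) addrC addnS trD; first last.
- by apply: pcutB_psd.
- by apply: inMB.
- by apply: pcutB_psd => //; apply: v_mono; rewrite leq_addr.
- by apply: inMB.
apply: leeD => //; apply: le_trans (pcutB_tr (v0 _) (vS _) (hv _)) _.
by rewrite lee_fin.
Qed.

Hypothesis odfin : forall s, 0 < s -> (od x s < +oo)%E.

(* band l is x cut to the spectral interval (lowcut l, v l]. *)
Definition lowcut (l : nat) : R := Num.min (v 0%N) l.+1%:R^-1.
Definition band l : bop := pcut (v l) - pcut (lowcut l).
Lemma lowcut_ge0 l : 0 <= lowcut l. Proof. by rewrite /lowcut le_min v0 invr_ge0 ler0n. Qed.
Lemma lowcut_le l m : lowcut l <= v m.
Proof. by apply: le_trans (v_mono (leq0n m)); rewrite /lowcut ge_min lexx. Qed.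
Lemma lowcut_dec l : lowcut l.+1 <= lowcut l.
Proof.
have h : (l.+2%:R : R)^-1 <= l.+1%:R^-1 by rewrite lef_pV2 ?posrE ?ltr0n// ler_nat.
by rewrite /lowcut le_min ge_min lexx /= ge_min h orbT.
Qed.
Lemma inM_app l : inM (band l).
Proof. by apply: inMB; apply: inM_pcut => //; exact: lowcut_ge0. Qed.
Lemma app_psd l : psd (band l).
Proof. by apply: pcutB_psd; [exact: lowcut_ge0|exact: lowcut_le]. Qed.
Lemma app_mono l m : (l <= m)%N -> ole (band l) (band m).
Proof.
move=> lm; have low i j : (i <= j)%N -> lowcut j <= lowcut i.
  move=> ij; rewrite -(subnK ij) addnC; elim: (j - i)%N => [|d IH]; first by rewrite addn0.
  by rewrite addnS; apply: le_trans (lowcut_dec _) IH.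
rewrite /ole /band opprB [pcut (lowcut l) - _]addrC addrACA; apply: psdD.
  by apply: pcutB_psd => //; exact: v_mono.
rewrite addrC; apply: pcutB_psd; [exact: lowcut_ge0|exact: low].
Qed.
(** The lower cut confines the band to a spectral set of finite trace, as [dual_doob] demands of its
    operators. *)
Lemma app_tr l : 0 < v 0%N -> (tr (band l) < +oo)%E.
Proof.
move=> v00; have l0 : 0 < lowcut l by rewrite /lowcut lt_min v00 invr_gt0 ltr0n.
have h := odfin l0; rewrite opdistE ?(ltW l0)// in h.
have h0 : (0 <= tr (1 - G (lowcut l))%R)%E.
  apply: tr_ge0; first by apply: inMB; [exact: inM1|exact: inM_sG].
  by apply: proj_psd; apply: projC; exact: (sG_proj pr).
have fe : (tr (1 - G (lowcut l))%R <= (fine (tr (1 - G (lowcut l))%R))%:E)%E.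
  by rewrite fineK// ge0_fin_numE.
by apply: le_lt_trans (pcutB_tr (lowcut_ge0 l) (lowcut_le l l) fe) _; rewrite ltry.
Qed.
Lemma app_dist l : nearb (pcut (v l)) (band l) l.+1%:R^-1 0.
Proof.
apply: nearb_norm => // u; rewrite /band subE opprB addrC subrK.
apply: le_trans (pcut_nq u (lowcut_ge0 l)) _; apply: ler_wpM2r; first exact: nq_ge0.
by rewrite ler_pXn2r ?nnegrE ?lowcut_ge0 ?invr_ge0//; rewrite /lowcut ge_min lexx orbT.
Qed.
Lemma app_near l : near x (band l) l.+1%:R^-1 (2^-1 ^+ l).
Proof.
have := near_tri (lexx 0) _ (pcut_near (v0 l) (hv l)) (app_dist l); rewrite add0r addr0; apply.
by rewrite invr_ge0.
Qed.
End PositiveOperators.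

Lemma sum_int_shift (R : realType) (f : int -> R) n :
  \sum_(i < n) (f (i : nat)%:Z + f (Negz i)) = \sum_(j < n + n) f (j%:Z - n%:Z).
Proof.
rewrite big_split_ord /= big_split /= [LHS]addrC; congr (_ + _).
  rewrite (reindex_inj rev_ord_inj) /=; apply: eq_bigr => i _; congr (f _).
  by have := ltn_ord i; lia.
by apply: eq_bigr => i _; congr (f _); lia.
Qed.
Lemma lim_sum (R : realType) n (F : 'I_n -> nat -> R) (L : 'I_n -> R) :
  (forall i, F i m @[m --> \oo] --> L i) -> (\sum_(i < n) F i m) @[m --> \oo] --> \sum_(i < n) L i.
Proof.
elim: n F L => [|n IH] F L h; first by rewrite big_ord0; under eq_fun do rewrite big_ord0; exact: cvg_cst.
rewrite big_ord_recr /=; under eq_fun do rewrite big_ord_recr /=.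
by apply: cvgD; [apply: IH => i; exact: h|exact: h].
Qed.

(** * The norm of L^1 and traces *)

Section IntegralNorm.
Variables (R : realType) (H : completeNormedModType R[i]) (dot : hdot H) (A : tvna dot).
Local Notation bop := (bop H).
Local Notation sa := (sa dot).
Local Notation psd := (psd dot).
Local Notation ole := (ole dot).
Local Notation inM := (inM A).
Local Notation tr := (tr A).
Local Notation near := (near A).
Local Notation nearb := (nearb A).
Local Notation spr := (spr dot).
Local Notation mu := (op_mu dot (vtau A)).
Local Notation od := (op_dist dot (vtau A)).
Local Notation L1 := (L1_norm dot (vtau A)).
Local Notation tmeas := (tau_measurable dot (vM A) (vtau A)).
Implicit Types (a b c e f g z : bop) (u v w : H) (s t d : R).

Lemma p2_gt0 (k : int) : 0 < (2 : R) ^ k. Proof. exact: pow2_gt0. Qed.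
Lemma spr_psd c l : sa c -> psd (spr c l). Proof. by move=> hc; apply: proj_psd; have [] := sprP l hc. Qed.
Lemma spr_fin c d l : inM c -> psd c -> (tr c <= d%:E)%E -> 0 < l ->
  tr (spr c l) = (fine (tr (spr c l)))%:E /\ l * fine (tr (spr c l)) <= d.
Proof.
move=> Mc pc hd l0; have h := le_trans (chebyshev Mc pc l0) hd.
have h0 : (0 <= tr (spr c l))%E by apply: tr_ge0; [exact: inM_spr pc.1 Mc|exact: spr_psd pc.1].
have e : tr (spr c l) = (fine (tr (spr c l)))%:E.
  rewrite fineK// ge0_fin_numE//; move: h; case: (tr _) h0 => [y| |] //; first by rewrite ltry.
  by rewrite gt0_muley ?lte_fin.
by split=> //; move: h; rewrite {1}e -EFinM lee_fin.
Qed.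
Definition sprd c (k : int) : R := fine (tr (spr c (2 ^ k))).
Lemma tr_layers c d n : inM c -> psd c -> (tr c <= d%:E)%E ->
  \sum_(i < n) (2 ^ (i : nat)%:Z * sprd c (i : nat)%:Z + 2 ^ (Negz i) * sprd c (Negz i)) <= 2 * d.
Proof.
move=> Mc pc hd; rewrite (sum_int_shift (fun k => 2 ^ k * sprd c k)).
pose l (j : nat) : R := if j is j'.+1 then 2 ^ (j'%:Z - n%:Z) else 0.
have lS j : 2 ^ (j%:Z - n%:Z) <= 2 * (l j.+1 - l j).
  rewrite /l; case: j => [|j]; first by rewrite subr0; have := p2_gt0 (0%:Z - n%:Z); lra.
  have -> : (j.+1%:Z - n%:Z = (j%:Z - n%:Z) + 1)%R by lia.
  by rewrite pow2S; have := p2_gt0 (j%:Z - n%:Z); lra.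
have l0 j : 0 <= l j.+1 - l j by have := lS j; have := p2_gt0 (j%:Z - n%:Z); lra.
have lm j : l j <= l j.+1 by rewrite -subr_ge0.
have lo := layer_low (n + n) pc (erefl : l 0%N = 0) lm.
have Ms j : inM (spr c (l j)) by exact: inM_spr pc.1 Mc.
have ps j : psd (spr c (l j)) by exact: spr_psd pc.1.
have h : (tr (\sum_(j < n + n) (l j.+1 - l j) *: spr c (l j.+1))%R <= d%:E)%E.
  apply: le_trans hd; apply: tr_mono => //; first by apply: inM_sum => j _; exact: inMZ.
  by apply: psd_sum => j _; exact: psdZ.
move: h; rewrite tr_sum; last by move=> j _; split; [exact: inMZ|exact: psdZ].
have e j : tr ((l j.+1 - l j) *: spr c (l j.+1))%R = ((l j.+1 - l j) * sprd c (j%:Z - n%:Z))%:E.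
  by rewrite trZ// (spr_fin Mc pc hd (p2_gt0 _)).1 EFinM.
under eq_bigr do rewrite e.
rewrite sumEFin lee_fin => h1; apply: le_trans (_ : 2 * \sum_(j < n + n) (l j.+1 - l j) * sprd c (j%:Z - n%:Z) <= _); last by rewrite ler_pM2l.
rewrite mulr_sumr; apply: ler_sum => j _; rewrite mulrA; apply: ler_wpM2r; last exact: lS.
by rewrite fine_ge0// tr_ge0// ; [exact: inM_spr pc.1 Mc|exact: spr_psd pc.1].
Qed.

(** D k, the limit of the traces of the spectral projections of c m above 2^k, bounds the
    distribution of Z there because c m approximates Z in measure, up to sign. The constant 16 is 8
    from [integral_dyadic] times 2 from [tr_layers]; the sign alternative covers differences written
    in the opposite order. *)
Lemma L1_upper (Z : set (H * H)) (c : nat -> bop) d : tmeas Z -> (forall m, inM (c m)) -> (forall m, psd (c m)) ->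
  (forall m, ole (c m) (c m.+1)) -> (forall m, (tr (c m) <= d%:E)%E) ->
  (forall s, 0 < s -> exists m, near Z (c m) s s \/ near Z (- c m) s s) -> (L1 Z <= (16 * d)%:E)%E.
Proof.
move=> hZ Mc pc oc tc hn; have cZ := tmeas_cdd hZ; have aZ := tmeas_aff hZ.
have d0 k m : 0 <= sprd (c m) k.
  by rewrite fine_ge0// tr_ge0//; [exact: inM_spr (pc m).1 (Mc m)|exact: spr_psd (pc m).1].
have nd k : nondecreasing_seq (fun m => sprd (c m) k).
  apply/nondecreasing_seqP => m; rewrite -lee_fin /sprd.
  rewrite -(spr_fin (Mc m) (pc m) (tc m) (p2_gt0 k)).1 -(spr_fin (Mc m.+1) (pc m.+1) (tc m.+1) (p2_gt0 k)).1.
  by apply: spr_tr_mono => //; [exact: (pc m).1|exact: (pc m.+1).1].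
have cv k : cvgn (fun m => sprd (c m) k).
  apply: nondecreasing_is_cvgn => //; exists (d / 2 ^ k) => _ [m _ <-].
  rewrite ler_pdivlMr ?p2_gt0// mulrC; exact: (spr_fin (Mc m) (pc m) (tc m) (p2_gt0 k)).2.
pose D k := limn (fun m => sprd (c m) k).
have dD k m : sprd (c m) k <= D k by exact: nondecreasing_cvgn_le.
have D0 k : 0 <= D k by apply: le_trans (d0 k 0%N) (dD k 0%N).
have -> : (16 * d)%:E = (8 * (2 * d))%:E by congr (_%:E); ring.
apply: (integral_dyadic (D := D)).
- by apply: edec_measurable => s t _; exact: mu_dec.
- by move=> t; exact: mu_ge0.
- exact: D0.
- move=> k t Dt; apply/lee_addgt0Pr => e e0; rewrite -EFinD.
  pose s := Num.min e (t - D k); have s0 : 0 < s by rewrite lt_min e0 subr_gt0.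
  have [m hm] := hn s s0.
  have hb : nearb (c m) 0 (2 ^ k) (D k).
    apply: nearb_psd => //; first exact: p2_gt0.
    by rewrite (spr_fin (Mc m) (pc m) (tc m) (p2_gt0 k)).1 lee_fin; exact: dD.
  have h : near Z 0 (s + 2 ^ k) (s + D k).
    case: hm => hm; apply: (near_tri _ _ hm) => //; try exact: ltW; try exact: (ltW (p2_gt0 k)).
    exact: nearb_opp.
  have p1 : 0 <= s + 2 ^ k by rewrite addr_ge0 ?(ltW s0)// ltW// p2_gt0.
  apply: le_trans (mu_dec A Z (_ : s + D k <= t)) _; first by rewrite -lerBrDr ge_min lexx orbT.
  apply: le_trans (near_mu cZ aZ p1 h) _; rewrite lee_fin addrC lerD2l ge_min lexx; by [].
move=> n; rewrite (sum_int_shift (fun k => 2 ^ k * D k)).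
have h : (\sum_(j < n + n) 2 ^ (j%:Z - n%:Z) * sprd (c m) (j%:Z - n%:Z)) @[m --> \oo] --> \sum_(j < n + n) 2 ^ (j%:Z - n%:Z) * D (j%:Z - n%:Z).
  apply: (lim_sum (F := fun j m => 2 ^ (j%:Z - n%:Z) * sprd (c m) (j%:Z - n%:Z))) => j.
  by apply: cvgM; [exact: cvg_cst|exact: cv].
rewrite -(cvg_lim (@Rhausdorff R) h); apply: limr_le; first by apply/cvg_ex; eexists; exact: h.
apply: nearW => m; rewrite -(sum_int_shift (fun k => 2 ^ k * sprd (c m) k)).
exact: tr_layers.
Qed.

(** Weak-type estimates see an operator through its distribution at the levels th 2^j; these values,
    weighted by the levels, sum to at most twice the L^1 norm. *)
Lemma L1_lower (Z : set (H * H)) d th : tmeas Z -> 0 <= d -> (L1 Z <= d%:E)%E -> 0 < th ->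
  exists p : nat -> R, (forall j, 0 <= p j /\ (od Z (th * 2 ^+ j) <= (p j)%:E)%E) /\
    forall n, \sum_(j < n) (th * 2 ^+ j) * p j <= 2 * d.
Proof.
move=> hZ d0 hd th0; have cZ := tmeas_cdd hZ; have aZ := tmeas_aff hZ.
have thj j : 0 < th * 2 ^+ j by rewrite mulr_gt0// exprn_gt0.
have o0 j : (0 <= od Z (th * 2 ^+ j))%E by apply: od_ge0 => //; exact: ltW.
have key n : (\sum_(j < n) (th * 2 ^+ j)%:E * od Z (th * 2 ^+ j) <= (2 * d)%:E)%E.
  have mg : measurable_fun (`[0%R, +oo[%classic : set R) (mu Z) by apply: edec_measurable => s t _; exact: mu_dec.
  have hj j t : (t%:E < od Z (th * 2 ^+ j))%E -> ((th * 2 ^+ j)%:E <= mu Z t)%E by apply: od_lt_mu => //; exact: ltW.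
  apply: le_trans (dyadic_le_integral n mg (mu_ge0 A Z) th0 o0 hj) _.
  by rewrite EFinM; apply: lee_wpmul2l.
have fo j : od Z (th * 2 ^+ j) = (fine (od Z (th * 2 ^+ j)))%:E.
  rewrite fineK// ge0_fin_numE//; have := key j.+1; rewrite big_ord_recr /=.
  have s0 : (0 <= \sum_(i < j) (th * 2 ^+ i)%:E * od Z (th * 2 ^+ i))%E.
    by apply: sume_ge0 => i _; apply: mule_ge0 => //; rewrite lee_fin ltW.
  move=> h; have {}h : ((th * 2 ^+ j)%:E * od Z (th * 2 ^+ j) <= (2 * d)%:E)%E by apply: le_trans h; rewrite leeDr.
  move: h; case: (od _ _) (o0 j) => [y| |] //; first by rewrite ltry.
  by rewrite gt0_muley ?lte_fin.
exists (fun j => fine (od Z (th * 2 ^+ j))); split=> [j|n]; first by rewrite fine_ge0// {1}fo.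
have := key n; under eq_bigr do rewrite fo -EFinM.
by rewrite sumEFin lee_fin.
Qed.
(** Chebyshev's inequality, as the one-term case of [L1_lower] at level s / 2. *)
Lemma L1_near (Z : set (H * H)) s : tmeas Z -> 0 < s -> (L1 Z <= (s ^+ 2 / 4)%:E)%E -> near Z 0 s s.
Proof.
move=> hZ s0 hd; have d0 : 0 <= s ^+ 2 / 4 by rewrite divr_ge0// sqr_ge0.
have s2 : 0 < s / 2 by rewrite divr_gt0.
have [p [hp /(_ 1%N)]] := L1_lower hZ d0 hd s2; have [p0 op] := hp 0%N.
rewrite big_ord1 expr0 mulr1 => h; rewrite expr0 mulr1 in op.
have := od_near (tmeas_cdd hZ) (tmeas_aff hZ) s2 op; rewrite mulrC divfK// => h1.
apply: (near_mono _ (lexx s) _ h1); first exact: ltW.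
have : s * p 0%N <= s * s by move: h; rewrite expr2; lra.
by rewrite ler_pM2l.
Qed.
Lemma L1_cvg0 (Z : nat -> set (H * H)) (s : R) : L1 (Z n) @[n --> \oo] --> 0%E -> 0 < s ->
  exists N, forall n, (N <= n)%N -> (L1 (Z n) <= s%:E)%E.
Proof.
move=> /fine_cvgP[[N1 _ h1] h2] s0; have [N2 hN2] := cvg0_bound h2 s0.
exists (maxn N1 N2) => n; rewrite geq_max => /andP[n1 n2].
by rewrite -(fineK (h1 n n1)) lee_fin ltW//; exact: hN2.
Qed.
Lemma L1_ge0 Z : (0 <= L1 Z)%E.
Proof. by apply: integral_ge0 => t _; exact: mu_ge0. Qed.
Lemma L1_cvg_geom (Z : nat -> set (H * H)) (K q : R) : 0 < q -> q < 1 ->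
  (forall n, (L1 (Z n) <= (K * q ^+ n)%:E)%E) -> L1 (Z n) @[n --> \oo] --> 0%E.
Proof.
move=> q0 q1 h; apply: (@squeeze_cvge _ _ _ _ (fun=> 0%E) _ (fun n => (K * q ^+ n)%:E)).
- by apply: nearW => n; rewrite L1_ge0 h.
- exact: cvg_cst.
by apply: cvg_EFin; [exact: nearW|apply: cvg_geometric; rewrite ger0_norm// ltW].
Qed.
End IntegralNorm.

(** * Extension of a conditional expectation *)

Section CexpGraph.
Variables (R : realType) (H : completeNormedModType R[i]) (dot : hdot H) (A : tvna dot).
Local Notation bop := (bop H).
Local Notation one := (1 : bop).
Local Notation ip := (rip dot).
Local Notation nq := (sqn dot).
Local Notation sa := (sa dot).
Local Notation psd := (psd dot).
Local Notation ole := (ole dot).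
Local Notation proj := (proj dot).
Local Notation inM := (inM A).
Local Notation tr := (tr A).
Local Notation near := (near A).
Local Notation nearb := (nearb A).
Local Notation spr := (spr dot).
Local Notation sadd := (@strong_add R H).
Local Notation ssb := (@strong_sub R H).
Local Notation tmeas := (tau_measurable dot (vM A) (vtau A)).
Implicit Types (a b c e f g h z : bop) (s t : R).
Variables (N : vna dot) (NM : vM N `<=` vM A) (Eps : (H -> H) -> H -> H).
Hypothesis hE : cond_expectation dot (vM A) (vtau A) (vM N) Eps.
Local Notation ce := (ce Eps).
Let Mce a (Ma : inM a) : inM (ce a). Proof. exact: (inM_ce NM hE Ma). Qed.

Section OneOperator.
Variable x : set (H * H).
Hypotheses (px : positive dot x) (hx : tmeas x).
Let cx : cdd x := tmeas_cdd hx.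
Let pr : psd (res dot x). Proof. by have [] := resP dot cx. Qed.
Variables (q K : R) (v : nat -> R).
Hypotheses (q0 : 0 < q) (q1 : q < 1) (K0 : 0 <= K).
Hypothesis (v0 : forall i, 0 <= v i) (vS : forall i, v i <= v i.+1).
Hypothesis (vq : forall i, v i.+1 * 2^-1 ^+ i <= K * q ^+ i).
Hypothesis hv : forall i, (tr (1 - sG dot (res dot x) (v i))%R <= (2^-1 ^+ i)%:E)%E.
Local Notation pc_ := (pcut dot x).
Local Notation K1 := (K / (1 - q)).
Let vm := v_mono vS.

Let d n m := pc_ (v m) - pc_ (v n).
Let Md n m : inM (d n m). Proof. by apply: inMB; exact: inM_pcut. Qed.
Let pd n m (nm : (n <= m)%N) : psd (d n m). Proof. by apply: (pcutB_psd hx) => //; exact: vm. Qed.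
Let od_ n m m' (nm : (n <= m)%N) (mm : (m <= m')%N) : ole (d n m) (d n m').
Proof. by rewrite /ole /d opprB addrA subrK; apply: (pcutB_psd hx) => //; exact: vm. Qed.
Let td n m (nm : (n <= m)%N) : (tr (d n m) <= (K1 * q ^+ n)%:E)%E.
Proof. exact: (pcut_tail hx q0 q1 K0 v0 vS vq hv nm). Qed.
Let dB n m k : d n k - d n m = d m k. Proof. by rewrite /d opprB addrA subrK. Qed.

Lemma half_pow_small s : 0 < s -> exists n0, forall n, (n0 <= n)%N -> 2^-1 ^+ n <= s.
Proof.
move=> s0; have c : 1 * (2^-1 : R) ^+ n @[n --> \oo] --> (0 : R).
  by apply: cvg_geometric; rewrite ger0_norm ?invr_ge0// invf_lt1// ltr1n.
by have [n0 hn] := cvg0_bound c s0; exists n0 => n /hn; rewrite mul1r => /ltW.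
Qed.
Lemma pcut_near_eps s : 0 < s -> exists n0, forall n, (n0 <= n)%N -> near x (pc_ (v n)) s s.
Proof.
move=> s0; have [n0 hn] := half_pow_small s0; exists n0 => n /hn h.
by apply: (near_mono (lexx 0) (ltW s0) h); exact: pcut_near.
Qed.

(** x splits into a bounded cut and y, approximated by the increasing [d 0 n]. The images of these
    have increments with the same small traces, hence are Cauchy in measure, and [L1_upper] upgrades
    both limits to the L^1 norm. *)
Lemma cexp_graph_ex : exists w, cexp_graph dot (vM A) (vtau A) Eps x w.
Proof.
pose z := pc_ (v 0%N); pose y := ssb x (graph z); have Mz : inM z by exact: inM_pcut.
have ty : tmeas y by apply: ssb_tmeas => //; exact: graph_tmeas.
have cy := tmeas_cdd ty.
have ny s : 0 < s -> exists n0, forall n, (n0 <= n)%N -> near y (d 0 n) s s.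
  move=> s0; have [n0 hn] := pcut_near_eps s0; exists n0 => n /hn h.
  by have := near_sub (ltW s0) (lexx 0) h (near_graph A z); rewrite !addr0.
have Mcd n m : inM (ce (d n m)) by exact: Mce.
have pcd n m : (n <= m)%N -> psd (ce (d n m)) by move=> nm; apply: (ce_psd hE) => //; exact: pd.
have tcd n m : (n <= m)%N -> (tr (ce (d n m)) <= (K1 * q ^+ n)%:E)%E.
  by move=> nm; rewrite (ce_tr hE)//; [exact: td|exact: pd].
have K10 : 0 <= K1 by rewrite divr_ge0// subr_ge0 ltW.
have cauchy (t : R) : 0 < t -> exists n0, forall m n, (n0 <= m)%N -> (n0 <= n)%N -> nearb (ce (d 0 m)) (ce (d 0 n)) t t.
  move=> t0; have c : K1 * q ^+ n @[n --> \oo] --> (0 : R).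
    by apply: cvg_geometric; rewrite ger0_norm// ltW.
  have t2 : 0 < t * t by rewrite mulr_gt0.
  have [n0 hn] := cvg0_bound c t2; exists n0.
  have key m n : (n0 <= n)%N -> (n <= m)%N -> nearb (ce (d 0 m)) (ce (d 0 n)) t t.
    move=> n0n nm; apply: nearb_sub0; rewrite -(ceB NM hE)// dB; apply: nearb_psd => //; first exact: pcd.
    have [e1 e2] := spr_fin (Mcd n m) (pcd n m nm) (tcd n m nm) t0.
    rewrite e1 lee_fin -(ler_pM2l t0); apply: le_trans e2 _; apply: ltW; exact: hn.
  move=> m n hm hn'; case/orP: (leq_total n m) => nm; first exact: key.
  by apply: nearb_sym; exact: key.
have [u tu hu] := meas_complete (fun n => Mcd 0%N n) (fun n => (pcd 0%N n (leq0n n)).1) cauchy.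
have cu := tmeas_cdd tu.
exists (sadd u (graph (Eps (bf z)))), y, (bf z), u, (fun n => bf (d 0 n)); split.
- split=> //; apply: le_lt_trans (_ : _ <= (16 * (K1 * q ^+ 0))%:E)%E _; last by rewrite ltry.
  apply: (L1_upper (c := fun m => d 0 m)) => //.
  + by move=> m; exact: pd.
  + by move=> m; apply: od_.
  + by move=> m; exact: td.
  + by move=> s /ny[n0 h]; exists n0; left; exact: h.
- exact: Mz.
- by rewrite ssb_graphK.
- move=> n; split; first exact: Md.
  split; first exact: graph_tmeas.
  apply: le_lt_trans (_ : _ <= (16 * (K1 * q ^+ 0))%:E)%E _; last by rewrite ltry.
  apply: (L1_upper (c := fun m => d 0 n)) => //.
  + exact: graph_tmeas.
  + by move=> _; exact: pd.
  + by move=> _; apply: od_.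
  + by move=> _; exact: td.
  + by move=> s s0; exists 0%N; left; apply: near_mono (near_graph A _) => //; exact: ltW.
split.
- apply: (L1_cvg_geom (K := 16 * K1) q0 q1) => n; rewrite -mulrA.
  apply: (L1_upper (c := fun m => d n (n + m))) => //.
  + by apply: ssb_tmeas => //; exact: graph_tmeas.
  + by move=> m; apply: pd; rewrite leq_addr.
  + by move=> m; apply: od_; rewrite ?leq_addr// leq_add2l.
  + by move=> m; apply: td; rewrite leq_addr.
  move=> s s0; have [n0 h] := ny s s0; exists n0; right.
  have := near_sub (lexx 0) (ltW s0) (near_graph A (d 0 n)) (h (n + n0)%N (leq_addl _ _)).
  by rewrite !add0r -opprB dB.
- split=> //; apply: le_lt_trans (_ : _ <= (16 * (K1 * q ^+ 0))%:E)%E _; last by rewrite ltry.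
  apply: (L1_upper (c := fun m => ce (d 0 m))) => //.
  + by move=> m; exact: pcd.
  + by move=> m; apply: (ce_mono NM hE) => //; apply: od_.
  + by move=> m; exact: tcd.
  + by move=> s /hu[n0 h]; exists n0; left; exact: h.
- apply: (L1_cvg_geom (K := 16 * K1) q0 q1) => n; rewrite -mulrA -(ceE hE)//.
  apply: (L1_upper (c := fun m => ce (d n (n + m)))) => //.
  + by apply: ssb_tmeas => //; exact: graph_tmeas.
  + by move=> m; apply: pcd; rewrite leq_addr.
  + by move=> m; apply: (ce_mono NM hE) => //; apply: od_; rewrite ?leq_addr// leq_add2l.
  + by move=> m; apply: tcd; rewrite leq_addr.
  move=> s s0; have [n0 h] := hu s s0; exists n0; right.
  have := near_sub (lexx 0) (ltW s0) (near_graph A (ce (d 0 n))) (h (n + n0)%N (leq_addl _ _)).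
  by rewrite !add0r -opprB -(ceB NM hE)// dB.
- by [].
Qed.
End OneOperator.

(* h <= 8 th + Q with trace Q <= 16 d by the layer decomposition of h, and
   Chebyshev's inequality applies to E(Q), which has the same trace as Q. *)
Lemma ce_tail h th d (p : nat -> R) : sa h -> inM h -> 0 < th -> (forall j, 0 <= p j) ->
  (forall j, (tr (spr h (8 * (th * 2 ^+ j))) <= (p j)%:E)%E) ->
  (forall n, \sum_(j < n) (th * 2 ^+ j) * p j <= 2 * d) ->
  (tr (spr (ce h) (9 * th)) <= (16 * d / th)%:E)%E.
Proof.
(* Doubling levels make each increment equal to the level it starts from. *)
move=> hh Mh th0 p0 hp sp; pose l (j : nat) : R := 8 * (th * 2 ^+ j).
have l0 j : 0 < l j by rewrite !mulr_gt0// exprn_gt0.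
have lS j : l j.+1 - l j = l j by rewrite /l exprS; ring.
have lm j : l j <= l j.+1 by rewrite -subr_ge0 lS ltW.
have [k k0 hk] := nbP dot h; pose m := Num.bound ((k + 1) / th).
have hm : k + 1 <= l m.
  have := archi_boundP (divr_ge0 (addr_ge0 k0 ler01) (ltW th0)); rewrite -/m ltr_pdivrMr// => h1.
  have h2 : (m%:R : R) <= 2 ^+ m by rewrite -natrX ler_nat ltnW// ltn_expl.
  apply: le_trans (ltW h1) _; rewrite /l mulrC; apply: le_trans (ler_wpM2l (ltW th0) h2) _.
  have := mulr_ge0 (ltW th0) (exprn_ge0 m (ler0n R 2)); lra.
have hole : ole h (l m *: one).
  apply: oleP => [//||u]; first exact/saZ/sa1.
  rewrite scaleE oneE ipZl; change (ip u u) with (nq u).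
  have := CS2 dot (h u) u ltr01; rewrite invr1 !mul1r; have := hk u; have := nq_ge0 dot u; nra.
pose Q := \sum_(j < m) l j *: spr h (l j).
have up : ole h (l 0%N *: one + Q).
  by have := layer_up hh lm hole; under eq_bigr do rewrite lS.
have Ms j : inM (l j *: spr h (l j)) by apply: inMZ; exact: inM_spr.
have ps j : psd (l j *: spr h (l j)) by apply: psdZ; [exact: ltW|exact: spr_psd].
have MQ : inM Q by apply: inM_sum => j _; exact: Ms.
have pQ : psd Q by apply: psd_sum => j _; exact: ps.
have tQ : (tr Q <= (16 * d)%:E)%E.
  rewrite tr_sum// (_ : 16 * d = 8 * (2 * d)); last by ring.
  apply: le_trans (_ : (\sum_(j < m) (8 * (th * 2 ^+ j * p j))%:E <= _)%E).
    apply: lee_sum => j _; rewrite trZ//; [|exact: ltW|exact: inM_spr|exact: spr_psd].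
    rewrite (_ : 8 * (th * 2 ^+ j * p j) = l j * p j); last by rewrite /l mulrA.
    by rewrite [leRHS]EFinM; apply: lee_wpmul2l; [rewrite lee_fin ltW|exact: hp].
  by rewrite sumEFin lee_fin -mulr_sumr ler_pM2l.
have M1 := inM1 A; have l00 : l 0%N = 8 * th by rewrite /l expr0 mulr1.
have Ml : inM (l 0%N *: one) by exact: inMZ.
have up' : ole (ce h) ((8 * th) *: one + ce Q).
  have := ce_mono NM hE Mh (inMD Ml MQ) up.
  by rewrite (ceD hE)// (ceZ NM hE)// (ce1 NM hE) l00.
have pcQ : psd (ce Q) by exact: (ce_psd hE).
have sch : sa (ce h) by exact: (ce_sa NM hE).
have s2 : sa ((8 * th) *: one + ce Q) by apply: saD; [exact/saZ/sa1|exact: pcQ.1].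
have M2 : inM ((8 * th) *: one + ce Q) by apply: inMD; [exact: inMZ|exact: Mce].
apply: le_trans (spr_tr_mono sch s2 (Mce Mh) M2 up' (lexx (9 * th))) _.
(* The bounded part uses up 8 th of the level, leaving th for Chebyshev's inequality on E(Q). *)
have -> : spr ((8 * th) *: one + ce Q) (9 * th) = spr (ce Q) th.
  rewrite /spr; congr (pp _ _); rewrite addrAC -scalerBl addrC (_ : 8 * th - 9 * th = - th) ?scaleNr//; by ring.
have tcQ : (tr (ce Q) <= (16 * d)%:E)%E by rewrite (ce_tr hE).
have [e1 e2] := spr_fin (Mce MQ) pcQ tcQ th0.
by rewrite e1 lee_fin ler_pdivlMr// mulrC.
Qed.
Lemma form_le_nq h u k : 0 <= k -> nq (h u) <= k ^+ 2 * nq u -> `|ip (h u) u| <= k * nq u.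
Proof.
move=> k0 hu; have := CS dot (h u) u; have Y0 := nq_ge0 dot u.
move: hu; set X := nq (h u); set Y := nq u in Y0 *; set Z := ip _ _ => hX hZ.
rewrite -(ger0_norm (mulr_ge0 k0 Y0)) -ler_sqr ?nnegrE// !real_normK ?num_real//.
have : X * Y <= k ^+ 2 * Y * Y by rewrite ler_wpM2r.
by rewrite exprMn expr2 [Y ^+ 2]expr2; lra.
Qed.
Lemma ce_near_sa h th d (p : nat -> R) : sa h -> inM h -> 0 < th -> (forall j, 0 <= p j) ->
  (forall j, exists e, [/\ inM e, proj e, (tr (1 - e)%R <= (p j)%:E)%E &
     forall u, e u = u -> `|ip (h u) u| <= 4 * (th * 2 ^+ j) * nq u]) ->
  (forall n, \sum_(j < n) (th * 2 ^+ j) * p j <= 2 * d) ->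
  nearb (ce h) 0 (9 * th) (16 * d / th + 16 * d / th).
Proof.
move=> hh Mh th0 p0 he sp.
have thj j : 0 < th * 2 ^+ j by rewrite mulr_gt0// exprn_gt0.
have lt4 j : 4 * (th * 2 ^+ j) < 8 * (th * 2 ^+ j) by have := thj j; lra.
apply: nearb_spr.
- exact: (ce_sa NM hE).
- exact: Mce.
- by rewrite mulr_ge0// ltW.
- apply: (ce_tail hh Mh th0 p0 _ sp) => j; have [e [Me pe te hu]] := he j.
  apply: le_trans te; apply: (tr_spr_le hh Mh Me pe (lt4 j)) => u eu.
  by apply: le_trans (ler_norm _) (hu u eu).
have -> : - ce h = ce (- h) by rewrite -[- h]scaleN1r (ceZ NM hE)// scaleN1r.
apply: (ce_tail (saN hh) (inMN Mh) th0 p0 _ sp) => j; have [e [Me pe te hu]] := he j.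
apply: le_trans te; apply: (tr_spr_le (saN hh) (inMN Mh) Me pe (lt4 j)) => u eu.
by apply: le_trans (ler_norm _) _; rewrite oppE ipNl normrN; exact: hu.
Qed.
End CexpGraph.

(** * Independence of the approximants *)

Section CexpLimit.
Variables (R : realType) (H : completeNormedModType R[i]) (dot : hdot H) (A : tvna dot).
Local Notation bop := (bop H).
Local Notation one := (1 : bop).
Local Notation ip := (rip dot).
Local Notation nq := (sqn dot).
Local Notation adjo := (adjo dot).
Local Notation sa := (sa dot).
Local Notation psd := (psd dot).
Local Notation ole := (ole dot).
Local Notation inM := (inM A).
Local Notation tr := (tr A).
Local Notation near := (near A).
Local Notation nearb := (nearb A).
Local Notation ssb := (@strong_sub R H).
Local Notation L1 := (L1_norm dot (vtau A)).
Local Notation tmeas := (tau_measurable dot (vM A) (vtau A)).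
Implicit Types (a b c e f g h z : bop) (s t : R).
Variables (N : vna dot) (NM : vM N `<=` vM A) (Eps : (H -> H) -> H -> H).
Hypothesis hE : cond_expectation dot (vM A) (vtau A) (vM N) Eps.
Local Notation ce := (ce Eps).
Let Mce a (Ma : inM a) : inM (ce a). Proof. exact: (inM_ce NM hE Ma). Qed.

Definition imul a : bop := Bop (scale_bounded 'i%C a).
Lemma imulE a u : imul a u = 'i%C *: a u. Proof. by []. Qed.
Lemma nq_imul u : nq ('i%C *: u) = nq u. Proof. exact: ip_ii. Qed.
Lemma inM_imul a : inM a -> inM (imul a).
Proof.
move=> /inMP h; apply/inMP => c hc; apply: bopE => u; rewrite mulE imulE mulE imulE -mulE (h c hc) mulE.
by rewrite [RHS]bopZ.
Qed.
Lemma re_im c : inM c -> exists h1 h2, [/\ sa h1 /\ inM h1, sa h2 /\ inM h2, (forall u, c u = 'i%C *: h2 u + h1 u),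
  (forall u, ip (h1 u) u = ip (c u) u) & forall u, ip (h2 u) u = - ip ('i%C *: c u) u].
Proof.
move=> Mc; pose h1 := 2^-1 *: (c + adjo c); pose s := 2^-1 *: (adjo c - c).
have ei (w : H) : 'i%C *: ('i%C *: w) = - w by rewrite scalerA -expr2 sqr_i scaleN1r.
have hs : adjo s = - s by rewrite /s adjZ adjD adjN adjK -scalerN opprB.
exists h1, (imul s); split.
- split; last by apply: inMZ; apply: inMD => //; exact: inM_adj.
  by rewrite /sa /h1 adjZ adjD adjK addrC.
- split; last by apply: inM_imul; apply: inMZ; apply: inMB => //; exact: inM_adj.
  apply: adj_uniq => u v; rewrite !imulE ip_iC adjP hs oppE ipNr opprK; congr (ip _ _).
  by rewrite bopZ.
- move=> u; rewrite imulE ei /s /h1 !scaleE subE addE -scalerN -scalerDr opprB addrACA addNr addr0.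
  rewrite scalerDr -scalerDl -rmorphD /= (_ : 2^-1 + 2^-1 = 1 :> R) ?scale1r//; lra.
- by move=> u; rewrite /h1 scaleE addE ipZl ipDl -[ip (adjo c u) u]adjPr [ip u _]ipC; lra.
move=> u; rewrite imulE ip_iC /s scaleE subE ipZl ipBl -adjPr bopZ ipC ip_iC.
rewrite [ip (c u) _]ipC ip_iC ipC; lra.
Qed.
(** The approximants in [cexp_graph] are arbitrary elements of M, so real and imaginary parts are
    treated separately by [ce_near_sa]. The two parts turn 9 into 18; two parts and two signs turn
    16 into 64. *)
Lemma ce_near c th d (p : nat -> R) : inM c -> 0 < th -> (forall j, 0 <= p j) ->
  (forall j, nearb c 0 (4 * (th * 2 ^+ j)) (p j)) ->
  (forall n, \sum_(j < n) (th * 2 ^+ j) * p j <= 2 * d) ->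
  nearb (ce c) 0 (18 * th) (64 * d / th).
Proof.
move=> Mc th0 p0 hc sp; have [h1 [h2 [[s1 M1] [s2 M2] ec f1 f2]]] := re_im Mc.
have k0 j : 0 <= 4 * (th * 2 ^+ j) by rewrite !mulr_ge0 ?exprn_ge0// ltW.
have n1 : nearb (ce h1) 0 (9 * th) (16 * d / th + 16 * d / th).
  apply: (ce_near_sa NM hE s1 M1 th0 p0 _ sp) => j; have /nearbP[e [Me pe te he]] := hc j.
  exists e; split=> // u /he; rewrite zeroE subr0 f1; exact: form_le_nq.
have n2 : nearb (ce h2) 0 (9 * th) (16 * d / th + 16 * d / th).
  apply: (ce_near_sa NM hE s2 M2 th0 p0 _ sp) => j; have /nearbP[e [Me pe te he]] := hc j.
  exists e; split=> // u /he; rewrite zeroE subr0 f2 normrN => h.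
  by have := @form_le_nq _ _ dot (imul c) u _ (k0 j); rewrite imulE nq_imul; apply.
have {}n2 : nearb (imul (ce h2)) 0 (9 * th) (16 * d / th + 16 * d / th).
  have /nearbP[e [Me pe te he]] := n2; apply/nearbP; exists e; split=> // u /he.
  by rewrite zeroE !subr0 imulE nq_imul.
have -> : ce c = imul (ce h2) + ce h1.
  by apply: bopE => u; rewrite addE imulE; exact: (ce_lin hE M2 M1 Mc ec u).
have t0 : 0 <= 9 * th by rewrite mulr_ge0// ltW.
have := nearb_add t0 t0 n2 n1; congr (nearb _ _ _ _); first by ring.
by field; rewrite gt_eqF.
Qed.
Section OneOperator.
Variable x : set (H * H).
Hypotheses (px : positive dot x) (hx : tmeas x).
Let cx : cdd x := tmeas_cdd hx.
Let pr : psd (res dot x). Proof. by have [] := resP dot cx. Qed.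
Variables (q K : R) (v : nat -> R).
Hypotheses (q0 : 0 < q) (q1 : q < 1) (K0 : 0 <= K).
Hypothesis (v0 : forall i, 0 <= v i) (vS : forall i, v i <= v i.+1).
Hypothesis (vq : forall i, v i.+1 * 2^-1 ^+ i <= K * q ^+ i).
Hypothesis hv : forall i, (tr (1 - sG dot (res dot x) (v i))%R <= (2^-1 ^+ i)%:E)%E.
Local Notation pc_ := (pcut dot x).
Local Notation K1 := (K / (1 - q)).
Let vm := v_mono vS.

Let d n m := pc_ (v m) - pc_ (v n).
Let Md n m : inM (d n m). Proof. by apply: inMB; exact: inM_pcut. Qed.
Let pd n m (nm : (n <= m)%N) : psd (d n m). Proof. by apply: (pcutB_psd hx) => //; exact: vm. Qed.
Let od_ n m m' (nm : (n <= m)%N) (mm : (m <= m')%N) : ole (d n m) (d n m').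
Proof. by rewrite /ole /d opprB addrA subrK; apply: (pcutB_psd hx) => //; exact: vm. Qed.
Let td n m (nm : (n <= m)%N) : (tr (d n m) <= (K1 * q ^+ n)%:E)%E.
Proof. exact: (pcut_tail hx q0 q1 K0 v0 vS vq hv nm). Qed.
Let dB n m k : d n k - d n m = d m k. Proof. by rewrite /d opprB addrA subrK. Qed.

Lemma tail_tmeas l : tmeas (ssb x (graph (pc_ (v l)))).
Proof. by apply: ssb_tmeas => //; apply: graph_tmeas; exact: inM_pcut. Qed.
Lemma L1_tail l : (L1 (ssb x (graph (pc_ (v l)))) <= (16 * (K1 * q ^+ l))%:E)%E.
Proof.
apply: (L1_upper (c := fun m => d l (l + m))).
- exact: tail_tmeas.
- by [].
- by move=> m; apply: pd; rewrite leq_addr.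
- by move=> m; apply: od_; rewrite ?leq_addr// leq_add2l.
- by move=> m; apply: td; rewrite leq_addr.
move=> s s0; have [n0 h] := pcut_near_eps px hx v0 hv s0; exists n0; left.
by have := near_sub (ltW s0) (lexx 0) (h (l + n0)%N (leq_addl _ _)) (near_graph A (pc_ (v l))); rewrite !addr0.
Qed.
Local Notation app := (band dot x v).
(** All solutions w of the relation are identified in measure at once. Both [a n + z] and the cut at
    v l are L^1-close to x, so the distribution of their difference c is small at all dyadic levels,
    and the weak-type bound [ce_near] makes E(c) small in measure. *)
Lemma cexp_near w : cexp_graph dot (vM A) (vtau A) Eps x w ->
  tmeas w /\ forall t : R, 0 < t -> exists L, forall l, (L <= l)%N -> near w (ce (app l)) t t.
Proof.
move=> [y [z' [u [a' [[ty _] /vM_bop[z <- Mz] ex Ma [ca [tu _] cu ->]]]]]].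
have exa n : exists b : bop, bf b = a' n /\ inM b.
  by have [/vM_bop[b h1 h2] _] := Ma n; exists b.
have [a ha] := choice exa.
have Ma_ n : inM (a n) := (ha n).2.
rewrite (_ : Eps (bf z) = bf (ce z)); last by rewrite (ceE hE).
have cy := tmeas_cdd ty; have cu_ := tmeas_cdd tu.
split; first by apply: sadd_tmeas => //; apply: graph_tmeas; exact: Mce.
(* s is spent once on the L^1 limit u, 18 times by [ce_near] and once on the lower cut; D is chosen
   so that 64 D / s = s. *)
move=> t t0; pose s := t / 20; have s0 : 0 < s by rewrite divr_gt0.
pose D := s * s / 64; have D0 : 0 < D by rewrite divr_gt0// mulr_gt0.
have D2 : 0 < D / 2 by rewrite divr_gt0.
have [n1 h1] := L1_cvg0 ca D2; have s4 : 0 < s ^+ 2 / 4 by rewrite divr_gt0// exprn_gt0.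
have [n2 h2] := L1_cvg0 cu s4.
have cK : 16 * K1 * q ^+ l @[l --> \oo] --> (0 : R) by apply: cvg_geometric; rewrite ger0_norm// ltW.
have [L1_ hL1] := cvg0_bound cK D2.
have [L2 hL2] : exists L2, forall l, (L2 <= l)%N -> (l.+1%:R : R)^-1 <= s.
  exists (Num.bound s^-1) => l hl; rewrite -[s]invrK lef_pV2 ?posrE ?invr_gt0 ?ltr0n//.
  apply: ltW; apply: lt_trans (archi_boundP (ltW _)) _; first by rewrite invr_gt0.
  by rewrite ltr_nat ltnS.
exists (maxn L1_ L2) => l; rewrite geq_max => /andP[l1 l2].
pose n := maxn n1 n2; pose c := a n + z - pc_ (v l).
have Mc : inM c by apply: inMB; [apply: inMD|exact: inM_pcut].
pose Z' := ssb (graph (a n)) y; have tZ' : tmeas Z' by apply: ssb_tmeas => //; exact: graph_tmeas.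
have b1 : (L1 Z' <= (D / 2)%:E)%E by have := h1 n (leq_maxl _ _); rewrite -(ha n).1.
have b2 : (L1 (ssb x (graph (pc_ (v l)))) <= (D / 2)%:E)%E.
  by apply: le_trans (L1_tail l) _; rewrite lee_fin mulrA ltW//; exact: hL1.
have [p1 [hp1 sp1]] := L1_lower tZ' (ltW D2) b1 s0.
have [p2 [hp2 sp2]] := L1_lower (tail_tmeas l) (ltW D2) b2 s0.
have nc j : nearb c 0 (4 * (s * 2 ^+ j)) (p1 j + p2 j).
  have sj : 0 < s * 2 ^+ j by rewrite mulr_gt0// exprn_gt0.
  have sj2 : 0 <= 2 * (s * 2 ^+ j) by rewrite mulr_ge0// ltW.
  have m1 := near_ssbl cy (od_near (tmeas_cdd tZ') (tmeas_aff tZ') sj (hp1 j).2).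
  have m2 := near_ssbr cx (od_near (tmeas_cdd (tail_tmeas l)) (tmeas_aff (tail_tmeas l)) sj (hp2 j).2).
  have m3 := near_add sj2 (lexx 0) m1 (near_graph A z); rewrite -ex !addr0 in m3.
  have [lx _ _] := cx; have := nearb_sub (near_near x sj2 sj2 m3 m2 lx).
  by congr (nearb _ _ _ _); ring.
have nce : nearb (ce c) 0 (18 * s) (64 * D / s).
  apply: (ce_near Mc s0 (p := fun j => p1 j + p2 j)) => //.
    by move=> j; apply: addr_ge0; [exact: (hp1 j).1|exact: (hp2 j).1].
  move=> m; under eq_bigr do rewrite mulrDr; rewrite big_split /=.
  by have := sp1 m; have := sp2 m; lra.
have eD : 64 * D / s = s by rewrite /D; field; rewrite gt_eqF.
rewrite eD /c (ceB NM hE)// ?(ceD hE)// in nce; [|exact: inMD|exact: inM_pcut].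
have w1 : near u (ce (a n)) s s.
  apply: near_ssbl => //; apply: L1_near => //; first by apply: ssb_tmeas => //; apply: graph_tmeas; exact: Mce.
  by have := h2 n (leq_maxr _ _); rewrite -(ha n).1 -(ceE hE).
have w2 := near_add (ltW s0) (lexx 0) w1 (near_graph A (ce z)); rewrite !addr0 in w2.
have s18 : 0 <= 18 * s by rewrite mulr_ge0// ltW.
have w3 := near_tri (ltW s0) s18 w2 (nearb_sub0 nce).
have lo0 := lowcut_ge0 v0 l.
have los : lowcut v l <= s by apply: le_trans (hL2 l l2); rewrite /lowcut ge_min lexx orbT.
have nl : nearb (ce (pc_ (v l))) (ce (app l)) s 0.
  apply: nearb_norm => // u0; rewrite -subE -(ceB NM hE)//; [|exact: inM_pcut|exact: (inM_app hx v0)].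
  rewrite /band opprB addrC subrK.
  have Mlo : inM (pc_ (lowcut v l)) by exact: inM_pcut.
  have plo : psd (pc_ (lowcut v l)) by exact: (pcut_psd hx).
  have ol : ole (ce (pc_ (lowcut v l))) (s *: one).
    have := ce_mono NM hE Mlo (inMZ (lowcut v l) (inM1 A)) (pcut_le hx lo0).
    rewrite (ceZ NM hE)//; last exact: inM1.
    rewrite (ce1 NM hE) => /ole_trans; apply; rewrite -subr_ge0 in los.
    by have := psdZ los (psd1 dot); rewrite scalerBl.
  exact: (psd_nb (ltW s0) (ce_psd hE Mlo plo) ol).
have s19 : 0 <= s + 18 * s by lra.
have := near_tri s19 (ltW s0) w3 nl; rewrite addr0 => h.
by apply: (near_mono _ _ _ h); rewrite /s; lra.
Qed.
End OneOperator.
End CexpLimit.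

(** * Approximation of elements of E(M) *)

Section Approximation.
Variables (R : realType) (E : symmetricSpace R).
Hypotheses (p_gt1 : (1 < lower_boyd E)%E) (p_le_q : (lower_boyd E <= upper_boyd E)%E)
  (q_fin : (upper_boyd E < +oo)%E).
Local Notation qn := (qnorm E).
Local Notation car := (carrier E).

(** The Hardy operator spreads the indicator of ]0, 1] over the whole half-line. A small multiple of
    h later makes inequalities between singular numbers strict. *)
Lemma positive_dec_ex : exists h : R -> R, [/\ dec h, car h & forall t, 0 < t -> 0 < h t].
Proof.
have [rho [C [r1 r2 C0 hd]]] := hardy_E p_gt1 p_le_q q_fin.
have [F [dF cF _ hF]] := hd _ (dec_ind (1 : R)) (car_ind E ltr01).
exists F; split=> // t t0; have t4 : 0 < (4 * t)^-1 by rewrite invr_gt0 mulr_gt0.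
have [m hm] := half_pow_small t4; have {}hm := hm m.+1 (leqnSn m).
apply: lt_le_trans (hF m.+1 t t0).
have rV : rho^-1 < 1 by rewrite invf_lt1 ?(lt_trans ltr01).
have pos i j : 0 <= rho ^+ j * 2^-1 ^+ i * ind 1 (2^-1 ^+ i * (2 ^+ j.+2 * t)) :> R.
  have [i0 _] := dec_ind (1 : R); rewrite !mulr_ge0 ?exprn_ge0 ?invr_ge0 ?i0//; lra.
rewrite !mulr_gt0 ?invr_gt0 ?subr_gt0//.
rewrite big_ord_recl ltr_wpDr//; first by apply: sumr_ge0 => j _; apply: sumr_ge0 => i _; exact: pos.
rewrite big_ord_recr ltr_wpDl//; first by apply: sumr_ge0 => i _; exact: (pos i 0%N).
rewrite /= expr0 mul1r /ind (_ : _ <= 1) ?mulr1 ?exprn_gt0 ?invr_gt0//.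
rewrite (_ : 2 ^+ 2 = 4 :> R); last by rewrite expr2; ring.
by rewrite -ler_pdivlMr ?mulr_gt0// mul1r.
Qed.

Variables (H : completeNormedModType R[i]) (dot : hdot H) (A : tvna dot).
Local Notation bop := (bop H).
Local Notation psd := (psd dot).
Local Notation ole := (ole dot).
Local Notation inM := (inM A).
Local Notation tr := (tr A).
Local Notation near := (near A).
Local Notation sadd := (@strong_add R H).
Local Notation od := (op_dist dot (vtau A)).
Local Notation tmeas := (tau_measurable dot (vM A) (vtau A)).
Local Notation fmu := (fmu A).
Implicit Types (x y X : set (H * H)) (a b : bop) (s t : R).

(** One increasing sequence of bands serves x and all its conditional expectations, so inequalities
    proved for the bands pass to both limits. *)
Lemma approx_ex x : positive dot x -> tmeas x -> car (fmu x) -> exists xl : nat -> bop,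
  [/\ forall l, [/\ inM (xl l), psd (xl l) & (tr (xl l) < +oo)%E],
      forall l m, (l <= m)%N -> ole (xl l) (xl m),
      forall t, 0 < t -> exists L, forall l, (L <= l)%N -> near x (xl l) t t
    & forall (N : vna dot) Eps, vM N `<=` vM A -> cond_expectation dot (vM A) (vtau A) (vM N) Eps ->
        tmeas (cexp_ext dot (vM A) (vtau A) Eps x) /\
        forall t, 0 < t -> exists L, forall l, (L <= l)%N ->
          near (cexp_ext dot (vM A) (vtau A) Eps x) (ce Eps (xl l)) t t].
Proof.
move=> px hx cx_; have cx := tmeas_cdd hx; have dx := fmu_dec hx.
have [rho [C [r1 r2 C0 hC]]] := dec_bound_small p_gt1 p_le_q q_fin.
have [sig [C' [s0 s1 C'0 hC']]] := dec_bound_big p_gt1 p_le_q q_fin.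
have qx : 0 <= qn (fmu x) by exact: qnorm_ge0.
have r0 : 0 < rho by apply: lt_trans r1.
(* The summand 1 makes the comparison of [fmu x] at 2^-i with v i strict, as [od_le_fmu]
   requires. *)
pose B := C * qn (fmu x) + 1; have B0 : 0 < B by rewrite ltr_wpDl// mulr_ge0// ltW.
pose v i := B * rho ^+ i; pose q := rho / 2; pose K := B * rho.
have q0 : 0 < q by rewrite divr_gt0.
have q1 : q < 1 by rewrite ltr_pdivrMr// mul1r.
have K0 : 0 <= K by rewrite mulr_ge0// ltW.
have v0 i : 0 <= v i by rewrite mulr_ge0 ?exprn_ge0// ltW.
have vS i : v i <= v i.+1.
  by rewrite ler_pM2l// exprS ler_peMl ?exprn_ge0 ?(ltW r0)// ltW.
have vq i : v i.+1 * 2^-1 ^+ i <= K * q ^+ i.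
  suff -> : v i.+1 * 2^-1 ^+ i = K * q ^+ i by [].
  by rewrite /v /K /q exprS exprMn; ring.
have hlt i : fmu x (2^-1 ^+ i) < v i.
  apply: le_lt_trans (hC i _ dx cx_) _; rewrite /v /B mulrDl mul1r mulrAC ltrDl exprn_gt0//.
have hv i : (tr (1 - sG dot (res dot x) (v i))%R <= (2^-1 ^+ i)%:E)%E.
  by apply: od_le_fmu => //; rewrite exprn_gt0// invr_gt0.
(* Finiteness of q_E makes singular numbers tend to 0, so every positive level is exceeded on finite
   trace. *)
have odfin s : 0 < s -> (od x s < +oo)%E.
  move=> sp; have c : C' * qn (fmu x) * sig ^+ j @[j --> \oo] --> (0 : R).
    by apply: cvg_geometric; rewrite ger0_norm// ltW.
  have [j hj] := cvg0_bound c sp; have {}hj := hj j (leqnn j).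
  rewrite (opdistE A cx (ltW sp)); apply: le_lt_trans (_ : _ <= (2 ^+ j)%:E)%E _; last by rewrite ltry.
  apply: od_le_fmu => //.
  by apply: le_lt_trans (hC' j _ dx cx_) _; rewrite mulrAC.
have v00 : 0 < v 0%N by rewrite /v expr0 mulr1.
exists (band dot x v); split.
- move=> l; split; [exact: (inM_app hx v0)|exact: (app_psd hx v0 vS)|exact: (app_tr hx v0 vS odfin)].
- by move=> l m lm; exact: (app_mono hx v0 vS).
- move=> t t0; have [n1 h1] := half_pow_small t0.
  exists (maxn n1 (Num.bound t^-1)) => l; rewrite geq_max => /andP[l1 l2].
  apply: near_mono (app_near px hx v0 hv l); [by rewrite invr_ge0|idtac|exact: h1].
  rewrite -[leRHS]invrK lef_pV2 ?posrE ?invr_gt0 ?ltr0n//; apply: ltW.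
  apply: lt_trans (archi_boundP (ltW _)) _; first by rewrite invr_gt0.
  by rewrite ltr_nat ltnS.
move=> N Eps NM hE; have [w hw] := cexp_graph_ex NM hE px hx q0 q1 K0 v0 vS vq hv.
have : cexp_graph dot (vM A) (vtau A) Eps x (cexp_ext dot (vM A) (vtau A) Eps x).
  by rewrite /cexp_ext; case: xgetP => [y _ //|/(_ w)].
exact: (cexp_near NM hE px hx q0 q1 K0 v0 vS vq hv).
Qed.

Lemma car_half (f : R -> R) : dec f -> car f -> car (fun t => f (2^-1 * t)) /\ dec (fun t => f (2^-1 * t)).
Proof.
move=> df cf; have h : 0 < (2^-1 : R) by rewrite invr_gt0.
by split; [exact: carrier_dil|exact: dec_scale].
Qed.
(** Singular numbers of a sum at t are compared with those of the summands at t / 2, and E is stable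
    under this dilation. *)
Lemma car_sadd x y : tmeas x -> tmeas y -> car (fmu x) -> car (fmu y) -> car (fmu (sadd x y)).
Proof.
move=> hx hy cx cy; have dx := fmu_dec hx; have dy := fmu_dec hy.
have [c1 d1] := car_half dx cx; have [c2 d2] := car_half dy cy.
have h := carrierD c1 c2; have d := decD d1 d2.
apply: (dec_le _ d h _).1; first by apply: fmu_dec; exact: sadd_tmeas.
move=> t t0; have t2 : 0 < 2^-1 * t by rewrite mulr_gt0// invr_gt0.
by have := fmu_sadd hx hy t2; rewrite mulrA mulfV ?mul1r// pnatr_eq0.
Qed.
Lemma car_opp x : tmeas x -> car (fmu x) -> car (fmu [set p | x (p.1, - p.2)]).
Proof.
move=> hx cx; apply: (dec_le _ (fmu_dec hx) cx _).1; first by apply: fmu_dec; exact: opp_tmeas.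
by move=> t t0; exact: fmu_opp.
Qed.
Lemma graph0 : graph (fun=> 0) = graph (0 : bop). Proof. by []. Qed.
Lemma near_zero k t : 0 <= k -> 0 <= t -> near (graph (fun=> 0 : H)) 0 k t.
Proof. by move=> k0 t0; rewrite graph0; apply: near_mono (near_graph A 0). Qed.
Lemma tmeas_zero : tmeas (graph (fun=> 0 : H)).
Proof. by rewrite graph0; apply: graph_tmeas; exact: inM0. Qed.
Lemma car_zero : car (fmu (graph (fun=> 0 : H))).
Proof.
have [h [dh ch hp]] := positive_dec_ex.
apply: (dec_le _ dh ch _).1; first by apply: fmu_dec; exact: tmeas_zero.
move=> t t0; apply: fmu_le => //; [exact: tmeas_zero|exact: ltW (hp t t0)|].
by apply: near_zero; [exact: ltW (hp t t0)|exact: ltW].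
Qed.
Lemma psum_ind (P : set (H * H) -> Prop) (x : nat -> set (H * H)) n : P (graph (fun=> 0)) ->
  (forall y z, P y -> P z -> P (sadd y z)) -> (forall k, P (x k)) -> P (partial_sum x n).
Proof.
move=> h0 hD hx; rewrite /partial_sum; elim: (index_iota 0 n) => [|k s IH]; first by rewrite big_nil.
by rewrite big_cons; exact: hD.
Qed.
Lemma psum_tmeas (x : nat -> set (H * H)) n : (forall k, tmeas (x k)) -> tmeas (partial_sum x n).
Proof. by move=> hx; apply: psum_ind => //; [exact: tmeas_zero|move=> y z; exact: sadd_tmeas]. Qed.
Lemma psum_car (x : nat -> set (H * H)) n : (forall k, tmeas (x k)) -> (forall k, car (fmu (x k))) -> car (fmu (partial_sum x n)).
Proof.
move=> hx cx; suff [] : tmeas (partial_sum x n) /\ car (fmu (partial_sum x n)) by [].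
apply: (@psum_ind (fun y => tmeas y /\ car (fmu y))) => [|y z [h1 h2] [h3 h4]|k]; [|idtac|by split]; first by split; [exact: tmeas_zero|exact: car_zero].
by split; [exact: sadd_tmeas|exact: car_sadd].
Qed.
Lemma psum_near (x : nat -> set (H * H)) (a : nat -> nat -> bop) n t : (forall k, tmeas (x k)) ->
  (forall k s, 0 < s -> exists L, forall l, (L <= l)%N -> near (x k) (a k l) s s) -> 0 < t ->
  exists L, forall l, (L <= l)%N -> near (partial_sum x n) (\sum_(k < n) a k l) t t.
Proof.
move=> hx ha t0; rewrite /partial_sum.
suff [L hL] : exists L, forall l, (L <= l)%N ->
    near (\big[sadd/graph (fun=> 0)]_(0 <= k < n) x k) (\sum_(0 <= k < n) a k l) t t.
  by exists L => l /hL; rewrite (big_mkord xpredT (fun k => a k l)).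
elim: (index_iota 0 n) t t0 => [|k s IH] t t0.
  by exists 0%N => l _; rewrite !big_nil; apply: near_zero; exact: ltW.
have t2 : 0 < t / 2 by rewrite divr_gt0.
have [L1 h1] := IH _ t2; have [L2 h2] := ha k _ t2.
exists (maxn L1 L2) => l; rewrite geq_max => /andP[/h1 l1 /h2 l2].
by rewrite !big_cons [t]splitr; apply: near_add => //; exact: ltW.
Qed.
Lemma od_cvg0 (f : nat -> R -> R) t : (forall n, dec (f n)) -> (forall n, car (f n)) -> 0 < t ->
  qn (f n) @[n --> \oo] --> (0 : R) -> forall e, 0 < e -> exists n0, forall n, (n0 <= n)%N -> f n t < e.
Proof.
move=> df cf t0 hc e e0; have qi := qn_ind E t0; have p : 0 < e * qn (ind t) by rewrite mulr_gt0.
have [n0 hn] := cvg0_bound hc p; exists n0 => n /hn h.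
by rewrite -(ltr_pM2r qi); apply: le_lt_trans (dec_le_ind (df n) (cf n) t0) h.
Qed.
End Approximation.

(** * Convergence of the series *)

Section Convergence.
Variables (R : realType) (E : symmetricSpace R) (H : completeNormedModType R[i]) (dot : hdot H) (A : tvna dot).
Local Notation bop := (bop H).
Local Notation psd := (psd dot).
Local Notation ole := (ole dot).
Local Notation inM := (inM A).
Local Notation tr := (tr A).
Local Notation spr := (spr dot).
Local Notation near := (near A).
Local Notation nearb := (nearb A).
Local Notation ssb := (@strong_sub R H).
Local Notation tmeas := (tau_measurable dot (vM A) (vtau A)).
Local Notation fmu := (fmu A).

Variables (N : nat -> vna dot) (NM : forall k, vM (N k) `<=` vM A) (NS : forall k, vM (N k) `<=` vM (N k.+1)).
Variable Eps : nat -> (H -> H) -> H -> H.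
Hypothesis hE : forall k, cond_expectation dot (vM A) (vtau A) (vM (N k)) (Eps k).
Variables (x w : nat -> set (H * H)) (X : set (H * H)) (xl : nat -> nat -> bop).
Hypotheses (tx : forall k, tmeas (x k)) (tw : forall k, tmeas (w k)) (tX : tmeas X).
Hypothesis xlP : forall k l, [/\ inM (xl k l), psd (xl k l) & (tr (xl k l) < +oo)%E].
Hypothesis xl_mono : forall k l m, (l <= m)%N -> ole (xl k l) (xl k m).
Hypothesis xl_near : forall k (s : R), 0 < s -> exists L, forall l, (L <= l)%N -> near (x k) (xl k l) s s.
Hypothesis wl_near : forall k (s : R), 0 < s -> exists L, forall l, (L <= l)%N -> near (w k) (ce (Eps k) (xl k l)) s s.
Local Notation S := (partial_sum x).
Local Notation W := (partial_sum w).
Local Notation D n := (ssb (S n) X).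
Hypothesis gap : forall s : R, 0 < s -> exists n0, forall n, (n0 <= n)%N -> near (D n) 0 s s.

Let tS n : tmeas (S n). Proof. exact: psum_tmeas. Qed.
Let tW n : tmeas (W n). Proof. exact: psum_tmeas. Qed.
Let tD n : tmeas (D n). Proof. exact: ssb_tmeas. Qed.
Let cl k l := ce (Eps k) (xl k l).
Let Mx k l : inM (xl k l). Proof. by case: (xlP k l). Qed.
Let px k l : psd (xl k l). Proof. by case: (xlP k l). Qed.
Let Mc k l : inM (cl k l). Proof. exact: (inM_ce (NM (k:=k)) (hE k)). Qed.
Let pc k l : psd (cl k l). Proof. by apply: (ce_psd (hE k)). Qed.

Definition block (a : nat -> nat -> bop) n m l : bop := \sum_(i < m) a (n + i)%N l.
Lemma block_cat a n m m' l : block a n (m + m') l = block a n m l + block a (n + m) m' l.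
Proof.
by rewrite /block big_split_ord /=; congr (_ + _); apply: eq_bigr => i _; rewrite addnA.
Qed.
Lemma block_inM a n m l : (forall k l, inM (a k l)) -> inM (block a n m l).
Proof. by move=> h; apply: inM_sum => i _. Qed.
Lemma block_psd a n m l : (forall k l, psd (a k l)) -> psd (block a n m l).
Proof. by move=> h; apply: psd_sum => i _. Qed.
Lemma block_mono n m l l' : (l <= l')%N -> ole (block xl n m l) (block xl n m l').
Proof. by move=> ll; rewrite /ole /block -sumrB; apply: psd_sum => i _; exact: xl_mono. Qed.
Lemma S_near n (s : R) : 0 < s -> exists L, forall l, (L <= l)%N -> near (S n) (block xl 0 n l) s s.
Proof. exact: psum_near. Qed.
Lemma W_near n (s : R) : 0 < s -> exists L, forall l, (L <= l)%N -> near (W n) (block cl 0 n l) s s.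
Proof. exact: (psum_near (a := cl)). Qed.

(* The bounded approximants of a block of the series are dominated by
   approximants of S_M - S_n, which is close to X - S_n for large M. *)
Lemma block_form n m l (s k k' e : R) : 0 < s -> fmu (D n) s < k -> k < k' -> 0 < e ->
  (tr (spr (block xl n m l) k') <= (s + e)%:E)%E.
Proof.
move=> s0 hk kk e0; have k0 : 0 <= k by apply: le_trans (ltW hk); exact: (fmu_dec (tD n)).1.
pose d := Num.min e (k' - k) / 8.
have de : 8 * d <= e by rewrite /d mulrC divfK ?pnatr_eq0// ge_min lexx.
have dk : 8 * d <= k' - k by rewrite /d mulrC divfK ?pnatr_eq0// ge_min lexx orbT.
have d0 : 0 < d by rewrite divr_gt0// lt_min e0 subr_gt0.
have [n0 hn0] := gap d0; pose m' := maxn m n0.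
have hM := hn0 (n + m')%N (leq_trans (leq_maxr _ _) (leq_addl _ _)).
have [cX aX] := (tmeas_cdd tX, tmeas_aff tX).
have [sX sX0 hsX] := tr_cut_small cX aX tX d0.
have nX := cut_near cX aX sX0 hsX; set Xb := xc _ _ _ in nX.
have [L1 hL1] := S_near n d0; have [L2 hL2] := S_near (n + m') d0.
pose l' := maxn l (maxn L1 L2).
have l1 : (L1 <= l')%N by rewrite !leq_max leqnn orbT.
have l2 : (L2 <= l')%N by rewrite !leq_max leqnn !orbT.
have ll : (l <= l')%N by rewrite leq_max leqnn.
have a1 := near_sub (ltW d0) (lexx 0) (hL1 l' l1) nX; rewrite addr0 in a1.
have a2 := near_sub (ltW d0) (lexx 0) (hL2 l' l2) nX; rewrite addr0 in a2.
have hD : near (D n) 0 k s by exact: fmu_lt_near.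
have [lD1 _ _] := tmeas_cdd (tD n); have [lD2 _ _] := tmeas_cdd (tD (n + m')).
have b1 := near_near X (ltW d0) k0 a1 hD lD1.
have b2 := near_near X (ltW d0) (ltW d0) a2 hM lD2.
have kd : 0 <= d + k by rewrite addr_ge0// ltW.
have dd : 0 <= d + d by rewrite addr_ge0// ltW.
have b3 := nearb_sub (nearb_tri dd kd b2 (nearb_sym b1)).
have eB : block xl 0 (n + m') l' - Xb - (block xl 0 n l' - Xb) = block xl n m' l'.
  by rewrite block_cat add0n opprB addrA subrK addrAC subrr add0r.
rewrite eB in b3; have pB := block_psd n m' l' px; have MB := block_inM n m' l' Mx.
have kk' : d + d + (d + k) < k' by lra.
have c1 := nearb_form pB.1 MB (addr_ge0 dd kd) kk' b3.
apply: le_trans (_ : (tr (spr (block xl n m' l') k') <= _)%E); last first.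
  by apply: le_trans c1 _; rewrite lee_fin; lra.
apply: spr_tr_mono => //; try exact: block_inM; try exact: (block_psd _ _ _ px).1.
apply: (@ole_trans _ _ dot (block xl n m l')); first exact: block_mono.
rewrite -[m'](subnKC (leq_maxl m n0)) block_cat /ole addrC addKr; exact: block_psd.
Qed.

Lemma hardyD (rho : R) m (g h : R -> R) (e t : R) : hardy rho m (fun s => g s + e * h s) t = hardy rho m g t + e * hardy rho m h t.
Proof.
rewrite /hardy [e * (_ * _)]mulrCA -mulrDr; congr (_ * _); rewrite mulr_sumr -big_split /=; apply: eq_bigr => j _.
by rewrite mulr_sumr -big_split /=; apply: eq_bigr => i _; ring.
Qed.

Variables (rho : R) (h Fh : R -> R).
Hypotheses (r1 : 1 < rho) (r2 : rho < 2) (dh : dec h) (h0 : forall t, 0 < t -> 0 < h t).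
Hypotheses (dFh : dec Fh) (hFh : forall m t, 0 < t -> hardy rho m h t <= Fh t).

(** [dual_doob] is fed a majorant strictly above the singular numbers of the tail: e h supplies the
    strictness, with e so small that the Hardy operator still gives less than V. The argument is
    halved because [block_form] enlarges the trace from s / 2 to s. *)
Lemma block_doob n m l (F : R -> R) (t V : R) : dec F -> 
  (forall m t, 0 < t -> hardy rho m (fun s => fmu (D n) (2^-1 * s)) t <= F t) -> 0 < t -> F t < V ->
  nearb (block cl n m l) 0 V t.
Proof.
move=> dF hF t0 FV; have dD := fmu_dec (tD n).
have V0 : 0 < V by apply: le_lt_trans FV; exact: dF.1.
apply: nearb_psd => //; [exact: block_psd|exact: block_inM|].
pose e := (V - F t) / (2 * (Fh t + 1)).
have p1 : 0 < 2 * (Fh t + 1) by rewrite mulr_gt0// ltr_wpDl// dFh.1.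
have e0 : 0 < e by rewrite divr_gt0// subr_gt0.
have eV : F t + e * Fh t < V.
  have : e * (2 * (Fh t + 1)) = V - F t by rewrite /e divfK// gt_eqF.
  have := mulr_ge0 (ltW e0) (dFh.1 t); lra.
pose g s := fmu (D n) (2^-1 * s) + e * h s.
have := @dual_doob _ _ dot A (fun k => N (n + k)%N) (fun k => NM (k := (n + k)%N)) _ (fun k => Eps (n + k)%N) (fun k => hE (n + k)%N) m (fun k => xl (n + k)%N l) t rho (F t + e * Fh t) V g r1 r2.
have i2 : 0 < (2^-1 : R) by rewrite invr_gt0.
apply=> //.
- by move=> k; rewrite addnS; exact: NS.
- by move=> k; case: (xlP (n + k)%N l).
- by move=> s; rewrite addr_ge0 ?dD.1// mulr_ge0 ?dh.1// ltW.
- move=> s s' s0 ss; apply: lerD; first by apply: dD.2; rewrite ?mulr_gt0// ler_pM2l.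
  by rewrite ler_pM2l//; exact: dh.2.
- move=> s s0; have s2 : 0 < 2^-1 * s by rewrite mulr_gt0.
  have eh : 0 < e * h s by rewrite mulr_gt0// h0.
  have := @block_form n m l (2^-1 * s) (fmu (D n) (2^-1 * s) + e * h s / 2) (g s) (2^-1 * s) s2.
  have -> : 2^-1 * s + 2^-1 * s = s by lra.
  by apply => //; rewrite /g; lra.
- by rewrite addr_ge0 ?dF.1// mulr_ge0 ?dFh.1// ltW.
- by move=> j; rewrite hardyD lerD ?hF// ler_pM2l// hFh.
Qed.

Variable F : nat -> R -> R.
Hypotheses (dF : forall n, dec (F n))
  (hF : forall n m t, 0 < t -> hardy rho m (fun s => fmu (D n) (2^-1 * s)) t <= F n t).
Hypothesis F0 : forall t, 0 < t -> forall e : R, 0 < e -> exists n0, forall n, (n0 <= n)%N -> F n t < e.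

(** The approximants of one term are below those of the block of the first k + 1 terms, to which
    [block_doob] applies with n = 0. *)
Lemma w_fmu k (t : R) : 0 < t -> fmu (w k) (2 * t) <= F 0%N t.
Proof.
move=> t0; apply/ler_addgt0Pr => V V0; have FV : F 0%N t < F 0%N t + V by rewrite ltrDl.
have p0 : 0 < F 0%N t + V by apply: le_lt_trans FV; exact: (dF 0%N).1.
have t2 : t < 2 * t by lra.
apply: (fmu_le_eps (tw k) t0 t2 _ (ltW p0)) => e e0; have [L hL] := wl_near k e0.
have nb : nearb (cl k L) 0 (F 0%N t + V) t.
  apply: nearb_psd => //.
  have := nearb_form (block_psd 0 k.+1 L pc).1 (block_inM 0 k.+1 L Mc) _ _ (block_doob k.+1 L (dF 0%N) (@hF 0%N) t0 _).
  move=> /(_ (F 0%N t + V / 2) (F 0%N t + V)); set P := (tr _ <= _)%E => hP.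
  have {}hP : P.
    apply: hP; [by rewrite addr_ge0 ?(dF 0%N).1// ltW// divr_gt0|lra|lra].
  apply: le_trans hP; apply: spr_tr_mono => //; [exact: (pc k L).1|exact: (block_psd 0 k.+1 L pc).1|exact: block_inM|].
  rewrite /block big_ord_recr /= add0n /ole addrK; apply: psd_sum => i _; exact: pc.
have := near_tri (ltW e0) (ltW p0) (hL L (leqnn L)) nb; rewrite addrC [e + t]addrC; exact.
Qed.

(** [c n] approximates the n-th partial sum at a cut depending on n; increments are therefore
    compared at a common cut, where they are blocks and [block_doob] applies. The argument 2 t
    leaves the room that [fmu_le_eps] asks for. *)
Lemma series_limit : exists2 Y, tmeas Y & forall n (t : R), 0 < t -> fmu (ssb (W n) Y) (2 * t) <= F n t.
Proof.
have q0 (n : nat) : 0 < (2^-1 : R) ^+ n by rewrite exprn_gt0// invr_gt0.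
have [l hl] := choice (fun n => W_near n (q0 n)).
pose c n := block cl 0 n (l n).
have nc n : near (W n) (c n) (2^-1 ^+ n) (2^-1 ^+ n) by exact: hl.
(* 4 d accounts for two passages from a chosen cut to the common one, each going through a partial
   sum. *)
have close n m (t V d : R) : 0 < t -> F n t < V -> 0 < d -> 2^-1 ^+ n <= d -> nearb (c (n + m)%N) (c n) (V + 4 * d) (t + 4 * d).
  move=> t0 FV d0 nd; have V0 : 0 <= V by apply: le_trans (ltW FV); exact: (dF n).1.
  have [L1 h1] := W_near n d0; have [L2 h2] := W_near (n + m) d0; pose L := maxn L1 L2.
  have n1 := h1 L (leq_maxl _ _); have n2 := h2 L (leq_maxr _ _).
  have [lW1 _ _] := tmeas_cdd (tW n); have [lW2 _ _] := tmeas_cdd (tW (n + m)).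
  have mono (k : nat) : 0 <= (2^-1 : R) ^+ k by exact: ltW.
  have nd' : (2^-1 : R) ^+ (n + m) <= d.
    apply: le_trans nd; rewrite exprD ler_piMr//; apply: exprn_ile1; first by rewrite invr_ge0.
    by rewrite invf_le1// ler1n.
  have c1 := near_near X (ltW d0) (ltW d0) n1 (near_mono (mono n) nd nd (nc n)) lW1.
  have c2 := near_near X (ltW d0) (ltW d0) (near_mono (mono _) nd' nd' (nc (n + m)%N)) n2 lW2.
  have c3 : nearb (block cl 0 (n + m) L) (block cl 0 n L) V t.
    apply: nearb_sub0; rewrite block_cat add0n addrC addKr.
    exact: (block_doob m L (dF n) (@hF n) t0 FV).
  have dd : 0 <= d + d by rewrite addr_ge0// ltW.
  have := nearb_tri dd (addr_ge0 V0 dd) c2 (nearb_tri V0 dd c3 c1).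
  by congr (nearb _ _ _ _); ring.
have Mcn n : inM (c n) by exact: block_inM.
have pcn n : psd (c n) by exact: block_psd.
have cauchy (t : R) : 0 < t -> exists n0, forall m n, (n0 <= m)%N -> (n0 <= n)%N -> nearb (c m) (c n) t t.
  move=> t0; have t2 : 0 < t / 2 by rewrite divr_gt0.
  have t8 : 0 < t / 8 by rewrite divr_gt0.
  have [n1 hn1] := F0 t2 t2; have [n2 hn2] := half_pow_small t8.
  exists (maxn n1 n2).
  have key m n : (maxn n1 n2 <= n)%N -> (n <= m)%N -> nearb (c m) (c n) t t.
    rewrite geq_max => /andP[/hn1 k1 /hn2 k2] nm; rewrite -(subnKC nm).
    have := close n (m - n)%N _ _ _ t2 k1 t8 k2.
    by have -> : t / 2 + 4 * (t / 8) = t by field.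
  move=> m n hm hn; case/orP: (leq_total n m) => nm; first exact: key.
  by apply: nearb_sym; exact: key.
have [Y tY hY] := meas_complete Mcn (fun n => (pcn n).1) cauchy.
exists Y => // n t t0; apply/ler_addgt0Pr => V V0; have FV : F n t < F n t + V by rewrite ltrDl.
have p0 : 0 < F n t + V by apply: le_lt_trans FV; exact: (dF n).1.
have t2 : t < 2 * t by lra.
apply: (fmu_le_eps (ssb_tmeas (tW n) tY) t0 t2 _ (ltW p0)) => e e0.
pose d := e / 8; have d0 : 0 < d by rewrite divr_gt0.
have [n1 hn1] := hY d d0; have [n2 hn2] := half_pow_small d0.
pose m := maxn n1 n2; have m1 : (n1 <= n + m)%N by apply: leq_trans (leq_maxl _ _) (leq_addl _ _).
have m2 : (n2 <= n + m)%N by apply: leq_trans (leq_maxr _ _) (leq_addl _ _).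
have [L1 h1] := W_near n d0; have [L2 h2] := W_near (n + m) d0; pose L := maxn L1 L2.
have k1 := h1 L (leq_maxl _ _); have k2 := h2 L (leq_maxr _ _).
have [lW2 _ _] := tmeas_cdd (tW (n + m)).
have dd : 0 <= d + d by rewrite addr_ge0// ltW.
have c2 := near_near X (ltW d0) (ltW d0) (near_mono (ltW (q0 _)) (hn2 _ m2) (hn2 _ m2) (nc (n + m)%N)) k2 lW2.
have c4 := near_tri (ltW d0) dd (hn1 _ m1) c2.
have c5 := near_sub (ltW d0) (addr_ge0 (ltW d0) dd) k1 c4.
have c6 : nearb (block cl 0 n L - block cl 0 (n + m) L) 0 (F n t + V) t.
  rewrite -opprB; apply: nearb_opp; rewrite block_cat add0n addrC addKr.
  exact: (block_doob m L (dF n) (@hF n) t0 FV).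
have c7 := near_tri (addr_ge0 (ltW d0) (addr_ge0 (ltW d0) dd)) (ltW p0) c5 c6.
have ed : e = 8 * d by rewrite /d; field.
apply: (near_mono _ _ _ c7); rewrite ?ed; lra.
Qed.
End Convergence.

Theorem corollary4p13 (R : realType) (E : symmetricSpace R)
    (E_convex : exists2 s : R, 0 < s & s_convex E s)
    (p_gt1 : (1 < lower_boyd E)%E)
    (p_le_q : (lower_boyd E <= upper_boyd E)%E)
    (q_fin : (upper_boyd E < +oo)%E) :
  exists C_E : R,
    forall (H : completeNormedModType R[i]) (dot : {dot H for (@Num.conj R[i])})
      (M : set (H -> H)) (tau : (H -> H) -> \bar R)
      (Mk : nat -> set (H -> H)) (Ek : nat -> (H -> H) -> H -> H),
    hilbert_norm dot ->
    von_neumann dot M ->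
    nsf_trace dot M tau ->
    (forall k, [/\ von_neumann dot (Mk k), Mk k `<=` M,
                   Mk k `<=` Mk k.+1 & semifinite_on dot (Mk k) tau]) ->
    (forall k, cond_expectation dot M tau (Mk k) (Ek k)) ->
    forall x : nat -> set (H * H),
    (forall k, in_EM dot M tau E (x k) /\ positive dot (x k)) ->
    forall X : set (H * H),
    EM_series_cvg dot M tau E x X ->
    exists2 Y : set (H * H),
      EM_series_cvg dot M tau E (fun k => cexp_ext dot M tau (Ek k) (x k)) Y &
      EM_norm dot tau E Y <= C_E * EM_norm dot tau E X.
Proof.
have [rho [C [r1 r2 C0 hC]]] := hardy_E p_gt1 p_le_q q_fin.
have [rho' [C' [r1' r2' C'0 hC']]] := dil_small p_gt1 p_le_q q_fin.
have [h [dh ch h0]] := positive_dec_ex p_gt1 p_le_q q_fin.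
have [Fh [dFh _ _ hFh]] := hC h dh ch.
pose K := C' * rho'; have K0 : 0 < K by rewrite mulr_gt0// (lt_trans ltr01).
have hK g : dec g -> carrier E g -> qnorm E (fun t => g (2^-1 * t)) <= K * qnorm E g.
  by move=> dg cg; have := hC' 1%N g dg cg; rewrite expr1.
(* One K for the halved argument inside the Hardy operator, C for that operator, one K for the
   doubled argument in [series_limit]. *)
exists (K * (C * K)) => H dot0 M tau Mk Ek hn hM htau hMk hEk x hx X [_ [tX cX] hXc].
pose dot : hdot H := HDot hn.
pose A : tvna dot := @Tvna _ _ dot (@Vna _ _ dot M hM) tau htau.
have tX' : tau_measurable dot (vM A) (vtau A) X := tX.
have cX' : carrier E (fmu A X) := cX.
have vMk k : von_neumann dot (Mk k) by case: (hMk k).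
pose N k : vna dot := Vna (vMk k).
have NM k : vM (N k) `<=` vM A by case: (hMk k).
have NS k : vM (N k) `<=` vM (N k.+1) by case: (hMk k).
have hE k : cond_expectation dot (vM A) (vtau A) (vM (N k)) (Ek k) := hEk k.
have tx k : tau_measurable dot (vM A) (vtau A) (x k) by case: (hx k) => -[].
have cx k : carrier E (fmu A (x k)) by case: (hx k) => -[].
have px k : positive dot (x k) := (hx k).2.
have [xl hxl] := choice (fun k => approx_ex p_gt1 p_le_q q_fin (px k) (tx k) (cx k)).
pose w k := cexp_ext dot M tau (Ek k) (x k).
have tw k : tau_measurable dot (vM A) (vtau A) (w k).
  by have [_ _ _ hw] := hxl k; have [] := hw _ _ (NM k) (hE k).
have wl k (s : R) : 0 < s -> exists L, forall l, (L <= l)%N -> near A (w k) (ce (Ek k) (xl k l)) s s.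
  by have [_ _ _ hw] := hxl k; have [_ h'] := hw _ _ (NM k) (hE k); exact: h'.
pose D n := strong_sub (partial_sum x n) X.
have tS n : tau_measurable dot (vM A) (vtau A) (partial_sum x n) by exact: psum_tmeas.
have tD n : tau_measurable dot (vM A) (vtau A) (D n) by exact: ssb_tmeas.
have dD n : dec (fmu A (D n)) by exact: fmu_dec.
have cD n : carrier E (fmu A (D n)).
  by apply: car_sadd => //; [exact: opp_tmeas|exact: psum_car|exact: car_opp].
have qD : qnorm E (fmu A (D n)) @[n --> \oo] --> (0 : R) by exact: hXc.
have gap (s : R) : 0 < s -> exists n0, forall n, (n0 <= n)%N -> near A (D n) 0 s s.
  move=> s0; have [n0 hn0] := od_cvg0 dD cD s0 qD s0; exists n0 => n /hn0.
  exact: fmu_lt_near.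
have [F hF] := choice (fun n => hC _ (car_half (dD n) (cD n)).2 (car_half (dD n) (cD n)).1).
have dF n : dec (F n) by case: (hF n).
have cF n : carrier E (F n) by case: (hF n).
have qF n : qnorm E (F n) <= C * K * qnorm E (fmu A (D n)).
  by have [_ _ h1 _] := hF n; apply: le_trans h1 _; rewrite -mulrA ler_pM2l//; exact: hK.
have qF0 : qnorm E (F n) @[n --> \oo] --> (0 : R).
  apply: (squeeze0 (b := fun n => C * K * qnorm E (fmu A (D n)))) => [n|]; first by rewrite qnorm_ge0// qF.
  by rewrite -(mulr0 (C * K)); apply: cvgM => //; exact: cvg_cst.
have hardyF n m t : 0 < t -> hardy rho m (fun s => fmu A (D n) (2^-1 * s)) t <= F n t.
  by have [_ _ _ h1] := hF n; exact: h1.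
have F0 t : 0 < t -> forall e : R, 0 < e -> exists n0, forall n, (n0 <= n)%N -> F n t < e.
  by move=> t0 e e0; exact: (od_cvg0 dF cF t0 qF0 e0).
have xlP k l : [/\ inM A (xl k l), psd dot (xl k l) & (tr A (xl k l) < +oo)%E] by have [] := hxl k.
have xlm k l m : (l <= m)%N -> ole dot (xl k l) (xl k m) by have [_ h1 _ _] := hxl k; exact: h1.
have xln k (s : R) : 0 < s -> exists L, forall l, (L <= l)%N -> near A (x k) (xl k l) s s.
  by have [_ _ h1 _] := hxl k; exact: h1.
have [Y tY hY] := series_limit NM NS hE tx tw tX' xlP xlm xln wl gap r1 r2 dh h0 dFh hFh dF hardyF F0.
have hw := w_fmu NM NS hE tx tw tX' xlP xlm xln wl gap r1 r2 dh h0 dFh hFh dF hardyF.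
have half f n : dec f -> (forall t, 0 < t -> f (2 * t) <= F n t) -> carrier E f /\ qnorm E f <= K * qnorm E (F n).
  move=> df hf; have [c1 d1] := car_half (dF n) (cF n).
  have [] := dec_le df d1 c1 => [t t0|c2 q2].
    by have := hf (2^-1 * t); rewrite mulrA mulfV ?mul1r ?pnatr_eq0//; apply; rewrite mulr_gt0// invr_gt0.
  by split=> //; apply: le_trans q2 _; exact: hK.
have tW n : tau_measurable dot (vM A) (vtau A) (partial_sum w n) by exact: psum_tmeas.
have tV n : tau_measurable dot (vM A) (vtau A) (strong_sub (partial_sum w n) Y) by exact: ssb_tmeas.
have W0 : partial_sum w 0 = graph (0 : bop H) by rewrite /partial_sum big_nil.
have S0 : partial_sum x 0 = graph (0 : bop H) by rewrite /partial_sum big_nil.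
(* The empty partial sum is 0, so the case n = 0 compares Y, and then X, with its negative. *)
have fY t : 0 < t -> fmu A Y t <= fmu A (strong_sub (partial_sum w 0) Y) t.
  move=> t0; apply/ler_addgt0Pr => e e0; apply: fmu_le => //.
    by rewrite addr_ge0 ?(fmu_dec (tV 0%N)).1// ltW.
  apply: (near_ssbl (tmeas_cdd tY)); rewrite -W0; apply: fmu_lt_near => //; by rewrite ltrDl.
have fX t : 0 < t -> fmu A (D 0%N) t <= fmu A X t.
  move=> t0; apply/ler_addgt0Pr => e e0; apply: fmu_le => //.
    by rewrite addr_ge0 ?(fmu_dec tX').1// ltW.
  rewrite /D S0; apply: (ssb_near (tmeas_cdd tX')); apply: fmu_lt_near => //; by rewrite ltrDl.
have t2 (t : R) : 0 < t -> 0 < 2 * t by move=> t0; rewrite mulr_gt0.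
have [cY qY] := half (fmu A Y) 0%N (fmu_dec tY) (fun t t0 => le_trans (fY _ (t2 t t0)) (hY 0%N t t0)).
exists Y.
  split=> [k||]; [split; [exact: tw|]|by split|].
    exact: (half (fmu A (w k)) 0%N (fmu_dec (tw k)) (hw k)).1.
  apply: (squeeze0 (b := fun n => K * qnorm E (F n))) => [n|]; last first.
    by rewrite -(mulr0 K); apply: cvgM => //; exact: cvg_cst.
  have [c1 q1] := half _ n (fmu_dec (tV n)) (hY n).
  by rewrite qnorm_ge0.
apply: le_trans qY _; rewrite -[leRHS]mulrA ler_pM2l//; apply: le_trans (qF 0%N) _.
have [_ qX] := dec_le (dD 0%N) (fmu_dec tX') cX' fX.
by apply: ler_wpM2l; [exact: ltW (mulr_gt0 C0 K0)|exact: qX].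
Qed.
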